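(* Let $d=2$ or $d=3$. If $B_e\in L^\infty(\mathbb{T}^d,\mathbb{R}^{d(d-1)/2})$, then the operator $\mathbf{K}=K_{\min}$, i.e. the closure in $L^2(\mathbb{T}^d\times\mathbb{R}^d)$ of the Fokker-Planck operator with magnetic field $$K=v\cdot\nabla_x-(v\wedge B_e)\cdot\nabla_v-\Delta_v+\frac{v^2}{4}-\frac d2,\qquad D(K)=\mathcal{S}(\mathbb{T}^d\times\mathbb{R}^d),$$ is maximally accretive.
   Context: Here $\mathbb{T}^d=\mathbb{R}^d/\mathbb{Z}^d$, $x\in\mathbb{T}^d$ is the space variable, $v\in\mathbb{R}^d$ is the velocity variable, and $v^2=|v|^2$. The magnetic field is $B_e=b$ (scalar) if $d=2$ and $B_e=(b_1,b_2,b_3)$ if $d=3$; it depends only on $x$. The notation $(v\wedge B_e)\cdot\nabla_v$ means $$(v\wedge B_e)\cdot\nabla_v=b(x)\,(v_1\partial_{v_2}-v_2\partial_{v_1})\quad\text{if } d=2,$$ $$(v\wedge B_e)\cdot\nabla_v=b_1(x)(v_2\partial_{v_3}-v_3\partial_{v_2})+b_2(x)(v_3\partial_{v_1}-v_1\partial_{v_3})+b_3(x)(v_1\partial_{v_2}-v_2\partial_{v_1})\quad\text{if } d=3.$$ $\mathcal{S}(\mathbb{T}^d\times\mathbb{R}^d)$ is the Schwartz space: smooth functions on $\mathbb{T}^d\times\mathbb{R}^d$ all of whose derivatives decay faster than any power of $|v|$, uniformly in $x$. The operator $K$ is considered as an unbounded operator on the Hilbert space $H=L^2(\mathbb{T}^d\times\mathbb{R}^d)$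 with domain $\mathcal{S}(\mathbb{T}^d\times\mathbb{R}^d)$. $\mathbf{K}=K_{\min}$ denotes its minimal closed extension, whose domain is the closure of $D(K)$ with respect to the graph norm. An operator $A$ on $H$ is accretive if $\mathrm{Re}\,\langle Au,u\rangle\ge 0$ for all $u\in D(A)$, and maximally accretive if it is accretive and has no proper accretive extension in $H$. *)

(* Defs.v *)
From HB Require Import structures.
From mathcomp Require Import all_boot all_order all_algebra.
From mathcomp Require Import all_classical all_reals all_analysis.
From mathcomp Require Import measurable_realfun complex.

Set Implicit Arguments.
Unset Strict Implicit.
Unset Printing Implicit Defensive.

Import Order.TTheory GRing.Theory Num.Theory.
Import numFieldNormedType.Exports.

Local Open Scope classical_set_scope.
Local Open Scope ring_scope.

Definition rV_display : measure_display.
Proof. exact: default_measure_display. Qed.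

Section sigma_algebra_rV.
Context {R : realType} (n : nat).

Let coord (i : 'I_n) (x : 'rV[R]_n) : measurableTypeR R := x ord0 i.

Let rV_set0 : g_sigma_preimage coord set0.
Proof. exact: sigma_algebra0. Qed.
Let rV_setC A : g_sigma_preimage coord A -> g_sigma_preimage coord (~` A).
Proof. exact: sigma_algebraC. Qed.
Let rV_bigcup (F : (set 'rV[R]_n)^nat) :
  (forall i, g_sigma_preimage coord (F i)) ->
  g_sigma_preimage coord (\bigcup_i F i).
Proof. exact: sigma_algebra_bigcup. Qed.

(* Product sigma-algebra, i.e. the Borel sigma-algebra of R^n. *)
HB.instance Definition _ := @isMeasurable.Build rV_display 'rV[R]_n
  (g_sigma_preimage coord) rV_set0 rV_setC rV_bigcup.

Lemma measurable_coord (i : 'I_n) :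
  measurable_fun [set: 'rV[R]_n]
    (fun x : 'rV[R]_n => x ord0 i : measurableTypeR R).
Proof.
move=> _ Y mY; rewrite setTI; apply: sub_sigma_algebra => /=.
rewrite -bigcup_seq/=; exists i => /=; first by rewrite mem_index_enum.
by exists Y => //; rewrite setTI.
Qed.

Lemma measurable_fun_rVP d (T : measurableType d) (f : T -> 'rV[R]_n) :
  (forall i, measurable_fun [set: T] (fun t => f t ord0 i : measurableTypeR R)) ->
  measurable_fun [set: T] f.
Proof.
move=> mf.
have : g_sigma_preimage (fun i => coord i \o f) `<=` measurable.
  apply: smallest_sub; first exact: sigma_algebra_measurable.
  case: n f @coord mf => [|m] f coor mf; first by rewrite big_ord0.
  rewrite -bigcup_mkord_ord; apply: bigcup_sub => i Ii.
  by move=> A [B mB <-]; exact: mf.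
rewrite g_sigma_preimage_comp => fS _ A mA.
by apply: fS; exists A.
Qed.

End sigma_algebra_rV.

Section lebesgue_rV.
Context {R : realType}.

Definition rV_cons n (p : measurableTypeR R * 'rV[R]_n) : 'rV[R]_n.+1 :=
  \row_i (if unlift ord0 i is Some j then p.2 ord0 j else p.1).

Definition rV_uncons n (x : 'rV[R]_n.+1) : measurableTypeR R * 'rV[R]_n :=
  (x ord0 ord0, \row_j x ord0 (lift ord0 j)).

Lemma rV_cons_ord0 n (p : measurableTypeR R * 'rV[R]_n) :
  rV_cons p ord0 ord0 = p.1.
Proof. by rewrite mxE unlift_none. Qed.

Lemma rV_cons_lift n (p : measurableTypeR R * 'rV[R]_n) j :
  rV_cons p ord0 (lift ord0 j) = p.2 ord0 j.
Proof. by rewrite mxE liftK. Qed.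

Lemma rV_consK n : cancel (@rV_cons n) (@rV_uncons n).
Proof.
move=> [t x]; rewrite /rV_uncons rV_cons_ord0; congr pair.
by apply/rowP => j; rewrite mxE rV_cons_lift.
Qed.

Lemma measurable_rV_cons n : measurable_fun setT (@rV_cons n).
Proof.
apply: measurable_fun_rVP => i.
have [j ->|->] := unliftP ord0 i.
  under eq_fun do rewrite rV_cons_lift.
  exact: (measurableT_comp (measurable_coord _) measurable_snd).
by under eq_fun do rewrite rV_cons_ord0; exact: measurable_fst.
Qed.

Lemma measurable_rV_uncons n : measurable_fun setT (@rV_uncons n).
Proof.
apply/measurable_fun_pairP; split; first exact: measurable_coord.
apply: measurable_fun_rVP => i.
under eq_fun do rewrite /= mxE.
exact: measurable_coord.
Qed.

Section volS.
Local Open Scope ereal_scope.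
Context (n : nat) (mu : {sigma_finite_measure set 'rV[R]_n -> \bar R}).

Definition volS : set 'rV[R]_n.+1 -> \bar R :=
  pushforward (lebesgue_measure \x mu) (@rV_cons n).

Let meas (A : set 'rV[R]_n.+1) : measurable A ->
  measurable (@rV_cons n @^-1` A).
Proof.
by move=> mA; rewrite -[X in measurable X]setTI; exact: measurable_rV_cons.
Qed.

Let volS0 : volS set0 = 0.
Proof. by rewrite /volS /pushforward preimage_set0 measure0. Qed.

Let volS_ge0 A : 0 <= volS A.
Proof. by rewrite /volS /pushforward; exact: measure_ge0. Qed.

Let volS_sigma_additive : semi_sigma_additive volS.
Proof.
move=> F mF tF mUF; rewrite /volS /pushforward preimage_bigcup.
apply: measure_semi_sigma_additive.
- by move=> k; exact: meas.
- apply/trivIsetP => i j _ _ ij; rewrite -preimage_setI.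
  by move/trivIsetP : tF => /(_ _ _ _ _ ij) ->//; rewrite preimage_set0.
- by rewrite -preimage_bigcup; exact: meas.
Qed.

HB.instance Definition _ := isMeasure.Build _ _ _ volS
  volS0 volS_ge0 volS_sigma_additive.

Let volS_sigma_finite : sigma_finite setT volS.
Proof.
have /sigma_finiteP[F [FT ndF Foo]] := sigma_finiteT (@lebesgue_measure R).
have /sigma_finiteP[G [GT ndG Goo]] := sigma_finiteT mu.
exists (fun k => @rV_uncons n @^-1` (F k `*` G k)).
  rewrite -preimage_bigcup (_ : \bigcup_i _ = setT) ?preimage_setT//.
  rewrite -subTset -setXTT FT GT => -[x y] [[i _ Fx] [j _ Gy]].
  exists (maxn i j) => //; split.
    by have /subsetPset := ndF _ _ (leq_maxl i j); exact.
  by have /subsetPset := ndG _ _ (leq_maxr i j); exact.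
move=> k; have [mF Fk] := Foo k; have [mG Gk] := Goo k; split.
  rewrite -[X in measurable X]setTI; apply: measurable_rV_uncons => //.
  exact: measurableX.
rewrite /volS /pushforward -comp_preimage.
rewrite (_ : _ \o _ = id) ?preimage_id; last exact/funext/rV_consK.
by rewrite product_measure1E// lte_mul_pinfty// ge0_fin_numE.
Qed.

HB.instance Definition _ := Measure_isSigmaFinite.Build _ _ _ volS
  volS_sigma_finite.

End volS.

(* Lebesgue measure on R^n, as the n-fold product of [lebesgue_measure]. *)
Fixpoint vol n : {sigma_finite_measure set 'rV[R]_n -> \bar R} :=
  match n with
  | 0 => \d_ (0 : 'rV[R]_0)
  | n.+1 => volS (vol n)
  end.

End lebesgue_rV.

(* The complex Hilbert space L^2(mu): square-integrable functions T -> R[i]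
   modulo almost-everywhere equality. The library's Lp spaces are real-valued. *)
Section L2_functions.
Context d (T : measurableType d) (R : realType).
Variable mu : {measure set T -> \bar R}.

Definition is_L2 : {pred T -> R[i]^o} := fun u =>
  ((fun z => complex.Re (u z)) \in Lfun mu 2%:E) &&
  ((fun z => complex.Im (u z)) \in Lfun mu 2%:E).

Lemma is_L2_submod_closed : submod_closed is_L2.
Proof.
have le12 : (1 <= 2%:E :> \bar R)%E by rewrite lee_fin ler1n.
have [L0 L] := Lfun_submod_closed mu le12.
have LZ (a : R) (f : T -> R) : f \in Lfun mu 2%:E ->
    (fun z => a * f z) \in Lfun mu 2%:E.
  by move=> Lf; have h := L a f 0 Lf L0; rewrite addr0 in h; exact: h.
have LD (f g : T -> R) : f \in Lfun mu 2%:E -> g \in Lfun mu 2%:E ->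
    (fun z => f z + g z) \in Lfun mu 2%:E.
  by move=> Lf Lg; have h := L 1 f g Lf Lg; rewrite scale1r in h; exact: h.
have LB (f g : T -> R) : f \in Lfun mu 2%:E -> g \in Lfun mu 2%:E ->
    (fun z => f z - g z) \in Lfun mu 2%:E.
  move=> Lf Lg; have h := L (- 1) g f Lg Lf.
  by rewrite scaleN1r addrC in h; exact: h.
split; first by apply/andP; split; exact: L0.
move=> a u v /andP[Lu1 Lu2] /andP[Lv1 Lv2]; apply/andP; split.
  rewrite [X in X \in _](_ : _ = fun z =>
    (complex.Re a * complex.Re (u z) - complex.Im a * complex.Im (u z))
    + complex.Re (v z)).
    by apply: (LD _ _ _ Lv1); apply: LB; exact: LZ.
  apply/funext => z; change ((a *: u + v) z) with ((a : R[i]) * u z + v z).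
  by case: a (u z) (v z) => [a1 a2] [u1 u2] [v1 v2].
rewrite [X in X \in _](_ : _ = fun z =>
  (complex.Re a * complex.Im (u z) + complex.Im a * complex.Re (u z))
  + complex.Im (v z)).
  by apply: (LD _ _ _ Lv2); apply: LD; exact: LZ.
apply/funext => z; change ((a *: u + v) z) with ((a : R[i]) * u z + v z).
by case: a (u z) (v z) => [a1 a2] [u1 u2] [v1 v2].
Qed.

HB.instance Definition _ := GRing.isSubmodClosed.Build _ _ is_L2
  is_L2_submod_closed.

Record L2fun := L2Fun { L2fun_val :> T -> R[i]^o; _ : L2fun_val \in is_L2 }.

HB.instance Definition _ := [isSub for L2fun_val].
HB.instance Definition _ := [Choice of L2fun by <:].
HB.instance Definition _ := [SubChoice_isSubLmodule of L2fun by <:].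

Definition L2null : {pred L2fun} :=
  [pred u : L2fun | `[< (u : T -> R[i]) = cst 0 %[ae mu] >]].

Lemma L2null_submod_closed : submod_closed L2null.
Proof.
split; first by apply/asboolP; apply: aeW.
move=> a u v /asboolP u0 /asboolP v0; apply/asboolP.
apply: filterS2 u0 v0 => z u0 v0 _.
change ((a : R[i]) * u z + v z = 0).
by rewrite u0// v0//= mulr0 addr0.
Qed.

HB.instance Definition _ := GRing.isSubmodClosed.Build _ _ L2null
  L2null_submod_closed.

Definition L2 := {ideal_quot L2null}.
HB.instance Definition _ := Choice.on L2.
HB.instance Definition _ := EqQuotient.on L2.
HB.instance Definition _ := GRing.Zmodule.on L2.
End L2_functions.

Section lmod.
Context d (T : measurableType d) (R : realType).
Variable mu : {measure set T -> \bar R}.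
Local Open Scope quotient_scope.
Notation H := (L2 mu).
Notation F := (L2fun mu).

Lemma L2_eqP (u v : F) :
  \pi_(H) u = \pi_(H) v <-> (u : T -> R[i]) = v %[ae mu].
Proof.
split.
  move/eqP; rewrite -Quotient.idealrBE => /asboolP.
  apply: filterS => z /(_ I) h _.
  by apply/eqP; rewrite -subr_eq0; apply/eqP; exact: h.
move=> uv; apply/eqP; rewrite -Quotient.idealrBE; apply/asboolP.
apply: filterS uv => z /(_ I) h _.
change ((u : T -> R[i]) z - v z = 0).
by rewrite h subrr.
Qed.

Lemma L2_repr_pi (u : F) : (repr (\pi_(H) u) : T -> R[i]) = u %[ae mu].
Proof. by apply/L2_eqP; rewrite reprK. Qed.

Definition L2_scale (a : R[i]) (h : H) : H := \pi_(H) (a *: repr h).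

Lemma pi_L2_scale a (u : F) : L2_scale a (\pi_(H) u) = \pi_(H) (a *: u).
Proof.
apply/L2_eqP; have := L2_repr_pi u.
apply: filterS => z /(_ I) h _.
change (a * (repr (\pi_(H) u) : T -> R[i]) z = a * u z).
by rewrite h.
Qed.

Let scaleA a b h : L2_scale a (L2_scale b h) = L2_scale (a * b) h.
Proof.
by elim/quotW: h => u; rewrite (pi_L2_scale b) !pi_L2_scale scalerA.
Qed.

Let scale1 : left_id 1 L2_scale.
Proof. by elim/quotW => u; rewrite pi_L2_scale scale1r. Qed.

Lemma pi_L2D (u v : F) : \pi_(H) (u + v) = \pi_(H) u + \pi_(H) v.
Proof. exact: Quotient.pi_add. Qed.

Let scaleDr : right_distributive L2_scale +%R.
Proof.
move=> a; elim/quotW => u; elim/quotW => v.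
by rewrite -pi_L2D !pi_L2_scale -pi_L2D scalerDr.
Qed.

Let scaleDl h : {morph L2_scale^~ h : a b / a + b}.
Proof.
by move=> a b; elim/quotW: h => u; rewrite !pi_L2_scale -pi_L2D scalerDl.
Qed.

HB.instance Definition _ := GRing.Zmodule_isLmodule.Build R[i] H
  scaleA scale1 scaleDr scaleDl.

Lemma pi_L2Z a (u : F) : \pi_(H) (a *: u) = a *: \pi_(H) u.
Proof. by rewrite -pi_L2_scale. Qed.

End lmod.

Section L2_norm.
Context d (T : measurableType d) (R : realType).
Variable mu : {measure set T -> \bar R}.
Local Open Scope quotient_scope.
Notation H := (L2 mu).
Notation F := (L2fun mu).

Definition Lnorm2 (u : T -> R[i]) : \bar R :=
  Lnorm mu 2%:E (fun z => (Normc.normc (u z))%:E).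

Lemma measurable_normc (u : F) :
  measurable_fun setT (fun z => Normc.normc (u z)).
Proof.
case: u => u /andP[/andP[/[!inE]/= mr _] /andP[/[!inE]/= mi _]] /=.
rewrite (_ : (fun z => _) = Num.sqrt \o
   (fun z => complex.Re (u z) ^+ 2 + complex.Im (u z) ^+ 2)); last first.
  by apply/funext => z /=; case: (u z).
apply: measurableT_comp.
  by apply: continuous_measurable_fun; exact: sqrt_continuous.
by apply: measurable_funD; exact: measurable_funX.
Qed.

Lemma le_Lnorm2 (f g : T -> R) : measurable_fun setT f ->
  measurable_fun setT g -> (forall z, 0 <= f z <= g z) ->
  (Lnorm mu 2%:E (EFin \o f) <= Lnorm mu 2%:E (EFin \o g))%E.
Proof.
move=> mf mg fg; rewrite unlock /Lnorm gt0_ler_poweR//.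
- by rewrite in_itv/= leey integral_ge0.
- by rewrite in_itv/= leey integral_ge0.
apply: ge0_le_integral => //=.
- apply/measurable_EFinP.
  apply/(@measurableT_comp _ _ _ _ _ _ (fun x : R => x `^ 2)%R) => //.
  exact/measurableT_comp.
- apply/measurable_EFinP.
  apply/(@measurableT_comp _ _ _ _ _ _ (fun x : R => x `^ 2)%R) => //.
  exact/measurableT_comp.
- move=> z _; have /andP[f0 fgz] := fg z.
  rewrite lee_fin ge0_ler_powR ?nnegrE//.
  by rewrite !ger0_norm// (le_trans f0).
Qed.

Lemma Lfun_normc (u : F) :
  (fun z => Normc.normc (u z) : R) \in Lfun mu 2%:E.
Proof.
have mu0 := measurable_normc u.
apply/andP; split; rewrite inE//=.
case: u mu0 => u /andP[/andP[/[!inE]/= mr Nr] /andP[/[!inE]/= mi Ni]] /= mu0.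
pose f := fun z => `|complex.Re (u z)|; pose g := fun z => `|complex.Im (u z)|.
have mf : measurable_fun setT f by exact: measurableT_comp.
have mg : measurable_fun setT g by exact: measurableT_comp.
apply: (@le_lt_trans _ _ (Lnorm mu 2%:E (EFin \o (f \+ g)%R))).
  apply: le_Lnorm2 => //; first exact: measurable_funD.
  move=> z /=; rewrite /f /g; case: (u z) => x y /=.
  rewrite sqrtr_ge0/= -[leRHS]ger0_norm ?addr_ge0// -sqrtr_sqr ler_wsqrtr//.
  rewrite sqrrD !real_normK ?num_real// lerD2r lerDl.
  by rewrite mulrn_wge0// mulr_ge0.
apply: le_lt_trans (minkowski_EFin _ _ _ _) _ => //; first by rewrite ler1n.
rewrite lte_add_pinfty//.
  rewrite (_ : EFin \o f = abse \o (EFin \o (fun z => complex.Re (u z))))//.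
  by rewrite Lnorm_abse.
rewrite (_ : EFin \o g = abse \o (EFin \o (fun z => complex.Im (u z))))//.
by rewrite Lnorm_abse.
Qed.

Lemma Lnorm2_fin (u : F) : Lnorm2 u \is a fin_num.
Proof.
rewrite ge0_fin_numE ?Lnorm_ge0//.
by have := Lfun_normc u => /andP[_]; rewrite inE.
Qed.

Lemma ae_eq_Lnorm2 (u v : F) : (u : T -> R[i]) = v %[ae mu] ->
  Lnorm2 u = Lnorm2 v.
Proof.
move=> uv; rewrite /Lnorm2 unlock /Lnorm; congr (_ `^ _)%E.
apply: ge0_ae_eq_integral => //=.
- apply/measurable_EFinP.
  apply/(@measurableT_comp _ _ _ _ _ _ (fun x : R => x `^ 2)%R) => //.
  exact/measurableT_comp/measurable_normc.
- apply/measurable_EFinP.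
  apply/(@measurableT_comp _ _ _ _ _ _ (fun x : R => x `^ 2)%R) => //.
  exact/measurableT_comp/measurable_normc.
by apply: filterS uv => z /(_ I) /= -> _.
Qed.

Lemma Lnorm2D (u v : F) : (Lnorm2 (u + v)%R <= Lnorm2 u + Lnorm2 v)%E.
Proof.
have m w := measurable_normc w.
apply: le_trans (minkowski_EFin mu (m u) (m v) _); last by rewrite ler1n.
apply: le_Lnorm2; [exact: m|exact: measurable_funD|move=> z].
apply/andP; split; last exact: le_normcD.
by case: ((u + v) z) => x y /=; exact: sqrtr_ge0.
Qed.

Lemma Lnorm2Z a (u : F) :
  (Lnorm2 (a *: u)%R = (Normc.normc a)%:E * Lnorm2 u)%E.
Proof.
have le12 : (1 <= 2%:E :> \bar R)%E by rewrite lee_fin ler1n.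
have := LnormZ (Lfun_Sub le12 (Lfun_normc u)) (Normc.normc a).
rewrite ger0_norm; last by case: a => x y /=; exact: sqrtr_ge0.
move=> <-; apply: eq_Lnorm => z /=; congr (_%:E).
exact: Normc.normcM.
Qed.

Lemma Lnorm2_eq0 (u : F) : Lnorm2 u = 0%E -> u \in @L2null _ _ _ mu.
Proof.
move=> /Lnorm_eq0_eq0 u0; apply/asboolP.
have /u0 : measurable_fun setT (fun z => (Normc.normc (u z))%:E).
  exact/measurable_EFinP/measurable_normc.
move=> /(_ (ltr0n _ 2)).
by apply: filterS => z /(_ I) [] /Normc.eq0_normc h _.
Qed.

Definition L2_norm (h : H) : R[i] := (fine (Lnorm2 (repr h)))%:C%C.

Lemma L2_norm_pi (u : F) : L2_norm (\pi_(H) u) = (fine (Lnorm2 u))%:C%C.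
Proof. by rewrite /L2_norm (ae_eq_Lnorm2 (L2_repr_pi u)). Qed.

Let ler_L2_normD g h : L2_norm (g + h) <= L2_norm g + L2_norm h.
Proof.
elim/quotW: g => u; elim/quotW: h => v; rewrite -pi_L2D !L2_norm_pi.
rewrite -rmorphD lecR -fineD ?Lnorm2_fin// fine_le ?Lnorm2D//.
  exact: Lnorm2_fin.
by rewrite fin_numD !Lnorm2_fin.
Qed.

Let L2_normZ a h : L2_norm (a *: h) = `|a| * L2_norm h.
Proof.
elim/quotW: h => u; rewrite -pi_L2Z !L2_norm_pi Lnorm2Z fineM ?Lnorm2_fin//=.
by rewrite rmorphM.
Qed.

Let L2_norm0_eq0 h : L2_norm h = 0 -> h = 0.
Proof.
elim/quotW: h => u; rewrite L2_norm_pi => -[] u0.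
have /Lnorm2_eq0 /asboolP N0 : Lnorm2 u = 0%E.
  by rewrite -[LHS]fineK ?Lnorm2_fin// u0.
have <- : \pi_(H) (0 : F) = 0 by exact: pi_zeror.
exact/L2_eqP.
Qed.

HB.instance Definition _ := isPointed.Build H 0.
HB.instance Definition _ := Lmodule_isNormed.Build R[i] H
  ler_L2_normD L2_normZ L2_norm0_eq0.

Definition L2_dot (g h : H) : R[i] :=
  let w z := (repr g : T -> R[i]) z * conjc ((repr h : T -> R[i]) z) in
  (\int[mu]_z complex.Re (w z) +i* \int[mu]_z complex.Im (w z))%C.

Lemma L2_dotxx (h : H) : L2_dot h h = `|h| ^+ 2.
Proof.
rewrite -[`|h|]/(fine (Lnorm2 (repr h)))%:C%C /L2_dot.
move: (repr h) => u; rewrite -rmorphXn/=.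
have ReE z : complex.Re ((u : T -> R[i]) z * conjc ((u : T -> R[i]) z)) =
    Normc.normc (u z) ^+ 2.
  case: (u z) => x y /=; rewrite sqr_sqrtr ?addr_ge0 ?sqr_ge0//.
  by rewrite mulrN opprK -!expr2.
have ImE z : complex.Im ((u : T -> R[i]) z * conjc ((u : T -> R[i]) z)) = 0.
  by case: (u z) => x y /=; rewrite mulrN mulrC addNr.
congr Complex; last first.
  rewrite /Rintegral; under eq_integral do rewrite ImE.
  by rewrite integral0.
rewrite /Rintegral; under eq_integral do rewrite ReE.
rewrite -[RHS]/(fine ((fine (Lnorm2 u) ^+ 2)%:E)).
rewrite -powR_mulrn ?fine_ge0 ?Lnorm_ge0//.
rewrite -poweR_EFin fineK ?Lnorm2_fin// poweR_Lnorm//; congr fine.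
apply: eq_integral => z _ /=; rewrite powR_mulrn ?normr_ge0// -normrX.
by rewrite ger0_norm ?sqr_ge0.
Qed.

End L2_norm.

(* Unbounded operators on H = L^2(mu) are identified with their graphs,
   (u, f) \in A meaning that u \in D(A) and f = A u. *)
Section operators.
Context d (T : measurableType d) (R : realType).
Context {mu : {measure set T -> \bar R}}.
Notation H := (L2 mu).

Definition is_operator (A : set (H * H)) : Prop :=
  [/\ A (0, 0),
      forall (a : R[i]) (p q : H * H), A p -> A q -> A (a *: p + q) &
      forall f : H, A (0, f) -> f = 0].

Definition accretive (A : set (H * H)) : Prop :=
  forall u f : H, A (u, f) -> 0 <= complex.Re (L2_dot f u).

Definition maximally_accretive (A : set (H * H)) : Prop :=
  [/\ is_operator A, accretive A &
      forall A' : set (H * H), is_operator A' -> accretive A' ->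
        A `<=` A' -> A' = A].

(* Closure of the graph for the product norm topology of H * H; its domain is
   the closure of D(A) for the graph norm. The closure need not be single-valued
   in general: this is part of [maximally_accretive (op_closure A)]. *)
Definition op_closure (A : set (H * H)) : set (H * H) := closure A.

Definition represents (h : H) (f : T -> R[i]) : Prop :=
  (repr h : T -> R[i]) = f %[ae mu].

End operators.

(* Functions on T^n = R^n / Z^n are encoded as Z^n-periodic functions on R^n, and
   the measure of T^n as Lebesgue measure restricted to the cell [0, 1)^n. *)
Section torus.
Context {R : realType} (n : nat).

Definition unit_cell : set 'rV[R]_n :=
  [set x | forall i, 0 <= x ord0 i < 1].

Lemma measurable_unit_cell : measurable unit_cell.
Proof.
rewrite (_ : unit_cell = \bigcap_(i in [set: 'I_n])
    ((fun x : 'rV[R]_n => x ord0 i : measurableTypeR R) @^-1` `[0, 1[%classic)).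
  apply: fin_bigcap_measurable => // i _.
  by rewrite -[X in measurable X]setTI; apply: measurable_coord.
apply/seteqP; split => x /=.
  by move=> h i _ /=; rewrite in_itv/=; exact: h.
by move=> h i; have := h i I; rewrite /= in_itv.
Qed.

Definition torus_vol : set 'rV[R]_n -> \bar R :=
  mrestr (vol n) measurable_unit_cell.

HB.instance Definition _ := Measure.on torus_vol.

Definition torus_periodic (Y : Type) (f : 'rV[R]_n -> Y) : Prop :=
  forall (x : 'rV[R]_n) (i : 'I_n), f (x + delta_mx ord0 i) = f x.

Definition Linfty_torus m (B : 'rV[R]_n -> 'rV[R]_m) : Prop :=
  torus_periodic B /\
  forall j : 'I_m, (fun x => B x ord0 j) \in Lfun torus_vol +oo%E.

End torus.

Section fokker_planck.
Context {R : realType} (d : nat).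
Local Open Scope complex_scope.

Notation phase := ('rV[R]_d * 'rV[R]_d)%type.

Definition phase_vol : set phase -> \bar R := (@torus_vol R d \x vol d)%E.

HB.instance Definition _ := Measure.on phase_vol.

Definition cderive (e : phase) (u : phase -> R[i]) (z : phase) : R[i] :=
  'D_e (fun y => complex.Re (u y)) z +i* 'D_e (fun y => complex.Im (u y)) z.

Definition ex (i : 'I_d) : phase := (delta_mx ord0 i, 0).
Definition ev (i : 'I_d) : phase := (0, delta_mx ord0 i).

(* Iterated partial derivatives, inl i standing for d/dx_i and inr i for d/dv_i. *)
Definition iter_derive (s : seq ('I_d + 'I_d)) (u : phase -> R[i]) :=
  foldr (fun k w => cderive (match k with inl i => ex i | inr i => ev i end) w)
    u s.

(* C^oo: the partial derivatives of every order exist and are differentiable. *)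
Definition smooth (u : phase -> R[i]) : Prop :=
  forall s z, differentiable (fun y => complex.Re (iter_derive s u y)) z /\
              differentiable (fun y => complex.Im (iter_derive s u y)) z.

(* The library's norm on 'rV is the sup norm, hence the explicit |v|^2. *)
Definition sqnorm (v : 'rV[R]_d) : R := \sum_i v ord0 i ^+ 2.

Definition schwartz (u : phase -> R[i]) : Prop :=
  [/\ forall v, torus_periodic (fun x => u (x, v)),
      smooth u &
      forall s (k : nat), exists C : R, forall x v,
        (Num.sqrt (sqnorm v) ^+ k)%:C * `|iter_derive s u (x, v)| <= C%:C].

End fokker_planck.

Section magnetic.
Context {R : realType}.
Local Open Scope complex_scope.

(* (v /\ b) . D for D the gradient in v; the formula only makes sense, and is only
   used, for d = 2 and d = 3. *)
Definition wedge_grad (d : nat) :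
    'rV[R]_((d * d.-1)./2) -> 'rV[R]_d -> ('I_d -> R[i]) -> R[i] :=
  match d with
  | 2 => fun (b : 'rV[R]_1) (v : 'rV[R]_2) (D : 'I_2 -> R[i]) =>
      (b 0 0)%:C * ((v 0 0)%:C * D 1 - (v 0 1)%:C * D 0)
  | 3 => fun (b v : 'rV[R]_3) (D : 'I_3 -> R[i]) =>
      (b 0 0)%:C * ((v 0 1)%:C * D 2 - (v 0 2)%:C * D 1)
    + (b 0 1)%:C * ((v 0 2)%:C * D 0 - (v 0 0)%:C * D 2)
    + (b 0 2)%:C * ((v 0 0)%:C * D 1 - (v 0 1)%:C * D 0)
  | _ => fun _ _ _ => 0
  end.

Definition fokker_planck d (B : 'rV[R]_d -> 'rV[R]_((d * d.-1)./2))
    (u : 'rV[R]_d * 'rV[R]_d -> R[i]) (z : 'rV[R]_d * 'rV[R]_d) : R[i] :=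
  let: (x, v) := z in
  (\sum_i (v ord0 i)%:C * cderive (ex i) u z)
  - wedge_grad (B x) v (fun i => cderive (ev i) u z)
  - (\sum_i cderive (ev i) (cderive (ev i) u) z)
  + (sqnorm v / 4%:R - d%:R / 2%:R)%:C * u z.

Definition fokker_planck_op d (B : 'rV[R]_d -> 'rV[R]_((d * d.-1)./2)) :
    set (L2 (@phase_vol R d) * L2 (@phase_vol R d)) :=
  [set p | exists2 u, schwartz u &
     represents p.1 u /\ represents p.2 (fokker_planck B u)].

End magnetic.

(* Main.v *)
(* With lam = d/2 + 1, an accretive extension of the closure of K is contained in it as
   soon as K + lam has dense range, and an accretive operator with dense domain has a
   single-valued closure. K is accretive because <K u, u> is, up to null divergences,
   the sum of the |d_{v_j} u + v_j u / 2|^2. Hence it suffices that f in L^2 with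
   <f, (K + lam) u> = 0 for all Schwartz u vanishes. The coefficients being only bounded,
   f cannot be tested against itself: let T be the convolution with a kernel k that is
   trigonometric in x and Gaussian in v, F = T f, chi = exp (- v^2 / 8) and u = T (chi^2 F).
   Moving T to the other side gives the energy identity of (K + lam) for chi F up to
   commutators. The commutator with v . d_x is the convolution by v_i k applied to
   d_{x_i} F; it is small when the velocity scale is small compared with the space scale.
   The commutator with the magnetic term is v_i (T (B f) - B T f), up to a small term:
   it tends to 0 for any bounded measurable B, the factor v_i being absorbed by chi.
   In the limit chi f = 0. *)
Require Import Defs.
From HB Require Import structures.
From mathcomp Require Import all_boot all_order all_algebra.
From mathcomp Require Import all_classical all_reals all_analysis.
From mathcomp Require Import measurable_realfun complex ring lra.
Set Implicit Arguments.
Unset Strict Implicit.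
Unset Printing Implicit Defensive.
Import Order.TTheory GRing.Theory Num.Theory.
Import numFieldNormedType.Exports.
Local Open Scope classical_set_scope.
Local Open Scope ring_scope.

(** * Square-integrable real functions *)

(** Commuting a mollifier past a coefficient that is merely bounded gives no rate: [T (B f) - B T f]
    only tends to 0 because [T] tends strongly to the identity, at [B f] and at [f]. As [B] depends
    on [x] alone and acts through an antisymmetric matrix, it passes through integrations by parts
    in [v] without being differentiated, and it drops out of the energy. The test function contains
    [T] twice so that, [T] being symmetric (even kernel), [F] appears on both sides. The weight is
    cheap: the gradient of [chi] is [- v chi / 4] and costs [v^2 / 16], against the [v^2 / 4] of the
    potential. The shift [d/2 + 1] cancels the constant of [K] and leaves [v^2 / 4 + 1]. Kernels are
    products of trigonometric polynomials in the [x_i] and of polynomials times Gaussians in the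
    [v_j], a class closed under derivatives and under multiplication by [v_j]: convolutions of
    regular functions with them are Schwartz, all moments and derivatives are again convolutions of
    this kind, and Schur's test bounds them. As [K] has real coefficients, the analysis is done for
    real functions and applied to real and imaginary parts. *)

Section square_integrable.
Context d (T : measurableType d) (R : realType).
Variable mu : {measure set T -> \bar R}.
Notation itg f := (mu.-integrable setT (EFin \o f)).

Lemma itg_meas (f : T -> R) : itg f -> measurable_fun setT f.
Proof. by move=> /integrableP[/measurable_EFinP]. Qed.

Lemma itg_le (f g : T -> R) : measurable_fun setT f -> itg g ->
  (forall z, `|f z| <= g z) -> itg f.
Proof.
move=> mf ig fg; apply: (le_integrable _ _ _ ig) => //.
  exact/measurable_EFinP.
by move=> z _ /=; rewrite lee_fin (le_trans (fg z))// ler_norm.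
Qed.

Lemma itgD (f g : T -> R) : itg f -> itg g -> itg (fun z => f z + g z).
Proof. by move=> /integrableD fi /fi; exact. Qed.

Lemma itgZ (a : R) (f : T -> R) : itg f -> itg (fun z => a * f z).
Proof. by move=> /integrableZl fi; exact: fi. Qed.

Lemma itgN (f : T -> R) : itg f -> itg (fun z => - f z).
Proof. by move=> /integrableN; exact. Qed.

Lemma itgB (f g : T -> R) : itg f -> itg g -> itg (fun z => f z - g z).
Proof. by move=> fi gi; apply: itgD => //; exact: itgN. Qed.

Lemma itg0 : itg (fun=> 0).
Proof. exact: integrable0. Qed.

Lemma itg_sum (I : Type) (s : seq I) (F : I -> T -> R) :
  (forall i, itg (F i)) -> itg (fun z => \sum_(i <- s) F i z).
Proof.
move=> Fi; elim: s => [|i s ih].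
  by under eq_fun do rewrite big_nil; exact: itg0.
by under eq_fun do rewrite big_cons; exact: itgD.
Qed.

Lemma Rint_sum (I : Type) (s : seq I) (F : I -> T -> R) :
  (forall i, itg (F i)) ->
  \int[mu]_z (\sum_(i <- s) F i z) = \sum_(i <- s) \int[mu]_z F i z.
Proof.
move=> Fi; elim: s => [|i s ih].
  under eq_Rintegral do rewrite big_nil.
  by rewrite big_nil /Rintegral integral0.
under eq_Rintegral do rewrite big_cons.
by rewrite RintegralD//; [rewrite big_cons ih|exact: itg_sum].
Qed.

Lemma RintN (f : T -> R) : itg f -> \int[mu]_z (- f z) = - \int[mu]_z f z.
Proof.
move=> fi; under eq_Rintegral do rewrite -mulN1r.
by rewrite RintegralZl// mulN1r.
Qed.

Lemma itg_EFin (f : T -> R) : itg f ->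
  (\int[mu]_z f z)%:E = (\int[mu]_z (f z)%:E)%E.
Proof. by move=> fi; rewrite /Rintegral fineK//; exact: integrable_fin_num. Qed.

Lemma ae_eq_Rint (f g : T -> R) : measurable_fun setT f ->
  measurable_fun setT g -> f = g %[ae mu] ->
  \int[mu]_z f z = \int[mu]_z g z.
Proof.
move=> mf mg fg; congr fine; apply: ae_eq_integral => //.
- exact/measurable_EFinP.
- exact/measurable_EFinP.
- by apply: filterS fg => z /(_ I) /= -> _.
Qed.

(** Stated for functions rather than classes, so that pointwise identities can be used; classes of
    [L2] come back only through [L2part]. *)
Definition sqi (f : T -> R) :=
  measurable_fun setT f /\ itg (fun z => f z ^+ 2).

Definition N2 (f : T -> R) := \int[mu]_z (f z ^+ 2).
Definition ip (f g : T -> R) := \int[mu]_z (f z * g z).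

Lemma N2_ge0 f : 0 <= N2 f.
Proof. by apply: Rintegral_ge0 => z _; exact: sqr_ge0. Qed.

Lemma sqi_mul (f g : T -> R) : sqi f -> sqi g -> itg (fun z => f z * g z).
Proof.
move=> [mf fi] [mg gi].
apply: (@itg_le _ (fun z => f z ^+ 2 + g z ^+ 2)).
- exact: measurable_funM.
- exact: itgD.
- move=> z; rewrite normrM -[f z ^+ 2]real_normK ?num_real//.
  rewrite -[g z ^+ 2]real_normK ?num_real//.
  have := sqr_ge0 (`|f z| - `|g z|); have := normr_ge0 (f z).
  have := normr_ge0 (g z); nra.
Qed.

Lemma sqiD f g : sqi f -> sqi g -> sqi (fun z => f z + g z).
Proof.
move=> sf sg; have [mf fi] := sf; have [mg gi] := sg; split.
  exact: measurable_funD.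
rewrite (_ : _ \o _ = EFin \o (fun z => f z ^+ 2 + (g z ^+ 2 + 2 * (f z * g z)))).
  by apply: itgD => //; apply: itgD => //; apply: itgZ; exact: sqi_mul.
by apply/funext => z /=; congr EFin; ring.
Qed.

Lemma sqiZ a f : sqi f -> sqi (fun z => a * f z).
Proof.
move=> [mf fi]; split; first exact: measurable_funM.
rewrite (_ : _ \o _ = EFin \o (fun z => a ^+ 2 * f z ^+ 2)); first exact: itgZ.
by apply/funext => z /=; rewrite exprMn.
Qed.

Lemma sqiN f : sqi f -> sqi (fun z => - f z).
Proof. by move=> /(sqiZ (-1)); under eq_fun do rewrite mulN1r. Qed.

Lemma sqiB f g : sqi f -> sqi g -> sqi (fun z => f z - g z).
Proof. by move=> sf sg; apply: sqiD => //; exact: sqiN. Qed.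

Lemma sqi0 : sqi (fun=> 0).
Proof.
split; first exact: measurable_cst.
by under eq_fun do rewrite expr0n/=; exact: itg0.
Qed.

Lemma sqi_sum (I : Type) (s : seq I) (F : I -> T -> R) :
  (forall i, sqi (F i)) -> sqi (fun z => \sum_(i <- s) F i z).
Proof.
move=> Fi; elim: s => [|i s ih].
  by under eq_fun do rewrite big_nil; exact: sqi0.
by under eq_fun do rewrite big_cons; exact: sqiD.
Qed.

Lemma sqi_le (f g : T -> R) : measurable_fun setT f -> sqi g ->
  (forall z, `|f z| <= `|g z|) -> sqi f.
Proof.
move=> mf [mg gi] fg; split=> //; apply: (itg_le _ gi).
  exact: measurable_funX.
move=> z; rewrite ger0_norm ?sqr_ge0// -[leLHS]real_normK ?num_real//.
by rewrite -[leRHS]real_normK ?num_real// ler_sqr// nnegrE.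
Qed.

Lemma sqi_bM (c f : T -> R) (C : R) : measurable_fun setT c ->
  (forall z, `|c z| <= C) -> sqi f -> sqi (fun z => c z * f z).
Proof.
move=> mc cC sf; apply: (@sqi_le _ (fun z => C * f z)).
- by apply: measurable_funM => //; case: sf.
- exact: sqiZ.
- move=> z; rewrite !normrM ler_wpM2r// (le_trans (cC z))//.
  exact: ler_norm.
Qed.

Lemma N2_bM (c f : T -> R) (C : R) : measurable_fun setT c ->
  (forall z, `|c z| <= C) -> sqi f ->
  N2 (fun z => c z * f z) <= C ^+ 2 * N2 f.
Proof.
move=> mc cC sf; have [_ fi] := sf; rewrite /N2 -RintegralZl//.
apply: le_Rintegral => //.
- by have [] := sqi_bM mc cC sf.
- exact: itgZ.
- move=> z _; rewrite exprMn ler_wpM2r ?sqr_ge0//.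
  rewrite -[leLHS]real_normK ?num_real// ler_sqr ?nnegrE//.
  exact: le_trans (cC z).
Qed.

(** Young's inequality with a free weight, from the square [a (x - y / (2 a))^2] under the integral;
    [ip_CS] follows by choosing [a]. *)
Lemma ip_le f g (a : R) : 0 < a -> sqi f -> sqi g ->
  `|ip f g| <= a * N2 f + a^-1 / 4 * N2 g.
Proof.
move=> a0 sf sg; have [_ fi] := sf; have [_ gi] := sg.
apply: le_trans (le_normr_Rintegral _ _) _ => //; first exact: sqi_mul.
rewrite /N2 -!RintegralZl// -RintegralD//; [|exact: itgZ|exact: itgZ].
apply: le_Rintegral => //.
- exact: integrable_norm (sqi_mul sf sg).
- by apply: itgD; exact: itgZ.
- move=> z _; rewrite normrM -[f z ^+ 2]real_normK ?num_real//.
  rewrite -[g z ^+ 2]real_normK ?num_real//.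
  set x := `|f z|; set y := `|g z|.
  have -> : a * x ^+ 2 + a^-1 / 4 * y ^+ 2 =
    x * y + a * (x - a^-1 / 2 * y) ^+ 2 by field; rewrite gt_eqF.
  by rewrite lerDl mulr_ge0 ?sqr_ge0// ltW.
Qed.

Lemma ip_CS f g : sqi f -> sqi g -> ip f g ^+ 2 <= N2 f * N2 g.
Proof.
move=> sf sg; rewrite -[ip f g ^+ 2]real_normK ?num_real//.
set s := `|_|; have s0 : 0 <= s by exact: normr_ge0.
have key a : 0 < a -> s <= a * N2 f + a^-1 / 4 * N2 g.
  by move=> a0; exact: ip_le.
have := N2_ge0 f; have := N2_ge0 g; move: key; set x := N2 f; set y := N2 g.
move=> key y0 x0.
have [s_0|sn0] := eqVneq s 0; first by rewrite s_0 expr0n/= mulr_ge0.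
have sp : 0 < s by rewrite lt_def sn0.
have [y_0|yn0] := eqVneq y 0.
  have xp : 0 < x + 1 by rewrite ltr_wpDl.
  (* Here [N2 g = 0], so the weight may be taken small; this one forces [s <= s / 2], which
     contradicts [0 < s]. *)
  have := key (s / (2 * (x + 1))); rewrite y_0 mulr0 addr0.
  rewrite divr_gt0 ?mulr_gt0// => /(_ isT); rewrite mulrAC ler_pdivlMr ?mulr_gt0//.
  by move: sp x0; nra.
have yp : 0 < y by rewrite lt_def yn0.
(* This weight makes the second term of Young's inequality exactly [s / 2]. *)
have := key (y / (2 * s)); rewrite divr_gt0 ?mulr_gt0// => /(_ isT).
have -> : y / (2 * s) * x + (y / (2 * s))^-1 / 4 * y = y * x / (2 * s) + s / 2.
  by field; rewrite sn0 yn0.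
rewrite -lerBlDr => h.
have {}h : s / 2 <= y * x / (2 * s) by lra.
move: h; rewrite ler_pdivlMr ?mulr_gt0//.
have -> : s / 2 * (2 * s) = s ^+ 2 by field.
by rewrite [x * y]mulrC.
Qed.

Lemma N2D_le f g : sqi f -> sqi g ->
  N2 (fun z => f z + g z) <= 2 * N2 f + 2 * N2 g.
Proof.
move=> sf sg; have [_ fi] := sf; have [_ gi] := sg.
rewrite /N2 -!RintegralZl// -RintegralD//; [|exact: itgZ|exact: itgZ].
apply: le_Rintegral => //.
- by have [] := sqiD sf sg.
- by apply: itgD; exact: itgZ.
- by move=> z _; have := sqr_ge0 (f z - g z); nra.
Qed.

Lemma N2N f : N2 (fun z => - f z) = N2 f.
Proof. by apply: eq_Rintegral => z _; rewrite sqrrN. Qed.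

Lemma N2B_le f g : sqi f -> sqi g ->
  N2 (fun z => f z - g z) <= 2 * N2 f + 2 * N2 g.
Proof.
by move=> sf sg; apply: le_trans (N2D_le sf (sqiN sg)) _; rewrite N2N.
Qed.

Lemma N2Z a f : sqi f -> N2 (fun z => a * f z) = a ^+ 2 * N2 f.
Proof.
move=> [_ fi]; rewrite /N2 -RintegralZl//.
by apply: eq_Rintegral => z _; rewrite exprMn.
Qed.

Lemma ipC f g : ip f g = ip g f.
Proof. by apply: eq_Rintegral => z _; rewrite mulrC. Qed.

Lemma ipDl f g h : sqi f -> sqi g -> sqi h ->
  ip (fun z => f z + g z) h = ip f h + ip g h.
Proof.
move=> sf sg sh; rewrite /ip -RintegralD//; [|exact: sqi_mul..].
by apply: eq_Rintegral => z _; rewrite mulrDl.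
Qed.

Lemma ipZl a f h : sqi f -> sqi h -> ip (fun z => a * f z) h = a * ip f h.
Proof.
move=> sf sh; rewrite /ip -RintegralZl//; last exact: sqi_mul.
by apply: eq_Rintegral => z _; rewrite mulrA.
Qed.

Lemma ipNl f h : sqi f -> sqi h -> ip (fun z => - f z) h = - ip f h.
Proof.
move=> sf sh; rewrite -mulN1r -ipZl//.
by congr ip; apply/funext => z; rewrite mulN1r.
Qed.

Lemma ipBl f g h : sqi f -> sqi g -> sqi h ->
  ip (fun z => f z - g z) h = ip f h - ip g h.
Proof.
by move=> sf sg sh; rewrite ipDl//; [rewrite ipNl|exact: sqiN].
Qed.

Lemma ipxx f : ip f f = N2 f.
Proof. by apply: eq_Rintegral => z _; rewrite expr2. Qed.

Lemma N2BE f g : sqi f -> sqi g ->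
  N2 (fun z => f z - g z) = N2 f - 2 * ip f g + N2 g.
Proof.
move=> sf sg; rewrite -ipxx ipBl//; [|exact: sqiB].
rewrite [ip f _]ipC [ip g (fun _ => _)]ipC !ipBl// !ipxx [ip g f]ipC.
by ring.
Qed.

Lemma N2_eq0 f : sqi f -> N2 f = 0 -> f = (fun=> 0) %[ae mu].
Proof.
move=> [mf fi] f0.
have : (\int[mu]_z `|(f z ^+ 2)%:E| = 0)%E.
  under eq_integral do rewrite gee0_abs ?lee_fin ?sqr_ge0//.
  by rewrite -itg_EFin//; congr EFin.
have mf2 : measurable_fun setT (fun z => (f z ^+ 2)%:E).
  by apply/measurable_EFinP; exact: measurable_funX.
move=> /(ae_eq_integral_abs mu measurableT mf2).
apply: filterS => z /= /(_ I) /= [] /eqP.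
by rewrite sqrf_eq0 => /eqP.
Qed.

Lemma ae_eq_N2 (f g : T -> R) : measurable_fun setT f ->
  measurable_fun setT g -> f = g %[ae mu] -> N2 f = N2 g.
Proof.
move=> mf mg fg; apply: ae_eq_Rint; [exact: measurable_funX..|].
by apply: filterS fg => z /(_ I) /= -> _.
Qed.

Lemma ae_eq_ip (f g h k : T -> R) : measurable_fun setT f ->
  measurable_fun setT g -> measurable_fun setT h -> measurable_fun setT k ->
  f = h %[ae mu] -> g = k %[ae mu] -> ip f g = ip h k.
Proof.
move=> mf mg mh mk fh gk; apply: ae_eq_Rint; [exact: measurable_funM..|].
by apply: filterS2 fh gk => z /(_ I) /= -> /(_ I) -> _.
Qed.

End square_integrable.

(** * Integral operators and Schur's test *)

Section fubini_real.
Context d1 d2 (T1 : measurableType d1) (T2 : measurableType d2) (R : realType).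
Variable m1 : {sigma_finite_measure set T1 -> \bar R}.
Variable m2 : {sigma_finite_measure set T2 -> \bar R}.
Variable f : T1 * T2 -> R.
Hypothesis fi : (m1 \x m2)%E.-integrable setT (EFin \o f).

Let ae1 : {ae m1, forall x, fubini_F m2 (EFin \o f) x = (\int[m2]_y f (x, y))%:E}.
Proof.
by have := ae_integrable1 fi; apply: filterS => x h; rewrite itg_EFin.
Qed.

Lemma Rint_fubini1 : measurable_fun setT (fun x => \int[m2]_y f (x, y)) ->
  \int[m1]_x (\int[m2]_y f (x, y)) = Rintegral (m1 \x m2)%E setT f.
Proof.
move=> mf; rewrite [RHS]/Rintegral -[X in _ = fine X]integral12_prod_meas1//.
congr fine; apply: ae_eq_integral => //.
- exact/measurable_EFinP.
- exact: (measurable_fubini_F fi).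
- by apply: filterS ae1 => x /= -> _.
Qed.

Let ae2 : {ae m2, forall y, fubini_G m1 (EFin \o f) y = (\int[m1]_x f (x, y))%:E}.
Proof.
by have := ae_integrable2 fi; apply: filterS => x h; rewrite itg_EFin.
Qed.

Lemma Rint_fubini2 : measurable_fun setT (fun y => \int[m1]_x f (x, y)) ->
  \int[m2]_y (\int[m1]_x f (x, y)) = Rintegral (m1 \x m2)%E setT f.
Proof.
move=> mf; rewrite [RHS]/Rintegral -[X in _ = fine X]integral21_prod_meas1//.
congr fine; apply: ae_eq_integral => //.
- exact/measurable_EFinP.
- exact: (measurable_fubini_G fi).
- by apply: filterS ae2 => x /= -> _.
Qed.

End fubini_real.

Section measurable_parametric.
Context d1 d2 (T1 : measurableType d1) (T2 : measurableType d2) (R : realType).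

(** Without any integrability: [Rintegral] is [fine] of a difference of integrals of nonnegative
    functions, each measurable by Tonelli, and [fine] is measurable. *)
Lemma measurable_Rint1 (m2 : {sigma_finite_measure set T2 -> \bar R})
    (f : T1 * T2 -> R) : measurable_fun setT f ->
  measurable_fun setT (fun x => \int[m2]_y f (x, y)).
Proof.
move=> mf; apply: measurableT_comp; first exact: fine_measurable.
have -> : (fun x => (\int[m2]_y (f (x, y))%:E)%E) =
   (fubini_F m2 (EFin \o f)^\+ \- fubini_F m2 (EFin \o f)^\-)%E.
  apply/funext => x; rewrite [LHS]integralE /fubini_F /fubini_G /=.
  by congr (adde _ (oppe _)); apply: eq_integral => y _; rewrite !(funeposE, funenegE).
by apply: emeasurable_funB; apply: measurable_fun_fubini_tonelli_F => //;
  [apply: measurable_funepos|apply: measurable_funeneg]; exact/measurable_EFinP.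
Qed.

Lemma measurable_Rint2 (m1 : {sigma_finite_measure set T1 -> \bar R})
    (f : T1 * T2 -> R) : measurable_fun setT f ->
  measurable_fun setT (fun y => \int[m1]_x f (x, y)).
Proof.
move=> mf; apply: measurableT_comp; first exact: fine_measurable.
have -> : (fun y => (\int[m1]_x (f (x, y))%:E)%E) =
   (fubini_G m1 (EFin \o f)^\+ \- fubini_G m1 (EFin \o f)^\-)%E.
  apply/funext => x; rewrite [LHS]integralE /fubini_F /fubini_G /=.
  by congr (adde _ (oppe _)); apply: eq_integral => y _; rewrite !(funeposE, funenegE).
by apply: emeasurable_funB; apply: measurable_fun_fubini_tonelli_G => //;
  [apply: measurable_funepos|apply: measurable_funeneg]; exact/measurable_EFinP.
Qed.

End measurable_parametric.

Lemma measurable_fun2 d d1 d2 d3 (T : measurableType d) (T1 : measurableType d1)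
    (T2 : measurableType d2) (T3 : measurableType d3) (k : T1 -> T2 -> T3)
    (f : T -> T1) (g : T -> T2) :
  measurable_fun setT (fun p : T1 * T2 => k p.1 p.2) ->
  measurable_fun setT f -> measurable_fun setT g ->
  measurable_fun setT (fun t => k (f t) (g t)).
Proof.
move=> mk mf mg.
by have := measurableT_comp mk (measurable_fun_pair mf mg).
Qed.

Section integral_operator.
Context d (T : measurableType d) (R : realType).
Variable mu : {sigma_finite_measure set T -> \bar R}.
Notation itg f := (mu.-integrable setT (EFin \o f)).
Notation sqi := (sqi mu).
Notation N2 := (N2 mu).
Notation ip := (ip mu).

(** One constant for rows and columns, so that [A] itself bounds the norm of [iop k] on L^2 and the
    transpose satisfies the same condition. *)
Definition schur (k : T -> T -> R) (A : R) :=
  [/\ measurable_fun setT (fun p : T * T => k p.1 p.2), 0 <= A,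
      forall z, (\int[mu]_z' `|k z z'|%:E <= A%:E)%E &
      forall z', (\int[mu]_z `|k z z'|%:E <= A%:E)%E].

Definition iop (k : T -> T -> R) (f : T -> R) (z : T) : R :=
  \int[mu]_z' (k z z' * f z').

Lemma schur_sym k A : schur k A -> schur (fun z z' => k z' z) A.
Proof.
move=> [mk A0 k1 k2]; split=> //.
exact: (measurable_fun2 mk).
Qed.

Lemma measurable_iop k f : measurable_fun setT (fun p : T * T => k p.1 p.2) ->
  measurable_fun setT f -> measurable_fun setT (iop k f).
Proof.
move=> mk mf; apply: (@measurable_Rint1 _ _ _ _ _ _ (fun p => k p.1 p.2 * f p.2)).
by apply: measurable_funM => //; exact: measurableT_comp.
Qed.

Lemma measurable_sec2 (k : T -> T -> R) z :
  measurable_fun setT (fun p : T * T => k p.1 p.2) ->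
  measurable_fun setT (k z).
Proof.
by move=> mk; apply: (measurable_fun2 mk).
Qed.

Lemma measurable_sec1 (k : T -> T -> R) z' :
  measurable_fun setT (fun p : T * T => k p.1 p.2) ->
  measurable_fun setT (fun z => k z z').
Proof.
by move=> mk; apply: (measurable_fun2 mk).
Qed.

(** Cauchy-Schwarz for the measure with density [|k z z'|] in [z'], whose mass is at most [A]. The
    inequality lives in the extended reals because the right-hand integral may diverge for some
    [z]. *)
Lemma iop_sqr_le k A f z : schur k A -> measurable_fun setT f ->
  ((iop k f z ^+ 2)%:E <= A%:E * \int[mu]_z' (`|k z z'| * f z' ^+ 2)%:E)%E.
Proof.
move=> [mk A0 k1 k2] mf.
have mkz := measurable_sec2 z mk.
set b := (\int[mu]_z' _)%E.
have b0 : (0 <= b)%E.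
  by apply: integral_ge0 => z' _; rewrite lee_fin mulr_ge0 ?sqr_ge0.
have mb : measurable_fun setT (fun z' => `|k z z'| * f z' ^+ 2).
  by apply: measurable_funM; [exact: measurableT_comp|exact: measurable_funX].
have ik : itg (k z).
  apply/integrableP; split; first exact/measurable_EFinP.
  by apply: le_lt_trans (ltry A); exact: k1.
(* For [A = 0] a divergent integral would give [0 * +oo = 0] on the right, so the left side has to
   vanish by itself: [k z] is null almost everywhere. *)
have [A_0|An0] := eqVneq A 0.
  have kae : ae_eq mu setT (EFin \o k z) (cst 0%E).
    apply/ae_eq_integral_abs => //; first exact/measurable_EFinP.
    apply/eqP; rewrite eq_le integral_ge0 ?andbT; last by move=> *; exact: abse_ge0.
    by have := k1 z; rewrite A_0.
  rewrite (_ : iop k f z = 0) ?A_0 ?expr0n ?mul0e//.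
  rewrite /iop (@ae_eq_Rint _ _ _ mu _ (fun=> 0)) ?/Rintegral ?integral0//.
    exact: measurable_funM.
  by apply: filterS kae => z' /(_ I) [] -> _; rewrite mul0r.
have Ap : 0 < A by rewrite lt_def An0.
have := leey b; rewrite le_eqVlt => /orP[/eqP->|bfin].
  by rewrite gt0_muley ?lte_fin// leey.
have ib : itg (fun z' => `|k z z'| * f z' ^+ 2).
  apply/integrableP; split; first exact/measurable_EFinP.
  rewrite (eq_integral (fun z' => (`|k z z'| * f z' ^+ 2)%:E))// => z' _.
  by rewrite gee0_abs// lee_fin mulr_ge0 ?sqr_ge0.
pose br := \int[mu]_z' (`|k z z'| * f z' ^+ 2).
have bE : b = br%:E by rewrite itg_EFin.
have br0 : 0 <= br by rewrite -lee_fin -bE.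
rewrite bE -EFinM lee_fin.
have ikf : itg (fun z' => k z z' * f z').
  apply: (@itg_le _ _ _ _ _ (fun z' => `|k z z'| + `|k z z'| * f z' ^+ 2)).
  - exact: measurable_funM.
  - by apply: itgD => //; exact: integrable_norm ik.
  - move=> z'; rewrite normrM -[f z' ^+ 2]real_normK ?num_real//.
    have := sqr_ge0 (`|f z'| - 1); have := normr_ge0 (k z z').
    have := normr_ge0 (f z'); nra.
pose a := \int[mu]_z' `|k z z'|.
have a0 : 0 <= a by apply: Rintegral_ge0.
have aA : a <= A.
  by rewrite -lee_fin itg_EFin//; exact: integrable_norm ik.
have key t : 0 < t -> 2 * `|iop k f z| <= t * a + t^-1 * br.
  move=> t0; apply: (@le_trans _ _ (2 * \int[mu]_z' `|k z z' * f z'|)).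
    by rewrite ler_pM2l//; exact: le_normr_Rintegral.
  rewrite /a /br -!RintegralZl//; last 2 first.
    exact: integrable_norm ik.
    exact: integrable_norm ikf.
  rewrite -RintegralD//; [|exact/itgZ/(integrable_norm ik)|exact: itgZ].
  apply: le_Rintegral => //.
  - exact/itgZ/(integrable_norm ikf).
  - by apply: itgD; apply: itgZ => //; exact: integrable_norm ik.
  - move=> z' _; rewrite normrM -[f z' ^+ 2]real_normK ?num_real//.
    set x := `|k z z'|; set y := `|f z'|.
    have -> : t * x + t^-1 * (x * y ^+ 2) =
      2 * (x * y) + x * (t * (1 - t^-1 * y) ^+ 2) by field; rewrite gt_eqF.
    by rewrite lerDl mulr_ge0 ?normr_ge0// mulr_ge0 ?sqr_ge0// ltW.
rewrite -[leLHS]real_normK ?num_real//; set s := `|iop k f z| in key *.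
have s0 : 0 <= s by exact: normr_ge0.
have [s_0|sn0] := eqVneq s 0; first by rewrite s_0 expr0n/= mulr_ge0.
have sp : 0 < s by rewrite lt_def sn0.
(* With [t = s / A] the term in [a] uses up at most [s] out of the [2 s] on the left. *)
have := key (s / A); rewrite divr_gt0// => /(_ isT).
have -> : (s / A)^-1 * br = A * br / s by field; rewrite sn0 An0.
have h : s / A * a <= s.
  by rewrite -[leRHS]mulr1 -mulrA ler_pM2l// mulrC ler_pdivrMr// mul1r.
move=> h2; have {h2} : s <= A * br / s by lra.
by rewrite ler_pdivlMr// -expr2.
Qed.

(** Schur's test. The row bound gives the pointwise estimate and one factor [A]; after Tonelli the
    column bound gives the other. *)
Lemma iop_sqi_N2 k A f : schur k A -> sqi f ->
  sqi (iop k f) /\ N2 (iop k f) <= A ^+ 2 * N2 f.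
Proof.
move=> sk [mf fi]; have [mk A0 k1 k2] := sk.
have mi : measurable_fun setT (iop k f) by exact: measurable_iop.
have mi2 : measurable_fun setT (fun z => iop k f z ^+ 2) by exact: measurable_funX.
pose g (p : T * T) := (`|k p.1 p.2| * f p.2 ^+ 2)%:E.
have mg : measurable_fun setT g.
  apply/measurable_EFinP; apply: measurable_funM; first exact: measurableT_comp.
  by apply: measurable_funX; exact: measurableT_comp.
have g0 p : (0 <= g p)%E by rewrite lee_fin mulr_ge0 ?sqr_ge0.
have le1 : (\int[mu]_z (iop k f z ^+ 2)%:E <= (A ^+ 2 * N2 f)%:E)%E.
  apply: (@le_trans _ _ (\int[mu]_z (A%:E * fubini_F mu g z))%E).
    apply: ge0_le_integral => //.
    - by move=> z _; rewrite lee_fin sqr_ge0.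
    - exact/measurable_EFinP.
    - by apply: measurable_funeM; exact: measurable_fun_fubini_tonelli_F.
    - by move=> z _; exact: iop_sqr_le.
  rewrite ge0_integralZl//; last 2 first.
    exact: measurable_fun_fubini_tonelli_F.
    by move=> z _; apply: integral_ge0.
  have -> : (\int[mu]_z fubini_F mu g z = \int[mu]_z' fubini_G mu g z')%E.
    exact: fubini_tonelli.
  rewrite expr2 -mulrA EFinM lee_wpmul2l ?lee_fin//.
  rewrite EFinM /N2 itg_EFin// -ge0_integralZl//.
  - apply: ge0_le_integral => //.
    + by move=> z _; apply: integral_ge0.
    + exact: measurable_fun_fubini_tonelli_G.
    + apply/measurable_EFinP; apply: measurable_funM => //.
      exact: measurable_funX.
    + move=> z' _; rewrite /fubini_G /g/=.
      under eq_integral do rewrite mulrC EFinM.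
      rewrite ge0_integralZl//; last 2 first.
        by apply/measurable_EFinP/measurableT_comp => //; exact: measurable_sec1.
        by rewrite lee_fin sqr_ge0.
      by rewrite muleC lee_wpmul2r ?lee_fin ?sqr_ge0.
  - exact/measurable_EFinP/measurable_funX.
  - by move=> z _; rewrite lee_fin sqr_ge0.
have ii : itg (fun z => iop k f z ^+ 2).
  apply/integrableP; split; first exact/measurable_EFinP.
  apply: le_lt_trans (ltry (A ^+ 2 * N2 f)); apply: le_trans le1.
  rewrite le_eqVlt; apply/orP; left; apply/eqP; apply: eq_integral => z _.
  by rewrite gee0_abs// lee_fin sqr_ge0.
by split; [split|rewrite -lee_fin itg_EFin].
Qed.

Lemma iop_sqi k A f : schur k A -> sqi f -> sqi (iop k f).
Proof. by move=> sk sf; have [] := iop_sqi_N2 sk sf. Qed.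

Lemma iop_N2 k A f : schur k A -> sqi f -> N2 (iop k f) <= A ^+ 2 * N2 f.
Proof. by move=> sk sf; have [] := iop_sqi_N2 sk sf. Qed.

(** Licence for Fubini: [|k f g|] is at most [|k| f^2 + |k| g^2], where the column bound integrates
    the first term and the row bound the second. *)
Lemma iop_itg2 k A f g : schur k A -> sqi f -> sqi g ->
  (mu \x mu)%E.-integrable setT (EFin \o (fun p : T * T => k p.1 p.2 * f p.2 * g p.1)).
Proof.
move=> sk sf sg; have [mf fi] := sf; have [mg gi] := sg.
have [mk A0 k1 k2] := sk.
have mkfg : measurable_fun setT (fun p : T * T => k p.1 p.2 * f p.2 * g p.1).
  apply: measurable_funM; last exact: measurableT_comp.
  by apply: measurable_funM => //; exact: measurableT_comp.
apply/integrableP; split; first exact/measurable_EFinP.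
pose h1 (p : T * T) := (`|k p.1 p.2| * f p.2 ^+ 2)%:E.
pose h2 (p : T * T) := (`|k p.1 p.2| * g p.1 ^+ 2)%:E.
have mh1 : measurable_fun setT h1.
  apply/measurable_EFinP; apply: measurable_funM; first exact: measurableT_comp.
  by apply: measurable_funX; exact: measurableT_comp.
have mh2 : measurable_fun setT h2.
  apply/measurable_EFinP; apply: measurable_funM; first exact: measurableT_comp.
  by apply: measurable_funX; exact: measurableT_comp.
have h10 p : (0 <= h1 p)%E by rewrite lee_fin mulr_ge0 ?sqr_ge0.
have h20 p : (0 <= h2 p)%E by rewrite lee_fin mulr_ge0 ?sqr_ge0.
apply: (@le_lt_trans _ _ (\int[(mu \x mu)%E]_p (h1 p + h2 p))%E).
  apply: ge0_le_integral => //.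
  - exact/measurableT_comp/measurable_EFinP.
  - exact: emeasurable_funD.
  - move=> p _; rewrite /h1 /h2 /= -EFinD lee_fin !normrM.
    rewrite -[f _ ^+ 2]real_normK ?num_real//.
    rewrite -[g _ ^+ 2]real_normK ?num_real//.
    set a := `|k _ _|; set b := `|f _|; set c := `|g _|.
    have : 0 <= a * (b - c) ^+ 2 by rewrite mulr_ge0 ?normr_ge0 ?sqr_ge0.
    have : 0 <= a * (b * c) by rewrite !mulr_ge0 ?normr_ge0.
    nra.
rewrite ge0_integralD// lte_add_pinfty//.
  rewrite fubini_tonelli2//; apply: le_lt_trans (ltry (A * N2 f)).
  rewrite EFinM /N2 itg_EFin// -ge0_integralZl//.
  - apply: ge0_le_integral => //.
    + by move=> z _; apply: integral_ge0.
    + exact: measurable_fun_fubini_tonelli_G.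
    + apply/measurable_EFinP; apply: measurable_funM => //.
      exact: measurable_funX.
    + move=> z' _; rewrite /fubini_G /h1/=.
      under eq_integral do rewrite mulrC EFinM.
      rewrite ge0_integralZl//; last 2 first.
        by apply/measurable_EFinP/measurableT_comp => //; exact: measurable_sec1.
        by rewrite lee_fin sqr_ge0.
      by rewrite muleC lee_wpmul2r ?lee_fin ?sqr_ge0.
  - exact/measurable_EFinP/measurable_funX.
  - by move=> z _; rewrite lee_fin sqr_ge0.
rewrite fubini_tonelli1//; apply: le_lt_trans (ltry (A * N2 g)).
rewrite EFinM /N2 itg_EFin// -ge0_integralZl//.
- apply: ge0_le_integral => //.
  + by move=> z _; apply: integral_ge0.
  + exact: measurable_fun_fubini_tonelli_F.
  + apply/measurable_EFinP; apply: measurable_funM => //.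
    exact: measurable_funX.
  + move=> z _; rewrite /fubini_F /h2/=.
    under eq_integral do rewrite mulrC EFinM.
    rewrite ge0_integralZl//; last 2 first.
      by apply/measurable_EFinP/measurableT_comp => //; exact: measurable_sec2.
      by rewrite lee_fin sqr_ge0.
    by rewrite muleC lee_wpmul2r ?lee_fin ?sqr_ge0.
- exact/measurable_EFinP/measurable_funX.
- by move=> z _; rewrite lee_fin sqr_ge0.
Qed.

Lemma iop_dual k A f g : schur k A -> sqi f -> sqi g ->
  ip (iop k f) g = ip f (iop (fun z z' => k z' z) g).
Proof.
move=> sk sf sg; have [mf fi] := sf; have [mg gi] := sg.
have [mk A0 k1 k2] := sk.
have kfg := iop_itg2 sk sf sg.
pose F (p : T * T) := k p.1 p.2 * f p.2 * g p.1.
have mF := itg_meas kfg.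
have mFc := measurable_Rint1 mu mF; have mFr := measurable_Rint2 mu mF.
have mkt : measurable_fun setT (fun p : T * T => k p.2 p.1).
  exact: (measurable_fun2 mk).
transitivity (\int[mu]_z (\int[mu]_z' F (z, z'))).
  apply: ae_eq_Rint => //.
    by apply: measurable_funM => //; exact: measurable_iop.
  have := ae_integrable1 kfg; apply: filterS => z Fi _; rewrite /F/=.
  (* The section of [F] is integrable, and dividing by [g z] gives the integrability of
     [k z z' * f z']; where [g z = 0] both sides are zero. *)
  have [g0|g0] := eqVneq (g z) 0.
    rewrite g0 mulr0; under eq_Rintegral do rewrite mulr0.
    by rewrite /Rintegral integral0.
  have kfi : itg (fun z' => k z z' * f z').
    rewrite (_ : _ \o _ = EFin \o (fun z' => (g z)^-1 * F (z, z'))); first exact: itgZ.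
    by apply/funext => z' /=; congr EFin; rewrite /F/=; field.
  by rewrite RintegralZr.
transitivity (\int[mu]_z' (\int[mu]_z F (z, z'))).
  by rewrite [LHS]Rint_fubini1// [RHS]Rint_fubini2.
apply: ae_eq_Rint => //.
  apply: measurable_funM => //; exact: measurable_iop.
have := ae_integrable2 kfg; apply: filterS => z' Fi _; rewrite /F/=.
have [f0|f0] := eqVneq (f z') 0.
  rewrite f0 mul0r; under eq_Rintegral do rewrite mulr0 mul0r.
  by rewrite /Rintegral integral0.
have kgi : itg (fun z => k z z' * g z).
  rewrite (_ : _ \o _ = EFin \o (fun z => (f z')^-1 * F (z, z'))); first exact: itgZ.
  by apply/funext => z /=; congr EFin; rewrite /F/=; field.
rewrite -RintegralZl//; apply: eq_Rintegral => z _; ring.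
Qed.

End integral_operator.

(** * Integration on the phase space *)

Section sigma_finite_instances.
Context {R : realType}.

Lemma torus_vol_sigma_finite n : sigma_finite setT (@torus_vol R n).
Proof.
have /sigma_finiteP[F [FT ndF Foo]] := sigma_finiteT (@vol R n).
exists F => // k; have [mF Fk] := Foo k; split => //.
apply: le_lt_trans Fk; rewrite /torus_vol /mrestr le_measure ?inE//.
by apply: measurableI => //; exact: measurable_unit_cell.
Qed.

HB.instance Definition _ n := Measure_isSigmaFinite.Build _ _ _
  (@torus_vol R n) (torus_vol_sigma_finite n).

Lemma phase_vol_sigma_finite n : sigma_finite setT (@phase_vol R n).
Proof.
have /sigma_finiteP[F [FT ndF Foo]] := sigma_finiteT (@torus_vol R n).
have /sigma_finiteP[G [GT ndG Goo]] := sigma_finiteT (@vol R n).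
exists (fun k => F k `*` G k).
  apply/esym; rewrite -subTset => -[x y] _.
  have [i _ Fx] : (\bigcup_i F i) x by rewrite -FT.
  have [j _ Gy] : (\bigcup_i G i) y by rewrite -GT.
  exists (maxn i j) => //; split.
    by have /subsetPset := ndF _ _ (leq_maxl i j); exact.
  by have /subsetPset := ndG _ _ (leq_maxr i j); exact.
move=> k; have [mF Fk] := Foo k; have [mG Gk] := Goo k; split.
  exact: measurableX.
rewrite /phase_vol product_measure1E// lte_mul_pinfty//.
by rewrite ge0_fin_numE.
Qed.

HB.instance Definition _ n := Measure_isSigmaFinite.Build _ _ _
  (@phase_vol R n) (phase_vol_sigma_finite n).

End sigma_finite_instances.

(** * Lebesgue measure on R^n by iterated integrals, and the torus measure as an indicator *)

Section vol_integrals.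
Context {R : realType}.

Lemma rV_consDl n (t s : R) (x : 'rV[R]_n) :
  rV_cons (t, x) + s *: delta_mx ord0 ord0 = rV_cons ((t + s)%R, x) :> 'rV[R]_n.+1.
Proof.
apply/rowP => i; rewrite !mxE /=.
by have [j ->|->] := unliftP ord0 i; rewrite ?liftK ?unlift_none//= ?mulr0 ?addr0// mulr1.
Qed.

Lemma rV_consDr n (t s : R) (x : 'rV[R]_n) j :
  rV_cons (t, x) + s *: delta_mx ord0 (lift ord0 j) =
  rV_cons (t, (x + s *: delta_mx ord0 j)%R) :> 'rV[R]_n.+1.
Proof.
apply/rowP => i; rewrite !mxE /=.
have [k ->|->] := unliftP ord0 i; rewrite ?liftK ?unlift_none//= ?mulr0 ?addr0//.
by rewrite !mxE /= (inj_eq lift_inj).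
Qed.

Notation leb := (@lebesgue_measure R).
Local Open Scope ereal_scope.

Lemma ge0_integral_volS n (G : 'rV[R]_n.+1 -> \bar R) :
  measurable_fun setT G -> (forall x, 0 <= G x) ->
  \int[vol n.+1]_x G x = \int[(leb \x vol n)%E]_p G (rV_cons p).
Proof.
move=> mG G0; rewrite /= /volS.
by rewrite (ge0_integral_pushforward (@measurable_rV_cons R n)).
Qed.

Lemma integrable_volS n (G : 'rV[R]_n.+1 -> \bar R) :
  (vol n.+1).-integrable setT G ->
  (leb \x vol n)%E.-integrable setT (G \o @rV_cons R n).
Proof.
move=> /integrableP[mG Gi]; apply/integrableP; split.
  exact: (measurableT_comp mG (@measurable_rV_cons R n)).
rewrite ge0_integral_volS// in Gi; exact: measurableT_comp.
Qed.

Lemma integral_volS n (G : 'rV[R]_n.+1 -> \bar R) :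
  (vol n.+1).-integrable setT G ->
  \int[vol n.+1]_x G x = \int[(leb \x vol n)%E]_p G (rV_cons p).
Proof.
move=> iG; have := integrable_volS iG => iG'; move: iG => /integrableP[mG _].
by rewrite /= /volS (integral_pushforward (@measurable_rV_cons R n)).
Qed.

(** The source of all integrations by parts: Fubini in the order that puts the [i]-th variable
    innermost. The induction peels off the first coordinate, which is a mere parameter when [i] is a
    later one. *)
Lemma vol_line n (i : 'I_n) (G : 'rV[R]_n -> R) :
  (vol n).-integrable setT (EFin \o G) ->
  (forall x, \int[leb]_t (G (x + t *: delta_mx ord0 i))%:E = 0) ->
  \int[vol n]_x (G x)%:E = 0.
Proof.
elim: n => [|n IH] in i G *; first by case: i.
move=> iG G0; rewrite integral_volS//; have iG' := integrable_volS iG.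
have [j ij|i0] := unliftP ord0 i.
  rewrite -(integral12_prod_meas1 iG').
  rewrite (ae_eq_integral (cst 0)) ?integral0//.
  - exact: (measurable_fubini_F iG').
  - have := ae_integrable1 iG'; apply: filterS => t it _ /=.
    rewrite /fubini_F; apply: (IH j (fun x => G (rV_cons (t, x)))) => // x.
    by under eq_integral do rewrite -rV_consDr; rewrite -ij; exact: G0.
rewrite -(integral21_prod_meas1 iG').
rewrite (eq_integral (cst 0)) ?integral0// => x _; rewrite /fubini_G/=.
rewrite -[RHS](G0 (rV_cons (0%R, x))); apply: eq_integral => t _.
by rewrite i0 rV_consDl add0r.
Qed.

Lemma measurable_prod_coord n (f : 'I_n -> R -> R) :
  (forall i, measurable_fun setT (f i)) ->
  measurable_fun setT (fun x : 'rV[R]_n => \prod_i f i (x ord0 i))%R.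
Proof.
move=> mf; apply: measurable_prod => i _.
exact: measurableT_comp (mf i) (measurable_coord i).
Qed.

Lemma vol_prod n (f : 'I_n -> R -> R) (I : 'I_n -> R) :
  (forall i, measurable_fun setT (f i)) -> (forall i t, (0 <= f i t)%R) ->
  (forall i, \int[leb]_t (f i t)%:E = (I i)%:E) ->
  \int[vol n]_x (\prod_i f i (x ord0 i))%:E = (\prod_i I i)%:E.
Proof.
elim: n => [|n IH] in f I *.
  move=> mf f0 fI; rewrite big_ord0 /= (eq_integral (cst 1)); last first.
    by move=> x _; rewrite big_ord0.
  by rewrite integral_dirac// diracT mul1e.
move=> mf f0 fI.
have mp : measurable_fun setT (fun x : 'rV[R]_n.+1 => (\prod_i f i (x ord0 i))%:E).
  by apply/measurable_EFinP; exact: (@measurable_prod_coord _ f).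
rewrite ge0_integral_volS//; last by move=> x; rewrite lee_fin prodr_ge0.
pose h (p : R * 'rV[R]_n) :=
  ((f ord0 p.1)%:E * (\prod_i f (lift ord0 i) (p.2 ord0 i))%:E).
have hE p : (\prod_i f i (rV_cons p ord0 i))%:E = h p.
  rewrite big_ord_recl rV_cons_ord0 EFinM; congr (_ * _%:E).
  by apply: eq_bigr => i _; rewrite rV_cons_lift.
under eq_integral do rewrite hE.
have mg : measurable_fun setT (fun x : 'rV[R]_n => (\prod_i f (lift ord0 i) (x ord0 i))%:E).
  by apply/measurable_EFinP; exact: (@measurable_prod_coord _ (fun i => f (lift ord0 i))).
have mh : measurable_fun setT h.
  apply: emeasurable_funM; first exact/measurable_EFinP/measurableT_comp.
  exact: (measurableT_comp mg measurable_snd).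
rewrite fubini_tonelli1//; last first.
  by move=> p; rewrite mule_ge0// lee_fin// prodr_ge0.
rewrite /fubini_F/h/=.
under eq_integral => t _.
  rewrite ge0_integralZl ?lee_fin//; last by move=> x _; rewrite lee_fin prodr_ge0.
  rewrite (IH (fun i => f (lift ord0 i)) (fun i => I (lift ord0 i)))//.
  over.
have P0 : 0 <= (\prod_(i < n) I (lift ord0 i))%:E.
  rewrite lee_fin prodr_ge0// => i _; rewrite -lee_fin -fI integral_ge0// => t _.
  by rewrite lee_fin.
rewrite ge0_integralZr; [by rewrite fI big_ord_recl EFinM|by []| |
  by move=> t _; rewrite lee_fin|by []].
by apply/measurable_EFinP; exact: mf.
Qed.

Lemma vol_prod_le n (f : 'I_n -> R -> R) (I : 'I_n -> R) :
  (forall i, measurable_fun setT (f i)) -> (forall i t, (0 <= f i t)%R) ->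
  (forall i, \int[leb]_t (f i t)%:E <= (I i)%:E) ->
  \int[vol n]_x (\prod_i f i (x ord0 i))%:E <= (\prod_i I i)%:E.
Proof.
move=> mf f0 fI.
have f0' i : 0 <= \int[leb]_t (f i t)%:E by apply: integral_ge0 => t _; rewrite lee_fin.
rewrite (vol_prod (I := fun i => fine (\int[leb]_t (f i t)%:E)))//.
  rewrite lee_fin ler_prod// => i _; rewrite fine_ge0//=.
  by rewrite -lee_fin fineK// ge0_fin_numE//; apply: le_lt_trans (fI i) (ltry _).
move=> i; rewrite fineK// ge0_fin_numE//; apply: le_lt_trans (fI i) (ltry _).
Qed.

Lemma ge0_integral_torus n (F : 'rV[R]_n -> \bar R) :
  measurable_fun setT F -> (forall x, 0 <= F x) ->
  \int[@torus_vol R n]_x F x = \int[vol n]_(x in @unit_cell R n) F x.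
Proof.
move=> mF F0; have mc := @measurable_unit_cell R n.
transitivity (\int[@torus_vol R n]_(x in @unit_cell R n) F x).
  rewrite -[in LHS](setUv (@unit_cell R n)) ge0_integral_setU//=; last 3 first.
    exact: measurableC.
    by rewrite setUv.
    by apply/disj_setPS; rewrite setICr.
  rewrite [X in _ + X](_ : _ = 0) ?adde0//.
  apply: null_set_integral; first exact: measurableC.
    exact: measurable_funTS.
  by rewrite /= /torus_vol /mrestr setICl measure0.
apply: eq_measure_integral => A mA Acell.
by rewrite /= /torus_vol /mrestr setIidl.
Qed.

Lemma ge0_integral_torusE n (F : 'rV[R]_n -> R) :
  measurable_fun setT F -> (forall x, (0 <= F x)%R) ->
  \int[@torus_vol R n]_x (F x)%:E = \int[vol n]_x (F x * \1_(@unit_cell R n) x)%:E.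
Proof.
move=> mF F0; rewrite ge0_integral_torus//; last exact/measurable_EFinP.
rewrite integral_mkcond; apply: eq_integral => x _.
rewrite restrict_EFin /= patchE indicE.
by case: ifPn => _; rewrite ?mulr1 ?mulr0.
Qed.

Lemma integrable_torus n (F : 'rV[R]_n -> R) :
  (@torus_vol R n).-integrable setT (EFin \o F) ->
  (vol n).-integrable setT (EFin \o (fun x => F x * \1_(@unit_cell R n) x)%R).
Proof.
move=> iF; have mF := itg_meas iF; move: iF => /integrableP[_ iF].
have m1 : measurable_fun setT (\1_(@unit_cell R n) : _ -> R).
  by apply: measurable_indic; exact: measurable_unit_cell.
apply/integrableP; split; first exact/measurable_EFinP/measurable_funM.
rewrite (_ : (\int[_]_x _)%E = \int[@torus_vol R n]_x (`|F x|)%:E)//.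
rewrite ge0_integral_torusE//; last exact: measurableT_comp.
apply: eq_integral => x _ /=; congr EFin; rewrite normrM; congr (_ * _)%R.
by rewrite ger0_norm.
Qed.

Lemma integral_torusE n (F : 'rV[R]_n -> R) :
  (@torus_vol R n).-integrable setT (EFin \o F) ->
  \int[@torus_vol R n]_x (F x)%:E = \int[vol n]_x (F x * \1_(@unit_cell R n) x)%:E.
Proof.
move=> iF; have mF := itg_meas iF; have iF' := integrable_torus iF.
rewrite [LHS]integralE [RHS]integralE.
have mp := measurable_funrpos mF; have mn := measurable_funrneg mF.
congr (_ - _).
  transitivity (\int[@torus_vol R n]_x ((F^\+)%R x)%:E).
    by apply: eq_integral => x _; rewrite funerpos.
  rewrite ge0_integral_torusE//; apply: eq_integral => x _.
  rewrite funerpos/=; congr EFin; rewrite /funrpos indicE; case: (_ \in _) => /=.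
    by rewrite !mulr1.
  by rewrite !mulr0 maxxx.
transitivity (\int[@torus_vol R n]_x ((F^\-)%R x)%:E).
  by apply: eq_integral => x _; rewrite funerneg.
rewrite ge0_integral_torusE//; apply: eq_integral => x _.
rewrite funerneg/=; congr EFin; rewrite /funrneg indicE; case: (_ \in _) => /=.
  by rewrite !mulr1.
by rewrite !mulr0 oppr0 maxxx.
Qed.

End vol_integrals.

(** * Continuous functions are measurable for the product sigma-algebra *)

Section continuous_measurable.
Context {R : realType}.

(** A function that factors through a countable code with measurable fibres is measurable, and so is
    a pointwise limit of such functions. This links continuity, a topological notion, with the
    product sigma-algebra. *)
Lemma measurable_countable_approx d (T : measurableType d) (C : countType)
    (code : nat -> T -> C) (rep : nat -> C -> T) (f : T -> R) :
  (forall k c, measurable [set x | code k x = c]) ->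
  (forall x, (fun k => f (rep k (code k x))) @ \oo --> f x) ->
  measurable_fun setT f.
Proof.
move=> mc cf.
apply: (@measurable_fun_cvg _ _ _ _ (fun k x => f (rep k (code k x)))) => // k.
move=> _ Y mY; rewrite setTI.
rewrite (_ : _ @^-1` _ = \bigcup_(i in [set: nat])
    (if unpickle i is Some c then
       if `[< Y (f (rep k c)) >] then [set x | code k x = c] else set0
     else set0)).
  by apply: bigcup_measurable => i _; case: unpickle => // c; case: ifP.
apply/seteqP; split => [x /= Yx|x [i _]].
  by exists (pickle (code k x)) => //; rewrite pickleK ifT//; exact/asboolP.
by case: unpickle => // c; case: ifPn => // /asboolP Yc /= xc; rewrite xc.
Qed.

(** Together with [rep], rounds each coordinate down to the grid of step [1 / (k + 1)]. *)
Let code n (k : nat) (x : 'rV[R]_n) : 'rV[int]_n :=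
  \row_i Num.floor (k.+1%:R * x ord0 i).

Let rep n (k : nat) (c : 'rV[int]_n) : 'rV[R]_n :=
  \row_i ((c ord0 i)%:~R / k.+1%:R).

Let measurable_code n k c : measurable [set x : 'rV[R]_n | code k x = c].
Proof.
rewrite (_ : [set _ | _] = \bigcap_(i in [set: 'I_n])
    ((fun x : 'rV[R]_n => x ord0 i : measurableTypeR R) @^-1`
       [set t | Num.floor (k.+1%:R * t) = c ord0 i])).
  apply: fin_bigcap_measurable => // i _.
  rewrite -[X in measurable X]setTI; apply: measurable_coord => //.
  rewrite (_ : [set t | _] = (fun t : R => k.+1%:R * t) @^-1`
    (`[(c ord0 i)%:~R, (c ord0 i + 1)%:~R[%classic)).
    by rewrite -[X in measurable X]setTI; exact: measurable_funM.
  apply/seteqP; split => t /=; rewrite in_itv/=.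
    by move=> <-; rewrite floor_le_tmp floorD1_gt.
  by move=> /floor_def.
apply/seteqP; split => x /=.
  by move=> h i _ /=; rewrite -h mxE.
by move=> h; apply/rowP => i; rewrite mxE; exact: h.
Qed.

Let cvg_rep n (x : 'rV[R]_n) : (fun k => rep k (code k x)) @ \oo --> x.
Proof.
apply/cvgrPdist_le => e e0; near=> k.
rewrite /Num.norm/= mx_normrE; apply: bigmax_le; first exact: ltW.
move=> -[i j] _ /=.
rewrite !mxE ord1.
set m := k.+1%:R; have m0 : 0 < m :> R by rewrite ltr0n.
have -> : x ord0 j - (Num.floor (m * x ord0 j))%:~R / m =
   (m * x ord0 j - (Num.floor (m * x ord0 j))%:~R) / m by field; rewrite gt_eqF.
set y := m * _.
have h1 : (Num.floor y)%:~R <= y by exact: floor_le_tmp.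
have h2 : y < (Num.floor y + 1)%:~R by exact: floorD1_gt.
rewrite ger0_norm; last by rewrite divr_ge0 ?subr_ge0// ltW.
rewrite ler_pdivrMr//.
have : 1 <= e * m.
  rewrite -ler_pdivrMl// mulr1 /m.
  near: k; have := nbhs_infty_ger e^-1; apply: filterS => k /le_trans; apply.
  by rewrite ler_nat.
by move: h2; rewrite intrD => h2 h3; lra.
Unshelve. all: by end_near. Qed.

Lemma continuous_measurable_phase n (f : 'rV[R]_n * 'rV[R]_n -> R) :
  continuous f -> measurable_fun setT f.
Proof.
move=> cf; apply: (@measurable_countable_approx _ _ ('rV[int]_n * 'rV[int]_n)%type
  (fun k x => (code k x.1, code k x.2)) (fun k c => (rep k c.1, rep k c.2))).
  move=> k [c1 c2]; rewrite (_ : [set _ | _] =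
    [set x | code k x = c1] `*` [set x | code k x = c2]).
    by apply: measurableX; exact: measurable_code.
  by apply/seteqP; split => [x /= [-> ->]|x /= [/= -> ->]].
case=> x1 x2; apply: (continuous_cvg _ (cf (x1, x2))).
exact: (cvg_pair (@cvg_rep n x1) (@cvg_rep n x2)).
Qed.

End continuous_measurable.

(** * Trigonometric polynomials and Gaussians *)

Section one_variable_calculus.
Context {R : realType}.
Notation leb := (@lebesgue_measure R).

Definition deriv1 (F F' : R -> R) := forall t : R, is_derive t (1 : R) F (F' t).

Lemma is_derive_continuous (F F' : R -> R) :
  deriv1 F F' -> continuous F.
Proof.
move=> dF t; apply: differentiable_continuous.
by apply/derivable1_diffP; exact: (@ex_derive _ _ _ _ _ _ _ (dF t)).
Qed.

Lemma mvt_incr (F F' : R -> R) : deriv1 F F' ->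
  forall t h, exists2 c, `|c| <= `|h| & F (t + h) - F t = h * F' (t + c).
Proof.
move=> dF t h; have cF := is_derive_continuous dF.
have [h0|h0|h0] := ltgtP 0 h.
- have [||c] := @MVT_segment _ F F' t (t + h) _ (fun x _ => dF x).
  + by rewrite lerDl ltW.
  + exact: continuous_subspaceT.
  rewrite in_itv/= => /andP[tc ch] ->; exists (c - t).
    by rewrite !ger0_norm ?subr_ge0// ?lerBlDl// ltW.
  by rewrite subrKC addrAC subrr add0r mulrC.
- have [||c] := @MVT_segment _ F F' (t + h) t _ (fun x _ => dF x).
  + by rewrite gerDl ltW.
  + exact: continuous_subspaceT.
  rewrite in_itv/= => /andP[tc ch] e; exists (c - t).
    by rewrite !ler0_norm ?subr_le0// ?lerN2 ?lerBrDl// ltW.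
  rewrite subrKC -[LHS]opprB e; ring.
- by exists 0; rewrite -h0 ?addr0 ?subrr ?mul0r.
Qed.

(** The mean value theorem twice. The weight changes by at most a factor [K] over a unit distance,
    so the bound on [F''] at the intermediate point transfers back to [t]. *)
Lemma taylor2 (F F' F'' w : R -> R) (C K : R) :
  deriv1 F F' -> deriv1 F' F'' ->
  0 <= C -> (forall t, 0 <= w t) ->
  (forall t, `|F'' t| <= C * w t) ->
  (forall t h, `|h| <= 1 -> w (t + h) <= K * w t) ->
  forall t h, `|h| <= 1 -> `|F (t + h) - F t - h * F' t| <= C * K * (h ^+ 2 * w t).
Proof.
move=> dF dF' C0 w0 F2 wK t h h1.
have [c ch ->] := mvt_incr dF t h.
have -> : h * F' (t + c) - h * F' t = h * (F' (t + c) - F' t) by ring.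
have [e ec ->] := mvt_incr dF' t c.
rewrite !normrM.
have le2 : `|h| * `|c| <= h ^+ 2.
  by rewrite -[h ^+ 2]real_normK ?num_real// expr2 ler_wpM2l.
have e1 : `|e| <= 1 by rewrite (le_trans ec)// (le_trans ch).
have F2' : `|F'' (t + e)| <= C * (K * w t).
  by apply: le_trans (F2 _) _; rewrite ler_wpM2l// wK.
rewrite mulrA (le_trans (ler_pM _ _ le2 F2'))// ?mulr_ge0//.
by rewrite le_eqVlt; apply/orP; left; apply/eqP; ring.
Qed.

Lemma integral_deriv_itv (F F' : R -> R) (a b : R) : a < b ->
  deriv1 F F' -> continuous F' ->
  (\int[leb]_(t in `[a, b]) (F' t)%:E = (F b - F a)%:E)%E.
Proof.
move=> ab dF cF'; have cF := is_derive_continuous dF.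
rewrite (@continuous_FTC2 _ F' F)//.
- exact: continuous_subspaceT.
- split.
  + by move=> t _; exact: (@ex_derive _ _ _ _ _ _ _ (dF t)).
  + exact: cvg_at_right_filter (cF a).
  + exact: cvg_at_left_filter (cF b).
- by move=> t _; rewrite derive1E; exact: (@derive_val _ _ _ _ _ _ _ (dF t)).
Qed.

Lemma integral_deriv_itvco (F F' : R -> R) (a b : R) : a < b ->
  deriv1 F F' -> continuous F' ->
  (\int[leb]_(t in `[a, b[) (F' t)%:E = (F b - F a)%:E)%E.
Proof.
move=> ab dF cF'; rewrite integral_itv_bndo_bndc; first exact: integral_deriv_itv.
apply/measurable_EFinP; apply: measurable_funTS.
exact: continuous_measurable_fun.
Qed.

(** The fundamental theorem on growing symmetric intervals: the decay of [F] kills the boundary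
    values, and dominated convergence recovers the integral over the line. *)
Lemma integral_deriv_R (F F' : R -> R) (C : R) :
  deriv1 F F' -> continuous F' ->
  leb.-integrable setT (EFin \o F') ->
  (forall t, `|F t| <= C / (1 + t ^+ 2)) ->
  (\int[leb]_t (F' t)%:E = 0)%E.
Proof.
move=> dF cF' iF' FC.
have mF' : measurable_fun setT F' by exact: continuous_measurable_fun.
pose f n t := (F' t * \1_(`[- n.+1%:R, n.+1%:R]%classic : set R) t)%:E.
have fE n : (\int[leb]_t f n t = (F n.+1%:R - F (- n.+1%:R))%:E)%E.
  rewrite -(@integral_deriv_itv F F')//; last first.
    by rewrite (@lt_trans _ _ 0) ?oppr_lt0.
  rewrite [RHS]integral_mkcond; apply: eq_integral => t _.
  rewrite restrict_EFin /= patchE /f indicE.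
  by case: ifPn => _; rewrite ?mulr1 ?mulr0.
have cv1 : (\int[leb]_t f n t)%E @[n --> \oo] --> (\int[leb]_t (F' t)%:E)%E.
  apply: (@dominated_cvg _ _ _ leb _ _ f _ (fun t => `|F' t|%:E)) => //.
  - by move=> n; apply/measurable_EFinP/measurable_funM.
  - move=> t _; apply: cvg_EFin; first by near=> n.
    apply: cvg_near_cst; near=> n.
    rewrite /f /= indicE mem_set ?mulr1//= in_itv/= -ler_norml.
    near: n; have := nbhs_infty_ger `|t|; apply: filterS => n /le_trans; apply.
    by rewrite ler_nat.
  - exact: integrable_abse iF'.
  - move=> n t _; rewrite lee_fin normrM ler_piMr// indicE.
    by case: (_ \in _) => /=; rewrite ?normr1 ?normr0.
have cv2 : (\int[leb]_t f n t)%E @[n --> \oo] --> 0%E.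
  under eq_fun do rewrite fE.
  apply: cvg_EFin; first by near=> n.
  rewrite /=; apply/cvgrPdist_le => e e0; near=> n.
  rewrite sub0r normrN.
  have h0 : `|F n.+1%:R - F (- n.+1%:R)| <= 2 * C / (1 + n.+1%:R ^+ 2).
    have := FC n.+1%:R; have := FC (- n.+1%:R); rewrite sqrrN.
    by have := ler_normB (F n.+1%:R) (F (- n.+1%:R)); lra.
  apply: le_trans h0 _.
  rewrite ler_pdivrMr; last by rewrite ltr_pwDl// sqr_ge0.
  have n1 : 1 <= n.+1%:R :> R by rewrite ler1n.
  have : 2 * C <= e * n.+1%:R.
    rewrite -ler_pdivrMl//; near: n.
    have := nbhs_infty_ger (e^-1 * (2 * C)); apply: filterS => n /le_trans; apply.
    by rewrite ler_nat.
  move/le_trans; apply; rewrite ler_pM2l//.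
  by move: n1; nra.
by rewrite -(cvg_lim _ cv1)// (cvg_lim _ cv2).
Unshelve. all: by end_near. Qed.

Lemma ge0_integral_shift (h : R -> R) (a : R) : continuous h ->
  (forall t, 0 <= h t) ->
  (\int[leb]_t (h (t - a))%:E = \int[leb]_t (h t)%:E)%E.
Proof.
move=> ch h0.
have dF (t : R) : is_derive t (1 : R) (fun t : R => t - a) 1.
  apply: (is_derive_eq (is_deriveB (is_derive_id t 1) (is_derive_cst a t 1))).
  by rewrite subr0.
have F'E : (fun t : R => t - a)^`()%classic = cst 1.
  by apply/funext => t; rewrite derive1E; exact: (@derive_val _ _ _ _ _ _ _ (dF t)).
rewrite [RHS](@increasing_ge0_integration_by_substitutionT _ (fun t => t - a))//.
- by apply: eq_integral => t _; rewrite F'E /= mulr1.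
- by move=> x y; rewrite ltrD2r.
- by rewrite F'E; exact: cst_continuous.
- by rewrite F'E; exact: is_cvg_cst.
- by rewrite F'E; exact: is_cvg_cst.
- by apply: cvg_addrr_Ny.
- by apply: cvg_addrr.
Qed.

(** The reference decay in one velocity variable: integrable with mass [pi], and comparable with its
    translates by polynomial inequalities. *)
Definition cauchyw (t : R) : R := (1 + t ^+ 2)^-1.

Lemma cauchyw_gt0 t : 0 < cauchyw t.
Proof. by rewrite invr_gt0 ltr_pwDl// sqr_ge0. Qed.

Lemma cauchyw_ge0 t : 0 <= cauchyw t.
Proof. exact/ltW/cauchyw_gt0. Qed.

Lemma cauchyw_le1 t : cauchyw t <= 1.
Proof. by rewrite invf_le1 ?lerDl ?sqr_ge0// ltr_pwDl// sqr_ge0. Qed.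

Lemma continuous_cauchyw : continuous cauchyw.
Proof.
move=> t; apply: cvgV; first by rewrite gt_eqF// ltr_pwDl// sqr_ge0.
apply: cvgD; first exact: cvg_cst.
exact: exprn_continuous.
Qed.

Lemma measurable_cauchyw : measurable_fun setT cauchyw.
Proof. by apply: continuous_measurable_fun; exact: continuous_cauchyw. Qed.

Lemma cauchyw_sym t : cauchyw (- t) = cauchyw t.
Proof. by rewrite /cauchyw sqrrN. Qed.

Lemma cauchyw_shift t h : `|h| <= 1 -> cauchyw (t + h) <= 3 * cauchyw t.
Proof.
move=> h1; rewrite /cauchyw.
have h2 : h ^+ 2 <= 1 by rewrite -[h ^+ 2]real_normK ?num_real// expr_le1.
rewrite ler_pdivlMr ?ltr_pwDl ?sqr_ge0// mulrC ler_pdivrMr ?ltr_pwDl ?sqr_ge0//.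
have := sqr_ge0 (t + 2 * h); have := sqr_ge0 t; have := sqr_ge0 (2 * t + 3 * h).
move: h2; nra.
Qed.

Lemma integral_cauchyw : (\int[leb]_t (cauchyw t)%:E = pi%:E)%E.
Proof.
rewrite ge0_symfun_integralT//; last 3 first.
- by move=> t; exact: cauchyw_ge0.
- exact: continuous_cauchyw.
- by move=> t; rewrite /= cauchyw_sym.
rewrite (_ : [set x | _] = `[0, +oo[%classic); last first.
  by apply/seteqP; split => x /=; rewrite in_itv/= andbT.
rewrite (@ge0_continuous_FTC2y _ cauchyw atan 0 (pi / 2)).
- by rewrite atan0 sube0 -EFinM; congr EFin; field.
- by move=> x _; exact: cauchyw_ge0.
- exact/continuous_subspaceT/continuous_cauchyw.
- exact: cvgy_atan.
- by move=> x _; exact: (@ex_derive _ _ _ _ _ _ _ (is_derive1_atan x)).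
- by apply: cvg_at_right_filter; exact: continuous_atan.
- by move=> x _; rewrite derive1E; exact: (@derive_val _ _ _ _ _ _ _ (is_derive1_atan x)).
Qed.

Lemma integrable_cauchyw : leb.-integrable setT (EFin \o cauchyw).
Proof.
apply/integrableP; split; first by apply/measurable_EFinP; exact: measurable_cauchyw.
under eq_integral do rewrite /= ger0_norm ?cauchyw_ge0//.
by rewrite integral_cauchyw ltry.
Qed.

End one_variable_calculus.

Section kernels_1d.
Context {R : realType}.
Notation leb := (@lebesgue_measure R).

(** Integer frequencies give period 1, frequency 0 gives the constants, and the class is closed
    under derivatives. *)
Inductive trigpoly : (R -> R) -> Prop :=
| trig_cos (m : int) (a : R) : trigpoly (fun t => a * cos (2 * pi * m%:~R * t))
| trig_sin (m : int) (a : R) : trigpoly (fun t => a * sin (2 * pi * m%:~R * t))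
| trig_add p q : trigpoly p -> trigpoly q -> trigpoly (fun t => p t + q t).

Lemma trigpoly_cst c : trigpoly (fun=> c).
Proof.
have := trig_cos 0 c; under eq_fun do rewrite mulr0 mul0r cos0 mulr1.
by [].
Qed.

Lemma trigpoly_sum (I : Type) (s : seq I) (p : I -> R -> R) :
  (forall i, trigpoly (p i)) -> trigpoly (fun t => \sum_(i <- s) p i t).
Proof.
move=> tp; elim: s => [|i s ih].
  by under eq_fun do rewrite big_nil; exact: trigpoly_cst.
by under eq_fun do rewrite big_cons; exact: trig_add.
Qed.

Lemma is_derive_cosl (a c t : R) :
  is_derive t (1 : R) (fun t => a * cos (c * t)) (- (a * c) * sin (c * t)).
Proof.
have dl : is_derive t (1 : R) (fun t => c * t) c.
  apply: (is_derive_eq (is_deriveZ c (is_derive_id t 1))).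
  by rewrite /GRing.scale/= mulr1.
have dc : is_derive t (1 : R) (cos \o (fun t => c * t)) (- sin (c * t) * c).
  exact: is_derive1_comp.
apply: (is_derive_eq (is_deriveZ a dc)).
by rewrite /GRing.scale/=; ring.
Qed.

Lemma is_derive_sinl (a c t : R) :
  is_derive t (1 : R) (fun t => a * sin (c * t)) (a * c * cos (c * t)).
Proof.
have dl : is_derive t (1 : R) (fun t => c * t) c.
  apply: (is_derive_eq (is_deriveZ c (is_derive_id t 1))).
  by rewrite /GRing.scale/= mulr1.
have dc : is_derive t (1 : R) (sin \o (fun t => c * t)) (cos (c * t) * c).
  exact: is_derive1_comp.
apply: (is_derive_eq (is_deriveZ a dc)).
by rewrite /GRing.scale/=; ring.
Qed.

Lemma trigpoly_derive p : trigpoly p ->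
  exists2 p', trigpoly p' & deriv1 p p'.
Proof.
elim=> [m a|m a|q r _ [q' tq' dq'] _ [r' tr' dr']].
- exists (fun t => - (a * (2 * pi * m%:~R)) * sin (2 * pi * m%:~R * t)).
    exact: trig_sin.
  by move=> t; exact: is_derive_cosl.
- exists (fun t => a * (2 * pi * m%:~R) * cos (2 * pi * m%:~R * t)).
    exact: trig_cos.
  by move=> t; exact: is_derive_sinl.
- exists (fun t => q' t + r' t); first exact: trig_add.
  by move=> t; exact: is_deriveD.
Qed.

Lemma trigpoly_bounded p : trigpoly p -> exists2 C, 0 <= C & forall t, `|p t| <= C.
Proof.
elim=> [m a|m a|q r _ [C C0 qC] _ [D D0 rD]].
- exists `|a| => // t; rewrite normrM ler_piMr// ler_norml cos_geN1 cos_le1//.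
- exists `|a| => // t; rewrite normrM ler_piMr// ler_norml sin_geN1 sin_le1//.
- exists (C + D); first exact: addr_ge0.
  by move=> t; rewrite (le_trans (ler_normD _ _))// lerD.
Qed.

Lemma cos_sin_2pi_int (m : int) (x : R) :
  cos (x + 2 * pi * m%:~R) = cos x /\ sin (x + 2 * pi * m%:~R) = sin x.
Proof.
have hn (n : nat) (y : R) : cos (y + 2 * pi * n%:R) = cos y /\ sin (y + 2 * pi * n%:R) = sin y.
  elim: n y => [|n IH] y; first by rewrite mulr0 addr0.
  have -> : y + 2 * pi * n.+1%:R = (y + 2 * pi * n%:R) + pi *+ 2.
    by rewrite -natr1 -mulr_natl; ring.
  by have [e1 e2] := IH y; split; [rewrite cosD|rewrite sinD];
      rewrite cos2pi sin2pi e1 e2; ring.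
case: m => n; first exact: hn.
have [h1 h2] := hn n.+1 (x + 2 * pi * (Negz n)%:~R).
have e : x + 2 * pi * (Negz n)%:~R + 2 * pi * n.+1%:R = x.
  by rewrite NegzE intrN -pmulrn; ring.
by rewrite -h1 -h2 e.
Qed.

Lemma trigpoly_periodic p : trigpoly p -> forall t, p (t + 1) = p t.
Proof.
elim=> [m a t|m a t|q r _ qP _ rP t]; last by rewrite qP rP.
- by rewrite mulrDr mulr1 (cos_sin_2pi_int m _).1.
- by rewrite mulrDr mulr1 (cos_sin_2pi_int m _).2.
Qed.

Lemma trigpoly_continuous p : trigpoly p -> continuous p.
Proof. by move=> /trigpoly_derive[p' _ /is_derive_continuous]. Qed.

Definition gauspoly (q : R -> R) := exists2 a, 0 < a &
  exists P : {poly R}, q = fun t => P.[t] * expR (- (a * t ^+ 2)).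

Lemma gauspoly_derive q : gauspoly q ->
  exists2 q', gauspoly q' & deriv1 q q'.
Proof.
move=> [a a0 [P ->]].
exists (fun t => (P^`() - (2 * a)%:P * 'X * P).[t] * expR (- (a * t ^+ 2))).
  by exists a => //; exists (P^`() - (2 * a)%:P * 'X * P).
move=> t.
have d1 : is_derive t (1 : R) (fun t => - (a * t ^+ 2)) (- (2 * a * t)).
  have -> : (fun t => - (a * t ^+ 2)) = horner ((- a)%:P * 'X^2).
    by apply/funext => x; rewrite hornerM hornerC hornerXn mulNr.
  apply: is_derive_eq; rewrite derivM derivC mul0r add0r derivXn hornerM hornerC.
  by rewrite hornerMn expr1 hornerX; ring.
have d2 : is_derive t (1 : R) (expR \o (fun t => - (a * t ^+ 2)))
    (expR (- (a * t ^+ 2)) * - (2 * a * t)).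
  exact: is_derive1_comp.
apply: (is_derive_eq (is_deriveM (is_derive_poly P t) d2)).
rewrite /GRing.scale/= hornerD hornerN !hornerM hornerC hornerX; ring.
Qed.

Lemma gauspoly_mulX q : gauspoly q -> gauspoly (fun t => t * q t).
Proof.
move=> [a a0 [P ->]]; exists a => //; exists ('X * P).
by apply/funext => t; rewrite hornerM ?hornerX; ring.
Qed.

Lemma gauspoly_mulp q (Q : {poly R}) : gauspoly q -> gauspoly (fun t => Q.[t] * q t).
Proof.
move=> [a a0 [P ->]]; exists a => //; exists (Q * P).
by apply/funext => t; rewrite hornerM ?hornerX; ring.
Qed.

(** Induction on the polynomial, with the rate [a] left free: each factor [t] is absorbed by one
    half of the exponential, and the other half goes to the induction hypothesis. *)
Lemma gauspoly_bounded q : gauspoly q -> exists2 C, 0 <= C & forall t, `|q t| <= C.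
Proof.
move=> [a a0 [P ->]] {q}.
elim/poly_ind: P a a0 => [|P c IH] a a0.
  by exists 0 => // t; rewrite horner0 mul0r normr0.
have a20 : 0 < a / 2 by rewrite divr_gt0.
have [C C0 PC] := IH _ a20.
exists (C * (1 + 2 / a) + `|c|).
  by rewrite addr_ge0// mulr_ge0// addr_ge0// divr_ge0// ltW.
move=> t; rewrite hornerD hornerM hornerC hornerX mulrDl (le_trans (ler_normD _ _))// lerD//.
  rewrite [X in `|X|](_ : _ =
     (P.[t] * expR (- (a / 2 * t ^+ 2))) * (t * expR (- (a / 2 * t ^+ 2)))); last first.
    have -> : expR (- (a * t ^+ 2)) =
       expR (- (a / 2 * t ^+ 2)) * expR (- (a / 2 * t ^+ 2)).
      by rewrite -expRD; congr expR; field.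
    ring.
  rewrite normrM ler_pM// normrM [`|expR _|]ger0_norm ?expR_ge0//.
  rewrite expRN ler_pdivrMr ?expR_gt0//.
  (* The constant [1 + 2 / a] is such that the product with [1 + a t^2 / 2], a lower bound of the
     exponential, exceeds [1 + t^2] and hence [|t|]. *)
  apply: (@le_trans _ _ ((1 + 2 / a) * (1 + a / 2 * t ^+ 2))); last first.
    by rewrite ler_pM2l ?expR_ge1Dx// addr_gt0// divr_gt0.
  have -> : (1 + 2 / a) * (1 + a / 2 * t ^+ 2) =
    1 + t ^+ 2 + 2 / a + a / 2 * t ^+ 2 by field; rewrite gt_eqF.
  have : 0 <= a / 2 * t ^+ 2 by rewrite mulr_ge0 ?sqr_ge0// ltW.
  have : 0 <= 2 / a by rewrite divr_ge0// ltW.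
  rewrite -[t ^+ 2]real_normK ?num_real//.
  have := sqr_ge0 (`|t| - 1); have := normr_ge0 t; nra.
rewrite normrM ler_piMr// ger0_norm ?expR_ge0// expR_le1 oppr_le0.
by rewrite mulr_ge0 ?sqr_ge0// ltW.
Qed.

Lemma gauspoly_decay q : gauspoly q ->
  exists2 C, 0 <= C & forall t, `|q t| <= C * cauchyw t.
Proof.
move=> gq; have [C C0 qC] := gauspoly_bounded (gauspoly_mulp (1 + 'X^2) gq).
exists C => // t; rewrite /cauchyw ler_pdivlMr ?ltr_pwDl ?sqr_ge0//.
have := qC t; rewrite hornerD hornerC hornerXn normrM ger0_norm ?addr_ge0 ?sqr_ge0//.
by rewrite mulrC.
Qed.

Lemma gauspoly_continuous q : gauspoly q -> continuous q.
Proof. by move=> /gauspoly_derive[q' _ /is_derive_continuous]. Qed.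

Lemma trigpoly_taylor (p p' : R -> R) : trigpoly p -> deriv1 p p' ->
  exists2 C, 0 <= C & forall t h, `|h| <= 1 ->
    `|p (t + h) - p t - h * p' t| <= C * h ^+ 2.
Proof.
move=> tp dp; have [q tq dq] := trigpoly_derive tp.
have pq : p' = q.
  apply/funext => t; rewrite -(@derive_val _ _ _ _ _ _ _ (dp t)).
  by rewrite -(@derive_val _ _ _ _ _ _ _ (dq t)).
have [r tr dr] := trigpoly_derive tq; have [C C0 rC] := trigpoly_bounded tr.
exists C => // t h h1; rewrite pq.
have rC1 s : `|r s| <= C * (fun=> 1) s by rewrite mulr1.
have w1 (s e : R) : `|e| <= 1 -> (fun=> 1 : R) (s + e) <= 1 * (fun=> 1) s.
  by rewrite mulr1.
apply: le_trans (taylor2 dq dr C0 (fun=> ler01) rC1 w1 _ h1) _.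
by rewrite !mulr1.
Qed.

Lemma gauspoly_taylor (p p' : R -> R) : gauspoly p -> deriv1 p p' ->
  exists2 C, 0 <= C & forall t h, `|h| <= 1 ->
    `|p (t + h) - p t - h * p' t| <= C * (h ^+ 2 * cauchyw t).
Proof.
move=> tp dp; have [q tq dq] := gauspoly_derive tp.
have pq : p' = q.
  apply/funext => t; rewrite -(@derive_val _ _ _ _ _ _ _ (dp t)).
  by rewrite -(@derive_val _ _ _ _ _ _ _ (dq t)).
have [r tr dr] := gauspoly_derive tq; have [C C0 rC] := gauspoly_decay tr.
exists (C * 3); first by rewrite mulr_ge0.
move=> t h h1; rewrite pq.
exact: (taylor2 dq dr C0 (@cauchyw_ge0 _) rC (@cauchyw_shift _)).
Qed.

End kernels_1d.

(** * Partial derivatives and integration by parts *)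

Section phase_calculus.
Context {R : realType} (d : nat).
Notation Z := ('rV[R]_d * 'rV[R]_d)%type.
Implicit Types (F G : Z -> R) (z h e : Z).

Definition pdir (k : 'I_d + 'I_d) : Z := match k with inl i => ex i | inr i => ev i end.

Definition pcoord (h : Z) (k : 'I_d + 'I_d) : R :=
  match k with inl i => h.1 ord0 i | inr i => h.2 ord0 i end.

Lemma pcoord_sum h : h = \sum_k pcoord h k *: pdir k.
Proof.
rewrite big_sumType /= /ex /ev; case: h => x v; congr pair => /=.
  rewrite !raddf_sum/= [X in _ + X]big1 ?addr0; last by move=> i _; rewrite scaler0.
  by rewrite [LHS]row_sum_delta.
rewrite !raddf_sum/= [X in X + _]big1 ?add0r; last by move=> i _; rewrite scaler0.
by rewrite [LHS]row_sum_delta.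
Qed.

Lemma pcoord_le h k : `|pcoord h k| <= `|h|.
Proof.
have coord_le (x : 'rV[R]_d) i : `|x ord0 i| <= `|x|.
  rewrite /Num.norm/= mx_normrE.
  exact: (le_bigmax _ (fun ij => `|x ij.1 ij.2|) (ord0, i)).
rewrite prod_normE; case: k => i /=.
  by rewrite le_max coord_le.
by rewrite le_max coord_le orbT.
Qed.

Definition pform (c : 'I_d + 'I_d -> R) (h : Z) : R := \sum_k pcoord h k * c k.

Lemma pform_linear c : linear (pform c).
Proof.
move=> a x y; rewrite /pform scaler_sumr -big_split/=; apply: eq_bigr => k _.
by rewrite /GRing.scale/= mulrA -mulrDl; congr (_ * _); case: k => i /=; rewrite !mxE.
Qed.

HB.instance Definition _ c := GRing.isLinear.Build R Z R _ (pform c) (pform_linear c).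

Lemma pform_continuous c : continuous (pform c).
Proof.
apply: (@linear_bounded_continuous _ _ _ (pform c)).1; apply/linear_boundedP.
near=> M => h; rewrite /pform (le_trans (ler_norm_sum _ _ _))//.
apply: (@le_trans _ _ ((\sum_k `|c k|) * `|h|)).
  rewrite mulr_suml ler_sum// => k _; rewrite normrM mulrC ler_wpM2l//.
  exact: pcoord_le.
rewrite ler_wpM2r//; near: M; apply: nbhs_pinfty_ge; exact: num_real.
Unshelve. all: by end_near. Qed.

Definition pderiv (F F' : Z -> R) e := forall z, is_derive z e F (F' z).

Lemma is_derive_line F D z e :
  is_derive z e F D <-> is_derive (0 : R) (1 : R) (fun t : R => F (z + t *: e)) D.
Proof.
have E : (fun h : R => h^-1 *: (F (h *: e + z) - F z)) =
  (fun h : R => h^-1 *: (F (z + (h *: (1 : R) + 0) *: e) - F (z + (0 : R) *: e))).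
  apply/funext => h; have -> : h *: (1 : R) + 0 = h by rewrite addr0 [LHS]mulr1.
  by rewrite scale0r addr0 [h *: e + z]addrC.
split=> -[de dv]; split.
- by move: de; rewrite /derivable /= E.
- by rewrite -dv /derive /= E.
- by move: de; rewrite /derivable /= E.
- by rewrite -dv /derive /= E.
Qed.

Lemma pderiv_line F (F' : Z -> R) e : pderiv F F' e ->
  forall z, deriv1 (fun t : R => F (z + t *: e)) (fun t : R => F' (z + t *: e)).
Proof.
move=> dF z t; have /is_derive_line := dF (z + t *: e).
set g := fun s : R => _ => dg.
have -> : (fun t : R => F (z + t *: e)) = g \o (fun s => s - t).
  by apply/funext => s /=; rewrite /g -addrA -scalerDl subrKC.
have h : is_derive t (1 : R) (fun s : R => s - t) 1.
  apply: (is_derive_eq (is_deriveB (is_derive_id t 1) (is_derive_cst t t 1))).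
  by rewrite subr0.
have dg' : is_derive (t - t) (1 : R) g (F' (z + t *: e)) by rewrite subrr.
by have := @is_derive1_comp _ g (fun s => s - t) t _ _ dg' h; rewrite mulr1.
Qed.

Lemma is_derive_quad F D z e C :
  (forall t : R, `|t| <= 1 -> `|F (z + t *: e) - F z - t * D| <= C * t ^+ 2) ->
  is_derive z e F D.
Proof.
move=> FC; have C0 : 0 <= C.
  by have := FC 1; rewrite normr1 expr1n mulr1 => /(_ (lexx _)) /(le_trans (normr_ge0 _)).
have cv : h^-1 *: (F (h *: e + z) - F z) @[h --> (0 : R)^'] --> D.
  apply/cvgrPdist_le => eps eps0; near=> h.
  have h0 : h != 0 by near: h; exact: nbhs_dnbhs_neq.
  have h1 : `|h| <= 1.
    near: h; apply: dnbhs0_le; exact: ltr01.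
  have h2 : (C + 1) * `|h| <= eps.
    rewrite -ler_pdivlMl ?ltr_wpDl//; near: h; apply: dnbhs0_le.
    by rewrite mulr_gt0// invr_gt0 ltr_wpDl.
  have -> : D - h^-1 *: (F (h *: e + z) - F z) =
      - h^-1 * (F (z + h *: e) - F z - h * D).
    by rewrite [h *: e + z]addrC /GRing.scale/=; field.
  rewrite normrM normrN normfV ler_pdivrMl ?normr_gt0//.
  apply: le_trans (FC h h1) _.
  rewrite -[h ^+ 2]real_normK ?num_real//.
  move: h2; have := normr_ge0 h; nra.
split; first by apply/cvg_ex; exists D.
exact: cvg_lim.
Unshelve. all: by end_near. Qed.

(* Uniform second-order Taylor bounds pass to convolutions without any limit theorem;
   for a family closed under partial derivatives they yield differentiability. *)
Definition quad_partial (F F' : Z -> R) e :=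
  exists C, forall z (t : R), `|t| <= 1 -> `|F (z + t *: e) - F z - t * F' z| <= C * t ^+ 2.

Definition bounded_fct F := exists C, forall z, `|F z| <= C.

Variable fam : (Z -> R) -> Prop.
Hypothesis fam_bounded : forall F, fam F -> bounded_fct F.
Hypothesis fam_partial : forall F k, fam F ->
  exists2 F', fam F' & quad_partial F F' (pdir k).

Let fam_partials F : fam F -> exists2 P : 'I_d + 'I_d -> Z -> R, (forall k, fam (P k)) &
  exists2 C, 0 <= C & forall k z (t : R), `|t| <= 1 ->
     `|F (z + t *: pdir k) - F z - t * P k z| <= C * t ^+ 2.
Proof.
move=> fF.
have /choice[P PP] : forall k, exists F', fam F' /\ quad_partial F F' (pdir k).
  by move=> k; have [F' f' q] := fam_partial k fF; exists F'.
have /choice[C CP] : forall k, exists C, forall z (t : R), `|t| <= 1 ->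
    `|F (z + t *: pdir k) - F z - t * P k z| <= C * t ^+ 2.
  by move=> k; have [_ [C h]] := PP k; exists C.
exists P; first by move=> k; have [] := PP k.
exists (\sum_k `|C k|); first by apply: sumr_ge0.
move=> k z t t1; apply: le_trans (CP k z t t1) _; rewrite ler_wpM2r ?sqr_ge0//.
rewrite (bigD1 k)//= (le_trans (ler_norm _))// lerDl; exact: sumr_ge0.
Qed.

Let fam_lipschitz F : fam F -> exists2 L, 0 <= L & forall k z (t : R), `|t| <= 1 ->
  `|F (z + t *: pdir k) - F z| <= L * `|t|.
Proof.
move=> fF; have [P fP [C C0 CP]] := fam_partials fF.
have /choice[D DP] : forall k, exists D, forall z, `|P k z| <= D.
  by move=> k; exact: fam_bounded.
exists (C + \sum_k `|D k|); first by rewrite addr_ge0//; exact: sumr_ge0.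
move=> k z t t1.
have -> : F (z + t *: pdir k) - F z =
  (F (z + t *: pdir k) - F z - t * P k z) + t * P k z by ring.
rewrite (le_trans (ler_normD _ _))// mulrDl lerD//.
  apply: le_trans (CP k z t t1) _; rewrite ler_wpM2l//.
  by rewrite -[t ^+ 2]real_normK ?num_real// expr2 ler_piMr.
rewrite normrM mulrC ler_wpM2r// (le_trans (DP k z))//.
rewrite (bigD1 k)//= (le_trans (ler_norm _))// lerDl; exact: sumr_ge0.
Qed.

Let fam_lipschitz_sum F : fam F -> exists2 L, 0 <= L &
  forall s (a : 'I_d + 'I_d -> R) (r : R) z, r <= 1 -> (forall k, `|a k| <= r) ->
  `|F (z + \sum_(k <- s) a k *: pdir k) - F z| <= L * (size s)%:R * r.
Proof.
move=> fF; have [L L0 LP] := fam_lipschitz fF; exists L => // s a r z r1 ar.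
elim: s z => [|k s IH] z.
  by rewrite big_nil addr0 subrr normr0 mulr0 mul0r.
rewrite big_cons addrA.
set z1 := z + a k *: _.
have -> : F (z1 + \sum_(k <- s) a k *: pdir k) - F z =
  (F (z1 + \sum_(k <- s) a k *: pdir k) - F z1) + (F z1 - F z) by ring.
rewrite (le_trans (ler_normD _ _))//= -natr1 mulrDr mulr1 mulrDl lerD//.
apply: le_trans (LP k z (a k) (le_trans (ar k) r1)) _.
by rewrite ler_wpM2l.
Qed.

(** The increment is made one coordinate at a time. Each step costs its own Taylor remainder plus
    the variation of a partial derivative over the other steps, whence the square of the number of
    steps. *)
Let fam_taylor F : fam F -> exists2 P : 'I_d + 'I_d -> Z -> R,
  (forall k, fam (P k) /\ pderiv F (P k) (pdir k)) &
  exists2 C, 0 <= C &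
  forall s (a : 'I_d + 'I_d -> R) (r : R) z, 0 <= r -> r <= 1 -> (forall k, `|a k| <= r) ->
  `|F (z + \sum_(k <- s) a k *: pdir k) - F z - \sum_(k <- s) a k * P k z|
    <= C * (size s)%:R ^+ 2 * r ^+ 2.
Proof.
move=> fF; have [P fP [C C0 CP]] := fam_partials fF.
have /choice[D DP] : forall k, exists L, 0 <= L /\
  forall s (a : 'I_d + 'I_d -> R) (r : R) z, r <= 1 -> (forall k, `|a k| <= r) ->
  `|P k (z + \sum_(k <- s) a k *: pdir k) - P k z| <= L * (size s)%:R * r.
  by move=> k; have [L L0 LP] := fam_lipschitz_sum (fP k); exists L.
exists P.
  by move=> k; split=> // z; apply: (is_derive_quad (C := C)); exact: CP.
pose E := \sum_k D k.
have E0 : 0 <= E by apply: sumr_ge0 => k _; have [] := DP k.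
have DE k : D k <= E.
  by rewrite /E (bigD1 k)//= lerDl; apply: sumr_ge0 => j _; have [] := DP j.
exists (C + E); first exact: addr_ge0.
move=> s a r z r0 r1 ar; elim: s => [|k s IH].
  by rewrite !big_nil addr0 !subrr normr0 expr0n/= mulr0 mul0r.
rewrite !big_cons [a k *: _ + _]addrC addrA.
set z1 := z + _.
have -> : F (z1 + a k *: pdir k) - F z - (a k * P k z + \sum_(k <- s) a k * P k z) =
  (F (z1 + a k *: pdir k) - F z1 - a k * P k z1) + a k * (P k z1 - P k z)
   + (F z1 - F z - \sum_(k <- s) a k * P k z) by ring.
rewrite (le_trans (ler_normD _ _))//.
have h1 : `|F (z1 + a k *: pdir k) - F z1 - a k * P k z1| <= C * r ^+ 2.
  apply: le_trans (CP k z1 (a k) (le_trans (ar k) r1)) _; rewrite ler_wpM2l//.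
  by rewrite -[a k ^+ 2]real_normK ?num_real// lerXn2r// nnegrE.
have h2 : `|a k * (P k z1 - P k z)| <= E * (size s)%:R * r ^+ 2.
  rewrite normrM; have [D0 DPk] := DP k.
  apply: (@le_trans _ _ (r * (D k * (size s)%:R * r))).
    by rewrite ler_pM// DPk.
  have -> : r * (D k * (size s)%:R * r) = D k * (size s)%:R * r ^+ 2 by ring.
  by rewrite ler_wpM2r ?sqr_ge0// ler_wpM2r.
have n0 : 0 <= (size s)%:R :> R by [].
have := ler_normD (F (z1 + a k *: pdir k) - F z1 - a k * P k z1) (a k * (P k z1 - P k z)).
rewrite /= -natr1; move: h1 h2 IH => h1 h2 IH h3.
set n := (size s)%:R in n0 h2 IH *.
have -> : (C + E) * (n + 1) ^+ 2 * r ^+ 2 =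
  (C + E) * n ^+ 2 * r ^+ 2 + (C * r ^+ 2 + E * n * r ^+ 2)
  + (2 * C * n * r ^+ 2 + E * n * r ^+ 2 + E * r ^+ 2) by ring.
have : 0 <= 2 * C * n * r ^+ 2 + E * n * r ^+ 2 + E * r ^+ 2.
  by rewrite !addr_ge0// !mulr_ge0// sqr_ge0.
lra.
Qed.

(** With the norm of [h] for [r], which dominates all its coordinates, the quadratic bound becomes a
    little o; the differential is the linear form built from the partial derivatives. *)
Lemma fam_differentiable F : fam F -> forall z, differentiable F z.
Proof.
move=> fF z; have [P PP [C C0 CP]] := fam_taylor fF.
pose df := pform (fun k => P k z).
have cdf : continuous df by exact: pform_continuous.
have near_le (r : R) : 0 < r -> \forall h \near (0 : Z), `|h| <= r.
  move=> r0; apply/nbhs_normP; exists r => // y /=.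
  by rewrite /ball_ /= sub0r normrN => /ltW.
have E : F \o shift z = cst (F z) + df +o_ (0 : Z) id.
  apply/eqaddoP => eps eps0.
  pose n : R := (size (index_enum ('I_d + 'I_d)%type))%:R.
  have p0 : 0 < C * n ^+ 2 + 1 by rewrite ltr_wpDl// mulr_ge0 ?sqr_ge0.
  near=> h.
  have h1 : `|h| <= 1 by near: h; exact: near_le.
  have h2 : (C * n ^+ 2 + 1) * `|h| <= eps.
    rewrite -ler_pdivlMl//; near: h; apply: near_le.
    by rewrite mulr_gt0// invr_gt0.
  have := CP (index_enum ('I_d + 'I_d)%type) (pcoord h) `|h| z (normr_ge0 _) h1 (pcoord_le h).
  rewrite -pcoord_sum -/n => h3.
  have -> : (F \o shift z - (cst (F z) + df)) h = F (z + h) - F z - \sum_k pcoord h k * P k z.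
    by rewrite !fctE /= [h + z]addrC /df /pform opprD addrA.
  apply: le_trans h3 _; move: h2; have := normr_ge0 h; nra.
have dE := @diff_unique _ _ _ F df z cdf E.
by apply/diff_locallyP; rewrite dE; split.
Unshelve. all: by end_near. Qed.

End phase_calculus.

(** * Velocity decay and integration by parts in [x] and in [v] *)

Section phase_integration.
Context {R : realType} (d : nat).
Notation Z := ('rV[R]_d * 'rV[R]_d)%type.
Notation mu := (@phase_vol R d).
Notation leb := (@lebesgue_measure R).
Notation itg f := (mu.-integrable setT (EFin \o f)).
Notation cell := (@unit_cell R d).

Lemma phase_line_v (j : 'I_d) (G : Z -> R) : itg G ->
  (forall x v, \int[leb]_t (G (x, v + t *: delta_mx ord0 j))%:E = 0)%E ->
  (\int[mu]_z (G z)%:E = 0)%E.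
Proof.
move=> iG G0; have iG' : (@torus_vol R d \x vol d)%E.-integrable setT (EFin \o G) by [].
rewrite -[LHS](integral12_prod_meas1 iG').
rewrite (ae_eq_integral (cst 0%E)) ?integral0//.
- exact: (measurable_fubini_F iG').
- have := ae_integrable1 iG'; apply: filterS => x ix _ /=.
  exact: (vol_line (i := j) (G := fun v => G (x, v))).
Qed.

Lemma phase_line_x (j : 'I_d) (G : Z -> R) : itg G ->
  (forall x v, \int[leb]_t (G ((x + t *: delta_mx ord0 j), v)
     * \1_cell (x + t *: delta_mx ord0 j))%:E = 0)%E ->
  (\int[mu]_z (G z)%:E = 0)%E.
Proof.
move=> iG G0; have iG' : (@torus_vol R d \x vol d)%E.-integrable setT (EFin \o G) by [].
rewrite -[LHS](integral21_prod_meas1 iG').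
rewrite (ae_eq_integral (cst 0%E)) ?integral0//.
- exact: (measurable_fubini_G iG').
- have := ae_integrable2 iG'; apply: filterS => v iv _ /=.
  rewrite /fubini_G [LHS](integral_torusE (F := fun x => G (x, v)))//.
  apply: (vol_line (i := j) (G := fun x => G (x, v) * \1_cell x)) => //.
  exact: (integrable_torus (F := fun x => G (x, v))).
Qed.

Lemma torus_vol_setT_le1 : (@torus_vol R d setT <= 1)%E.
Proof.
have -> : @torus_vol R d setT = (\int[@torus_vol R d]_x (1 : R)%:E)%E.
  by rewrite integral_cst// mul1e.
rewrite (ge0_integral_torusE (F := fun=> 1))//.
have E x : (1 * \1_cell x = \prod_(i < d) \1_(`[0, 1[%classic : set R) (x ord0 i) :> R).
  rewrite mul1r indicE; case: (asboolP (cell x)) => cx.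
    rewrite mem_set// big1// => i _; rewrite indicE mem_set//=.
    by rewrite in_itv/=; exact: cx.
  rewrite memNset//; have /existsNP[i ci] := cx; rewrite (bigD1 i)//=.
  have -> : \1_(`[0, 1[%classic : set R) (x ord0 i) = 0 :> R.
    by rewrite indicE memNset//= in_itv.
  by rewrite mul0r.
under eq_integral do rewrite E.
apply: le_trans (@vol_prod_le _ d (fun=> \1_(`[0, 1[%classic : set R)) (fun=> 1) _ _ _) _.
- by move=> i; apply: measurable_indic; exact: measurable_itv.
- by move=> i t; rewrite indicE.
- move=> i; rewrite integral_indic//= setIT lebesgue_measure_itv/= lte_fin ltr01.
  by rewrite oppr0 adde0.
- by rewrite big1.
Qed.

(** A product, not a radial function, so that its integral over R^d factors into [pi ^+ d] by
    Tonelli. *)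
Definition vweight (v : 'rV[R]_d) : R := \prod_j cauchyw (v ord0 j).

Lemma vweight_gt0 v : 0 < vweight v.
Proof. by apply: prodr_gt0 => j _; exact: cauchyw_gt0. Qed.

Lemma vweight_ge0 v : 0 <= vweight v.
Proof. exact/ltW/vweight_gt0. Qed.

Lemma vweight_le1 v : vweight v <= 1.
Proof.
apply: (@le_trans _ _ (\prod_(j < d) 1)); last by rewrite big1.
by apply: ler_prod => j _; rewrite cauchyw_ge0 cauchyw_le1.
Qed.

Lemma vweight_le v j : vweight v <= cauchyw (v ord0 j).
Proof.
rewrite /vweight (bigD1 j)//= ler_piMr ?cauchyw_ge0//.
apply: (@le_trans _ _ (\prod_(i < d | i != j) 1)); last by rewrite big1.
by apply: ler_prod => i _; rewrite cauchyw_ge0 cauchyw_le1.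
Qed.

Lemma measurable_vweight_sub (v0 : 'rV[R]_d) :
  measurable_fun setT (fun v : 'rV[R]_d => vweight (v0 - v)).
Proof.
rewrite (_ : (fun _ => _) = fun v : 'rV[R]_d => \prod_j cauchyw (v0 ord0 j - v ord0 j)).
  apply: (measurable_prod_coord (f := fun j t => cauchyw (v0 ord0 j - t))) => j.
  apply: measurableT_comp; first exact: measurable_cauchyw.
  exact: measurable_funB.
by apply/funext => v; apply: eq_bigr => j _; rewrite !mxE.
Qed.

Lemma integral_vweight_sub (v0 : 'rV[R]_d) :
  (\int[mu]_z (vweight (v0 - z.2))%:E <= (pi ^+ d)%:E)%E.
Proof.
rewrite [leLHS](@fubini_tonelli1 _ _ _ _ _ (@torus_vol R d) (vol d)
    (fun z => (vweight (v0 - z.2))%:E)); last 2 first.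
- apply/measurable_EFinP.
  by apply: (measurableT_comp (measurable_vweight_sub v0)); exact: measurable_snd.
- by move=> z; rewrite lee_fin vweight_ge0.
rewrite /fubini_F/= integral_cst// -[leRHS]mule1.
have h : (\int[vol d]_v (vweight (v0 - v))%:E <= (pi ^+ d)%:E :> \bar R)%E.
  under eq_integral.
    move=> v _; rewrite /vweight.
    have -> : \prod_j cauchyw ((v0 - v) ord0 j) = \prod_j cauchyw (v ord0 j - v0 ord0 j).
      by apply: eq_bigr => j _; rewrite !mxE -cauchyw_sym opprB.
    over.
  rewrite (vol_prod (f := fun j t => cauchyw (t - v0 ord0 j)) (I := fun=> pi)).
  - by rewrite prodr_const card_ord.
  - move=> j; apply: measurableT_comp; first exact: measurable_cauchyw.
    exact: measurable_funB.
  - by move=> j t; exact: cauchyw_ge0.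
  - move=> j; rewrite ge0_integral_shift ?integral_cauchyw//.
      exact: continuous_cauchyw.
    exact: cauchyw_ge0.
apply: lee_pmul => //; last exact: torus_vol_setT_le1.
by apply: integral_ge0 => v _; rewrite lee_fin vweight_ge0.
Qed.

Lemma itg_vweight_sub (v0 : 'rV[R]_d) : itg (fun z => vweight (v0 - z.2)).
Proof.
apply/integrableP; split.
  apply/measurable_EFinP.
  by apply: (measurableT_comp (measurable_vweight_sub v0)); exact: measurable_snd.
under eq_integral do rewrite /= ger0_norm ?vweight_ge0//.
exact: le_lt_trans (integral_vweight_sub v0) (ltry _).
Qed.

Lemma vweightN v : vweight (- v) = vweight v.
Proof. by apply: eq_bigr => j _; rewrite mxE cauchyw_sym. Qed.

Lemma itg_vweight : itg (fun z => vweight z.2).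
Proof.
have := itg_vweight_sub 0.
by under eq_fun do rewrite /= sub0r vweightN.
Qed.

Definition decaying (G : Z -> R) := exists2 C, 0 <= C & forall z, `|G z| <= C * vweight z.2.

Lemma decaying_itg G : measurable_fun setT G -> decaying G -> itg G.
Proof.
move=> mG [C C0 GC]; apply: (itg_le mG _ GC).
by apply: itgZ; exact: itg_vweight.
Qed.

Lemma decaying_sqi G : measurable_fun setT G -> decaying G -> sqi mu G.
Proof.
move=> mG [C C0 GC]; split=> //.
apply: (@itg_le _ _ _ _ _ (fun z => C ^+ 2 * vweight z.2)).
- exact: measurable_funX.
- by apply: itgZ; exact: itg_vweight.
- move=> z; rewrite normrX; apply: (@le_trans _ _ ((C * vweight z.2) ^+ 2)).
    by rewrite ler_sqr ?nnegrE// mulr_ge0// vweight_ge0.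
  rewrite exprMn ler_wpM2l ?sqr_ge0// expr2 ler_piMr ?vweight_ge0//.
  exact: vweight_le1.
Qed.

Lemma decayingD F G : decaying F -> decaying G -> decaying (fun z => F z + G z).
Proof.
move=> [C C0 FC] [D D0 GD]; exists (C + D); first exact: addr_ge0.
by move=> z; rewrite mulrDl (le_trans (ler_normD _ _))// lerD.
Qed.

Lemma decayingM (F G : Z -> R) : bounded_fct F -> decaying G -> decaying (fun z => F z * G z).
Proof.
move=> [C FC] [D D0 GD]; exists (`|C| * D); first by rewrite mulr_ge0.
move=> z; rewrite normrM -mulrA ler_pM//.
by rewrite (le_trans (FC z))// ler_norm.
Qed.

Lemma decaying_bounded G : decaying G -> bounded_fct G.
Proof.
move=> [C C0 h]; exists C => z; rewrite (le_trans (h z))// ler_piMr//.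
exact: vweight_le1.
Qed.

Lemma cauchyw_translate (a t : R) : cauchyw (a + t) <= 2 * (1 + a ^+ 2) * cauchyw t.
Proof.
rewrite /cauchyw ler_pdivlMr ?ltr_pwDl ?sqr_ge0// mulrC.
rewrite ler_pdivrMr ?ltr_pwDl ?sqr_ge0//.
have := sqr_ge0 (a * (a + t)); have := sqr_ge0 (2 * a + t); nra.
Qed.

Let line_cont (F : Z -> R) (e : Z) z : continuous F -> continuous (fun t : R => F (z + t *: e)).
Proof.
move=> cF t; apply: continuous_comp; last exact: cF.
apply: cvgD; first exact: cvg_cst.
by apply: cvgZr_tmp; exact: cvg_id.
Qed.

(** The coefficient depends on [x] alone, hence is constant along each line in direction [v_j] and
    comes out of the integral. This is how a merely bounded measurable magnetic field goes through
    the integrations by parts. *)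
Lemma ibp_v (j : 'I_d) (c : 'rV[R]_d -> R) (G G' : Z -> R) :
  measurable_fun setT c -> (exists C, forall x, `|c x| <= C) ->
  pderiv G G' (ev j) -> continuous G' -> decaying G -> decaying G' ->
  itg (fun z => c z.1 * G' z) /\ \int[mu]_z (c z.1 * G' z) = 0.
Proof.
move=> mc [C cC] dG cG' [D D0 GD] [D' D'0 GD'].
have mG' : measurable_fun setT G' by exact: continuous_measurable_phase.
have ic : itg (fun z => c z.1 * G' z).
  apply: decaying_itg.
    by apply: measurable_funM => //; exact: measurableT_comp.
  apply: decayingM; last by exists D'.
  by exists C => z; exact: cC.
split=> //; rewrite /Rintegral (phase_line_v (j := j) ic)// => x v /=.
have le1 (t : R) : vweight (v + t *: delta_mx ord0 j) <=
    2 * (1 + (v ord0 j) ^+ 2) * cauchyw t.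
  apply: le_trans (vweight_le _ j) _; rewrite !mxE !eqxx mulr1.
  exact: cauchyw_translate.
set g' := fun t : R => G' ((x, v) + t *: ev j).
have E t : G' (x, v + t *: delta_mx ord0 j) = g' t.
  by rewrite /g' /ev; congr G'; congr pair; rewrite /= scaler0 addr0.
have cg' : continuous g' by exact: line_cont.
have mg' : measurable_fun setT g' by exact: continuous_measurable_fun.
have V (t : R) : ((x, v) + t *: ev j).2 = v + t *: delta_mx ord0 j by [].
have ig' : leb.-integrable setT (EFin \o g').
  apply: (@itg_le _ _ _ leb g' (fun t : R => (D' * (2 * (1 + (v ord0 j) ^+ 2))) * cauchyw t)) => //.
    by apply: itgZ; exact: integrable_cauchyw.
  move=> t; rewrite (le_trans (GD' _))// V -mulrA ler_wpM2l//.
under eq_integral do rewrite E EFinM.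
rewrite integralZl// (integral_deriv_R (F := fun t : R => G ((x, v) + t *: ev j))
   (C := D * (2 * (1 + (v ord0 j) ^+ 2)))) ?mule0//.
- by move=> t; exact: (pderiv_line dG).
- by move=> t; rewrite (le_trans (GD _))// V -mulrA ler_wpM2l.
Qed.

(** A line in direction [x_j] meets the cell in one full period or not at all, and the derivative of
    a periodic function has zero integral over a period. *)
Lemma ibp_x (j : 'I_d) (G G' : Z -> R) :
  pderiv G G' (ex j) -> continuous G' -> decaying G' ->
  (forall v, torus_periodic (fun x => G (x, v))) ->
  itg G' /\ \int[mu]_z G' z = 0.
Proof.
move=> dG cG' dG' pG.
have mG' : measurable_fun setT G' by exact: continuous_measurable_phase.
have ic : itg G' by exact: decaying_itg.
split=> //; rewrite /Rintegral (phase_line_x (j := j) ic)// => x v /=.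
set g' := fun t : R => G' ((x, v) + t *: ex j).
have E t : G' (x + t *: delta_mx ord0 j, v) = g' t.
  by rewrite /g' /ex; congr G'; congr pair; rewrite /= scaler0 addr0.
have cg' : continuous g' by exact: line_cont.
(* The line through [x] has its [j]-th coordinate in the unit interval exactly when
   [a <= t < a + 1]. *)
pose a := - x ord0 j.
have [others|others] := pselect (forall i, i != j -> 0 <= x ord0 i < 1); last first.
  rewrite (eq_integral (cst 0%E)) ?integral0// => t _.
  rewrite indicE memNset ?mulr0// => xt; apply: others => i ij.
  by have := xt i; rewrite !mxE eqxx (negbTE ij) mulr0 addr0.
transitivity (\int[leb]_(t in `[a, (a + 1)%R[) (g' t)%:E)%E.
  rewrite [RHS]integral_mkcond; apply: eq_integral => t _.
  rewrite restrict_EFin /= patchE indicE E.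
  have -> : (x + t *: delta_mx ord0 j \in cell) = (t \in `[a, (a + 1)%R[%classic).
    apply/idP/idP; rewrite !inE /= in_itv/=.
      move=> /(_ j); rewrite !mxE !eqxx mulr1 /a => /andP[h1 h2].
      by apply/andP; split; lra.
    move=> /andP[h1 h2] i; rewrite !mxE eqxx/=.
    have [->|ij] := eqVneq i j; last by rewrite mulr0 addr0; exact: others.
    by rewrite mulr1; move: h1 h2; rewrite /a => h1 h2; apply/andP; split; lra.
  by case: ifPn => _; rewrite ?mulr1 ?mulr0.
rewrite (integral_deriv_itvco (F := fun t : R => G ((x, v) + t *: ex j)))//.
- have -> : (x, v) + (a + 1) *: ex j = ((x + a *: delta_mx ord0 j) + delta_mx ord0 j, v).
    by rewrite /ex; congr pair; rewrite /= ?scaler0 ?addr0// scalerDl scale1r addrA.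
  have -> : (x, v) + a *: ex j = (x + a *: delta_mx ord0 j, v).
    by rewrite /ex; congr pair; rewrite /= ?scaler0 ?addr0.
  by rewrite pG subrr.
- by rewrite ltrDl.
- by move=> t; exact: (pderiv_line dG).
Qed.

End phase_integration.

(** * Convolution with tensor kernels *)

Section tensor_kernels.
Context {R : realType} (d : nat).
Notation Z := ('rV[R]_d * 'rV[R]_d)%type.
Notation mu := (@phase_vol R d).
Notation leb := (@lebesgue_measure R).
Notation itg f := (mu.-integrable setT (EFin \o f)).
Notation sqi := (sqi mu).
Notation N2 := (N2 mu).
Notation ip := (ip mu).
Implicit Types (p q : 'I_d -> R -> R) (k : Z -> R) (f g : Z -> R).

Definition tensor p q (z : Z) : R :=
  (\prod_i p i (z.1 ord0 i)) * (\prod_j q j (z.2 ord0 j)).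

Definition upd (p : 'I_d -> R -> R) i (r : R -> R) : 'I_d -> R -> R :=
  fun l => if l == i then r else p l.

(** Periodic in [x], and closed under all partial derivatives and under multiplication by [v_j]:
    derivatives and velocity moments of a convolution are again convolutions with such kernels. *)
Definition kernelf k := exists p, exists q,
  [/\ forall i, trigpoly (p i), forall j, gauspoly (q j) & k = tensor p q].

Lemma prod_upd p i r (x : 'I_d -> R) :
  \prod_l upd p i r l (x l) = r (x i) * \prod_(l | l != i) p l (x l).
Proof.
rewrite (bigD1 i)//= {1}/upd eqxx; congr (_ * _).
by apply: eq_bigr => l li; rewrite /upd (negbTE li).
Qed.

Lemma prod_shift p i (x : 'rV[R]_d) (t : R) :
  \prod_l p l ((x + t *: delta_mx ord0 i) ord0 l) =
  p i (x ord0 i + t) * \prod_(l | l != i) p l (x ord0 l).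
Proof.
rewrite (bigD1 i)//= !mxE !eqxx mulr1; congr (_ * _).
by apply: eq_bigr => l li; rewrite !mxE (negbTE li) andbF mulr0 addr0.
Qed.

Lemma gauspoly_bound_fun q : (forall j, gauspoly (q j)) ->
  exists2 C : 'I_d -> R, forall j, 0 <= C j & forall j t, `|q j t| <= C j * cauchyw t.
Proof.
move=> gq; have /choice[C CP] : forall j, exists C, 0 <= C /\ forall t, `|q j t| <= C * cauchyw t.
  by move=> j; have [C C0 h] := gauspoly_decay (gq j); exists C.
by exists C => j; have [] := CP j.
Qed.

Lemma trigpoly_bound_fun p : (forall j, trigpoly (p j)) ->
  exists2 C : 'I_d -> R, forall j, 0 <= C j & forall j t, `|p j t| <= C j.
Proof.
move=> gq; have /choice[C CP] : forall j, exists C, 0 <= C /\ forall t, `|p j t| <= C.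
  by move=> j; have [C C0 h] := trigpoly_bounded (gq j); exists C.
by exists C => j; have [] := CP j.
Qed.

Lemma kernelf_decay_pow k (n : nat) : kernelf k ->
  exists2 C, 0 <= C & forall z, `|k z| <= C * vweight z.2 ^+ n.
Proof.
move=> [p [q [tp gq ->]]]; have [A A0 pA] := trigpoly_bound_fun tp.
have /choice[B BP] : forall j, exists C, 0 <= C /\ forall t, `|q j t| <= C * cauchyw t ^+ n.
  move=> j; have [C C0 h] := gauspoly_bounded (gauspoly_mulp ((1 + 'X^2) ^+ n) (gq j)).
  exists C; split=> // t; have := h t.
  rewrite horner_exp hornerD hornerC hornerXn normrM ger0_norm; last first.
    by rewrite exprn_ge0// addr_ge0// sqr_ge0.
  by rewrite /cauchyw exprVn ler_pdivlMr ?exprn_gt0 ?ltr_pwDl ?sqr_ge0// mulrC.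
exists (\prod_i A i * \prod_j B j).
  by rewrite mulr_ge0 ?prodr_ge0// => j _; have [] := BP j.
move=> z; rewrite /tensor normrM !normr_prod -mulrA ler_pM ?prodr_ge0//.
  by apply: ler_prod => i _; rewrite normr_ge0 pA.
rewrite /vweight -prodrXl -big_split/=; apply: ler_prod => j _.
by rewrite normr_ge0; have [_] := BP j; exact.
Qed.

Lemma kernelf_decaying k : kernelf k -> decaying k.
Proof.
by move=> /(kernelf_decay_pow 1)[C C0 h]; exists C => // z; rewrite -(expr1 (vweight _)).
Qed.

(** The weight makes the Taylor remainder of the translated kernel integrable against a function of
    L^2, uniformly in the base point. *)
Definition weighted_partial (k k' : Z -> R) (e : Z) := exists2 C, 0 <= C & forall z (t : R),
  `|t| <= 1 -> `|k (z + t *: e) - k z - t * k' z| <= C * t ^+ 2 * vweight z.2.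

Lemma tensor_partial_x p q i (p' : R -> R) : (forall i, trigpoly (p i)) -> (forall j, gauspoly (q j)) ->
  deriv1 (p i) p' -> weighted_partial (tensor p q) (tensor (upd p i p') q) (ex i).
Proof.
move=> tp gq dp; have [A A0 pA] := trigpoly_bound_fun tp.
have [B B0 qB] := gauspoly_bound_fun gq.
have [C C0 pC] := trigpoly_taylor (tp i) dp.
exists (C * \prod_(l | l != i) A l * \prod_j B j); first by rewrite !mulr_ge0 ?prodr_ge0.
move=> [x v] t t1; rewrite /tensor /= scaler0 addr0 prod_shift prod_upd.
rewrite [\prod_i p _ _](bigD1 i)//=.
set a := x ord0 i; set P := \prod_(l | _) p l _; set Q := \prod_j _.
have -> : p i (a + t) * P * Q - p i a * P * Q - t * (p' a * P * Q) =
  (p i (a + t) - p i a - t * p' a) * P * Q by ring.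
have PA : `|P| <= \prod_(l | l != i) A l.
  by rewrite /P normr_prod ler_prod// => l _; rewrite normr_ge0 pA.
have QB : `|Q| <= \prod_j B j * vweight v.
  by rewrite /Q normr_prod -big_split/= ler_prod// => j _; rewrite normr_ge0 qB.
rewrite !normrM; have -> : C * \prod_(l | l != i) A l * \prod_j B j * t ^+ 2 * vweight v =
  C * t ^+ 2 * (\prod_(l | l != i) A l) * (\prod_j B j * vweight v) by ring.
by rewrite !ler_pM// ?mulr_ge0//; exact: pC.
Qed.

Lemma tensor_partial_v p q i (q' : R -> R) : (forall i, trigpoly (p i)) -> (forall j, gauspoly (q j)) ->
  deriv1 (q i) q' -> weighted_partial (tensor p q) (tensor p (upd q i q')) (ev i).
Proof.
move=> tp gq dp; have [A A0 pA] := trigpoly_bound_fun tp.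
have [B B0 qB] := gauspoly_bound_fun gq.
have [C C0 pC] := gauspoly_taylor (gq i) dp.
exists (C * \prod_l A l * \prod_(j | j != i) B j); first by rewrite !mulr_ge0 ?prodr_ge0.
move=> [x v] t t1; rewrite /tensor /= scaler0 addr0 prod_shift prod_upd.
rewrite [\prod_j q j _](bigD1 i)//=.
set a := v ord0 i; set Q := \prod_(l | _) q l _; set P := \prod_j p _ _.
have -> : P * (q i (a + t) * Q) - P * (q i a * Q) - t * (P * (q' a * Q)) =
  (q i (a + t) - q i a - t * q' a) * P * Q by ring.
have PA : `|P| <= \prod_l A l.
  by rewrite /P normr_prod ler_prod// => l _; rewrite normr_ge0 pA.
have QB : `|Q| <= \prod_(j | j != i) B j * \prod_(j | j != i) cauchyw (v ord0 j).
  by rewrite /Q normr_prod -big_split/= ler_prod// => j _; rewrite normr_ge0 qB.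
rewrite !normrM /vweight [\prod_j cauchyw _](bigD1 i)//=.
have -> : C * \prod_l A l * \prod_(j | j != i) B j * t ^+ 2
   * (cauchyw (v ord0 i) * \prod_(j | j != i) cauchyw (v ord0 j)) =
  C * (t ^+ 2 * cauchyw a) * (\prod_l A l)
   * (\prod_(j | j != i) B j * \prod_(j | j != i) cauchyw (v ord0 j)) by rewrite /a; ring.
by rewrite !ler_pM// ?mulr_ge0//; exact: pC.
Qed.

Lemma trigpoly_upd p i r : (forall i, trigpoly (p i)) -> trigpoly r ->
  forall l, trigpoly (upd p i r l).
Proof. by move=> tp tr l; rewrite /upd; case: ifP. Qed.

Lemma gauspoly_upd p i r : (forall i, gauspoly (p i)) -> gauspoly r ->
  forall l, gauspoly (upd p i r l).
Proof. by move=> tp tr l; rewrite /upd; case: ifP. Qed.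

Lemma kernelf_partial k l : kernelf k ->
  exists2 k', kernelf k' & weighted_partial k k' (pdir l).
Proof.
move=> [p [q [tp gq ->]]]; case: l => i.
  have [p' tp' dp'] := trigpoly_derive (tp i).
  exists (tensor (upd p i p') q); last exact: tensor_partial_x.
  by exists (upd p i p'), q; split=> //; exact: trigpoly_upd.
have [q' gq' dq'] := gauspoly_derive (gq i).
exists (tensor p (upd q i q')); last exact: tensor_partial_v.
by exists p, (upd q i q'); split=> //; exact: gauspoly_upd.
Qed.

Lemma kernelf_mulv k j : kernelf k -> kernelf (fun z => z.2 ord0 j * k z).
Proof.
move=> [p [q [tp gq ->]]]; exists p, (upd q j (fun t => t * q j t)); split=> //.
  by apply: gauspoly_upd => //; exact: gauspoly_mulX.
apply/funext => z; rewrite /tensor prod_upd [\prod_j q _ _](bigD1 j)//=; ring.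
Qed.

Lemma weighted_quad k k' e : weighted_partial k k' e -> quad_partial k k' e.
Proof.
move=> [C C0 h]; exists C => z t t1; rewrite (le_trans (h z t t1))// ler_piMr//.
  by rewrite mulr_ge0// sqr_ge0.
exact: vweight_le1.
Qed.

Lemma kernelf_differentiable k : kernelf k -> forall z, differentiable k z.
Proof.
apply: fam_differentiable => [F /kernelf_decaying /decaying_bounded//|F l kF].
by have [F' kF' w] := kernelf_partial l kF; exists F' => //; exact: weighted_quad w.
Qed.

Lemma kernelf_continuous k : kernelf k -> continuous k.
Proof. by move=> kk z; apply: differentiable_continuous; exact: kernelf_differentiable. Qed.

Lemma kernelf_periodic k : kernelf k -> forall z i, k (z + ex i) = k z.
Proof.
move=> [p [q [tp gq ->]]] [x v] i; rewrite /tensor /= addr0; congr (_ * _).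
rewrite -[delta_mx _ _]scale1r prod_shift (trigpoly_periodic (tp i)).
by rewrite [RHS](bigD1 i).
Qed.

Lemma measurable_subZ : measurable_fun setT (fun s : Z * Z => s.1 - s.2).
Proof.
apply: (@measurable_fun_pair _ _ _ _ _ _ (fun s : Z * Z => s.1.1 - s.2.1)
   (fun s : Z * Z => s.1.2 - s.2.2)).
  apply: measurable_fun_rVP => i; under eq_fun do rewrite !mxE.
  apply: measurable_funB; apply: measurableT_comp (measurable_coord i) _ => //.
    exact: measurableT_comp.
  exact: measurableT_comp.
apply: measurable_fun_rVP => i; under eq_fun do rewrite !mxE.
apply: measurable_funB; apply: measurableT_comp (measurable_coord i) _ => //.
  exact: measurableT_comp.
exact: measurableT_comp.
Qed.

Lemma kernelf_measurable k : kernelf k -> measurable_fun setT k.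
Proof. by move=> kk; apply: continuous_measurable_phase; exact: kernelf_continuous. Qed.

Lemma kernelf_measurable2 k : kernelf k -> measurable_fun setT (fun s : Z * Z => k (s.1 - s.2)).
Proof. by move=> kk; apply: (measurableT_comp (kernelf_measurable kk)); exact: measurable_subZ. Qed.

Lemma kernelf_measurable_sub k (z : Z) : kernelf k -> measurable_fun setT (fun z' : Z => k (z - z')).
Proof.
by move=> kk; exact: (@measurable_sec2 _ _ _ (fun z z' : Z => k (z - z')) z (kernelf_measurable2 kk)).
Qed.

(** The kernel is periodic and is the only factor translated, so integration over the cell is the
    convolution on the torus, computed from the values of [f] on the cell. *)
Definition kconv k f : Z -> R := iop mu (fun z z' => k (z - z')) f.

Lemma kernelf_sub_sqi k (z : Z) : kernelf k -> sqi (fun z' : Z => k (z - z')).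
Proof.
move=> kk; have mk := kernelf_measurable_sub z kk.
have [C C0 h] := kernelf_decay_pow 1 kk.
split=> //; apply: (@itg_le _ _ _ _ _ (fun z' : Z => C ^+ 2 * vweight (z.2 - z'.2))).
- exact: measurable_funX.
- by apply: itgZ; exact: itg_vweight_sub.
- move=> z'; rewrite normrX; have := h (z - z'); rewrite expr1 => h'.
  apply: (@le_trans _ _ ((C * vweight (z.2 - z'.2)) ^+ 2)).
    by rewrite ler_sqr ?nnegrE// mulr_ge0// vweight_ge0.
  rewrite exprMn ler_wpM2l ?sqr_ge0// expr2 ler_piMr ?vweight_ge0//.
  exact: vweight_le1.
Qed.

Lemma kconv_itg k f z : kernelf k -> sqi f -> itg (fun z' => k (z - z') * f z').
Proof. by move=> kk sf; apply: sqi_mul => //; exact: kernelf_sub_sqi. Qed.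

Lemma kconvD k f g z : kernelf k -> sqi f -> sqi g ->
  kconv k (fun z => f z + g z) z = kconv k f z + kconv k g z.
Proof.
move=> kk sf sg; rewrite /kconv /iop -RintegralD//; [|exact: kconv_itg..].
by apply: eq_Rintegral => z' _; rewrite mulrDr.
Qed.

(** A weight [q] between 0 and 1 satisfies [q |f| <= q + f^2], and both terms have integrals bounded
    independently of [z]. *)
Lemma kconv_weight_bound (C : R) (h : Z -> Z -> R) f z : 0 <= C -> sqi f ->
  measurable_fun setT (h z) -> (forall z', `|h z z'| <= C * vweight (z.2 - z'.2)) ->
  itg (fun z' => h z z' * f z') /\
  `|\int[mu]_z' (h z z' * f z')| <= C * (pi ^+ d + N2 f).
Proof.
move=> C0 sf mh hC; have [mf fi] := sf.
have iw := itg_vweight_sub z.2.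
have ib : itg (fun z' => C * (vweight (z.2 - z'.2) + f z' ^+ 2)).
  by apply: itgZ; exact: itgD.
have le1 z' : `|h z z' * f z'| <= C * (vweight (z.2 - z'.2) + f z' ^+ 2).
  rewrite normrM; apply: (@le_trans _ _ (C * vweight (z.2 - z'.2) * `|f z'|)).
    by rewrite ler_wpM2r.
  rewrite -mulrA ler_wpM2l// -[f z' ^+ 2]real_normK ?num_real//.
  have := vweight_ge0 (z.2 - z'.2); have := vweight_le1 (z.2 - z'.2).
  have := normr_ge0 (f z'); have := sqr_ge0 (`|f z'| - 1).
  set w := vweight _; set y := `|_|; nra.
have ih : itg (fun z' => h z z' * f z').
  by apply: (itg_le _ ib) => //; exact: measurable_funM.
split=> //; apply: le_trans (le_normr_Rintegral _ _) _ => //.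
apply: (@le_trans _ _ (\int[mu]_z' (C * (vweight (z.2 - z'.2) + f z' ^+ 2)))).
  apply: le_Rintegral => //; exact: integrable_norm ih.
rewrite RintegralZl//; last exact: itgD.
rewrite RintegralD// ler_wpM2l// lerD2r -lee_fin itg_EFin//.
exact: integral_vweight_sub.
Qed.

Lemma kconv_bounded k f : kernelf k -> sqi f -> bounded_fct (kconv k f).
Proof.
move=> kk sf; have [C C0 h] := kernelf_decaying kk.
exists (C * (pi ^+ d + N2 f)) => z.
apply: (kconv_weight_bound (h := fun z z' => k (z - z')) C0 sf _ _).2.
  exact: kernelf_measurable_sub.
by move=> z'; exact: h.
Qed.

(** The Taylor remainder of the convolution is the integral of the remainder of the kernel against
    [f]; no theorem on differentiation under the integral sign is involved. *)
Lemma kconv_partial k k' e f : kernelf k -> kernelf k' -> sqi f ->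
  weighted_partial k k' e -> quad_partial (kconv k f) (kconv k' f) e.
Proof.
move=> kk kk' sf [C C0 h]; exists (C * (pi ^+ d + N2 f)) => z t t1.
pose H z z' := k (z + t *: e - z') - k (z - z') - t * k' (z - z').
have i1 := kconv_itg (z + t *: e) kk sf; have i2 := kconv_itg z kk sf.
have i3 := kconv_itg z kk' sf.
have -> : kconv k f (z + t *: e) - kconv k f z - t * kconv k' f z =
    \int[mu]_z' (H z z' * f z').
  rewrite /kconv /iop -RintegralZl// -!RintegralB//; last 2 first.
  - exact: itgB.
  - exact: itgZ.
  by apply: eq_Rintegral => z' _; rewrite /H; ring.
have -> : C * (pi ^+ d + N2 f) * t ^+ 2 = (C * t ^+ 2) * (pi ^+ d + N2 f) by ring.
apply: (kconv_weight_bound (h := H) _ sf _ _).2.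
- by rewrite mulr_ge0// sqr_ge0.
- apply: measurable_funB.
    apply: measurable_funB.
      exact: kernelf_measurable_sub.
    exact: kernelf_measurable_sub.
  apply: measurable_funM => //.
  exact: kernelf_measurable_sub.
- move=> z'; have := h (z - z') t t1.
  by have -> : z - z' + t *: e = z + t *: e - z' by rewrite addrAC.
Qed.

Lemma kconv_periodic k f : kernelf k -> forall v, torus_periodic (fun x => kconv k f (x, v)).
Proof.
move=> kk v x i; apply: eq_Rintegral => z' _; congr (_ * _).
rewrite -[RHS](kernelf_periodic kk _ i); congr k.
by case: z' => y w; rewrite /ex; congr pair; rewrite /= ?addr0// addrAC.
Qed.

Let fam f (F : Z -> R) := exists2 k, kernelf k & F = kconv k f.

Lemma kconv_fam_partial f F l : sqi f -> fam f F ->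
  exists2 F', fam f F' & quad_partial F F' (pdir l).
Proof.
move=> sf [k kk ->]; have [k' kk' w] := kernelf_partial l kk.
by exists (kconv k' f); [exists k'|exact: kconv_partial w].
Qed.

Lemma kconv_differentiable k f : kernelf k -> sqi f -> forall z, differentiable (kconv k f) z.
Proof.
move=> kk sf; apply: (@fam_differentiable _ _ (fam f)); last by exists k.
- by move=> F [l kl ->]; exact: kconv_bounded.
- by move=> F l fF; exact: kconv_fam_partial.
Qed.

Lemma kconv_continuous k f : kernelf k -> sqi f -> continuous (kconv k f).
Proof. by move=> kk sf z; apply: differentiable_continuous; exact: kconv_differentiable. Qed.

Lemma quad_pderiv (F F' : Z -> R) e : quad_partial F F' e -> pderiv F F' e.
Proof. by move=> [C h] z; apply: (is_derive_quad (C := C)) => t; exact: h. Qed.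

Lemma kconv_pderiv k k' e f : kernelf k -> kernelf k' -> sqi f ->
  weighted_partial k k' e -> pderiv (kconv k f) (kconv k' f) e.
Proof. by move=> kk kk' sf w; apply: quad_pderiv; exact: kconv_partial. Qed.

Lemma pderivM (F F' G G' : Z -> R) e : pderiv F F' e -> pderiv G G' e ->
  pderiv (fun z => F z * G z) (fun z => F z * G' z + F' z * G z) e.
Proof.
move=> dF dG z; apply: (is_derive_eq (is_deriveM (dF z) (dG z))).
by rewrite /GRing.scale/=; ring.
Qed.

Lemma pderivD (F F' G G' : Z -> R) e : pderiv F F' e -> pderiv G G' e ->
  pderiv (fun z => F z + G z) (fun z => F' z + G' z) e.
Proof. by move=> dF dG z; exact: is_deriveD. Qed.

Lemma pderivZ (a : R) (F F' : Z -> R) e : pderiv F F' e ->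
  pderiv (fun z => a * F z) (fun z => a * F' z) e.
Proof. by move=> dF z; exact: is_deriveZ. Qed.

(** The derivative in [z'] of [k (z - z') * g z'] has integral zero, and it falls on the kernel with
    a minus sign. *)
Lemma kconv_deriv_swap k k' l g g' : kernelf k -> kernelf k' ->
  weighted_partial k k' (pdir l) -> pderiv g g' (pdir l) -> continuous g -> continuous g' ->
  decaying g -> decaying g' -> (forall v, torus_periodic (fun x => g (x, v))) ->
  kconv k' g =1 kconv k g'.
Proof.
move=> kk kk' w dg cg cg' deg deg' pg z.
have sg : sqi g by apply: decaying_sqi => //; exact: continuous_measurable_phase.
have sg' : sqi g' by apply: decaying_sqi => //; exact: continuous_measurable_phase.
have csub (F : Z -> R) : continuous F -> continuous (fun z' : Z => F (z - z')).
  move=> cF z'; apply: continuous_comp; last exact: cF.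
  by apply: cvgB; [exact: cvg_cst|exact: cvg_id].
have dk : pderiv (fun z' => k (z - z')) (fun z' => - k' (z - z')) (pdir l).
  have [C h] := weighted_quad w; apply: quad_pderiv; exists C => z' t t1.
  have := h (z - z') (- t); rewrite normrN sqrrN => /(_ t1); apply: le_trans.
  rewrite le_eqVlt; apply/orP; left; apply/eqP; congr `|_ - _ - _|.
    by congr k; rewrite scaleNr opprD addrA.
  by rewrite mulrN mulNr.
pose G z' := k (z - z') * g z'.
pose G' z' := k (z - z') * g' z' + - k' (z - z') * g z'.
have dG : pderiv G G' (pdir l) by exact: pderivM.
have bk F : kernelf F -> bounded_fct (fun z' => F (z - z')).
  by move=> /kernelf_decaying /decaying_bounded[C h]; exists C => z'.
have cG' : continuous G'.
  move=> z'; apply: cvgD; apply: cvgM.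
  - exact: (csub _ (kernelf_continuous kk)).
  - exact: cg'.
  - apply: cvgN; exact: (csub _ (kernelf_continuous kk')).
  - exact: cg.
have deG : decaying G by apply: decayingM => //; exact: bk.
have deG' : decaying G'.
  apply: decayingD; apply: decayingM => //; first exact: bk.
  by have [C h] := bk _ kk'; exists C => z'; rewrite normrN.
have : \int[mu]_z' G' z' = 0.
  case: l w dg dk dG => i w dg dk dG.
    apply: (ibp_x (j := i) dG cG' deG' _).2 => v x l.
    rewrite /G pg; congr (_ * _); rewrite -[LHS](kernelf_periodic kk _ l); congr k.
    by rewrite /ex; congr pair; rewrite /= ?addr0// opprD addrA subrK.
  have := (ibp_v (c := fun=> 1) (measurable_cst _) _ dG cG' deG deG').2.
  under eq_Rintegral do rewrite mul1r.
  by apply; exists 1 => _; rewrite normr1.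
rewrite /G'; under eq_Rintegral do rewrite mulNr.
rewrite RintegralB//; [|exact: kconv_itg..].
by move/eqP; rewrite subr_eq0 => /eqP.
Qed.

Definition rapid g := forall n : nat, exists2 C, 0 <= C & forall z, `|g z| <= C * vweight z.2 ^+ n.

(** Peetre's inequality in each coordinate: [1 + a^2 <= 2 (1 + (a - b)^2) (1 + b^2)]. *)
Lemma vweight_peetre (v w : 'rV[R]_d) : vweight (v - w) * vweight w <= 2 ^+ d * vweight v.
Proof.
have -> : 2 ^+ d = \prod_(j < d) (2 : R) by rewrite prodr_const card_ord.
rewrite /vweight -!big_split/=; apply: ler_prod => j _.
rewrite mulr_ge0 ?cauchyw_ge0//= !mxE.
set a := v ord0 j; set b := w ord0 j.
rewrite /cauchyw -invfM ler_pdivlMr ?ltr_pwDl ?sqr_ge0// mulrC.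
rewrite ler_pdivrMr ?mulr_gt0 ?ltr_pwDl ?sqr_ge0//.
have := sqr_ge0 ((a - b) * b); have := sqr_ge0 (a - 2 * b); nra.
Qed.

Lemma kconv_rapid k g : kernelf k -> measurable_fun setT g -> rapid g -> rapid (kconv k g).
Proof.
move=> kk mg rg n; have [C C0 kC] := kernelf_decay_pow n kk.
(* One power more than required: [n] of them enter Peetre's inequality and the last one makes the
   integral converge. *)
have [D D0 gD] := rg n.+1.
have sg : sqi g.
  apply: decaying_sqi => //; have [E E0 gE] := rg 1%N.
  by exists E => // z; rewrite -(expr1 (vweight _)).
exists (C * D * (2 ^+ d) ^+ n * `|\int[mu]_z' vweight z'.2|).
  by rewrite !mulr_ge0 ?exprn_ge0.
move=> z; have ikg := kconv_itg z kk sg.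
apply: le_trans (le_normr_Rintegral _ _) _ => //.
have -> : C * D * (2 ^+ d) ^+ n * `|\int[mu]_z' vweight z'.2| * vweight z.2 ^+ n =
    \int[mu]_z' (C * D * (2 ^+ d * vweight z.2) ^+ n * vweight z'.2).
  rewrite RintegralZl//; last exact: itg_vweight.
  rewrite ger0_norm; first by rewrite exprMn; ring.
  by apply: Rintegral_ge0 => z' _; exact: vweight_ge0.
apply: le_Rintegral => //.
- exact: integrable_norm ikg.
- by apply: itgZ; exact: itg_vweight.
- move=> z' _; rewrite normrM.
  apply: (@le_trans _ _ ((C * vweight (z.2 - z'.2) ^+ n) * (D * vweight z'.2 ^+ n.+1))).
    by rewrite ler_pM//; exact: kC.
  rewrite exprSr; have -> : C * vweight (z.2 - z'.2) ^+ n * (D * (vweight z'.2 ^+ n * vweight z'.2)) =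
    C * D * (vweight (z.2 - z'.2) * vweight z'.2) ^+ n * vweight z'.2 by rewrite exprMn; ring.
  rewrite ler_wpM2r ?vweight_ge0// ler_wpM2l ?mulr_ge0// lerXn2r ?nnegrE ?mulr_ge0 ?vweight_ge0//.
  exact: vweight_peetre.
Qed.

End tensor_kernels.

(** * Mollifiers *)

Section one_dim_kernels.
Context {R : realType}.
Notation leb := (@lebesgue_measure R).

(* The square of [|\sum_(j < n.+1) exp (2 pi i j t)|] divided by [n.+1]. *)
Definition fejer (n : nat) (t : R) : R := n.+1%:R^-1 *
  \sum_(j < n.+1) \sum_(k < n.+1) cos (2 * pi * (j%:Z - k%:Z)%:~R * t).

Lemma fejer_trigpoly n : trigpoly (fejer n).
Proof.
rewrite /fejer; under eq_fun do rewrite mulr_sumr.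
apply: trigpoly_sum => j; under eq_fun do rewrite mulr_sumr.
by apply: trigpoly_sum => k; exact: trig_cos.
Qed.

Lemma fejerE n t : fejer n t = n.+1%:R^-1 *
  ((\sum_(j < n.+1) cos (2 * pi * j%:R * t)) ^+ 2 +
   (\sum_(j < n.+1) sin (2 * pi * j%:R * t)) ^+ 2).
Proof.
congr (_ * _); rewrite !expr2 !mulr_suml -big_split/=; apply: eq_bigr => j _.
rewrite !mulr_sumr -big_split/=; apply: eq_bigr => k _.
rewrite rmorphB/= -!pmulrn mulrBr mulrBl cosB; ring.
Qed.

Lemma fejer_ge0 n t : 0 <= fejer n t.
Proof. by rewrite fejerE mulr_ge0 ?invr_ge0// addr_ge0 ?sqr_ge0. Qed.

Lemma fejerN n t : fejer n (- t) = fejer n t.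
Proof.
rewrite /fejer; congr (_ * _); apply: eq_bigr => j _; apply: eq_bigr => k _.
by rewrite mulrN cosN.
Qed.

(** Multiplication by [2 sin (pi t)] telescopes the cosine sum and the sine sum, so both products
    are at most 2 in absolute value, uniformly in [n]; the factor [1 / (n + 1)] of the kernel
    remains. *)
Lemma fejer_local n t : sin (pi * t) ^+ 2 * fejer n t <= 2 / n.+1%:R.
Proof.
rewrite fejerE; set s := sin (pi * t).
set S := \sum_(j < _) cos _; set Q := \sum_(j < _) sin _.
have hS : 2 * s * S = sin ((2 * n%:R + 1) * (pi * t)) + s.
  rewrite /S; elim: (n) => [|m IH].
    by rewrite big_ord1 !mulr0 mul0r cos0 add0r mul1r -/s; ring.
  rewrite big_ord_recr/= mulrDr IH.
  have -> : 2 * pi * m.+1%:R * t = (2 * m%:R + 1) * (pi * t) + pi * t.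
    by rewrite -natr1; ring.
  have -> : (2 * m.+1%:R + 1) * (pi * t) = ((2 * m%:R + 1) * (pi * t) + pi * t) + pi * t.
    by rewrite -natr1; ring.
  set a := (2 * m%:R + 1) * (pi * t); set b := pi * t.
  have sb : s = sin b by [].
  rewrite [sin (a + b + b)]sinD.
  have e : sin a = sin (a + b) * cos b - cos (a + b) * sin b by rewrite -sinB addrK.
  by rewrite e sb; ring.
have hQ : 2 * s * Q = cos (pi * t) - cos ((2 * n%:R + 1) * (pi * t)).
  rewrite /Q; elim: (n) => [|m IH].
    by rewrite big_ord1 !mulr0 mul0r sin0 add0r mul1r; ring.
  rewrite big_ord_recr/= mulrDr IH.
  have -> : 2 * pi * m.+1%:R * t = (2 * m%:R + 1) * (pi * t) + pi * t.
    by rewrite -natr1; ring.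
  have -> : (2 * m.+1%:R + 1) * (pi * t) = ((2 * m%:R + 1) * (pi * t) + pi * t) + pi * t.
    by rewrite -natr1; ring.
  set a := (2 * m%:R + 1) * (pi * t); set b := pi * t.
  have sb : s = sin b by [].
  rewrite [cos (a + b + b)]cosD.
  have e : cos a = cos (a + b) * cos b + sin (a + b) * sin b by rewrite -cosB addrK.
  by rewrite e sb; ring.
have bS : `|2 * s * S| <= 2.
  rewrite hS (le_trans (ler_normD _ _))// -[leRHS](_ : 1 + 1 = _)//.
  by apply: lerD; rewrite ler_norml sin_geN1 sin_le1.
have bQ : `|2 * s * Q| <= 2.
  rewrite hQ (le_trans (ler_normB _ _))// -[leRHS](_ : 1 + 1 = _)//.
  by apply: lerD; rewrite ler_norml cos_geN1 cos_le1.
rewrite mulrCA mulrC ler_wpM2r ?invr_ge0//.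
have h1 : (2 * s * S) ^+ 2 <= 4.
  rewrite -[leLHS]real_normK ?num_real// (_ : 4 = 2 ^+ 2 :> R); last by ring.
  by rewrite ler_sqr ?nnegrE.
have h2 : (2 * s * Q) ^+ 2 <= 4.
  rewrite -[leLHS]real_normK ?num_real// (_ : 4 = 2 ^+ 2 :> R); last by ring.
  by rewrite ler_sqr ?nnegrE.
have -> : s ^+ 2 * (S ^+ 2 + Q ^+ 2) = ((2 * s * S) ^+ 2 + (2 * s * Q) ^+ 2) / 4 by field.
by lra.
Qed.

(** [sin (pi x)] is [cos (pi |x - 1/2|)], and the cosine decreases between 0 and [pi]. *)
Lemma sin_sqr_ge (tau u : R) : 0 < tau -> tau <= `|u| -> `|u| <= 1 - tau ->
  0 < sin (pi * tau) ^+ 2 <= sin (pi * u) ^+ 2.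
Proof.
move=> t0 tu u1; have pi0 : 0 < pi :> R := pi_gt0 R.
have s0 : 0 < sin (pi * tau).
  apply: sin_gt0_pi; rewrite mulr_gt0//=.
  by rewrite -[ltRHS]mulr1 ltr_pM2l//; move: tu u1 => /le_trans h /h; lra.
rewrite exprn_gt0//=.
have -> : sin (pi * u) ^+ 2 = sin (pi * `|u|) ^+ 2.
  by case: (ger0P u) => // _; rewrite mulrN sinN sqrrN.
suff h : sin (pi * tau) <= sin (pi * `|u|).
  by rewrite ler_sqr// nnegrE ?ltW// (lt_le_trans s0).
have sE (x : R) : sin (pi * x) = cos (pi * `|x - 2^-1|).
  have -> : cos (pi * `|x - 2^-1|) = cos (pi * (x - 2^-1)).
    by case: (ger0P (x - 2^-1)) => // _; rewrite mulrN cosN.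
  have -> : pi * (x - 2^-1) = pi * x - pi / 2 by ring.
  by rewrite cosBpihalf.
rewrite !sE; set y := `|u|.
have y1 : `|y - 2^-1| <= 2^-1 - tau.
  by rewrite ler_norml; move: tu u1; rewrite -/y => h1 h2; apply/andP; split; lra.
have -> : `|tau - 2^-1| = 2^-1 - tau.
  by rewrite ler0_norm ?opprB//; move: (normr_ge0 (y - 2^-1)); lra.
have ht : 2^-1 - tau <= 2^-1 by lra.
rewrite leNgt ltr_cos ?in_itv/= -?leNgt ?ler_pM2l//.
- have y2 := le_trans (normr_ge0 _) y1.
  by rewrite mulr_ge0 ?(ltW pi0)//= -[leRHS]mulr1 ler_pM2l//; lra.
- by rewrite mulr_ge0 ?(ltW pi0)//= -[leRHS]mulr1 ler_pM2l//; lra.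
Qed.

Lemma integral_cos_shift (m : int) (a x : R) :
  (\int[leb]_(y in `[0%R, 1%R[) (a * cos (2 * pi * m%:~R * (x - y)))%:E =
   (a * (m == 0)%:R)%:E)%E.
Proof.
have [->|m0] := eqVneq m 0.
  rewrite mulr1; under eq_integral do rewrite mulr0 mul0r cos0 mulr1.
  rewrite integral_cst//= lebesgue_measure_itv/= lte_fin ltr01 oppr0 adde0.
  by rewrite mule1.
rewrite mulr0; pose c : R := 2 * pi * m%:~R.
have c0 : c != 0.
  by rewrite !mulf_neq0// ?intr_eq0// gt_eqF// pi_gt0.
pose F (y : R) := - (a / c) * sin (c * (x - y)).
have dF : deriv1 F (fun y => a * cos (c * (x - y))).
  move=> y.
  have dl : is_derive y (1 : R) (fun y => x - y) (-1).
    apply: (is_derive_eq (is_deriveB (is_derive_cst x y 1) (is_derive_id y 1))).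
    by rewrite sub0r.
  have := @is_derive1_comp _ (fun u => - (a / c) * sin (c * u)) (fun y => x - y) y _ _
    (is_derive_sinl (- (a / c)) c (x - y)) dl.
  by move/is_derive_eq; apply; field.
rewrite (integral_deriv_itvco ltr01 dF).
  congr EFin; rewrite /F subr0.
  have -> : c * (x - 1) = c * x + 2 * pi * (- m)%:~R.
    by rewrite /c rmorphN/=; ring.
  by rewrite (cos_sin_2pi_int _ _).2 subrr.
move=> y; apply: cvgM; first exact: cvg_cst.
apply: (@continuous_comp _ _ _ (fun y => c * (x - y)) cos); last exact: continuous_cos.
apply: cvgM; first exact: cvg_cst.
by apply: cvgB; [exact: cvg_cst|exact: cvg_id].
Qed.

(** Over a period only the [n + 1] diagonal terms of the double sum survive. *)
Lemma integral_fejer n x : (\int[leb]_(y in `[0%R, 1%R[) (fejer n (x - y))%:E = 1)%E.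
Proof.
have icos (m : int) a : leb.-integrable `[0, 1[%classic
    (EFin \o (fun y => a * cos (2 * pi * m%:~R * (x - y)))).
  have cc : continuous (fun y => a * cos (2 * pi * m%:~R * (x - y))).
    move=> y; apply: cvgM; first exact: cvg_cst.
    apply: (@continuous_comp _ _ _ (fun y => 2 * pi * m%:~R * (x - y)) cos); last exact: continuous_cos.
    apply: cvgM; first exact: cvg_cst.
    by apply: cvgB; [exact: cvg_cst|exact: cvg_id].
  have : leb.-integrable `[0, 1]%classic
      (EFin \o (fun y => a * cos (2 * pi * m%:~R * (x - y)))).
    apply: continuous_compact_integrable; first exact: segment_compact.
    exact: continuous_subspaceT.
  apply: integrableS => //.
  by move=> z /=; rewrite !in_itv/= => /andP[-> /ltW ->].
rewrite (_ : (\int[_]_(y in _) _)%E = (\int[leb]_(y in `[0%R, 1%R[)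
    \sum_(j < n.+1) \sum_(k < n.+1)
      (n.+1%:R^-1 * cos (2 * pi * (j%:Z - k%:Z)%:~R * (x - y)))%:E)%E); last first.
  apply: eq_integral => y _; rewrite /fejer mulr_sumr -sumEFin; apply: eq_bigr => j _.
  by rewrite mulr_sumr -sumEFin.
rewrite integral_sum//; last first.
  by move=> j; apply: integrable_sum => // k _; exact: icos.
rewrite (eq_bigr (fun=> (n.+1%:R^-1)%:E)) => [|j _].
  by rewrite sumEFin sumr_const card_ord -[X in X%:E]mulr_natl mulfV.
rewrite integral_sum//; last by move=> k; exact: icos.
rewrite (eq_bigr (fun k : 'I_n.+1 => (n.+1%:R^-1 * (k == j)%:R)%:E)) => [|k _].
  rewrite sumEFin (bigD1 j)//= eqxx mulr1 big1 ?addr0// => k kj.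
  by rewrite (negbTE kj) mulr0.
rewrite integral_cos_shift subr_eq0; congr (_ * _%:R)%:E.
by rewrite eqz_nat eq_sym.
Qed.

(** The centred Gaussian density of variance [1 / (2 c)], written through [normal_pdf] to inherit
    its unit mass; [gauE] is the explicit form. *)
Definition gau (c t : R) : R := normal_pdf 0 (Num.sqrt (2 * c))^-1 t.

Lemma gauE c t : 0 < c -> gau c t = Num.sqrt (c / pi) * expR (- (c * t ^+ 2)).
Proof.
move=> c0; have s0 : (Num.sqrt (2 * c))^-1 != 0.
  by rewrite invr_eq0 sqrtr_eq0 -ltNge mulr_gt0.
rewrite /gau /normal_pdf (negbTE s0) /normal_peak /normal_fun subr0.
have sq : (Num.sqrt (2 * c))^-1 ^+ 2 = (2 * c)^-1.
  by rewrite exprVn sqr_sqrtr// mulr_ge0// ltW.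
rewrite sq; congr (_ * expR _).
  rewrite -sqrtrV; last first.
    by rewrite -mulr_natl !mulr_ge0 ?invr_ge0 ?mulr_ge0 ?pi_ge0// ltW.
  congr Num.sqrt; rewrite -mulr_natl.
  by have := pi_gt0 R; move: (pi : R) => P P0; field; rewrite !gt_eqF.
by rewrite -mulr_natl; field; rewrite gt_eqF.
Qed.

Lemma gau_ge0 c t : 0 <= gau c t.
Proof. exact: normal_pdf_ge0. Qed.

Lemma gau_gauspoly c : 0 < c -> gauspoly (gau c).
Proof.
move=> c0; exists c => //; exists (Num.sqrt (c / pi))%:P.
by apply/funext => t; rewrite gauE// hornerC.
Qed.

Lemma gauN c t : 0 < c -> gau c (- t) = gau c t.
Proof. by move=> c0; rewrite !gauE// sqrrN. Qed.

Lemma integral_gau_shift c x : 0 < c -> (\int[leb]_y (gau c (x - y))%:E = 1)%E.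
Proof.
move=> c0; rewrite -(integral_normal_pdf 0 (Num.sqrt (2 * c))^-1).
rewrite -[RHS](@ge0_integral_shift _ (gau c) x).
- by apply: eq_integral => y _; rewrite -gauN// opprB.
- exact/gauspoly_continuous/gau_gauspoly.
- exact: gau_ge0.
Qed.

Lemma sqrt2_half (c : R) : 0 < c -> Num.sqrt (c / pi) <= 2 * Num.sqrt (c / 2 / pi).
Proof.
move=> c0; have p0 := pi_gt0 R.
have e4 : Num.sqrt 4 = 2 :> R.
  by rewrite (_ : 4 = 2 ^+ 2); [rewrite sqrtr_sqr ger0_norm|ring].
have -> : 2 * Num.sqrt (c / 2 / pi) = Num.sqrt (4 * (c / 2 / pi)) by rewrite (sqrtrM (c / 2 / pi) (ler0n R 4)) e4.
rewrite ler_wsqrtr//.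
have : 0 < c / pi by rewrite divr_gt0.
have -> : 4 * (c / 2 / pi) = 2 * (c / pi).
  by move: p0; move: (pi : R) => P P0; field; rewrite gt_eqF.
by lra.
Qed.

(** One half of the exponent absorbs the factor [t] and the other half is a Gaussian density again,
    so the first absolute moment is of order [1 / sqrt c]. *)
Lemma gau_moment1 c t : 0 < c ->
  `|t * gau c t| <= 2 / Num.sqrt c * gau (c / 2) t.
Proof.
move=> c0; have c20 : 0 < c / 2 by rewrite divr_gt0.
rewrite normrM [`|gau c t|]ger0_norm ?gau_ge0// !gauE//.
have r0 : 0 < Num.sqrt c by rewrite sqrtr_gt0.
have -> : expR (- (c * t ^+ 2)) = expR (- (c / 2 * t ^+ 2)) * expR (- (c / 2 * t ^+ 2)).
  by rewrite -expRD; congr expR; field.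
have h : `|t| * expR (- (c / 2 * t ^+ 2)) <= (Num.sqrt c)^-1.
  rewrite expRN ler_pdivrMr ?expR_gt0// mulrC ler_pdivlMr//.
  apply: le_trans (expR_ge1Dx _).
  have : (`|t| * Num.sqrt c) ^+ 2 = c * t ^+ 2.
    by rewrite exprMn sqr_sqrtr ?ltW// real_normK ?num_real// mulrC.
  set y := `|t| * Num.sqrt c => yE; have := sqr_ge0 (y - 1).
  by rewrite mulrAC -yE; lra.
set e := expR _ in h *; have e0 : 0 <= e by exact: expR_ge0.
have -> : `|t| * (Num.sqrt (c / pi) * (e * e)) = Num.sqrt (c / pi) * (`|t| * e) * e by ring.
have -> : 2 / Num.sqrt c * (Num.sqrt (c / 2 / pi) * e) =
  (2 * Num.sqrt (c / 2 / pi)) * (Num.sqrt c)^-1 * e by ring.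
rewrite ler_wpM2r// ler_pM ?mulr_ge0 ?sqrtr_ge0//; exact: sqrt2_half.
Qed.

Lemma gau_moment2 c t : 0 < c ->
  `|t * (t * gau c t)| <= 4 / c * gau (c / 2) t.
Proof.
move=> c0; have c20 : 0 < c / 2 by rewrite divr_gt0.
rewrite mulrA -expr2 normrM [`|gau c t|]ger0_norm ?gau_ge0// ger0_norm ?sqr_ge0// !gauE//.
have -> : expR (- (c * t ^+ 2)) = expR (- (c / 2 * t ^+ 2)) * expR (- (c / 2 * t ^+ 2)).
  by rewrite -expRD; congr expR; field.
have h : t ^+ 2 * expR (- (c / 2 * t ^+ 2)) <= 2 / c.
  rewrite expRN ler_pdivrMr ?expR_gt0//.
  apply: (@le_trans _ _ (2 / c * (1 + c / 2 * t ^+ 2))).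
    have -> : 2 / c * (1 + c / 2 * t ^+ 2) = 2 / c + t ^+ 2 by field; rewrite gt_eqF.
    by rewrite lerDr divr_ge0// ltW.
  by rewrite ler_pM2l ?expR_ge1Dx// divr_gt0.
set e := expR _ in h *; have e0 : 0 <= e by exact: expR_ge0.
have -> : t ^+ 2 * (Num.sqrt (c / pi) * (e * e)) = Num.sqrt (c / pi) * (t ^+ 2 * e) * e by ring.
have -> : 4 / c * (Num.sqrt (c / 2 / pi) * e) =
  (2 * Num.sqrt (c / 2 / pi)) * (2 / c) * e by ring.
rewrite ler_wpM2r//; apply: ler_pM; [exact: sqrtr_ge0| |exact: sqrt2_half|exact: h].
by rewrite mulr_ge0 ?sqr_ge0.
Qed.

End one_dim_kernels.

Section mollifier.
Context {R : realType} (d : nat).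
Notation Z := ('rV[R]_d * 'rV[R]_d)%type.
Notation mu := (@phase_vol R d).
Notation leb := (@lebesgue_measure R).
Notation itg f := (mu.-integrable setT (EFin \o f)).
Notation sqi := (sqi mu).
Notation N2 := (N2 mu).
Notation ip := (ip mu).
Notation cell := (@unit_cell R d).
Implicit Types (p q : 'I_d -> R -> R) (k : Z -> R) (f g : Z -> R).

Lemma measurable_tensor p q : (forall i, measurable_fun setT (p i)) ->
  (forall j, measurable_fun setT (q j)) -> measurable_fun setT (@tensor R d p q).
Proof.
move=> mp mq; apply: measurable_funM.
  by apply: (measurableT_comp (measurable_prod_coord mp)); exact: measurable_fst.
by apply: (measurableT_comp (measurable_prod_coord mq)); exact: measurable_snd.
Qed.

Lemma cell_indic (x : 'rV[R]_d) :
  \1_cell x = \prod_(i < d) \1_(`[0, 1[%classic : set R) (x ord0 i) :> R.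
Proof.
rewrite indicE; case: (asboolP (cell x)) => cx.
  rewrite mem_set// big1// => i _; rewrite indicE mem_set//=.
  by rewrite in_itv/=; exact: cx.
rewrite memNset//; have /existsNP[i ci] := cx; rewrite (bigD1 i)//=.
have -> : \1_(`[0, 1[%classic : set R) (x ord0 i) = 0 :> R.
  by rewrite indicE memNset//= in_itv.
by rewrite mul0r.
Qed.

Lemma phase_tensor p q (P Q : 'I_d -> R) : (forall i, measurable_fun setT (p i)) ->
  (forall j, measurable_fun setT (q j)) -> (forall i t, 0 <= p i t) -> (forall j t, 0 <= q j t) ->
  (forall i, \int[leb]_(t in `[0%R, 1%R[) (p i t)%:E = (P i)%:E)%E ->
  (forall j, \int[leb]_t (q j t)%:E = (Q j)%:E)%E ->
  (\int[mu]_z (tensor p q z)%:E = (\prod_i P i * \prod_j Q j)%:E)%E.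
Proof.
move=> mp mq p0 q0 pP qQ.
have mt := measurable_tensor mp mq.
have P0 i : 0 <= P i by rewrite -lee_fin -pP integral_ge0// => t _; rewrite lee_fin.
have Q0 j : 0 <= Q j by rewrite -lee_fin -qQ integral_ge0// => t _; rewrite lee_fin.
rewrite [LHS](@fubini_tonelli1 _ _ _ _ _ (@torus_vol R d) (vol d)
    (fun z => (tensor p q z)%:E)); last 2 first.
- exact/measurable_EFinP.
- by move=> z; rewrite lee_fin mulr_ge0// prodr_ge0.
rewrite /fubini_F /tensor/=.
under eq_integral => x _.
  under eq_integral do rewrite EFinM.
  rewrite ge0_integralZl//; last 3 first.
  - by apply/measurable_EFinP; exact: (measurable_prod_coord mq).
  - by move=> v _; rewrite lee_fin prodr_ge0.
  - by rewrite lee_fin prodr_ge0.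
  rewrite (vol_prod mq q0 qQ) -EFinM.
  over.
rewrite (@ge0_integral_torusE _ d (fun x => (\prod_i p i (x ord0 i)) * \prod_j Q j)); last 2 first.
- by apply: measurable_funM => //; exact: (measurable_prod_coord mp).
- by move=> x; rewrite mulr_ge0// prodr_ge0.
under eq_integral.
  move=> x _; rewrite cell_indic.
  have -> : (\prod_i p i (x ord0 i)) * (\prod_j Q j) * \prod_(i < d) \1_`[0, 1[ (x ord0 i) =
    (\prod_j Q j) * \prod_i (p i (x ord0 i) * \1_(`[0, 1[%classic : set R) (x ord0 i)).
    by rewrite big_split/=; ring.
  rewrite EFinM; over.
have mpi i : measurable_fun setT (fun t : R => p i t * \1_(`[0, 1[%classic : set R) t).
  by apply: measurable_funM => //; exact: measurable_indic.
have ppi i (t : R) : 0 <= p i t * \1_(`[0, 1[%classic : set R) t by rewrite mulr_ge0.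
rewrite ge0_integralZl//; last 3 first.
- by apply/measurable_EFinP; exact: (measurable_prod_coord mpi).
- by move=> v _; rewrite lee_fin prodr_ge0.
- by rewrite lee_fin prodr_ge0.
rewrite (vol_prod mpi ppi (I := P)) -?EFinM 1?mulrC// => i.
rewrite -pP [RHS]integral_mkcond; apply: eq_integral => t _.
by rewrite restrict_EFin /= patchE indicE; case: ifPn => _; rewrite ?mulr1 ?mulr0.
Qed.

Lemma phase_tensor_le p q (P Q : 'I_d -> R) : (forall i, measurable_fun setT (p i)) ->
  (forall j, measurable_fun setT (q j)) -> (forall i t, 0 <= p i t) -> (forall j t, 0 <= q j t) ->
  (forall i, \int[leb]_(t in `[0%R, 1%R[) (p i t)%:E <= (P i)%:E)%E ->
  (forall j, \int[leb]_t (q j t)%:E <= (Q j)%:E)%E ->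
  (\int[mu]_z (tensor p q z)%:E <= (\prod_i P i * \prod_j Q j)%:E)%E.
Proof.
move=> mp mq p0 q0 pP qQ.
have p0' i : (0 <= \int[leb]_(t in `[0%R, 1%R[) (p i t)%:E)%E.
  by apply: integral_ge0 => t _; rewrite lee_fin.
have q0' i : (0 <= \int[leb]_t (q i t)%:E)%E.
  by apply: integral_ge0 => t _; rewrite lee_fin.
have pf i : (\int[leb]_(t in `[0%R, 1%R[) (p i t)%:E)%E \is a fin_num.
  by rewrite ge0_fin_numE//; apply: le_lt_trans (pP i) (ltry _).
have qf i : (\int[leb]_t (q i t)%:E)%E \is a fin_num.
  by rewrite ge0_fin_numE//; apply: le_lt_trans (qQ i) (ltry _).
rewrite (phase_tensor (P := fun i => fine (\int[leb]_(t in `[0%R, 1%R[) (p i t)%:E)%E)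
  (Q := fun j => fine (\int[leb]_t (q j t)%:E)%E))//; last 2 first.
- by move=> i; rewrite fineK.
- by move=> j; rewrite fineK.
rewrite lee_fin ler_pM ?prodr_ge0//; try by move=> i _; rewrite fine_ge0.
- by apply: ler_prod => i _; rewrite fine_ge0//= -lee_fin fineK.
- by apply: ler_prod => i _; rewrite fine_ge0//= -lee_fin fineK.
Qed.

Lemma schur_tensor p q (P Q : 'I_d -> R) : (forall i, measurable_fun setT (p i)) ->
  (forall j, measurable_fun setT (q j)) ->
  (forall i, 0 <= P i) -> (forall j, 0 <= Q j) ->
  (forall i x, \int[leb]_(y in `[0%R, 1%R[) `|p i (x - y)|%:E <= (P i)%:E)%E ->
  (forall i x, \int[leb]_(y in `[0%R, 1%R[) `|p i (y - x)|%:E <= (P i)%:E)%E ->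
  (forall i x, \int[leb]_y `|q i (x - y)|%:E <= (Q i)%:E)%E ->
  (forall i x, \int[leb]_y `|q i (y - x)|%:E <= (Q i)%:E)%E ->
  schur mu (fun z z' : Z => tensor p q (z - z')) (\prod_i P i * \prod_j Q j).
Proof.
move=> mp mq P0 Q0 p1 p2 q1 q2; split.
- by apply: (measurableT_comp (measurable_tensor mp mq)); exact: measurable_subZ.
- by rewrite mulr_ge0// prodr_ge0.
- move=> [x v]; apply: le_trans (@phase_tensor_le (fun i t => `|p i (x ord0 i - t)|)
    (fun j t => `|q j (v ord0 j - t)|) P Q _ _ _ _ _ _) => //.
  + rewrite le_eqVlt; apply/orP; left; apply/eqP; apply: eq_integral => -[y w] _.
    rewrite /tensor normrM !normr_prod /=; congr (_ * _)%:E.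
      by apply: eq_bigr => i _; rewrite !mxE.
    by apply: eq_bigr => i _; rewrite !mxE.
  + move=> i; apply: measurableT_comp => //; apply: measurableT_comp => //.
    exact: measurable_funB.
  + move=> i; apply: measurableT_comp => //; apply: measurableT_comp => //.
    exact: measurable_funB.
- move=> [x v]; apply: le_trans (@phase_tensor_le (fun i t => `|p i (t - x ord0 i)|)
    (fun j t => `|q j (t - v ord0 j)|) P Q _ _ _ _ _ _) => //.
  + rewrite le_eqVlt; apply/orP; left; apply/eqP; apply: eq_integral => -[y w] _.
    rewrite /tensor normrM !normr_prod /=; congr (_ * _)%:E.
      by apply: eq_bigr => i _; rewrite !mxE.
    by apply: eq_bigr => i _; rewrite !mxE.
  + move=> i; apply: measurableT_comp => //; apply: measurableT_comp => //.
    exact: measurable_funB.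
  + move=> i; apply: measurableT_comp => //; apply: measurableT_comp => //.
    exact: measurable_funB.
Qed.

(** Off [U] the squared sine is at least some [s > 0], hence the kernel is at most [2 / ((n + 1) s)]
    by [fejer_local], and little mass is left outside [U]. *)
Lemma fejer_near (x : R) (U : set R) : 0 < x < 1 -> open U -> U x ->
  forall eps, 0 < eps -> exists M, forall n, (M <= n)%N ->
  ((1 - eps)%:E <= \int[leb]_(y in `[0%R, 1%R[) (fejer n (x - y) * \1_U y)%:E)%E.
Proof.
move=> /andP[x0 x1] oU Ux eps eps0.
have /nbhs_ballP[r /= r0 rU] : nbhs x U by exact: open_nbhs_nbhs.
(* Besides fitting in [U], this radius keeps [x - y] away from 1 and -1, where [sin (pi t)] vanishes
   too; hence the restriction to interior points [x]. *)
pose tau := Num.min r (Num.min x (1 - x)).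
have tau0 : 0 < tau by rewrite !lt_min r0 x0 subr_gt0 x1.
have taur : tau <= r by rewrite ge_min lexx.
have taux : tau <= x by rewrite !ge_min lexx orbT.
have tau1 : tau <= 1 - x by rewrite !ge_min lexx !orbT.
have [s s0 sP] : exists2 s, 0 < s & forall y, 0 <= y < 1 -> ~ U y ->
    s <= sin (pi * (x - y)) ^+ 2.
  have h y : 0 <= y < 1 -> ~ U y -> 0 < sin (pi * tau) ^+ 2 <= sin (pi * (x - y)) ^+ 2.
    move=> /andP[y0 y1] nU; apply: sin_sqr_ge => //.
      rewrite leNgt; apply/negP => xy; apply: nU; apply: rU.
      by rewrite /ball/=; exact: lt_le_trans taur.
    by rewrite ler_norml; apply/andP; split; lra.
  (* Positivity of the squared sine comes from a point of the cell outside [U]; if there is none the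
     claim is vacuous and [s = 1] serves. *)
  have [//|s0] := ltP 0 (sin (pi * tau) ^+ 2).
    by move=> s0; exists (sin (pi * tau) ^+ 2) => // y y01 nU; have /andP[] := h y y01 nU.
  by exists 1 => // y y01 nU; have /andP[] := h y y01 nU; rewrite ltNge s0.
have [M MP] : exists M, forall n, (M <= n)%N -> 2 / n.+1%:R / s <= eps.
  have [M _ h] := nbhs_infty_ger (2 / s / eps).
  exists M => n Mn; rewrite ler_pdivrMr// ler_pdivrMr ?ltr0n//.
  have := h M (leqnn _); rewrite ler_pdivrMr// ler_pdivrMr// => /le_trans; apply.
  have Mn' : M%:R <= n.+1%:R :> R by rewrite ler_nat (leq_trans Mn).
  have : M%:R * (eps * s) <= n.+1%:R * (eps * s) by rewrite ler_wpM2r// mulr_ge0// ltW.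
  by lra.
exists M => n Mn; set I := (\int[_]_(y in _) _)%E.
have mU : measurable U by exact: open_measurable.
have mf : measurable_fun setT (fun y : R => fejer n (x - y)).
  apply: measurableT_comp; last exact: measurable_funB.
  exact: (continuous_measurable_fun (trigpoly_continuous (fejer_trigpoly n))).
have mfU : measurable_fun setT (fun y : R => fejer n (x - y) * \1_U y).
  by apply: measurable_funM => //; exact: measurable_indic.
have I0 : (0 <= I)%E.
  by apply: integral_ge0 => y _; rewrite lee_fin mulr_ge0 ?fejer_ge0.
have : (1 <= I + eps%:E)%E.
  rewrite -(integral_fejer n x).
  have -> : eps%:E = (\int[leb]_(y in `[0%R, 1%R[) eps%:E)%E.
    rewrite integral_cst//= lebesgue_measure_itv/= lte_fin ltr01 oppr0 adde0.
    by rewrite mule1.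
  rewrite -ge0_integralD//; last 3 first.
  - by move=> y _; rewrite lee_fin mulr_ge0 ?fejer_ge0.
  - by apply/measurable_EFinP; exact: measurable_funTS.
  - by move=> y _; rewrite lee_fin ltW.
  apply: ge0_le_integral => //.
  - by move=> y _; rewrite lee_fin fejer_ge0.
  - by apply/measurable_EFinP; exact: measurable_funTS.
  - apply: emeasurable_funD => //.
    by apply/measurable_EFinP; exact: measurable_funTS.
  - move=> y /=; rewrite in_itv/= => y01; rewrite -EFinD lee_fin indicE.
    have [Uy|nUy] := pselect (U y).
      by rewrite mem_set// mulr1 lerDl ltW.
    rewrite memNset// mulr0 add0r.
    have h1 := sP y y01 nUy; have h2 := fejer_local n (x - y).
    have h3 := MP n Mn; apply: le_trans h3; rewrite ler_pdivlMr//.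
    by apply: le_trans h2; rewrite mulrC ler_wpM2r ?fejer_ge0.
rewrite EFinB leeBlDr//; move: I0; case: I => //.
Qed.

(** Chebyshev with the second moment: at distance at least [r] from [x], [gau c] is at most
    [4 / (c r^2)] times [gau (c / 2)], which has mass 1. *)
Lemma gau_near (x : R) (U : set R) : open U -> U x ->
  forall eps, 0 < eps -> exists M, forall c, 0 < c -> M <= c ->
  ((1 - eps)%:E <= \int[leb]_y (gau c (x - y) * \1_U y)%:E)%E.
Proof.
move=> oU Ux eps eps0.
have /nbhs_ballP[r /= r0 rU] : nbhs x U by exact: open_nbhs_nbhs.
exists (4 / r ^+ 2 / eps) => c c0 Mc; set I := (\int[_]_y _)%E.
have mU : measurable U by exact: open_measurable.
have mg e : 0 < e -> measurable_fun setT (fun y : R => gau e (x - y)).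
  move=> e0; apply: measurableT_comp; last exact: measurable_funB.
  exact: (continuous_measurable_fun (gauspoly_continuous (gau_gauspoly e0))).
have mfU : measurable_fun setT (fun y : R => gau c (x - y) * \1_U y).
  by apply: measurable_funM; [exact: mg|exact: measurable_indic].
have I0 : (0 <= I)%E.
  by apply: integral_ge0 => y _; rewrite lee_fin mulr_ge0 ?gau_ge0.
have c20 : 0 < c / 2 by rewrite divr_gt0.
have : (1 <= I + eps%:E)%E.
  rewrite -(integral_gau_shift x c0).
  have -> : eps%:E = (\int[leb]_y (eps * gau (c / 2) (x - y))%:E)%E.
    under eq_integral do rewrite EFinM.
    rewrite ge0_integralZl//; last 3 first.
    - by apply/measurable_EFinP; exact: (mg _ c20).
    - by move=> y _; rewrite lee_fin gau_ge0.
    - by rewrite lee_fin ltW.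
    by rewrite integral_gau_shift// mule1.
  rewrite -ge0_integralD//; last 4 first.
  - by move=> y _; rewrite lee_fin mulr_ge0 ?gau_ge0.
  - exact/measurable_EFinP.
  - by move=> y _; rewrite lee_fin mulr_ge0 ?gau_ge0// ltW.
  - by apply/measurable_EFinP; apply: measurable_funM => //; exact: (mg _ c20).
  apply: ge0_le_integral => //.
  - by move=> y _; rewrite lee_fin gau_ge0.
  - by apply/measurable_EFinP; exact: (mg _ c0).
  - apply: emeasurable_funD; first exact/measurable_EFinP.
    by apply/measurable_EFinP; apply: measurable_funM => //; exact: (mg _ c20).
  - move=> y _; rewrite -EFinD lee_fin indicE.
    have [Uy|nUy] := pselect (U y).
      by rewrite mem_set// mulr1 lerDl mulr_ge0 ?gau_ge0// ltW.
    rewrite memNset// mulr0 add0r.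
    have xy : r <= `|x - y|.
      by rewrite leNgt; apply/negP => xy; apply: nUy; apply: rU.
    have := gau_moment2 (x - y) c0.
    rewrite mulrA -expr2 normrM [`|gau c _|]ger0_norm ?gau_ge0// => h.
    have h1 : r ^+ 2 * gau c (x - y) <= 4 / c * gau (c / 2) (x - y).
      apply: le_trans h; rewrite ler_wpM2r ?gau_ge0// normrX lerXn2r ?nnegrE//.
      exact: ltW.
    have r20 : 0 < r ^+ 2 by rewrite exprn_gt0.
    move: h1; rewrite -ler_pdivlMl// => /le_trans; apply.
    rewrite mulrA ler_wpM2r ?gau_ge0// mulrC ler_pdivrMr// ler_pdivrMr//.
    by move: Mc; rewrite ler_pdivrMr// ler_pdivrMr//; lra.
by rewrite EFinB leeBlDr//; move: I0; case: I.
Qed.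

End mollifier.

Section dominated.
Context d (T : measurableType d) (R : realType).
Variable mu : {measure set T -> \bar R}.
Notation itg f := (mu.-integrable setT (EFin \o f)).

Lemma Rint_dominated (F : nat -> T -> R) (g : T -> R) :
  (forall n, measurable_fun setT (F n)) -> itg g -> (forall n z, `|F n z| <= g z) ->
  (\forall z \ae mu, (F n z @[n --> \oo] --> (0 : R))) ->
  forall eps, 0 < eps -> exists M, forall n, (M <= n)%N -> \int[mu]_z F n z <= eps.
Proof.
move=> mF ig Fg F0 eps eps0.
have F0' : \forall z \ae mu, setT z -> ((F n z)%:E @[n --> \oo] --> 0%E).
  apply: filterS F0 => z h _; apply: cvg_EFin; last exact: h.
  exact: nearW.
have [_ _ cv] := @dominated_convergence _ _ _ mu setT measurableT
  (fun n z => (F n z)%:E) (cst 0%E) (EFin \o g)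
  (fun n => (measurable_EFinP _ _).2 (mF n)) (measurable_cst _) F0' ig
  (aeW _ (fun z n _ => Fg n z)).
move: cv; rewrite integral0 => cv.
have /fine_cvgP[_ cv'] : (\int[mu]_z (F n z)%:E)%E @[n --> \oo] --> (0 : R)%:E by exact: cv.
have /cvgrPdist_le/(_ _ eps0)[M _ MP] := cv'.
exists M => n Mn; have := MP n Mn; rewrite /= sub0r normrN; apply: le_trans.
exact: ler_norm.
Qed.

Lemma N2_dominated (F : nat -> T -> R) (g : T -> R) :
  (forall n, measurable_fun setT (F n)) -> sqi mu g -> (forall n z, `|F n z| <= `|g z|) ->
  (\forall z \ae mu, (F n z @[n --> \oo] --> (0 : R))) ->
  forall eps, 0 < eps -> exists M, forall n, (M <= n)%N -> N2 mu (F n) <= eps.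
Proof.
move=> mF [_ ig] Fg F0; apply: (Rint_dominated (g := fun z => g z ^+ 2)) => //.
- by move=> n; exact: measurable_funX.
- move=> n z; rewrite normrX -[leRHS]real_normK ?num_real// ler_sqr ?nnegrE//.
- by apply: filterS F0 => z h; rewrite -[X in _ --> X](mulr0 0); exact: cvgM.
Qed.

End dominated.

(** * Strong convergence of contractive convolutions, from boxes to all of L^2 *)

Section approximate_identity.
Context {R : realType} (d : nat).
Notation Z := ('rV[R]_d * 'rV[R]_d)%type.
Notation mu := (@phase_vol R d).
Notation leb := (@lebesgue_measure R).
Notation sqi := (sqi mu).
Notation N2 := (N2 mu).
Notation ip := (ip mu).
Variable kap : nat -> Z -> R.
Hypothesis kk : forall m, kernelf (kap m).
Hypothesis kap1 : forall m, schur mu (fun z z' : Z => kap m (z - z')) 1.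
Implicit Types (f g : Z -> R).

Definition mollified f := sqi f /\ forall eps, 0 < eps -> exists M, forall m, (M <= m)%N ->
  N2 (fun z => kconv (kap m) f z - f z) <= eps.

Lemma kconv_sqi m f : sqi f -> sqi (kconv (kap m) f).
Proof. exact: iop_sqi. Qed.

Lemma kconv_N2 m f : sqi f -> N2 (kconv (kap m) f) <= N2 f.
Proof. by move=> sf; have := iop_N2 (kap1 m) sf; rewrite expr1n mul1r. Qed.

Lemma kconvZ m (a : R) f z : sqi f -> kconv (kap m) (fun z => a * f z) z = a * kconv (kap m) f z.
Proof.
move=> sf; rewrite /kconv /iop -RintegralZl//; last exact: kconv_itg.
by apply: eq_Rintegral => z' _; ring.
Qed.

Lemma mollifiedD f g : mollified f -> mollified g -> mollified (fun z => f z + g z).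
Proof.
move=> [sf cf] [sg cg]; split; first exact: sqiD.
move=> eps eps0; have e4 : 0 < eps / 4 by rewrite divr_gt0.
have [M MP] := cf _ e4; have [N NP] := cg _ e4.
exists (maxn M N) => m; rewrite geq_max => /andP[Mm Nm].
rewrite (_ : (fun z => kconv _ _ z - _) = fun z => (kconv (kap m) f z - f z) + (kconv (kap m) g z - g z)).
  have sJ h : sqi h -> sqi (fun z => kconv (kap m) h z - h z).
    by move=> sh; apply: sqiB => //; exact: kconv_sqi.
  apply: le_trans (N2D_le (sJ _ sf) (sJ _ sg)) _.
  by have := MP m Mm; have := NP m Nm; lra.
by apply/funext => z; rewrite kconvD//; ring.
Qed.

Lemma mollifiedZ a f : mollified f -> mollified (fun z => a * f z).
Proof.
move=> [sf cf]; split; first exact: sqiZ.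
move=> eps eps0; have e4 : 0 < eps / (a ^+ 2 + 1) by rewrite divr_gt0// ltr_wpDl// sqr_ge0.
have [M MP] := cf _ e4; exists M => m Mm.
rewrite (_ : (fun z => kconv _ _ z - _) = fun z => a * (kconv (kap m) f z - f z)).
  rewrite N2Z//; last by apply: sqiB => //; exact: kconv_sqi.
  have := MP m Mm; rewrite ler_pdivlMr ?ltr_wpDl ?sqr_ge0//.
  by have := N2_ge0 mu (fun z => kconv (kap m) f z - f z); lra.
by apply/funext => z; rewrite kconvZ//; ring.
Qed.

(** The convolutions are uniformly contractions, so the functions at which they converge form a
    closed set. *)
Lemma mollified_lim f : sqi f ->
  (forall eps, 0 < eps -> exists2 g, mollified g & N2 (fun z => f z - g z) <= eps) -> mollified f.
Proof.
move=> sf ap; split=> // eps eps0; have e8 : 0 < eps / 16 by rewrite divr_gt0.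
have [g [sg cg] fg] := ap _ e8; have [M MP] := cg _ e8; exists M => m Mm.
have sfg : sqi (fun z => f z - g z) by exact: sqiB.
have s1 : sqi (fun z => kconv (kap m) g z - g z) by apply: sqiB => //; exact: kconv_sqi.
have s2 : sqi (fun z => kconv (kap m) (fun z => f z - g z) z - (f z - g z)).
  by apply: sqiB => //; exact: kconv_sqi.
rewrite (_ : (fun z => kconv _ _ z - _) = fun z => (kconv (kap m) (fun z => f z - g z) z - (f z - g z)) +
   (kconv (kap m) g z - g z)).
  apply: le_trans (N2D_le s2 s1) _; have := MP m Mm.
  have := N2B_le (kconv_sqi m sfg) sfg; have := kconv_N2 m sfg.
  by move: fg; lra.
apply/funext => z; rewrite -[X in kconv _ X z](_ : (fun z => (f z - g z) + g z) = f).
  by rewrite kconvD//; ring.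
by apply/funext => y; rewrite subrK.
Qed.

(** For a contraction [T], the squared distance from [T f] to [f] is at most
    [2 (N2 f - ip (T f) f)], so one scalar product decides. *)
Lemma mollified_ip f : sqi f -> (forall eps, 0 < eps -> exists M, forall m, (M <= m)%N ->
  N2 f - ip (kconv (kap m) f) f <= eps) -> mollified f.
Proof.
move=> sf h; split=> // eps eps0; have [|M MP] := h (eps / 2); first by rewrite divr_gt0.
exists M => m Mm; rewrite N2BE//; last exact: kconv_sqi.
by have := MP m Mm; have := kconv_N2 m sf; lra.
Qed.

Lemma kconv_le1 m f z : sqi f -> (forall z, `|f z| <= 1) -> `|kconv (kap m) f z| <= 1.
Proof.
move=> sf f1; apply: le_trans (le_normr_Rintegral _ _) _ => //; first exact: kconv_itg.
have [mk _ h _] := kap1 m.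
have ik : mu.-integrable setT (EFin \o (fun z' => kap m (z - z'))).
  apply/integrableP; split; last by apply: le_lt_trans (h z) (ltry _).
  by apply/measurable_EFinP; exact: kernelf_measurable_sub.
apply: (@le_trans _ _ (\int[mu]_z' `|kap m (z - z')|)).
  apply: le_Rintegral => //.
  - exact: integrable_norm (kconv_itg z (kk m) sf).
  - exact: integrable_norm ik.
  - by move=> z' _; rewrite normrM ler_piMr.
by rewrite -lee_fin itg_EFin//; exact: integrable_norm ik.
Qed.


(* Boxes are taken open and inside the interior of the cell, so that continuity of
   translations can be tested pointwise; the boundary of the cell is a null set. *)
Definition openbox (U V : 'I_d -> set R) : set Z :=
  [set z : Z | (forall i, U i (z.1 ord0 i)) /\ (forall j, V j (z.2 ord0 j))].

Definition openboxes : set (set Z) := [set A | exists U, exists V,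
  [/\ forall i, open (U i), forall j, open (V j) & A = openbox U V]].

Definition interior_box (n : nat) : set Z :=
  openbox (fun=> `]0, 1[%classic) (fun=> `]- n%:R, n%:R[%classic).

Lemma openboxI U V U' V' : openbox U V `&` openbox U' V' =
  openbox (fun i => U i `&` U' i) (fun j => V j `&` V' j).
Proof.
apply/seteqP; split => z /= [].
  by move=> [hU hV] [hU' hV']; split => i; split.
by move=> hU hV; split; split => i; by [case: (hU i)|case: (hV i)].
Qed.

Lemma openboxesI : setI_closed openboxes.
Proof.
move=> _ _ [U [V [oU oV ->]]] [U' [V' [oU' oV' ->]]].
exists (fun i => U i `&` U' i), (fun j => V j `&` V' j).
by split; [move=> i; exact: openI|move=> i; exact: openI|exact: openboxI].
Qed.

Lemma openboxes_interior n : openboxes (interior_box n).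
Proof.
exists (fun=> `]0, 1[%classic), (fun=> `]- n%:R, n%:R[%classic).
by split=> // i; exact: interval_open.
Qed.

Lemma measurable_openbox A : openboxes A -> measurable A.
Proof.
move=> [U [V [oU oV ->]]].
have m1 i : measurable ((fun z : Z => z.1 ord0 i : measurableTypeR R) @^-1` U i).
  rewrite -[X in measurable X]setTI.
  apply: (measurableT_comp (measurable_coord i) measurable_fst) => //.
  exact: open_measurable.
have m2 i : measurable ((fun z : Z => z.2 ord0 i : measurableTypeR R) @^-1` V i).
  rewrite -[X in measurable X]setTI.
  apply: (measurableT_comp (measurable_coord i) measurable_snd) => //.
  exact: open_measurable.
rewrite (_ : openbox U V = (\bigcap_(i in [set: 'I_d]) ((fun z : Z => z.1 ord0 i) @^-1` U i)) `&`
   (\bigcap_(i in [set: 'I_d]) ((fun z : Z => z.2 ord0 i) @^-1` V i))).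
  by apply: measurableI; apply: fin_bigcap_measurable.
apply/seteqP; split => z [h1 h2].
  by split => i _; [exact: h1|exact: h2].
by split => i; [exact: (h1 i I)|exact: (h2 i I)].
Qed.

(** Measurability of the identity from the generated sigma-algebra to the product one, which can be
    tested on coordinates and open half-lines. *)
Lemma measurable_sub_openboxes (A : set Z) : measurable A -> <<s openboxes >> A.
Proof.
move=> mA; pose idG := (fun z => z) : g_sigma_algebraType openboxes -> Z.
suff mi : measurable_fun setT idG by have := mi measurableT A mA; rewrite setTI.
have op (x : R) : open `]x, +oo[%classic by exact: interval_open.
apply/measurable_fun_pairP; split; apply: measurable_fun_rVP => i.
  apply: (measurability _ (RGenOInfty.measurableE R)) => _ [_ [x ->] <-].
  apply: sub_sigma_algebra; exists (fun l => if l == i then `]x, +oo[%classic else setT), (fun=> setT).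
  split; [by move=> l; case: ifP => // _; exact: openT|by move=> l; exact: openT|].
  apply/seteqP; split => z; rewrite /openbox/=.
    by move=> [_ h]; split => // l; case: eqP => // ->.
  by move=> [h _]; split => //; have := h i; rewrite eqxx.
apply: (measurability _ (RGenOInfty.measurableE R)) => _ [_ [x ->] <-].
apply: sub_sigma_algebra; exists (fun=> setT), (fun l => if l == i then `]x, +oo[%classic else setT).
split; [by move=> l; exact: openT|by move=> l; case: ifP => // _; exact: openT|].
apply/seteqP; split => z; rewrite /openbox/=.
  by move=> [_ h]; split => // l; case: eqP => // ->.
by move=> [_ h]; split => //; have := h i; rewrite eqxx.
Qed.

(** In the cell, a coordinate outside the open interval must be 0, a Lebesgue-null condition. The
    Cauchy factors give a nonnegative test function with zero integral that is positive on the
    exceptional set. *)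
Lemma ae_interior : \forall z \ae mu, forall i, 0 < (z : Z).1 ord0 i < 1.
Proof.
apply: filter_forall => i.
pose p (l : 'I_d) : R -> R := if l == i then \1_(~` `]0, 1[%classic) else (cst 1).
have mp l : measurable_fun setT (p l).
  rewrite /p; case: ifP => // _; first apply: measurable_indic.
  by apply: measurableC; exact: measurable_itv.
have p0 l t : 0 <= p l t by rewrite /p; case: ifP.
have mt := measurable_tensor mp (fun=> measurable_cauchyw).
have t0 z : 0 <= tensor p (fun=> @cauchyw R) z.
  by rewrite mulr_ge0// prodr_ge0// => j _; exact: cauchyw_ge0.
have := @phase_tensor R d p (fun=> @cauchyw R) (fun l => (l != i)%:R) (fun=> pi) mp
  (fun=> measurable_cauchyw) p0 (fun=> cauchyw_ge0).
rewrite (bigD1 i)//= eqxx !mul0r => h.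
have : (\int[mu]_z `|(tensor p (fun=> @cauchyw R) z)%:E| = 0)%E.
  under eq_integral do rewrite gee0_abs ?lee_fin//; apply: h.
    move=> l; rewrite /p; case: eqP => _ /=.
      rewrite integral_indic//; last by apply: measurableC; exact: measurable_itv.
      rewrite (_ : _ `&` _ = [set 0]); first exact: lebesgue_measure_set1.
      apply/seteqP; split => t /=; rewrite !in_itv/=.
        move=> [/negP + /andP[t0' t1]]; rewrite t1 andbT -leNgt => t0''.
        by apply/eqP; rewrite eq_le t0'' t0'.
      by move=> ->; rewrite lexx ltr01 ltxx; split.
    by rewrite integral_cst//= lebesgue_measure_itv/= lte_fin ltr01 oppr0 adde0 mule1.
  by move=> _; exact: integral_cauchyw.
move/(ae_eq_integral_abs mu measurableT (f := fun z => (tensor p (fun=> @cauchyw R) z)%:E)).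
have mt' := (measurable_EFinP _ _).2 mt.
move=> /(_ mt'); apply: filterS => -[x v] /(_ I) [] /eqP.
rewrite /tensor /= mulf_eq0 => /orP[|]; last first.
  by rewrite prodf_seq_eq0 => /hasP[j _ /=]; rewrite gt_eqF// cauchyw_gt0.
rewrite (bigD1 i)//= mulf_eq0 => /orP[|]; last first.
  rewrite prodf_seq_eq0 => /hasP[j _ /=] /andP[/negbTE ji].
  by rewrite /p ji oner_eq0.
rewrite /p eqxx indicE; case: (boolP (_ \in _)) => [_|]; first by rewrite oner_eq0.
by rewrite notin_setE/= in_itv/= => /contrapT.
Qed.

Lemma interior_box_sqi A n : measurable A -> sqi (\1_(A `&` interior_box n)).
Proof.
move=> mA.
have mB : measurable (A `&` interior_box n).
  by apply: measurableI => //; exact: (measurable_openbox (openboxes_interior _)).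
apply: decaying_sqi; first exact: measurable_indic.
exists ((1 + n%:R ^+ 2) ^+ d); first by rewrite exprn_ge0// addr_ge0// sqr_ge0.
move=> [x v]; rewrite ger0_norm// indicE.
have c0 : 0 < (1 + n%:R ^+ 2) ^+ d :> R by rewrite exprn_gt0// ltr_pwDl// sqr_ge0.
case: (boolP (_ \in _)) => [|_]; last by rewrite mulr_ge0 ?vweight_ge0// ltW.
rewrite inE => -[_ [_ /= hv]]; rewrite -ler_pdivrMl// mulr1 -exprVn.
rewrite -[d in _ ^+ d]card_ord -prodr_const; apply: ler_prod => j _.
rewrite invr_ge0 addr_ge0 ?sqr_ge0//= /cauchyw lef_pV2 ?posrE ?ltr_pwDl ?sqr_ge0//.
rewrite lerD2l -[leLHS]real_normK ?num_real// ler_sqr ?nnegrE// ler_norml.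
by have := hv j; rewrite in_itv/= => /andP[/ltW -> /ltW ->].
Qed.

Hypothesis mollified_box : forall A n, openboxes A -> mollified (\1_(A `&` interior_box n)).

Lemma mollifiedB f g : mollified f -> mollified g -> mollified (fun z => f z - g z).
Proof.
move=> cf cg; rewrite (_ : (fun z => _) = fun z => f z + (-1) * g z).
  by apply: mollifiedD => //; exact: mollifiedZ.
by apply/funext => z; rewrite mulN1r.
Qed.

(** A pi-lambda argument from the pi-system of open boxes; the cut by [interior_box n] keeps every
    indicator square integrable, so that increasing unions converge by domination. *)
Lemma mollified_indic A n : measurable A -> mollified (\1_(A `&` interior_box n)).
Proof.
move=> /measurable_sub_openboxes.
pose L := [set A | measurable A /\ mollified (\1_(A `&` interior_box n))].
suff : <<s openboxes >> `<=` L by move=> /[apply] -[].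
apply: lambda_system_subset => //; first exact: openboxesI.
- split=> //.
  + split=> //; apply: mollified_box; exists (fun=> setT), (fun=> setT).
    by split => //; [move=> _; exact: openT|move=> _; exact: openT|rewrite /openbox; apply/seteqP; split].
  + move=> {}A B BA [mA cA] [mB cB]; split; first exact: measurableD.
    rewrite (_ : \1_ _ = fun z => \1_(A `&` interior_box n) z - \1_(B `&` interior_box n) z).
      exact: mollifiedB.
    apply/funext => z; rewrite setDE; move: (interior_box n) => Q.
    rewrite !indicI /= !indicE in_setC; case: (boolP (z \in B)) => [|_] /=.
      by move=> /set_mem/BA/mem_set ->; rewrite mulr0 mul0r subrr.
    by rewrite mulr1 mul0r subr0.
  + move=> F ndF cF; have mF i : measurable (F i) by case: (cF i).
    have mU : measurable (\bigcup_i F i) by exact: bigcupT_measurable.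
    split=> //; have sU := interior_box_sqi n mU.
    apply: mollified_lim => // eps eps0.
    have [|||M MP] := @N2_dominated _ _ _ mu
      (fun k z => \1_((\bigcup_i F i) `&` interior_box n) z - \1_(F k `&` interior_box n) z) _ _ sU _ _ eps eps0.
    * move=> k; apply: measurable_funB; apply: measurable_indic; apply: measurableI => //;
      exact: (measurable_openbox (openboxes_interior _)).
    * move=> k z; rewrite !indicI /= !indicE.
      move: (interior_box n) => Q; rewrite -mulrBl !normrM ler_wpM2r//.
      case: (pselect (F k z)) => Fz.
        by rewrite (mem_set Fz) mem_set ?subrr ?normr0//; exists k.
      by rewrite (memNset Fz) subr0.
    * apply: aeW => z; apply/cvgrPdist_lt => e e0.
      case: (pselect ((\bigcup_i F i) z)) => [Uz|nU].
        have [k _ Fk] := Uz; exists k => // m /= km.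
        have Fm : F m z by have /subsetPset := ndF _ _ km; exact.
        move: (interior_box n) => Q.
        by rewrite !indicI /= !indicE (mem_set Uz) (mem_set Fm) subrr subr0 normr0.
      exists 0%N => // m _; have nF : ~ F m z by move=> Fm; apply: nU; exists m.
      move: (interior_box n) => Q.
      by rewrite !indicI /= !indicE (memNset nU) (memNset nF) mul0r subrr subr0 normr0.
    by exists (\1_(F M `&` interior_box n)); [case: (cF M)|exact: MP].
- by move=> {}A GA; split; [exact: measurable_openbox|exact: mollified_box].
Qed.

Lemma mollified_sum (I : Type) (s : seq I) (F : I -> Z -> R) :
  (forall i, mollified (F i)) -> mollified (fun z => \sum_(i <- s) F i z).
Proof.
move=> cF; elim: s => [|i s IH].
  rewrite (_ : (fun z => _) = fun z => 0 * \1_(setT `&` interior_box 0) z).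
    by apply: mollifiedZ; exact: mollified_indic.
  by apply/funext => z; rewrite big_nil mul0r.
rewrite (_ : (fun z => _) = fun z => F i z + \sum_(i <- s) F i z).
  exact: mollifiedD.
by apply/funext => z; rewrite big_cons.
Qed.

Lemma interior_box_near : \forall z \ae mu, \forall n \near \oo, interior_box n z.
Proof.
apply: filterS ae_interior => z z01.
have : \forall n \near \oo, forall j : 'I_d, `|z.2 ord0 j| < n%:R.
  by apply: filter_forall => j; exact: nbhs_infty_gtr.
apply: filterS => n hn; split => /= j; first by rewrite in_itv/=.
by rewrite in_itv/= -ltr_norml.
Qed.

Import HBNNSimple.

(** Simple functions below [f], cut off by growing boxes, converge to [f] in L^2 with [f] as
    dominating function. *)
Lemma mollified_ge0 f : sqi f -> (forall z, 0 <= f z) -> mollified f.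
Proof.
move=> sf f0; apply: mollified_lim => // eps eps0.
have mf : measurable_fun setT (EFin \o f) by apply/measurable_EFinP; case: sf.
pose g n := nnsfun_approx measurableT mf n.
have f0' z : setT z -> (0 <= (EFin \o f) z)%E by move=> _; rewrite lee_fin.
have gf n z : g n z <= f z.
  by rewrite -lee_fin /g nnsfun_approxE; exact: (le_approx n f0').
have g0 n z : 0 <= g n z by [].
have mQ n : measurable (interior_box n) by exact: (measurable_openbox (openboxes_interior _)).
have [|||M MP] := @N2_dominated _ _ _ mu (fun n z => f z - g n z * \1_(interior_box n) z) f _ sf _ _ eps eps0.
- move=> n; apply: measurable_funB; first by case: sf.
  by apply: measurable_funM; [exact: measurable_funP|exact: measurable_indic].
- move=> n z; rewrite ger0_norm ?(ger0_norm (f0 z)) ?subr_ge0; last first.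
    by rewrite (le_trans _ (gf n z))// ler_piMr// indicE; case: (_ \in _).
  by rewrite lerBlDr lerDl mulr_ge0// g0.
- apply: filterS interior_box_near => z hz.
  have cg : g n z @[n --> \oo] --> f z.
    have := cvg_approx (D := setT) (f := EFin \o f) (x := z) f0' I (ltry _).
    by under eq_fun do rewrite -(nnsfun_approxE measurableT mf).
  have : f z - g n z @[n --> \oo] --> (0 : R).
    by rewrite -[X in _ --> X](subrr (f z)); apply: cvgB => //; exact: cvg_cst.
  apply: cvg_trans; apply: near_eq_cvg; apply: filterS hz => n hn.
  by rewrite indicE mem_set// mulr1.
exists (fun z => g M z * \1_(interior_box M) z); last exact: MP.
pose s := finmap.enum_fset (fset_set (range (g M))).
rewrite (_ : (fun z => _) = fun z => \sum_(i <- index_enum 'I_(size s)) (s`_i * \1_((g M @^-1` [set s`_i]) `&` interior_box M) z)).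
  apply: mollified_sum => i; apply: mollifiedZ; apply: mollified_indic.
  rewrite -[X in measurable X]setTI; apply: measurable_funP => //.
apply/funext => z; rewrite {1}(fimfunEord (g M)) mulr_suml.
by apply: eq_bigr => i _; rewrite indicI mulrA.
Qed.

Lemma mollified_sqi f : sqi f -> mollified f.
Proof.
move=> sf; have [mf _] := sf.
have sabs : sqi (fun z => `|f z|).
  by apply: (sqi_le _ sf) => [|z]; [exact: measurableT_comp|rewrite normr_id].
rewrite (_ : f = fun z => (f z + `|f z|) - `|f z|); last by apply/funext => z; rewrite addrK.
apply: mollifiedB; apply: mollified_ge0 => //; first exact: sqiD.
by move=> z; have := ler_norm (- f z); rewrite normrN; lra.
Qed.

End approximate_identity.

(** * The kernel with Fejer factors in space and Gaussian factors in velocity *)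

Section fejer_gauss.
Context {R : realType} (d : nat).
Notation Z := ('rV[R]_d * 'rV[R]_d)%type.
Notation mu := (@phase_vol R d).
Notation leb := (@lebesgue_measure R).
Notation sqi := (sqi mu).
Notation N2 := (N2 mu).
Notation ip := (ip mu).

Definition fgker (m : nat) (c : R) : Z -> R := tensor (fun=> fejer m) (fun=> gau c).

Lemma fgker_kernelf m c : 0 < c -> kernelf (fgker m c).
Proof.
move=> c0; exists (fun=> fejer m), (fun=> gau c).
by split=> // _; [exact: fejer_trigpoly|exact: gau_gauspoly].
Qed.

Lemma fgkerN m c z : 0 < c -> fgker m c (- z) = fgker m c z.
Proof.
move=> c0; rewrite /fgker /tensor; congr (_ * _); apply: eq_bigr => i _; rewrite !mxE.
  exact: fejerN.
exact: gauN.
Qed.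

Lemma measurable_fejer m : measurable_fun setT (@fejer R m).
Proof. exact: (continuous_measurable_fun (trigpoly_continuous (fejer_trigpoly m))). Qed.

Lemma measurable_gau (c : R) : 0 < c -> measurable_fun setT (gau c).
Proof.
by move=> c0; exact: (continuous_measurable_fun (gauspoly_continuous (gau_gauspoly c0))).
Qed.

Lemma integral_abs_fejer m (x : R) :
  (\int[leb]_(y in `[0%R, 1%R[) `|fejer m (x - y)|%:E = 1)%E.
Proof.
rewrite -(integral_fejer m x); apply: eq_integral => y _.
by rewrite ger0_norm ?fejer_ge0.
Qed.

Lemma integral_abs_gau (c x : R) : 0 < c -> (\int[leb]_y `|gau c (x - y)|%:E = 1)%E.
Proof.
move=> c0; rewrite -(integral_gau_shift x c0); apply: eq_integral => y _.
by rewrite ger0_norm ?gau_ge0.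
Qed.

(** Serves both velocity moments: the replaced factor is dominated by [a] times a density, and all
    other factors have mass 1. *)
Lemma schur_fgker_upd m c (j : 'I_d) (r : R -> R) (a : R) : 0 < c -> 0 <= a ->
  measurable_fun setT r -> (forall t, `|r t| <= a * gau (c / 2) t) ->
  schur mu (fun z z' : Z => tensor (fun=> fejer m) (upd (fun=> gau c) j r) (z - z')) a.
Proof.
move=> c0 a0 mr ra; have c20 : 0 < c / 2 by rewrite divr_gt0.
have ir (h : R -> R) (x : R) : measurable_fun setT h -> (forall y, (h y = x - y) \/ (h y = y - x)) ->
  (\int[leb]_y `|r (h y)|%:E <= a%:E)%E.
  move=> mh hE.
  apply: (@le_trans _ _ (\int[leb]_y (a%:E * `|gau (c / 2) (x - y)|%:E))%E).
    apply: ge0_le_integral => //.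
    - by apply/measurable_EFinP; apply: measurableT_comp => //; exact: measurableT_comp.
    - apply/measurable_EFinP; apply: measurable_funM => //; apply: measurableT_comp => //.
      apply: (measurableT_comp (measurable_gau c20)); exact: measurable_funB.
    - move=> y _; rewrite -EFinM lee_fin [`|gau _ _|]ger0_norm ?gau_ge0//.
      by have [->|->] := hE y; rewrite // -gauN// opprB.
  rewrite ge0_integralZl//; last first.
  - apply/measurable_EFinP; apply: measurableT_comp => //.
    apply: (measurableT_comp (measurable_gau c20)); exact: measurable_funB.
  - by rewrite integral_abs_gau// mule1.
have mh1 (x : R) : measurable_fun setT (fun y : R => x - y) by exact: measurable_funB.
have mh2 (x : R) : measurable_fun setT (fun y : R => y - x) by exact: measurable_funB.
have -> : a = \prod_(i < d) 1 * \prod_(l < d) (if l == j then a else 1).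
  rewrite big1// mul1r (bigD1 j)//= eqxx big1 ?mulr1// => l /negbTE ->//.
apply: (schur_tensor (P := fun=> 1) (Q := fun l => if l == j then a else 1)) => //.
- by move=> _; exact: measurable_fejer.
- by move=> l; rewrite /upd; case: ifP => // _; exact: measurable_gau.
- by move=> l; case: ifP.
- by move=> _ x; rewrite integral_abs_fejer.
- move=> _ x; under eq_integral do rewrite -fejerN opprB; by rewrite integral_abs_fejer.
- move=> l x; rewrite /upd; case: ifP => _; last by rewrite integral_abs_gau.
  by apply: (ir _ x) => // y; left.
- move=> l x; rewrite /upd; case: ifP => _.
    by apply: (ir _ x) => // y; right.
  by under eq_integral do rewrite -gauN// opprB; rewrite integral_abs_gau.
Qed.

Lemma schur_fgker m c : 0 < c -> schur mu (fun z z' : Z => fgker m c (z - z')) 1.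
Proof.
move=> c0; have -> : (1 : R) = \prod_(i < d) 1 * \prod_(j < d) 1 by rewrite !big1 ?mul1r.
apply: schur_tensor => //.
- by move=> _; exact: measurable_fejer.
- by move=> _; exact: measurable_gau.
- by move=> _ x; rewrite integral_abs_fejer.
- by move=> _ x; under eq_integral do rewrite -fejerN opprB; rewrite integral_abs_fejer.
- by move=> _ x; rewrite integral_abs_gau.
- by move=> _ x; under eq_integral do rewrite -gauN// opprB; rewrite integral_abs_gau.
Qed.

Lemma fgker_moment1 m c j (z : Z) : z.2 ord0 j * fgker m c z =
  tensor (fun=> fejer m) (upd (fun=> gau c) j (fun t => t * gau c t)) z.
Proof.
rewrite /fgker /tensor.
rewrite (@prod_upd _ _ (fun=> gau c) j (fun t => t * gau c t) (fun l => z.2 ord0 l)).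
by rewrite [\prod_j0 gau _ _](bigD1 j)//=; ring.
Qed.

Lemma fgker_moment2 m c j (z : Z) : z.2 ord0 j * (z.2 ord0 j * fgker m c z) =
  tensor (fun=> fejer m) (upd (fun=> gau c) j (fun t => t * (t * gau c t))) z.
Proof.
rewrite /fgker /tensor.
rewrite (@prod_upd _ _ (fun=> gau c) j (fun t => t * (t * gau c t)) (fun l => z.2 ord0 l)).
by rewrite [\prod_j0 gau _ _](bigD1 j)//=; ring.
Qed.

(** Meant for space derivatives: the replaced factor is integrated over an interval of length 1, so
    its supremum is a Schur bound. *)
Lemma schur_fgker_dx m c (p' : R -> R) (C : R) (i : 'I_d) : 0 < c -> 0 <= C ->
  measurable_fun setT p' -> (forall t, `|p' t| <= C) ->
  schur mu (fun z z' : Z => tensor (upd (fun=> fejer m) i p') (fun=> gau c) (z - z')) C.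
Proof.
move=> c0 C0 mp pC.
have ir (h : R -> R) : measurable_fun setT h ->
  (\int[leb]_(y in `[0%R, 1%R[) `|p' (h y)|%:E <= C%:E)%E.
  move=> mh; apply: (@le_trans _ _ (\int[leb]_(y in `[0%R, 1%R[) C%:E)%E).
    apply: ge0_le_integral => //.
    - apply/measurable_EFinP; apply: measurable_funTS; apply: measurableT_comp => //.
      exact: measurableT_comp.
    - by move=> y _; rewrite lee_fin.
  by rewrite integral_cst//= lebesgue_measure_itv/= lte_fin ltr01 oppr0 adde0 mule1.
have -> : C = \prod_(l < d) (if l == i then C else 1) * \prod_(l < d) 1.
  by rewrite [X in _ * X]big1// mulr1 (bigD1 i)//= eqxx big1 ?mulr1// => l /negbTE ->.
apply: (schur_tensor (P := fun l => if l == i then C else 1) (Q := fun=> 1)) => //.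
- by move=> l; rewrite /upd; case: ifP => // _; exact: measurable_fejer.
- by move=> _; exact: measurable_gau.
- by move=> l; case: ifP.
- move=> l x; rewrite /upd; case: ifP => _; last by rewrite integral_abs_fejer.
  by apply: ir; exact: measurable_funB.
- move=> l x; rewrite /upd; case: ifP => _.
    by apply: ir; exact: measurable_funB.
  by under eq_integral do rewrite -fejerN opprB; rewrite integral_abs_fejer.
- by move=> _ x; rewrite integral_abs_gau.
- by move=> _ x; under eq_integral do rewrite -gauN// opprB; rewrite integral_abs_gau.
Qed.

Lemma bernoulli_le (e : R) n : 0 <= e <= 1 -> 1 - n%:R * e <= (1 - e) ^+ n.
Proof.
move=> /andP[e0 e1]; elim: n => [|n IH]; first by rewrite mul0r subr0.
rewrite exprS; apply: (@le_trans _ _ ((1 - e) * (1 - n%:R * e))).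
  rewrite -natr1; have : 0 <= n%:R * e * e by rewrite !mulr_ge0.
  by lra.
by rewrite ler_wpM2l// subr_ge0.
Qed.

Lemma openbox_indic (U V : 'I_d -> set R) (z : Z) :
  \1_(openbox U V) z = tensor (fun i => \1_(U i)) (fun j => \1_(V j)) z :> R.
Proof.
rewrite /tensor indicE; case: (pselect (openbox U V z)) => h.
  rewrite mem_set//; case: h => hU hV.
  by rewrite !big1 ?mulr1// => i _; rewrite indicE mem_set.
rewrite memNset//; have [/existsNP[i hi]|hU] := pselect (~ forall i, U i (z.1 ord0 i)).
  by rewrite (bigD1 i)//= indicE memNset// !mul0r.
have /existsNP[j hj] : ~ forall j, V j (z.2 ord0 j).
  by move=> hV; apply: h; split=> //; apply: contrapT.
by rewrite mulrC (bigD1 j)//= indicE memNset// !mul0r.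
Qed.

Variable c : nat -> R.
Hypothesis c_gt0 : forall m, 0 < c m.
Hypothesis c_infty : forall A, exists M, forall m, (M <= m)%N -> A <= c m.

(** The convolution of a box indicator factors into [2 d] one-dimensional masses; each is at least
    [1 - e], and Bernoulli's inequality bounds the product. *)
Lemma fgker_box_near (U V : 'I_d -> set R) (z : Z) :
  (forall i, open (U i)) -> (forall j, open (V j)) -> openbox U V z ->
  (forall i, 0 < z.1 ord0 i < 1) -> forall eps, 0 < eps -> exists M, forall m, (M <= m)%N ->
  1 - eps <= kconv (fgker m (c m)) (\1_(openbox U V)) z.
Proof.
move=> oU oV [Uz Vz] z01 eps eps0.
(* The successor keeps the denominator positive, and the minimum with 1 meets the hypothesis of
   Bernoulli's inequality. *)
pose e := Num.min 1 (eps / (d + d).+1%:R).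
have e0 : 0 < e by rewrite lt_min ltr01 divr_gt0.
have e1 : e <= 1 by rewrite ge_min lexx.
have ee : (d + d)%:R * e <= eps.
  apply: (@le_trans _ _ ((d + d).+1%:R * (eps / (d + d).+1%:R))).
    by apply: ler_pM => //; [exact: ltW|rewrite ler_nat|rewrite ge_min lexx orbT].
  by rewrite mulrC divfK.
have [M1 M1P] := choice (fun i => fejer_near (z01 i) (oU i) (Uz i) e0).
have [A AP] := choice (fun j => gau_near (oV j) (Vz j) e0).
have [M2 M2P] := choice (fun j => c_infty (A j)).
exists (maxn (\max_i M1 i) (\max_j M2 j)) => m; rewrite geq_max => /andP[m1 m2].
pose p i (t : R) := fejer m (z.1 ord0 i - t) * \1_(U i) t.
pose q j (t : R) := gau (c m) (z.2 ord0 j - t) * \1_(V j) t.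
have mU i : measurable (U i) by exact: open_measurable.
have mV i : measurable (V i) by exact: open_measurable.
have mp i : measurable_fun setT (p i).
  apply: measurable_funM; last exact: measurable_indic.
  by apply: (measurableT_comp (measurable_fejer m)); exact: measurable_funB.
have mq j : measurable_fun setT (q j).
  apply: measurable_funM; last exact: measurable_indic.
  by apply: (measurableT_comp (measurable_gau (c_gt0 m))); exact: measurable_funB.
have p0 i t : 0 <= p i t by rewrite mulr_ge0// fejer_ge0.
have q0 j t : 0 <= q j t by rewrite mulr_ge0// gau_ge0.
have i1 (B : set R) (t : R) : \1_B t <= 1 :> R by rewrite indicE; case: (_ \in _).
have p1 i : (\int[leb]_(t in `[0%R, 1%R[) (p i t)%:E <= 1)%E.
  rewrite -(integral_fejer m (z.1 ord0 i)); apply: ge0_le_integral => //.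
  - by move=> t _; rewrite lee_fin.
  - by apply/measurable_EFinP; apply: measurable_funTS; exact: mp.
  - apply/measurable_EFinP; apply: measurable_funTS.
    by apply: (measurableT_comp (measurable_fejer m)); exact: measurable_funB.
  - by move=> t _; rewrite lee_fin /p ler_piMr// fejer_ge0.
have q1 j : (\int[leb]_t (q j t)%:E <= 1)%E.
  rewrite -(integral_gau_shift (z.2 ord0 j) (c_gt0 m)); apply: ge0_le_integral => //.
  - by move=> t _; rewrite lee_fin.
  - by apply/measurable_EFinP; exact: mq.
  - apply/measurable_EFinP.
    by apply: (measurableT_comp (measurable_gau (c_gt0 m))); exact: measurable_funB.
  - by move=> t _; rewrite lee_fin /q ler_piMr// gau_ge0.
pose P i := fine (\int[leb]_(t in `[0%R, 1%R[) (p i t)%:E)%E.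
pose Q j := fine (\int[leb]_t (q j t)%:E)%E.
have PE i : (\int[leb]_(t in `[0%R, 1%R[) (p i t)%:E = (P i)%:E)%E.
  rewrite fineK// ge0_fin_numE; first exact: le_lt_trans (p1 i) (ltry _).
  by apply: integral_ge0 => t _; rewrite lee_fin.
have QE j : (\int[leb]_t (q j t)%:E = (Q j)%:E)%E.
  rewrite fineK// ge0_fin_numE; first exact: le_lt_trans (q1 j) (ltry _).
  by apply: integral_ge0 => t _; rewrite lee_fin.
have Pe i : 1 - e <= P i.
  by rewrite -lee_fin -PE; apply: M1P; exact: leq_trans (leq_bigmax i) m1.
have Qe j : 1 - e <= Q j.
  rewrite -lee_fin -QE; apply: AP => //; apply: M2P.
  exact: leq_trans (leq_bigmax j) m2.
rewrite /kconv /iop /Rintegral.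
have -> : (\int[mu]_z' (fgker m (c m) (z - z') * \1_(openbox U V) z')%:E =
    \int[mu]_z' (tensor p q z')%:E)%E.
  apply: eq_integral => z' _; rewrite openbox_indic /fgker /tensor /p /q; congr EFin.
  rewrite [LHS]mulrACA; congr (_ * _); rewrite -big_split/=; apply: eq_bigr => i _.
    by rewrite !mxE.
  by rewrite !mxE.
rewrite (phase_tensor mp mq p0 q0 PE QE) /=.
apply: (@le_trans _ _ ((1 - e) ^+ (d + d))).
  apply: le_trans (bernoulli_le _ _); last by rewrite (ltW e0).
  by rewrite lerD2l lerN2.
have e10 : 0 <= 1 - e by rewrite subr_ge0.
have -> : (1 - e) ^+ (d + d) = \prod_(i < d) (1 - e) * \prod_(j < d) (1 - e).
  by rewrite !prodr_const card_ord exprD.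
by rewrite ler_pM ?prodr_ge0//; apply: ler_prod => i _; rewrite e10/=.
Qed.

(** By [mollified_ip] it is enough that the integral over [B] of one minus the mollified indicator
    tends to 0. Pointwise convergence holds off the null boundary of the cell, and twice the
    indicator dominates. *)
Lemma fgker_mollified_box A n : openboxes A ->
  mollified (fun m => fgker m (c m)) (\1_(A `&` interior_box n)).
Proof.
move=> GA; pose kap m := fgker m (c m).
have kk m : kernelf (kap m) by exact: fgker_kernelf.
have k1 m : schur mu (fun z z' : Z => kap m (z - z')) 1 by exact: schur_fgker.
have mA : measurable A by exact: measurable_openbox.
have sA : sqi (\1_(A `&` interior_box n)) by exact: interior_box_sqi.
apply: (mollified_ip k1 sA) => eps eps0.
set B := A `&` interior_box n in sA *.
have B1 z : `|\1_B z| <= 1 :> R.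
  by rewrite indicE; case: (_ \in _); rewrite ?normr1// normr0.
have iB : mu.-integrable setT (EFin \o \1_B).
  have [mB] := sA; rewrite (_ : (fun z => _) = \1_B)//; apply/funext => z.
  by rewrite indicE; case: (_ \in _); rewrite ?expr1n// expr0n.
have sk m := kconv_sqi k1 m sA.
have [|||M MP] := @Rint_dominated _ _ _ mu
    (fun m z => \1_B z * (1 - kconv (kap m) \1_B z)) (fun z => 2 * \1_B z) _ (itgZ 2 iB) _ _ eps eps0.
- move=> m; apply: measurable_funM; first by case: sA.
  by apply: measurable_funB => //; case: (sk m).
- move=> m z; rewrite normrM mulrC [X in _ * X]ger0_norm// ler_wpM2r//.
  apply: le_trans (ler_normB _ _) _; rewrite normr1.
  by have := @kconv_le1 _ _ _ kk k1 m _ z sA B1; lra.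
- apply: filterS (@ae_interior R d) => z z01.
  have [Bz|nBz] := pselect (B z); last first.
    apply: cvg_near_cst; apply: nearW => m.
    by rewrite indicE memNset// mul0r.
  apply/cvgrPdist_le => e e0.
  have [U [V [oU oV BE]]] : openboxes B by apply: openboxesI => //; exact: openboxes_interior.
  have Bz' := Bz; rewrite BE in Bz'.
  have [M MP] := fgker_box_near oU oV Bz' z01 e0.
  exists M => // m Mm; rewrite sub0r normrN indicE mem_set// mul1r.
  have := @kconv_le1 _ _ _ kk k1 m _ z sA B1.
  have := MP m Mm; rewrite -BE -/(kap m) => h1 h2.
  have h3 : kconv (kap m) \1_B z <= 1 by apply: le_trans h2; exact: ler_norm.
  by rewrite ger0_norm ?subr_ge0//; lra.
exists M => m Mm; apply: le_trans (MP m Mm).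
rewrite /N2 /ip -RintegralB//; last 2 first.
- by case: sA.
- exact: sqi_mul.
rewrite le_eqVlt; apply/orP; left; apply/eqP; apply: eq_Rintegral => z _.
by rewrite indicE; case: (_ \in _); rewrite /=; ring.
Qed.

End fejer_gauss.

Section mollifier_package.
Context {R : realType} (d : nat).
Notation Z := ('rV[R]_d * 'rV[R]_d)%type.
Notation mu := (@phase_vol R d).

(* The velocity scale is chosen so small that the first velocity moment [a m] beats
   the size [C m] of the space derivatives of the kernel. *)
Lemma mollifier : exists (kap : nat -> Z -> R) (a C : nat -> R),
  [/\ forall m, kernelf (kap m), forall m z, kap m (- z) = kap m z,
      forall m, schur mu (fun z z' : Z => kap m (z - z')) 1 &
      forall f, sqi mu f -> mollified kap f] /\
  [/\ forall m, [/\ 0 <= a m, 0 <= C m, a m <= m.+1%:R^-1 & a m * C m <= m.+1%:R^-1],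
      forall m j, schur mu (fun z z' : Z => (z - z').2 ord0 j * kap m (z - z')) (a m),
      forall m j, schur mu (fun z z' : Z =>
        (z - z').2 ord0 j * ((z - z').2 ord0 j * kap m (z - z'))) (a m) &
      forall m i, exists2 k', kernelf k' & weighted_partial (kap m) k' (ex i) /\
        schur mu (fun z z' : Z => k' (z - z')) (C m)].
Proof.
have /choice[P PP] : forall m, exists P : (R -> R) * R,
    [/\ trigpoly P.1, deriv1 (fejer m) P.1, 0 <= P.2 & forall t, `|P.1 t| <= P.2].
  move=> m; have [p' tp dp] := trigpoly_derive (@fejer_trigpoly R m).
  by have [C C0 h] := trigpoly_bounded tp; exists (p', C).
pose C m := (P m).2; have C0 m : 0 <= C m by case: (PP m).
(* With [a = 1 / D], both [a] and [a C] are at most [1 / (m + 1)]. The rate [c = (2 D)^2] turns the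
   two Gaussian moment bounds into [2 / sqrt c = a] and [4 / c = a^2 <= a]. *)
pose D m := m.+1%:R * (C m + 1); have D0 m : 0 < D m by rewrite mulr_gt0// ltr_wpDl.
pose a m := (D m)^-1; pose c m := (2 * D m) ^+ 2.
have c0 m : 0 < c m by rewrite exprn_gt0// mulr_gt0.
have m1D m : m.+1%:R <= D m by rewrite ler_peMr// lerDr.
have a1 m : a m <= m.+1%:R^-1 by rewrite lef_pV2 ?posrE.
have sc m : Num.sqrt (c m) = 2 * D m by rewrite sqrtr_sqr ger0_norm// mulr_ge0// ltW.
exists (fun m => fgker m (c m)), a, C; split; split.
- by move=> m; exact: fgker_kernelf.
- by move=> m z; exact: fgkerN.
- by move=> m; exact: schur_fgker.
- move=> f sf; apply: mollified_sqi => //.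
  + by move=> m; exact: fgker_kernelf.
  + by move=> m; exact: schur_fgker.
  + move=> A n GA; apply: fgker_mollified_box => // B.
    have [M _ h] := nbhs_infty_ger B; exists M => m Mm.
    have := h m Mm; move=> /le_trans; apply; have := m1D m; rewrite -natr1 /c => Dm.
    have : 0 <= m%:R :> R by [].
    by move=> m0; nra.
- move=> m; split => //; first by rewrite invr_ge0 ltW.
  rewrite /a /D invfM -mulrA ler_piMr ?invr_ge0// mulrC ler_pdivrMr ?mul1r ?ltr_wpDl//.
  by rewrite lerDl.
- move=> m j; have h := @gau_moment1 R (c m) _ (c0 m).
  under eq_fun do under eq_fun do rewrite fgker_moment1.
  apply: schur_fgker_upd => //; first by rewrite invr_ge0 ltW.
    exact: (continuous_measurable_fun (gauspoly_continuous (gauspoly_mulX (gau_gauspoly (c0 m))))).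
  move=> t; have := h t; rewrite sc (_ : 2 / (2 * D m) = a m)//.
  by rewrite /a; field; rewrite gt_eqF.
- move=> m j; have h := @gau_moment2 R (c m) _ (c0 m).
  under eq_fun do under eq_fun do rewrite fgker_moment2.
  apply: schur_fgker_upd => //; first by rewrite invr_ge0 ltW.
    exact: (continuous_measurable_fun (gauspoly_continuous
      (gauspoly_mulX (gauspoly_mulX (gau_gauspoly (c0 m)))))).
  move=> t; apply: le_trans (h t) _; rewrite ler_wpM2r ?gau_ge0//.
  have -> : 4 / c m = a m * a m by rewrite /a /c; field; rewrite gt_eqF.
  rewrite ler_piMr ?invr_ge0 ?(ltW (D0 m))//; apply: le_trans (a1 m) _.
  by rewrite invf_le1// ler1n.
- move=> m i; have [tp dp _ h] := PP m.
  exists (tensor (upd (fun=> fejer m) i (P m).1) (fun=> gau (c m))).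
    exists (upd (fun=> fejer m) i (P m).1), (fun=> gau (c m)); split => //.
      by apply: trigpoly_upd => // _; exact: fejer_trigpoly.
    by move=> _; exact: gau_gauspoly.
  split.
    apply: tensor_partial_x => //; first by move=> _; exact: fejer_trigpoly.
    by move=> _; exact: gau_gauspoly.
  apply: schur_fgker_dx => //.
  exact: (continuous_measurable_fun (trigpoly_continuous tp)).
Qed.

End mollifier_package.

(** * The energy estimate *)

Section equal_integrals.
Context d (T : measurableType d) (R : realType).
Variable mu : {measure set T -> \bar R}.
Notation itg f := (mu.-integrable setT (EFin \o f)).
Implicit Types p q : T -> R.

(** Integrability travels with the equality of integrals, so that long sums can be transformed term
    by term. *)
Definition eqint p q := [/\ itg p, itg q & \int[mu]_z p z = \int[mu]_z q z].

Lemma eqintD p q p' q' : eqint p q -> eqint p' q' ->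
  eqint (fun z => p z + p' z) (fun z => q z + q' z).
Proof.
move=> [ip iq e] [ip' iq' e']; split; [exact: itgD|exact: itgD|].
by rewrite !RintegralD// e e'.
Qed.

Lemma eqintZ a p q : eqint p q -> eqint (fun z => a * p z) (fun z => a * q z).
Proof.
move=> [ip iq e]; split; [exact: itgZ|exact: itgZ|].
by rewrite !RintegralZl// e.
Qed.

Lemma eqintB p q p' q' : eqint p q -> eqint p' q' ->
  eqint (fun z => p z - p' z) (fun z => q z - q' z).
Proof.
move=> [ip iq e] [ip' iq' e']; split; [exact: itgB|exact: itgB|].
by rewrite !RintegralB// e e'.
Qed.

Lemma eqint_sum (I : Type) (s : seq I) (p q : I -> T -> R) :
  (forall i, eqint (p i) (q i)) ->
  eqint (fun z => \sum_(i <- s) p i z) (fun z => \sum_(i <- s) q i z).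
Proof.
move=> h; have hp i : itg (p i) by case: (h i).
have hq i : itg (q i) by case: (h i).
split; [exact: itg_sum|exact: itg_sum|].
by rewrite !Rint_sum//; apply: eq_bigr => i _; case: (h i).
Qed.

End equal_integrals.

(** * Regular test functions and the transposition of velocity factors *)

Section regular_functions.
Context {R : realType} (d : nat).
Notation Z := ('rV[R]_d * 'rV[R]_d)%type.
Notation mu := (@phase_vol R d).
Notation itg f := (mu.-integrable setT (EFin \o f)).
Notation sqi := (sqi mu).
Notation N2 := (N2 mu).
Notation ip := (ip mu).
Notation eqint := (eqint mu).
Implicit Types (k f g G : Z -> R).

Lemma pderiv_eq (F F' F'' : Z -> R) e : pderiv F F' e -> F' =1 F'' -> pderiv F F'' e.
Proof. by move=> dF FF z; rewrite -FF. Qed.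

(** The class in which integrations by parts are made. All powers of the weight are required because
    each multiplication by [v_j] costs one. *)
Definition regular G :=
  [/\ continuous G, rapid G & forall v, torus_periodic (fun x => G (x, v))].

Lemma rapid_decaying G : rapid G -> decaying G.
Proof. by move=> /(_ 1%N)[C C0 h]; exists C => // z; rewrite -(expr1 (vweight _)). Qed.

Lemma regular_sqi G : regular G -> sqi G.
Proof.
move=> [cG rG _]; apply: decaying_sqi; first exact: continuous_measurable_phase.
exact: rapid_decaying.
Qed.

Lemma regularD f g : regular f -> regular g -> regular (fun z => f z + g z).
Proof.
move=> [cf rf pf] [cg rg pg]; split.
- by move=> z; apply: cvgD; [exact: cf|exact: cg].
- move=> n; have [C C0 fC] := rf n; have [D D0 gD] := rg n.
  exists (C + D); first exact: addr_ge0.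
  by move=> z; rewrite mulrDl (le_trans (ler_normD _ _))// lerD.
- by move=> v x i; rewrite pf pg.
Qed.

Lemma regularZ a f : regular f -> regular (fun z => a * f z).
Proof.
move=> [cf rf pf]; split.
- by move=> z; apply: cvgM; [exact: cvg_cst|exact: cf].
- move=> n; have [C C0 fC] := rf n; exists (`|a| * C); first exact: mulr_ge0.
  by move=> z; rewrite normrM -mulrA ler_wpM2l.
- by move=> v x i; rewrite pf.
Qed.

Lemma continuous_coordv (j : 'I_d) : continuous (fun z : Z => z.2 ord0 j).
Proof.
move=> z; apply: (@continuous_comp _ _ _ snd (fun v : 'rV[R]_d => v ord0 j)).
  exact: cvg_snd.
exact: coord_continuous.
Qed.

Lemma coordv_vweight (v : 'rV[R]_d) (j : 'I_d) : `|v ord0 j| * vweight v <= 1.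
Proof.
apply: (@le_trans _ _ (`|v ord0 j| * cauchyw (v ord0 j))).
  by rewrite ler_wpM2l//; exact: vweight_le.
rewrite /cauchyw ler_pdivrMr ?mul1r ?ltr_pwDl ?sqr_ge0//.
rewrite -[X in 1 + X]real_normK ?num_real//; have := sqr_ge0 (`|v ord0 j| - 1).
by have := sqr_ge0 (`|v ord0 j|); lra.
Qed.

Lemma regular_mulv j f : regular f -> regular (fun z => z.2 ord0 j * f z).
Proof.
move=> [cf rf pf]; split.
- by move=> z; apply: cvgM; [exact: continuous_coordv|exact: cf].
- move=> n; have [C C0 fC] := rf n.+1; exists C => // z.
  rewrite normrM; apply: (@le_trans _ _ (`|z.2 ord0 j| * (C * vweight z.2 ^+ n.+1))).
    by rewrite ler_wpM2l.
  have -> : `|z.2 ord0 j| * (C * vweight z.2 ^+ n.+1) =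
    (`|z.2 ord0 j| * vweight z.2) * (C * vweight z.2 ^+ n) by rewrite exprS; ring.
  by rewrite ler_piMl ?coordv_vweight// mulr_ge0// exprn_ge0// vweight_ge0.
- by move=> v x i; rewrite /= pf.
Qed.

Lemma regular_kernelM h k f : kernelf h -> kernelf k -> sqi f ->
  regular (fun z => h z * kconv k f z).
Proof.
move=> kh kk sf; split.
- by move=> z; apply: cvgM; [exact: kernelf_continuous|exact: kconv_continuous].
- move=> n; have [C C0 hC] := kernelf_decay_pow n kh; have [D kD] := kconv_bounded kk sf.
  exists (C * `|D|); first exact: mulr_ge0.
  move=> z; rewrite normrM -mulrA [`|D| * _]mulrC mulrA ler_pM//.
  exact: le_trans (kD z) (ler_norm _).
- move=> v x i; congr (_ * _); last exact: kconv_periodic.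
  rewrite -[RHS](kernelf_periodic kh _ i) /ex; congr h; congr pair.
  by rewrite /= addr0.
Qed.

Lemma pderiv_coordv (i j : 'I_d) : pderiv (fun z : Z => z.2 ord0 i) (fun=> (i == j)%:R) (ev j).
Proof.
move=> z; apply: (is_derive_quad (C := 0)) => t _.
by rewrite !mxE/= mul0r eq_sym; set a := z.2 _ _; rewrite (_ : _ - _ = 0) ?normr0//; case: eqP => _; rewrite /=; ring.
Qed.

(** Under the integral, [v_j] is split into the coordinate of the integration point plus that of the
    difference; the latter yields the commutator, a convolution by the moment [v_j k]. *)
Lemma kconv_mulv k G j (z : Z) : kernelf k -> sqi G -> sqi (fun z => z.2 ord0 j * G z) ->
  z.2 ord0 j * kconv k G z =
  kconv k (fun z => z.2 ord0 j * G z) z + kconv (fun z => z.2 ord0 j * k z) G z.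
Proof.
move=> kk sG swG; have kvk := kernelf_mulv j kk.
rewrite /kconv /iop -RintegralZl//; last exact: kconv_itg.
have j1 := kconv_itg z kk swG; have j2 := kconv_itg z kvk sG.
rewrite -RintegralD//.
by apply: eq_Rintegral => z' _; rewrite !mxE; ring.
Qed.

Lemma kconv_even k A f G : (forall z, k (- z) = k z) ->
  schur mu (fun z z' : Z => k (z - z')) A -> sqi f -> sqi G ->
  ip f (kconv k G) = ip (kconv k f) G.
Proof.
move=> ke sk sf sG; rewrite [RHS](iop_dual sk sf sG); congr (ip f (iop mu _ G)).
by apply/funext => z; apply/funext => z'; rewrite -ke opprB.
Qed.

Lemma kconv_odd k A f G : kernelf k -> (forall z, k (- z) = - k z) ->
  schur mu (fun z z' : Z => k (z - z')) A -> sqi f -> sqi G ->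
  ip f (kconv k G) = - ip (kconv k f) G.
Proof.
move=> kk ke sk sf sG; rewrite (iop_dual sk sf sG).
have sT := iop_sqi (schur_sym sk) sG.
have -> : kconv k G = fun z => - iop mu (fun z z' : Z => k (z' - z)) G z.
  apply/funext => z; rewrite -RintN; last first.
    apply: sqi_mul => //; rewrite (_ : (fun z' => _) = fun z' => - k (z - z')).
      by apply: sqiN; exact: kernelf_sub_sqi.
    by apply/funext => z'; rewrite -ke opprB.
  by apply: eq_Rintegral => z' _; rewrite -[z - z']opprB ke mulNr.
by rewrite ipC ipNl// ipC.
Qed.

(** After [kconv_mulv] the convolutions are transposed onto [f]; [k] is even but [v_j k] is odd,
    which reverses the sign of the commutator. *)
Lemma eqint_mulv k (a : R) f G (j : 'I_d) : kernelf k -> (forall z, k (- z) = k z) ->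
  schur mu (fun z z' : Z => k (z - z')) 1 ->
  schur mu (fun z z' : Z => (z - z').2 ord0 j * k (z - z')) a -> sqi f -> regular G ->
  eqint (fun z => f z * (z.2 ord0 j * kconv k G z))
   (fun z => (z.2 ord0 j * kconv k f z - kconv (fun z => z.2 ord0 j * k z) f z) * G z).
Proof.
move=> kk ke k1 ka sf rG; set tk := fun z : Z => z.2 ord0 j * k z.
have sG := regular_sqi rG; have swG := regular_sqi (regular_mulv j rG).
have ktk : kernelf tk by exact: kernelf_mulv.
have tko z : tk (- z) = - tk z by rewrite /tk ke !mxE mulNr.
have i1 : itg (fun z => f z * kconv k (fun z => z.2 ord0 j * G z) z).
  by apply: sqi_mul => //; exact: (iop_sqi k1).
have i2 : itg (fun z => f z * kconv tk G z) by apply: sqi_mul => //; exact: (iop_sqi ka).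
have i3 : itg (fun z => kconv k f z * (z.2 ord0 j * G z)).
  by apply: sqi_mul => //; exact: (iop_sqi k1).
have i4 : itg (fun z => kconv tk f z * G z) by apply: sqi_mul => //; exact: (iop_sqi ka).
have -> : (fun z : Z => f z * (z.2 ord0 j * kconv k G z)) =
    fun z => f z * kconv k (fun z => z.2 ord0 j * G z) z + f z * kconv tk G z.
  by apply/funext => z; rewrite (kconv_mulv _ kk sG swG) mulrDr.
have -> : (fun z : Z => (z.2 ord0 j * kconv k f z - kconv tk f z) * G z) =
    fun z : Z => kconv k f z * (z.2 ord0 j * G z) - kconv tk f z * G z.
  by apply/funext => z; ring.
split; [exact: itgD|exact: itgB|rewrite RintegralD// RintegralB//; congr (_ + _)].
  exact: (kconv_even ke k1).
exact: (kconv_odd ktk tko ka).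
Qed.

(** Apply [eqint_mulv] to [v_j G] and commute the remaining factor [v_j] once more; the second
    moment of the kernel is even again. *)
Lemma eqint_mulv2 k (a : R) f G (j : 'I_d) : kernelf k -> (forall z, k (- z) = k z) ->
  schur mu (fun z z' : Z => k (z - z')) 1 ->
  schur mu (fun z z' : Z => (z - z').2 ord0 j * k (z - z')) a ->
  schur mu (fun z z' : Z => (z - z').2 ord0 j * ((z - z').2 ord0 j * k (z - z'))) a ->
  sqi f -> regular G ->
  eqint (fun z => f z * (z.2 ord0 j ^+ 2 * kconv k G z))
   (fun z => (z.2 ord0 j ^+ 2 * kconv k f z
     - 2 * z.2 ord0 j * kconv (fun z => z.2 ord0 j * k z) f z
     + kconv (fun z => z.2 ord0 j * (z.2 ord0 j * k z)) f z) * G z).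
Proof.
move=> kk ke k1 ka kb sf rG; set tk := fun z : Z => z.2 ord0 j * k z.
set ttk := fun z : Z => z.2 ord0 j * (z.2 ord0 j * k z).
have rwG := regular_mulv j rG; have rwwG := regular_mulv j rwG.
have [sG swG swwG] : [/\ sqi G, sqi (fun z => z.2 ord0 j * G z) &
  sqi (fun z => z.2 ord0 j * (z.2 ord0 j * G z))] by split; exact: regular_sqi.
have ktk : kernelf tk by exact: kernelf_mulv.
have kttk : kernelf ttk by exact: (kernelf_mulv j ktk).
have tko z : tk (- z) = - tk z by rewrite /tk ke !mxE mulNr.
have ttke z : ttk (- z) = ttk z by rewrite /ttk ke !mxE !(mulNr, mulrN) opprK.
have [i1 i1' e1] := @eqint_mulv k a f _ j kk ke k1 ka sf rwG.
have i2 : itg (fun z => f z * kconv tk (fun z => z.2 ord0 j * G z) z).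
  by apply: sqi_mul => //; exact: (iop_sqi ka).
have i3 : itg (fun z => f z * kconv ttk G z) by apply: sqi_mul => //; exact: (iop_sqi kb).
have i4 : itg (fun z => kconv tk f z * (z.2 ord0 j * G z)).
  by apply: sqi_mul => //; exact: (iop_sqi ka).
have i5 : itg (fun z => kconv ttk f z * G z) by apply: sqi_mul => //; exact: (iop_sqi kb).
have -> : (fun z : Z => f z * (z.2 ord0 j ^+ 2 * kconv k G z)) =
    fun z => f z * (z.2 ord0 j * kconv k (fun z => z.2 ord0 j * G z) z) +
      (f z * kconv tk (fun z => z.2 ord0 j * G z) z + f z * kconv ttk G z).
  apply/funext => z; rewrite expr2 -mulrA (kconv_mulv _ kk sG swG) mulrDr.
  by rewrite (kconv_mulv _ ktk sG swG) -/ttk; ring.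
have -> : (fun z : Z => (z.2 ord0 j ^+ 2 * kconv k f z - 2 * z.2 ord0 j * kconv tk f z
    + kconv ttk f z) * G z) = fun z : Z =>
    (z.2 ord0 j * kconv k f z - kconv tk f z) * (z.2 ord0 j * G z) +
      (- (kconv tk f z * (z.2 ord0 j * G z)) + kconv ttk f z * G z).
  by apply/funext => z; rewrite -/tk; ring.
have iN := itgN i4.
split; [by apply: itgD => //; exact: itgD|by apply: itgD => //; exact: itgD|].
rewrite RintegralD//; last exact: itgD.
rewrite [RHS]RintegralD//; last exact: itgD.
rewrite e1; congr (_ + _); rewrite RintegralD// [RHS]RintegralD// RintN//; congr (_ + _).
  exact: (kconv_odd ktk tko ka).
exact: (kconv_even ttke kb).
Qed.

End regular_functions.

(** * The energy inequality as pointwise algebra *)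

Section energy_algebra.
Context {R : realType} (d : nat).
Implicit Types (w T W Fx Fv : 'I_d -> R) (beta S U : 'I_d -> 'I_d -> R).

(** The magnetic rotation is orthogonal to [v], so it does not act on radial weights in the
    velocity. *)
Lemma antisym_sum beta w : (forall i j, beta i j = - beta j i) ->
  \sum_i \sum_j beta i j * (w i * w j) = 0.
Proof.
move=> ba; set s := \sum_i _.
have : s = - s.
  rewrite {1}/s exchange_big/= -sumrN; apply: eq_bigr => i _.
  by rewrite -sumrN; apply: eq_bigr => j _; rewrite ba; ring.
by lra.
Qed.

(* Here [chi = exp (- v^2 / 8)], [F = k * f], [T i], [W i], [S i j] and [U i j] stand for the
   convolutions [(v_i k) * f], [(v_i^2 k) * f], [k * (beta_ij f)] and
   [(v_i k) * (beta_ij f)], while [N] collects null divergences. *)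
Lemma energy_pointwise w T W Fx Fv Fvv beta S U (chi F : R) :
  0 <= chi <= 1 -> (forall i j, beta i j = - beta j i) ->
  let E := chi ^+ 2 in
  let gv j := E * (Fv j - 2^-1 * w j * F) in
  let e i j := w i * (S i j - beta i j * F) - U i j in
  let P := \sum_i (w i * F - T i) * (E * Fx i)
    - \sum_i \sum_j (w i * S i j - U i j) * gv j
    - \sum_j F * Fvv j
    + (4^-1 * (\sum_i (w i ^+ 2 * F - 2 * w i * T i + W i) * (E * F)) + F * (E * F)) in
  let N := \sum_i w i * E * F * Fx i
    - \sum_i \sum_j beta i j * (2^-1 * (i == j)%:R * E * F ^+ 2 + w i * E * F * Fv j
        - 4^-1 * w i * w j * E * F ^+ 2)
    - \sum_j (Fv j * gv j + F * Fvv j) in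
  is_true (2^-1 * (chi * F) ^+ 2 <= P - N +
    (\sum_i T i * (E * Fx i) + (2 * d.+1%:R) * (\sum_i \sum_j (chi * e i j) ^+ 2)
     + \sum_i T i ^+ 2 + d.+1%:R * \sum_i W i ^+ 2)).
Proof.
move=> /andP[c0 c1] ba E gv e P N; set n : R := d.+1%:R.
have n0 : 0 < n by rewrite ltr0n.
set y := chi * F.
(* The [v_j]-derivative of [y = chi F], as [chi] has derivative [- w_j chi / 4]. The energy
   available to pay for the errors is the sum of [D^2 + 3/16 w^2 y^2] over [j], plus [y^2]. *)
pose D j := chi * (Fv j - 4^-1 * w j * F).
(* Young with weight [n = d + 1]: summed over the [d] values of [i], the cost is at most a quarter
   of [D^2 + w^2 y^2 / 16]. *)
have Q1 i j : e i j * gv j <= 2 * n * (chi * e i j) ^+ 2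
    + (D j ^+ 2 + w j ^+ 2 * y ^+ 2 / 16) / (4 * n).
  have -> : e i j * gv j = (chi * e i j) * (D j - 4^-1 * w j * y).
    by rewrite /gv /D /E /y; field.
  set a := chi * e i j; set p := D j; set q := w j * y / 4.
  have -> : a * (p - 4^-1 * w j * y) = a * p - a * q by rewrite /q; field.
  have -> : w j ^+ 2 * y ^+ 2 / 16 = q ^+ 2 by rewrite /q; field.
  have h1 : 0 <= (2 * n * a - p) ^+ 2 / (4 * n) by rewrite divr_ge0 ?sqr_ge0// mulr_ge0// ltW.
  have h2 : 0 <= (2 * n * a + q) ^+ 2 / (4 * n) by rewrite divr_ge0 ?sqr_ge0// mulr_ge0// ltW.
  have e1 : (2 * n * a - p) ^+ 2 / (4 * n) = n * a ^+ 2 - a * p + p ^+ 2 / (4 * n).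
    by field; rewrite gt_eqF.
  have e2 : (2 * n * a + q) ^+ 2 / (4 * n) = n * a ^+ 2 + a * q + q ^+ 2 / (4 * n).
    by field; rewrite gt_eqF.
  rewrite e1 in h1; rewrite e2 in h2; rewrite (mulrDl (p ^+ 2)).
  have -> : 2 * n * a ^+ 2 = n * a ^+ 2 + n * a ^+ 2 by ring.
  move: h1 h2; move: (p ^+ 2 / _) (q ^+ 2 / _) (n * a ^+ 2) (a * p) (a * q).
  by clear; move=> x1 x2 x3 x4 x5; lra.
have chi2 : chi ^+ 2 <= 1 by rewrite expr_le1.
have Q2 j : 0 <= 16^-1 * (w j ^+ 2 * y ^+ 2) - 2^-1 * (w j * T j * (E * F)) + T j ^+ 2.
  have h := sqr_ge0 (chi * T j - w j * y / 4).
  have h1 : (chi * T j) ^+ 2 <= T j ^+ 2 by rewrite exprMn ler_piMl ?sqr_ge0.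
  have e1 : (chi * T j - w j * y / 4) ^+ 2 =
    (chi * T j) ^+ 2 - 2^-1 * (w j * T j * (E * F)) + 16^-1 * (w j ^+ 2 * y ^+ 2).
    by rewrite /y /E; field.
  by rewrite e1 in h; lra.
have Q3 j : 0 <= 4^-1 * (W j * (E * F)) + n * W j ^+ 2 + y ^+ 2 / (64 * n).
  have h : 0 <= (8 * n * (chi * W j) + y) ^+ 2 / (64 * n).
    by rewrite divr_ge0 ?sqr_ge0// mulr_ge0// ltW.
  have h1 : n * (chi * W j) ^+ 2 <= n * W j ^+ 2.
    by rewrite ler_wpM2l ?(ltW n0)// exprMn ler_piMl ?sqr_ge0.
  have e1 : (8 * n * (chi * W j) + y) ^+ 2 / (64 * n) =
    n * (chi * W j) ^+ 2 + 4^-1 * (W j * (E * F)) + y ^+ 2 / (64 * n).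
    by rewrite /y /E; field; rewrite gt_eqF.
  rewrite e1 in h; move: h h1; move: (y ^+ 2 / _) (n * _ ^+ 2) (n * _ ^+ 2) (W j * _).
  by clear; move=> x1 x2 x3 x4; lra.
(* An antisymmetric matrix has zero diagonal, which removes the term produced by differentiating
   [w_i] in direction [v_j]. *)
have b0 i j : beta i j * (i == j)%:R = 0.
  case: eqP => [->|_]; last by rewrite mulr0.
  by have := ba j j; rewrite mulr1; lra.
(* An exact identity: once the divergences are removed, only the energy and the terms with the
   commutators [T], [e] and [W] are left. *)
have PN : P - N = - (\sum_i T i * (E * Fx i)) - \sum_i \sum_j e i j * gv j
    + \sum_j (Fv j * gv j + 4^-1 * (w j ^+ 2 * y ^+ 2) - 2^-1 * (w j * T j * (E * F))
       + 4^-1 * (W j * (E * F))) + y ^+ 2.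
  have a0 := antisym_sum w ba.
  have -> : \sum_j (Fv j * gv j + 4^-1 * (w j ^+ 2 * y ^+ 2) - 2^-1 * (w j * T j * (E * F))
       + 4^-1 * (W j * (E * F))) = \sum_j (Fv j * gv j)
       + 4^-1 * (\sum_i (w i ^+ 2 * F - 2 * w i * T i + W i) * (E * F)).
    by rewrite mulr_sumr -big_split/=; apply: eq_bigr => j _; rewrite /y /E; field.
  have -> : \sum_i \sum_j e i j * gv j = \sum_i \sum_j (w i * S i j - U i j) * gv j
      - \sum_i \sum_j beta i j * (2^-1 * (i == j)%:R * E * F ^+ 2 + w i * E * F * Fv j
        - 4^-1 * w i * w j * E * F ^+ 2) + 4^-1 * E * F ^+ 2 * \sum_i \sum_j beta i j * (w i * w j).
    rewrite mulr_sumr -sumrB -big_split/=; apply: eq_bigr => i _.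
    rewrite mulr_sumr -sumrB -big_split/=; apply: eq_bigr => j _.
    have -> : beta i j * (2^-1 * (i == j)%:R * E * F ^+ 2 + w i * E * F * Fv j
        - 4^-1 * w i * w j * E * F ^+ 2) = beta i j * (i == j)%:R * (2^-1 * E * F ^+ 2)
        + beta i j * (w i * E * F * Fv j - 4^-1 * w i * w j * E * F ^+ 2) by ring.
    by rewrite b0 /e /gv; field.
  have e1 : \sum_i (w i * F - T i) * (E * Fx i) =
      \sum_i w i * E * F * Fx i - \sum_i T i * (E * Fx i).
    by rewrite -sumrB; apply: eq_bigr => i _; ring.
  have e2 : \sum_j (Fv j * gv j + F * Fvv j) = \sum_j Fv j * gv j + \sum_j F * Fvv j.
    by rewrite big_split.
  rewrite a0 mulr0 addr0 /P /N e1 e2.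
  have -> : F * (E * F) = y ^+ 2 by rewrite /y /E; ring.
  by ring.
have SQ1 : \sum_i \sum_j e i j * gv j <= 2 * n * (\sum_i \sum_j (chi * e i j) ^+ 2)
    + \sum_j 4^-1 * (D j ^+ 2 + w j ^+ 2 * y ^+ 2 / 16).
  apply: (@le_trans _ _ (\sum_i \sum_j (2 * n * (chi * e i j) ^+ 2
    + (D j ^+ 2 + w j ^+ 2 * y ^+ 2 / 16) / (4 * n)))).
    by apply: ler_sum => i _; apply: ler_sum => j _; exact: Q1.
  under eq_bigr do rewrite big_split/=.
  rewrite big_split/=; apply: lerD.
    by rewrite mulr_sumr; apply: ler_sum => i _; rewrite mulr_sumr.
  rewrite exchange_big/=; apply: ler_sum => j _.
  rewrite sumr_const card_ord -[leLHS]mulr_natl.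
  set X := D j ^+ 2 + _.
  have X0 : 0 <= X by rewrite addr_ge0 ?sqr_ge0// divr_ge0// mulr_ge0// sqr_ge0.
  rewrite mulrA ler_pdivrMr ?mulr_gt0//.
  have -> : 4^-1 * X * (4 * n) = n * X by field.
  by rewrite ler_wpM2r// /n ler_nat.
have SQ23 : 0 <= \sum_j (Fv j * gv j + 4^-1 * (w j ^+ 2 * y ^+ 2) - 2^-1 * (w j * T j * (E * F))
       + 4^-1 * (W j * (E * F)) + T j ^+ 2 + n * W j ^+ 2 + y ^+ 2 / (64 * n)
       - 4^-1 * (D j ^+ 2 + w j ^+ 2 * y ^+ 2 / 16)).
  apply: sumr_ge0 => j _; have h2 := Q2 j; have h3 := Q3 j.
  have -> : Fv j * gv j = D j ^+ 2 - w j ^+ 2 * y ^+ 2 / 16 by rewrite /gv /D /y /E; field.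
  have : 0 <= D j ^+ 2 by exact: sqr_ge0.
  have : 0 <= w j ^+ 2 * y ^+ 2 by rewrite mulr_ge0// sqr_ge0.
  move: h2 h3; move: (y ^+ 2 / _) (n * _ ^+ 2) (W j * _) (w j * T j * _) (T j ^+ 2) (D j ^+ 2) (w j ^+ 2 * _).
  by clear; move=> x1 x2 x3 x4 x5 x6 x7; lra.
have Sy : \sum_(j < d) y ^+ 2 / (64 * n) <= y ^+ 2 / 64.
  rewrite sumr_const card_ord -[leLHS]mulr_natl mulrA ler_pdivrMr ?mulr_gt0//.
  have -> : y ^+ 2 / 64 * (64 * n) = n * y ^+ 2 by field.
  by rewrite ler_wpM2r ?sqr_ge0// /n ler_nat.
have y20 : 0 <= y ^+ 2 by exact: sqr_ge0.
rewrite PN.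
move: SQ23; rewrite sumrB !big_split/= -mulr_sumr => SQ23.
rewrite [n * \sum_i _]mulr_sumr.
move: SQ23 SQ1 Sy y20.
set a1 := \sum_(j < d) y ^+ 2 / (64 * n); set a2 := \sum_i \sum_j e i j * gv j.
set a3 := 2 * n * _; set a4 := \sum_i n * _; set a5 := \sum_j 4^-1 * (D j ^+ 2 + _).
set a6 := \sum_i T i * (E * Fx i).
move: a1 a2 a3 a4 a5 a6 (y ^+ 2); move: (\sum_(i < d) Fv i * gv i)
  (\sum_(i < d) w i ^+ 2 * y ^+ 2) (\sum_(i < d) - (2^-1 * (w i * T i * (E * F))))
  (\sum_(i < d) 4^-1 * (W i * (E * F))) (\sum_(i < d) T i ^+ 2).
by clear; move=> x1 x2 x3 x4 x5 x6 x7 x8 x9 x10 x11 x12; lra.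
Qed.

End energy_algebra.

Section vanishing_sequences.
Context {R : realType}.
Implicit Types u v : nat -> R.

(* One-sided: only used for sequences bounding nonnegative quantities. *)
Definition vanishing u := forall eps, 0 < eps -> exists M, forall m, (M <= m)%N -> u m <= eps.

Lemma vanishing_le u v : (forall m, u m <= v m) -> vanishing v -> vanishing u.
Proof.
move=> uv hv eps /hv[M MP]; exists M => m Mm; exact: le_trans (uv m) (MP m Mm).
Qed.

Lemma vanishingD u v : vanishing u -> vanishing v -> vanishing (fun m => u m + v m).
Proof.
move=> hu hv eps eps0; have e2 : 0 < eps / 2 by rewrite divr_gt0.
have [M MP] := hu _ e2; have [N NP] := hv _ e2; exists (maxn M N) => m.
by rewrite geq_max => /andP[/MP h1 /NP h2]; lra.
Qed.

Lemma vanishingZ (c : R) u : 0 <= c -> vanishing u -> vanishing (fun m => c * u m).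
Proof.
move=> c0 hu eps eps0; have c1 : 0 < c + 1 by rewrite ltr_wpDl.
have [|M MP] := hu (eps / (c + 1)); first by rewrite divr_gt0.
exists M => m /MP; rewrite ler_pdivlMr// => h; have [u0|u0] := leP 0 (u m); first by lra.
by apply: le_trans (ltW eps0); rewrite mulr_ge0_le0// ltW.
Qed.

Lemma vanishing_cst0 : vanishing (fun=> 0).
Proof. by move=> eps /ltW eps0; exists 0%N. Qed.

Lemma vanishing_sum (I : Type) (s : seq I) (F : I -> nat -> R) :
  (forall i, vanishing (F i)) -> vanishing (fun m => \sum_(i <- s) F i m).
Proof.
move=> h; elim: s => [|i s IH].
  by under eq_fun do rewrite big_nil; exact: vanishing_cst0.
by under eq_fun do rewrite big_cons; exact: vanishingD.
Qed.

Lemma vanishing_harmonic : vanishing (fun m => m.+1%:R^-1).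
Proof.
move=> eps eps0; have [M _ h] := nbhs_infty_ger eps^-1; exists M => m Mm.
rewrite invf_ple ?posrE ?ltr0n//; apply: le_trans (h m Mm) _.
by rewrite ler_nat.
Qed.

End vanishing_sequences.

(** * Energy estimate for mollified functions and passage to the limit *)

Section energy.
Context {R : realType} (d : nat).
Notation Z := ('rV[R]_d * 'rV[R]_d)%type.
Notation mu := (@phase_vol R d).
Notation itg f := (mu.-integrable setT (EFin \o f)).
Notation sqi := (sqi mu).
Notation N2 := (N2 mu).
Notation ip := (ip mu).
Notation eqint := (eqint mu).
Implicit Types (k f g G : Z -> R).

Definition gweight (a : R) (z : Z) : R := expR (- (a * sqnorm z.2)).

Lemma gweight_tensor a :
  gweight a = tensor (fun=> cst 1) (fun=> fun t => expR (- (a * t ^+ 2))).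
Proof.
apply/funext => z; rewrite /tensor big1// mul1r /gweight /sqnorm mulr_sumr -sumrN.
by rewrite expR_sum.
Qed.

Lemma gweight_kernelf a : 0 < a -> kernelf (gweight a).
Proof.
move=> a0; exists (fun=> cst 1), (fun=> fun t => expR (- (a * t ^+ 2))); split.
- by move=> _; exact: trigpoly_cst.
- move=> _; exists a => //; exists 1; apply/funext => t.
  by rewrite hornerC mul1r.
- exact: gweight_tensor.
Qed.

Lemma gweight_le1 a z : 0 <= a -> 0 <= gweight a z <= 1.
Proof.
move=> a0; rewrite expR_ge0/= -expR0 ler_expR oppr_le0 mulr_ge0// sumr_ge0// => i _.
exact: sqr_ge0.
Qed.

Lemma pderiv_gweight_v a j : 0 < a ->
  pderiv (gweight a) (fun z => - 2 * a * (z.2 ord0 j * gweight a z)) (ev j).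
Proof.
move=> a0.
pose q : R -> R := fun t => expR (- (a * t ^+ 2)).
have gq : gauspoly q.
  by exists a => //; exists 1; apply/funext => t; rewrite hornerC mul1r.
have dq : deriv1 q (fun t => (- 2 * a * t) * q t).
  move=> t.
  have dl : is_derive t (1 : R) (fun t : R => - (a * t ^+ 2)) (- (a * (2 * t))).
    apply: is_deriveN; apply: is_deriveZ.
    apply: (is_derive_eq (is_deriveM (is_derive_id t 1) (is_derive_id t 1))).
    by rewrite /GRing.scale/=; ring.
  have := @is_derive1_comp _ expR (fun t : R => - (a * t ^+ 2)) t _ _
    (is_derive_expR (- (a * t ^+ 2))) dl.
  by move/is_derive_eq; apply; rewrite /q; ring.
have w := @tensor_partial_v R d (fun=> cst 1) (fun=> q) j _ (fun=> trigpoly_cst 1) (fun=> gq) dq.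
rewrite gweight_tensor; apply: pderiv_eq (quad_pderiv (weighted_quad w)) _ => z.
rewrite /tensor (@prod_upd _ _ (fun=> q) j _ (fun l => z.2 ord0 l)).
by rewrite [\prod_j0 expR _](bigD1 j)//= /q; ring.
Qed.

Lemma pderiv_x_cst G i : (forall x x' v, G (x, v) = G (x', v)) -> pderiv G (fun=> 0) (ex i).
Proof.
move=> h [x v]; apply: (is_derive_quad (C := 0)) => t _.
have -> : (x, v) + t *: ex i = (x + t *: delta_mx ord0 i, v).
  by rewrite /ex; congr pair; rewrite /= ?scaler0 ?addr0.
by rewrite (h _ x) subrr mulr0 subr0 normr0 mul0r.
Qed.

Lemma regular_kconvM k f G : kernelf k -> sqi f -> regular G ->
  regular (fun z => kconv k f z * G z).
Proof.
move=> kk sf [cG rG pG]; split.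
- by move=> z; apply: cvgM; [exact: kconv_continuous|exact: cG].
- have [D kD] := kconv_bounded kk sf.
  move=> n; have [C C0 hC] := rG n; exists (`|D| * C); first exact: mulr_ge0.
  move=> z; rewrite normrM -mulrA ler_pM//.
  exact: le_trans (kD z) (ler_norm _).
- by move=> v x i; rewrite pG (kconv_periodic _ kk).
Qed.

Lemma eqint_ibp_x G G' i : regular G -> regular G' -> pderiv G G' (ex i) ->
  eqint G' (fun=> 0).
Proof.
move=> [_ _ pG] [cG' rG' _] dG.
have [i1 i2] := ibp_x dG cG' (rapid_decaying rG') pG.
by split; [done|exact: itg0|rewrite i2 /Rintegral integral0].
Qed.

Lemma eqint_ibp_v (c : 'rV[R]_d -> R) G G' j : measurable_fun setT c ->
  (exists C, forall x, `|c x| <= C) -> regular G -> regular G' -> pderiv G G' (ev j) ->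
  eqint (fun z => c z.1 * G' z) (fun=> 0).
Proof.
move=> mc bc [_ rG _] [cG' rG' _] dG.
have [i1 i2] := ibp_v mc bc dG cG' (rapid_decaying rG) (rapid_decaying rG').
by split; [done|exact: itg0|rewrite i2 /Rintegral integral0].
Qed.

Lemma eqint_kconv k f G : kernelf k -> (forall z, k (- z) = k z) ->
  schur mu (fun z z' : Z => k (z - z')) 1 -> sqi f -> sqi G ->
  eqint (fun z => f z * kconv k G z) (fun z => kconv k f z * G z).
Proof.
move=> kk ke k1 sf sG; split.
- by apply: sqi_mul => //; exact: (iop_sqi k1).
- by apply: sqi_mul => //; exact: (iop_sqi k1).
- exact: (kconv_even ke k1 sf sG).
Qed.

Variables (beta : 'I_d -> 'I_d -> 'rV[R]_d -> R) (b : R).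
Hypothesis beta_measurable : forall i j, measurable_fun setT (beta i j).
Hypothesis beta_bounded : forall i j x, `|beta i j x| <= b.
Hypothesis beta_antisym : forall i j x, beta i j x = - beta j i x.

(* [K + d/2 + 1], applied to a function with the prescribed derivatives. *)
Definition kinetic (u : Z -> R) (ux uv uvv : 'I_d -> Z -> R) (z : Z) : R :=
  \sum_i z.2 ord0 i * ux i z
  - \sum_i \sum_j beta i j z.1 * (z.2 ord0 i * uv j z)
  - \sum_j uvv j z + (sqnorm z.2 / 4 + 1) * u z.

(** The derivatives are data, not computed from [g]. The same statements then apply to
    Gaussian-weighted convolutions and to the real or imaginary part of a Schwartz function. *)
Definition test_data g (gx gv gvv : 'I_d -> Z -> R) : Prop :=
  [/\ regular g, forall i, regular (gx i), forall j, regular (gv j) &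
      forall j, regular (gvv j)] /\
  [/\ forall i, pderiv g (gx i) (ex i), forall j, pderiv g (gv j) (ev j) &
      forall j, pderiv (gv j) (gvv j) (ev j)].

(** Orthogonality of [f] to the image of a convolution under [K + d/2 + 1]; the derivatives fall on
    [g], which [kconv_pderiv_swap] justifies, so that one and the same convolution is transposed in
    every term. *)
Definition kinetic_orthogonal f := forall k g gx gv gvv, kernelf k ->
  test_data g gx gv gvv ->
  \int[mu]_z (f z * kinetic (kconv k g) (fun i => kconv k (gx i)) (fun j => kconv k (gv j))
    (fun j => kconv k (gvv j)) z) = 0.

Lemma beta_sqi i j f : sqi f -> sqi (fun z => beta i j z.1 * f z).
Proof.
move=> sf; apply: (@sqi_bM _ _ _ _ (fun z => beta i j z.1) f b) => //.
by apply: measurableT_comp => //.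
Qed.

Local Notation chi := (gweight (8^-1)).
Local Notation E := (fun z : Z => chi z ^+ 2).

Lemma chi_sqr : E = gweight (4^-1).
Proof.
by apply/funext => z; rewrite expr2 /gweight -expRD; congr expR; field.
Qed.

Lemma chi_sqrE z : chi z ^+ 2 = gweight (4^-1) z.
Proof. by rewrite -chi_sqr. Qed.

(** Admissibility of the test function of the energy method. Its regularity is that of a Gaussian
    kernel times a bounded convolution, and the formulas come from [chi^2 = exp (- v^2 / 4)], of
    derivative [- v_j chi^2 / 2]. *)
Lemma gaussian_test_data k (kx kv kvv : 'I_d -> Z -> R) f : kernelf k -> sqi f ->
  (forall i, kernelf (kx i) /\ weighted_partial k (kx i) (ex i)) ->
  (forall j, kernelf (kv j) /\ weighted_partial k (kv j) (ev j)) ->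
  (forall j, kernelf (kvv j) /\ weighted_partial (kv j) (kvv j) (ev j)) ->
  let F := kconv k f in
  test_data (fun z => chi z ^+ 2 * F z) (fun i z => chi z ^+ 2 * kconv (kx i) f z)
   (fun j z => chi z ^+ 2 * (kconv (kv j) f z - 2^-1 * z.2 ord0 j * F z))
   (fun j z => chi z ^+ 2 * kconv (kvv j) f z - z.2 ord0 j * chi z ^+ 2 * kconv (kv j) f z
      - 2^-1 * chi z ^+ 2 * F z + 4^-1 * z.2 ord0 j ^+ 2 * chi z ^+ 2 * F z).
Proof.
move=> kk sf hx hv hvv F.
have kE : kernelf E by rewrite chi_sqr; apply: gweight_kernelf; rewrite invr_gt0.
have kE1 j : kernelf (fun z => z.2 ord0 j * chi z ^+ 2) by exact: kernelf_mulv.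
have kE2 j : kernelf (fun z => z.2 ord0 j * (z.2 ord0 j * chi z ^+ 2)).
  exact: (kernelf_mulv j (kE1 j)).
have dEv j : pderiv E (fun z => - 2^-1 * (z.2 ord0 j * chi z ^+ 2)) (ev j).
  rewrite {1}chi_sqr; apply: pderiv_eq (pderiv_gweight_v _ _) _ => [|z]; first by rewrite invr_gt0.
  by rewrite chi_sqrE; field.
have dFx i : pderiv F (kconv (kx i) f) (ex i) by have [? ?] := hx i; exact: kconv_pderiv.
have dFv j : pderiv F (kconv (kv j) f) (ev j) by have [? ?] := hv j; exact: kconv_pderiv.
have dFvv j : pderiv (kconv (kv j) f) (kconv (kvv j) f) (ev j).
  by have [? ?] := hvv j; have [? _] := hv j; exact: kconv_pderiv.
have gvE j : (fun z => chi z ^+ 2 * (kconv (kv j) f z - 2^-1 * z.2 ord0 j * F z)) =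
   fun z => chi z ^+ 2 * kconv (kv j) f z + (- 2^-1) * ((z.2 ord0 j * chi z ^+ 2) * F z).
  by apply/funext => z; ring.
split; split.
- exact: regular_kernelM.
- by move=> i; apply: regular_kernelM => //; case: (hx i).
- move=> j; rewrite gvE; apply: regularD.
    by apply: regular_kernelM => //; case: (hv j).
  by apply: regularZ; exact: (regular_kernelM (kE1 j)).
- move=> j; rewrite (_ : (fun z => _) = fun z =>
    (chi z ^+ 2 * kconv (kvv j) f z + (-1) * ((z.2 ord0 j * chi z ^+ 2) * kconv (kv j) f z))
    + ((- 2^-1) * (chi z ^+ 2 * F z) + 4^-1 * ((z.2 ord0 j * (z.2 ord0 j * chi z ^+ 2)) * F z))).
    apply: regularD; apply: regularD.
    + by apply: regular_kernelM => //; case: (hvv j).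
    + by apply: regularZ; apply: (regular_kernelM (kE1 j)) => //; case: (hv j).
    + by apply: regularZ; exact: regular_kernelM.
    + by apply: regularZ; exact: (regular_kernelM (kE2 j)).
  by apply/funext => z; ring.
- move=> i; have dE : pderiv E (fun=> 0) (ex i) by apply: pderiv_x_cst.
  by apply: pderiv_eq (pderivM dE (dFx i)) _ => z; rewrite mul0r addr0.
- by move=> j; apply: pderiv_eq (pderivM (dEv j) (dFv j)) _ => z; ring.
- move=> j; rewrite gvE.
  have d1 := pderivM (dEv j) (dFvv j).
  have d2 := pderivM (pderivM (pderiv_coordv j j) (dEv j)) (dFv j).
  apply: pderiv_eq (pderivD d1 (pderivZ (- 2^-1) d2)) _ => z.
  by rewrite eqxx /=; field.
Qed.

(** From [1 + v_j^2 / 8 <= exp (v^2 / 8)] and [4 |v_j| <= 4 + v_j^2]. This bound lets [chi] absorb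
    the unbounded factor of the magnetic commutator. *)
Lemma coordv_chi_bound j (z : Z) : `|z.2 ord0 j * chi z| <= 2.
Proof.
rewrite normrM [`|chi z|]ger0_norm ?expR_ge0// /gweight expRN ler_pdivrMr ?expR_gt0//.
have h : 1 + 8^-1 * z.2 ord0 j ^+ 2 <= expR (8^-1 * sqnorm z.2).
  apply: le_trans (expR_ge1Dx _); rewrite lerD2l ler_pM2l ?invr_gt0//.
  rewrite /sqnorm (bigD1 j)//= lerDl sumr_ge0// => i _; exact: sqr_ge0.
apply: (@le_trans _ _ (2 * (1 + 8^-1 * z.2 ord0 j ^+ 2))); last by rewrite ler_pM2l.
rewrite -[X in 8^-1 * X]real_normK ?num_real//.
by have := sqr_ge0 (`|z.2 ord0 j| - 2); lra.
Qed.

(** The factor [chi v_i] is bounded by 2, which leaves the plain commutator [S]; the remaining term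
    is a convolution by the first moment, of norm at most [a]. *)
Lemma commutator_bound (i j : 'I_d) (a : R) k f :
  schur mu (fun z z' : Z => k (z - z')) 1 ->
  schur mu (fun z z' : Z => (z - z').2 ord0 i * k (z - z')) a -> sqi f ->
  let S := fun z : Z => kconv k (fun z => beta i j z.1 * f z) z - beta i j z.1 * kconv k f z in
  let e := fun z : Z => z.2 ord0 i * S z
      - kconv (fun z => z.2 ord0 i * k z) (fun z => beta i j z.1 * f z) z in
  sqi (fun z => chi z * e z) /\
  is_true (N2 (fun z => chi z * e z) <=
    2 * (2 ^+ 2 * N2 S) + 2 * (a ^+ 2 * N2 (fun z => beta i j z.1 * f z))).
Proof.
move=> k1 ka sf S e; have hC := coordv_chi_bound i.
have kchi : kernelf chi by apply: gweight_kernelf; rewrite invr_gt0.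
have kc1 : kernelf (fun z => z.2 ord0 i * chi z) by exact: kernelf_mulv.
have chi1 z : `|chi z| <= 1.
  by have /andP[h1 h2] := @gweight_le1 (8^-1) z (ltac:(by rewrite invr_ge0)); rewrite ger0_norm.
have sbf : sqi (fun z => beta i j z.1 * f z) by exact: beta_sqi.
have sbF : sqi (fun z => beta i j z.1 * kconv k f z) by apply: beta_sqi; exact: (iop_sqi k1).
have sS : sqi S by apply: sqiB => //; exact: (iop_sqi k1).
set U := kconv (fun z => z.2 ord0 i * k z) (fun z => beta i j z.1 * f z).
have sU : sqi U by exact: (iop_sqi ka).
have -> : (fun z => chi z * e z) = fun z => (z.2 ord0 i * chi z) * S z - chi z * U z.
  by apply/funext => z; rewrite /e -/U; ring.
have s1 : sqi (fun z => (z.2 ord0 i * chi z) * S z).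
  exact: (sqi_bM (kernelf_measurable kc1) hC).
have s2 : sqi (fun z => chi z * U z) by exact: (sqi_bM (kernelf_measurable kchi) chi1).
split; first exact: sqiB.
apply: le_trans (N2B_le s1 s2) _; apply: lerD; rewrite ler_pM2l//.
  exact: (N2_bM (kernelf_measurable kc1) hC).
apply: le_trans (N2_bM (kernelf_measurable kchi) chi1 sU) _.
by rewrite expr1n mul1r; exact: (iop_N2 ka).
Qed.

(** The integral of [energy_pointwise]: [P] integrates to zero by orthogonality once the
    convolutions are transposed onto [f], and [N] because it is a sum of divergences. *)
Lemma energy_estimate k (kx : 'I_d -> Z -> R) (a : R) f : kernelf k ->
  (forall z, k (- z) = k z) ->
  schur mu (fun z z' : Z => k (z - z')) 1 ->
  (forall j, schur mu (fun z z' : Z => (z - z').2 ord0 j * k (z - z')) a) ->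
  (forall j, schur mu (fun z z' : Z =>
     (z - z').2 ord0 j * ((z - z').2 ord0 j * k (z - z'))) a) ->
  (forall i, kernelf (kx i) /\ weighted_partial k (kx i) (ex i)) ->
  sqi f -> kinetic_orthogonal f ->
  let F := kconv k f in
  let T i := kconv (fun z => z.2 ord0 i * k z) f in
  let W i := kconv (fun z => z.2 ord0 i * (z.2 ord0 i * k z)) f in
  let e i j (z : Z) := z.2 ord0 i * (kconv k (fun z => beta i j z.1 * f z) z - beta i j z.1 * F z)
      - kconv (fun z => z.2 ord0 i * k z) (fun z => beta i j z.1 * f z) z in
  is_true (2^-1 * N2 (fun z => chi z * F z) <=
    \sum_i ip (T i) (fun z => chi z ^+ 2 * kconv (kx i) f z)
    + (2 * d.+1%:R) * (\sum_i \sum_j N2 (fun z => chi z * e i j z))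
    + \sum_i N2 (T i) + d.+1%:R * \sum_i N2 (W i)).
Proof.
move=> kk ke k1 ka kb hx sf orth F T W e.
have /choice[kv hv] : forall j, exists k', kernelf k' /\ weighted_partial k k' (ev j).
  by move=> j; have [k' h1 h2] := kernelf_partial (inr j) kk; exists k'.
have /choice[kvv hvv] : forall j, exists k', kernelf k' /\ weighted_partial (kv j) k' (ev j).
  by move=> j; have [k' h1 h2] := kernelf_partial (inr j) (hv j).1; exists k'.
pose g (z : Z) := chi z ^+ 2 * F z; pose gx i (z : Z) := chi z ^+ 2 * kconv (kx i) f z.
pose gv j (z : Z) := chi z ^+ 2 * (kconv (kv j) f z - 2^-1 * z.2 ord0 j * F z).
pose gvv j (z : Z) := chi z ^+ 2 * kconv (kvv j) f z - z.2 ord0 j * chi z ^+ 2 * kconv (kv j) f z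
  - 2^-1 * chi z ^+ 2 * F z + 4^-1 * z.2 ord0 j ^+ 2 * chi z ^+ 2 * F z.
have td : test_data g gx gv gvv := gaussian_test_data kk sf hx hv hvv.
have orth0 := orth k _ _ _ _ kk td.
case: td => -[rg rgx rgv rgvv] [dgx dgv dgvv].
have kE : kernelf E by rewrite chi_sqr; apply: gweight_kernelf; rewrite invr_gt0.
have kE1 j : kernelf (fun z => z.2 ord0 j * chi z ^+ 2) by exact: kernelf_mulv.
have kchi : kernelf chi by apply: gweight_kernelf; rewrite invr_gt0.
have chi01 z : 0 <= chi z <= 1 by apply: gweight_le1; rewrite invr_ge0.
have sF : sqi F by exact: (iop_sqi k1).
have sT i : sqi (T i) by exact: (iop_sqi (ka i)).
have sW i : sqi (W i) by exact: (iop_sqi (kb i)).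
have sbf i j : sqi (fun z => beta i j z.1 * f z) by exact: beta_sqi.
have sbF i j : sqi (fun z => beta i j z.1 * F z) by exact: beta_sqi.
have sg := regular_sqi rg.
pose P (z : Z) := \sum_i (z.2 ord0 i * F z - T i z) * gx i z
    - \sum_i \sum_j (z.2 ord0 i * kconv k (fun z => beta i j z.1 * f z) z
        - kconv (fun z => z.2 ord0 i * k z) (fun z => beta i j z.1 * f z) z) * gv j z
    - \sum_j F z * gvv j z
    + (4^-1 * (\sum_i (z.2 ord0 i ^+ 2 * F z - 2 * z.2 ord0 i * T i z + W i z) * g z)
       + F z * g z).
(* Each term of the operator is transposed separately. In the magnetic term [beta] stays with [f],
   so the convolution ends up acting on [beta f]. *)
have eP : eqint (fun z => f z * kinetic (kconv k g) (fun i => kconv k (gx i))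
    (fun j => kconv k (gv j)) (fun j => kconv k (gvv j)) z) P.
  rewrite [X in eqint X](_ : _ = fun z => \sum_i f z * (z.2 ord0 i * kconv k (gx i) z)
    - \sum_i \sum_j (beta i j z.1 * f z) * (z.2 ord0 i * kconv k (gv j) z)
    - \sum_j f z * kconv k (gvv j) z
    + (4^-1 * (\sum_i f z * (z.2 ord0 i ^+ 2 * kconv k g z)) + f z * kconv k g z)).
    apply: eqintD; last apply: eqintD.
    - apply: eqintB; first apply: eqintB.
      + by apply: eqint_sum => i; exact: (eqint_mulv kk ke k1 (ka i) sf (rgx i)).
      + apply: eqint_sum => i; apply: eqint_sum => j.
        exact: (eqint_mulv kk ke k1 (ka i) (sbf i j) (rgv j)).
      + by apply: eqint_sum => j; apply: eqint_kconv => //; exact: regular_sqi.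
    - apply: eqintZ; apply: eqint_sum => i.
      exact: (eqint_mulv2 kk ke k1 (ka i) (kb i) sf rg).
    - exact: eqint_kconv.
  apply/funext => z; rewrite /kinetic mulrDr !mulrBr !mulr_sumr; congr (_ - _ - _ + _).
    apply: eq_bigr => i _; rewrite mulr_sumr; apply: eq_bigr => j _; ring.
  rewrite /sqnorm [X in _ = X + _](_ : _ = 4^-1 * f z * kconv k g z * \sum_i z.2 ord0 i ^+ 2).
    by field.
  by rewrite !mulr_sumr; apply: eq_bigr => i _; ring.
have P0 : \int[mu]_z P z = 0 by case: eP => _ _ <-.
have iP : itg P by case: eP.
have dFx i : pderiv F (kconv (kx i) f) (ex i) by have [? ?] := hx i; exact: kconv_pderiv.
have dFv j : pderiv F (kconv (kv j) f) (ev j) by have [? ?] := hv j; exact: kconv_pderiv.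
have dEv j : pderiv E (fun z => - 2^-1 * (z.2 ord0 j * chi z ^+ 2)) (ev j).
  rewrite {1}chi_sqr; apply: pderiv_eq (pderiv_gweight_v _ _) _ => [|z]; first by rewrite invr_gt0.
  by rewrite chi_sqrE; field.
pose N1 i (z : Z) := z.2 ord0 i * chi z ^+ 2 * F z * kconv (kx i) f z.
pose N2' i j (z : Z) := 2^-1 * (i == j)%:R * chi z ^+ 2 * F z ^+ 2 + z.2 ord0 i * chi z ^+ 2 * F z * kconv (kv j) f z
        - 4^-1 * z.2 ord0 i * z.2 ord0 j * chi z ^+ 2 * F z ^+ 2.
pose N3 j (z : Z) := kconv (kv j) f z * gv j z + F z * gvv j z.
have rGi i : regular (fun z => 2^-1 * (F z * ((z.2 ord0 i * chi z ^+ 2) * F z))).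
  by apply: regularZ; apply: regular_kconvM => //; exact: (regular_kernelM (kE1 i)).
have eN1 i : eqint (N1 i) (fun=> 0).
  apply: (eqint_ibp_x (i := i) (rGi i)).
    rewrite (_ : N1 i = fun z => F z * ((z.2 ord0 i * chi z ^+ 2) * kconv (kx i) f z)).
      by apply: regular_kconvM => //; apply: (regular_kernelM (kE1 i)) => //; case: (hx i).
    by apply/funext => z; rewrite /N1; ring.
  have dE : pderiv (fun z => z.2 ord0 i * chi z ^+ 2) (fun=> 0) (ex i) by apply: pderiv_x_cst.
  apply: pderiv_eq (pderivZ (2^-1) (pderivM (dFx i) (pderivM dE (dFx i)))) _ => z.
  by rewrite /N1; field.
(* [N2'] is the [v_j]-derivative of [v_i chi^2 F^2 / 2], and its coefficient depends on [x] only. *)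
have eN2 i j : eqint (fun z => beta i j z.1 * N2' i j z) (fun=> 0).
  apply: (eqint_ibp_v (j := j) (beta_measurable i j) _ (rGi i)).
  - by exists b => x; exact: beta_bounded.
  - rewrite (_ : N2' i j = fun z => (2^-1 * (i == j)%:R) * (F z * (chi z ^+ 2 * F z))
      + (F z * ((z.2 ord0 i * chi z ^+ 2) * kconv (kv j) f z)
        + (- 4^-1) * (z.2 ord0 i * (F z * ((z.2 ord0 j * chi z ^+ 2) * F z))))).
      apply: regularD; last apply: regularD.
      + by apply: regularZ; apply: regular_kconvM => //; exact: regular_kernelM.
      + by apply: regular_kconvM => //; apply: (regular_kernelM (kE1 i)) => //; case: (hv j).
      + apply: regularZ; apply: regular_mulv; apply: regular_kconvM => //.
        exact: (regular_kernelM (kE1 j)).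
    by apply/funext => z; rewrite /N2'; ring.
  - have d1 := pderivM (pderiv_coordv i j) (dEv j).
    apply: pderiv_eq (pderivZ (2^-1) (pderivM (dFv j) (pderivM d1 (dFv j)))) _ => z.
    by rewrite /N2'; field.
have eN3 j : eqint (N3 j) (fun=> 0).
  have rN3 : regular (N3 j).
    by apply: regularD; apply: regular_kconvM => //; case: (hv j).
  have := @eqint_ibp_v (cst 1) _ (N3 j) j (measurable_cst _) _
    (regular_kconvM kk sf (rgv j)) rN3.
  under [X in eqint X]eq_fun do rewrite mul1r.
  apply; first by exists 1 => x; rewrite normr1.
  by apply: pderiv_eq (pderivM (dFv j) (dgvv j)) _ => z; rewrite /N3; ring.
pose N (z : Z) := \sum_i N1 i z - \sum_i \sum_j beta i j z.1 * N2' i j z - \sum_j N3 j z.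
have eN : eqint N (fun=> \sum_(i < d) 0 - \sum_(i < d) \sum_(j < d) 0 - \sum_(j < d) 0).
  apply: eqintB; first apply: eqintB.
  - exact: eqint_sum.
  - by apply: eqint_sum => i; exact: eqint_sum.
  - exact: eqint_sum.
have N0 : \int[mu]_z N z = 0.
  case: eN => _ _ ->; have -> : \sum_(i < d) 0 - \sum_(i < d) \sum_(j < d) 0 - \sum_(j < d) 0 = 0 :> R.
    by under [X in _ - X - _]eq_bigr do rewrite big1_eq; rewrite !big1_eq !subr0.
  by rewrite /Rintegral integral0.
have iN : itg N by case: eN.
have sce i j : sqi (fun z => chi z * e i j z).
  by have [] := @commutator_bound i j _ _ _ k1 (ka i) sf.
pose Q (z : Z) := \sum_i T i z * gx i z + (2 * d.+1%:R) * (\sum_i \sum_j (chi z * e i j z) ^+ 2)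
     + \sum_i T i z ^+ 2 + d.+1%:R * \sum_i W i z ^+ 2.
have i1 i : itg (fun z => T i z * gx i z) by apply: sqi_mul => //; exact: regular_sqi.
have i2 i : itg (fun z => \sum_j (chi z * e i j z) ^+ 2).
  by apply: itg_sum => j; case: (sce i j).
have i3 i : itg (fun z => T i z ^+ 2) by case: (sT i).
have i4 i : itg (fun z => W i z ^+ 2) by case: (sW i).
have i1s : itg (fun z => \sum_i T i z * gx i z) by exact: itg_sum.
have i2s : itg (fun z => (2 * d.+1%:R) * (\sum_i \sum_j (chi z * e i j z) ^+ 2)).
  by apply: itgZ; exact: itg_sum.
have i3s : itg (fun z => \sum_i T i z ^+ 2) by exact: itg_sum.
have i4s : itg (fun z => d.+1%:R * \sum_i W i z ^+ 2) by apply: itgZ; exact: itg_sum.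
have i12 := itgD i1s i2s; have i123 := itgD i12 i3s.
have iQ : itg Q by exact: itgD.
have scF : sqi (fun z => chi z * F z).
  apply: (sqi_bM (kernelf_measurable kchi) (C := 1)) => //.
  by move=> z; have /andP[h1 h2] := chi01 z; rewrite ger0_norm.
have EQ : \int[mu]_z Q z = \sum_i ip (T i) (gx i)
    + (2 * d.+1%:R) * (\sum_i \sum_j N2 (fun z => chi z * e i j z))
    + \sum_i N2 (T i) + d.+1%:R * \sum_i N2 (W i).
  rewrite /Q RintegralD// RintegralD// RintegralD//.
  rewrite !RintegralZl//; [|exact: itg_sum|exact: itg_sum].
  rewrite !Rint_sum//; congr (_ + _ * _ + _ + _).
  by apply: eq_bigr => i _; rewrite Rint_sum// => j; case: (sce i j).
rewrite -EQ -RintegralZl//; last by case: scF.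
apply: (@le_trans _ _ (\int[mu]_z ((P z - N z) + Q z))).
  apply: le_Rintegral => //.
  - by apply: itgZ; case: scF.
  - by apply: itgD => //; exact: itgB.
  - move=> z _; have := @energy_pointwise R d (fun i => z.2 ord0 i) (fun i => T i z)
      (fun i => W i z) (fun i => kconv (kx i) f z) (fun j => kconv (kv j) f z)
      (fun j => gvv j z) (fun i j => beta i j z.1)
      (fun i j => kconv k (fun z => beta i j z.1 * f z) z)
      (fun i j => kconv (fun z => z.2 ord0 i * k z) (fun z => beta i j z.1 * f z) z)
      (chi z) (F z) (chi01 z) (fun i j => beta_antisym i j z.1).
    by apply.
have iPN := itgB iP iN.
by rewrite RintegralD// RintegralB// P0 N0 subrr add0r.
Qed.

(** [chi] is bounded, so [chi f] is the limit of its mollified version and vanishes; [chi] is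
    positive, so [f] vanishes too. *)
Lemma gweight_vanish (kap : nat -> Z -> R) f : sqi f -> mollified kap f ->
  (forall m, sqi (kconv (kap m) f)) ->
  (forall eps, 0 < eps -> exists M, forall m, (M <= m)%N ->
     N2 (fun z => chi z * kconv (kap m) f z) <= eps) ->
  f = (fun=> 0) %[ae mu].
Proof.
move=> sf [_ cf] sk van.
have kchi : kernelf chi by apply: gweight_kernelf; rewrite invr_gt0.
have chi1 z : `|chi z| <= 1.
  by have /andP[h1 h2] := @gweight_le1 (8^-1) z (ltac:(by rewrite invr_ge0)); rewrite ger0_norm.
have schi h : sqi h -> sqi (fun z => chi z * h z).
  by move=> sh; exact: (sqi_bM (kernelf_measurable kchi) chi1).
have N0 : N2 (fun z => chi z * f z) = 0.
  apply/eqP; rewrite eq_le N2_ge0 andbT; apply/ler_addgt0Pr => eps eps0; rewrite add0r.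
  have e4 : 0 < eps / 4 by rewrite divr_gt0.
  have [M MP] := van _ e4; have [M' MP'] := cf _ e4; pose m := maxn M M'.
  have -> : (fun z => chi z * f z) = fun z => chi z * kconv (kap m) f z
      - chi z * (kconv (kap m) f z - f z) by apply/funext => z; ring.
  have sd : sqi (fun z => kconv (kap m) f z - f z) by exact: sqiB.
  apply: le_trans (N2B_le (schi _ (sk m)) (schi _ sd)) _.
  have := MP m (leq_maxl _ _); have := MP' m (leq_maxr _ _).
  by have := N2_bM (kernelf_measurable kchi) chi1 sd; rewrite expr1n mul1r; lra.
have := N2_eq0 (schi _ sf) N0; apply: filterS => z h _; have /eqP := h I.
by rewrite mulf_eq0 gt_eqF ?expR_gt0//= => /eqP.
Qed.

Lemma kinetic_orthogonal_eq0 f : sqi f -> kinetic_orthogonal f -> f = (fun=> 0) %[ae mu].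
Proof.
move=> sf orth; have [kap [a [C [[kk ke k1 mol] [aC ka kb kx]]]]] := @mollifier R d.
apply: (gweight_vanish sf (mol f sf)); first by move=> m; exact: (iop_sqi (k1 m)).
have Nf0 := N2_ge0 mu f; have h1 := @vanishing_harmonic R.
have hf := vanishingZ Nf0 h1.
have am2 m : a m ^+ 2 <= m.+1%:R^-1.
  have [a0 _ a1 _] := aC m; apply: le_trans (_ : a m <= _) => //.
  by rewrite expr2 ler_piMr// (le_trans a1)// invf_le1// ler1n.
have vT i : vanishing (fun m => N2 (kconv (fun z : Z => z.2 ord0 i * kap m z) f)).
  apply: vanishing_le hf => m; apply: le_trans (iop_N2 (ka m i) sf) _.
  by rewrite mulrC ler_wpM2l.
have vW i : vanishing (fun m => N2 (kconv (fun z : Z => z.2 ord0 i * (z.2 ord0 i * kap m z)) f)).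
  apply: vanishing_le hf => m; apply: le_trans (iop_N2 (kb m i) sf) _.
  by rewrite mulrC ler_wpM2l.
(* The strong convergence of the mollifiers is used at [beta f] and at [f]; the commutator is the
   difference of the two errors, the second multiplied by the bounded [beta]. No rate is
   obtained. *)
have vS i j : vanishing (fun m => N2 (fun z => kconv (kap m) (fun z => beta i j z.1 * f z) z
    - beta i j z.1 * kconv (kap m) f z)).
  have sbf := beta_sqi i j sf.
  have [_ v1] := mol _ sbf; have [_ v2] := mol _ sf.
  apply: vanishing_le (vanishingD (vanishingZ (ler0n R 2) v1)
    (vanishingZ (_ : 0 <= 2 * b ^+ 2) v2)); last by rewrite mulr_ge0// sqr_ge0.
  move=> m; have s1 : sqi (fun z => kconv (kap m) (fun z => beta i j z.1 * f z) z - beta i j z.1 * f z).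
    by apply: sqiB => //; exact: (iop_sqi (k1 m) sbf).
  have s2 : sqi (fun z => kconv (kap m) f z - f z).
    by apply: sqiB => //; exact: (iop_sqi (k1 m) sf).
  rewrite (_ : (fun z => _ - _) = fun z =>
    (kconv (kap m) (fun z => beta i j z.1 * f z) z - beta i j z.1 * f z)
     - beta i j z.1 * (kconv (kap m) f z - f z)).
    apply: le_trans (N2B_le s1 (beta_sqi i j s2)) _.
    rewrite lerD2l -mulrA ler_pM2l//.
    apply: (@N2_bM _ _ _ mu (fun z => beta i j z.1)) => //.
    by apply: measurableT_comp => //.
  by apply/funext => z; ring.
have /choice[kx' hkx] : forall p : nat * 'I_d, exists k', [/\ kernelf k',
    weighted_partial (kap p.1) k' (ex p.2) & schur mu (fun z z' : Z => k' (z - z')) (C p.1)].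
  by move=> [m i]; have [k' h2 [h3 h4]] := kx m i; exists k'.
pose kxm m i := kx' (m, i).
have hx m i : kernelf (kxm m i) /\ weighted_partial (kap m) (kxm m i) (ex i).
  by have [? ? _] := hkx (m, i).
(* The only product of a velocity moment with a space derivative of the kernel: Cauchy-Schwarz
   produces [a m * C m], small by the choice of the two scales. *)
have vx i : vanishing (fun m => ip (kconv (fun z : Z => z.2 ord0 i * kap m z) f)
    (fun z => chi z ^+ 2 * kconv (kxm m i) f z)).
  apply: vanishing_le hf => m; have [a0 C0 _ aC1] := aC m.
  have [kk' _ sC] := hkx (m, i).
  have kE : kernelf E by rewrite chi_sqr; apply: gweight_kernelf; rewrite invr_gt0.
  have E1 z : `|E z| <= 1.
    by rewrite /= chi_sqrE; have /andP[h2 h3] := @gweight_le1 (4^-1) z (ltac:(by rewrite invr_ge0)); rewrite ger0_norm.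
  have sFx := iop_sqi sC sf.
  have sEF := sqi_bM (kernelf_measurable kE) E1 sFx.
  have sT := iop_sqi (ka m i) sf.
  have CS := ip_CS sT sEF.
  have N1 := iop_N2 (ka m i) sf.
  have N2' := N2_bM (kernelf_measurable kE) E1 sFx; rewrite expr1n mul1r in N2'.
  have N3 := iop_N2 sC sf.
  apply: le_trans (_ : N2 f * (a m * C m) <= _); last by rewrite ler_wpM2l.
  apply: le_trans (ler_norm _) _.
  rewrite -ler_sqr ?nnegrE ?mulr_ge0// real_normK ?num_real//.
  apply: le_trans CS _.
  have -> : (N2 f * (a m * C m)) ^+ 2 = (a m ^+ 2 * N2 f) * (C m ^+ 2 * N2 f) by ring.
  by apply: ler_pM; [exact: N2_ge0|exact: N2_ge0|exact: N1|exact: le_trans N2' N3].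
pose e m i j (z : Z) := z.2 ord0 i * (kconv (kap m) (fun z => beta i j z.1 * f z) z - beta i j z.1 * kconv (kap m) f z)
      - kconv (fun z => z.2 ord0 i * kap m z) (fun z => beta i j z.1 * f z) z.
have ve i j : vanishing (fun m => N2 (fun z => chi z * e m i j z)).
  have Nb0 := N2_ge0 mu (fun z => beta i j z.1 * f z).
  apply: vanishing_le (vanishingD (vanishingZ (_ : 0 <= 2 * 2 ^+ 2) (vS i j))
     (vanishingZ (_ : 0 <= 2 * N2 (fun z => beta i j z.1 * f z)) h1)).
  - move=> m; have [_ h] := @commutator_bound i j _ _ _ (k1 m) (ka m i) sf.
    apply: le_trans h _; apply: lerD; first by rewrite mulrA.
    by rewrite -[leRHS]mulrA ler_pM2l// mulrC ler_wpM2l.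
  - by rewrite mulr_ge0// exprn_ge0.
  - by rewrite mulr_ge0.
have n0 : 0 <= d.+1%:R :> R by [].
suff : vanishing (fun m => 2 * (\sum_i ip (kconv (fun z : Z => z.2 ord0 i * kap m z) f)
       (fun z => chi z ^+ 2 * kconv (kxm m i) f z)
    + (2 * d.+1%:R) * (\sum_i \sum_j N2 (fun z => chi z * e m i j z))
    + \sum_i N2 (kconv (fun z : Z => z.2 ord0 i * kap m z) f)
    + d.+1%:R * \sum_i N2 (kconv (fun z : Z => z.2 ord0 i * (z.2 ord0 i * kap m z)) f))).
  apply: vanishing_le => m.
  have := energy_estimate (kk m) (ke m) (k1 m) (ka m) (kb m) (hx m) sf orth.
  rewrite /= -/(e m); lra.
apply: vanishingZ => //; apply: vanishingD; last first.
  by apply: vanishingZ => //; exact: vanishing_sum.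
apply: vanishingD; last exact: vanishing_sum.
apply: vanishingD; first exact: vanishing_sum.
apply: vanishingZ; first by rewrite mulr_ge0.
by apply: vanishing_sum => i; exact: vanishing_sum.
Qed.

(** Density of the domain, from the same test functions: orthogonality to the mollification of
    [chi^2 F] says that [chi F] has norm zero, for every [m]. *)
Lemma test_orthogonal_eq0 f : sqi f ->
  (forall k g gx gv gvv, kernelf k -> test_data g gx gv gvv -> ip f (kconv k g) = 0) ->
  f = (fun=> 0) %[ae mu].
Proof.
move=> sf orth; have [kap [a [C [[kk ke k1 mol] [_ _ _ kx]]]]] := @mollifier R d.
have sF m : sqi (kconv (kap m) f) by exact: (iop_sqi (k1 m)).
apply: (gweight_vanish sf (mol f sf) sF) => eps eps0; exists 0%N => m _.
have /choice[kx' hx] : forall i, exists k', kernelf k' /\ weighted_partial (kap m) k' (ex i).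
  by move=> i; have [k' h2 h3] := kernelf_partial (inl i) (kk m); exists k'.
have /choice[kv hv] : forall j, exists k', kernelf k' /\ weighted_partial (kap m) k' (ev j).
  by move=> j; have [k' h1 h2] := kernelf_partial (inr j) (kk m); exists k'.
have /choice[kvv hvv] : forall j, exists k', kernelf k' /\ weighted_partial (kv j) k' (ev j).
  by move=> j; have [k' h1 h2] := kernelf_partial (inr j) (hv j).1; exists k'.
have td := gaussian_test_data (kk m) sf hx hv hvv.
have rg : regular (fun z => chi z ^+ 2 * kconv (kap m) f z) by case: td => -[].
have := orth _ _ _ _ _ (kk m) td.
rewrite (kconv_even (ke m) (k1 m) sf (regular_sqi rg)) => h.
rewrite [X in X <= _](_ : _ = 0) ?(ltW eps0)// -h; apply: eq_Rintegral => z _.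
by ring.
Qed.

End energy.

(** * Schwartz functions and the magnetic field *)

Section schwartz_functions.
Context {R : realType} (d : nat).
Notation Z := ('rV[R]_d * 'rV[R]_d)%type.
Notation mu := (@phase_vol R d).
Notation sqi := (sqi mu).
Local Open Scope complex_scope.

(** A boolean index for real and imaginary part, so that each statement is proved once for both. *)
Definition cpart (b : bool) (w : R[i]) : R := if b then complex.Re w else complex.Im w.

Lemma cpartD b x y : cpart b (x + y) = cpart b x + cpart b y.
Proof. by case: b; case: x y => [? ?] [? ?]. Qed.

Lemma cpartN b x : cpart b (- x) = - cpart b x.
Proof. by case: b; case: x. Qed.

Lemma cpartZ b (r : R) x : cpart b (r%:C * x) = r * cpart b x.
Proof. by case: b; case: x => p q /=; rewrite mul0r ?subr0 ?addr0. Qed.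

Lemma cpart0 b : cpart b 0 = 0. Proof. by case: b. Qed.

Lemma cpart_sum b (I : Type) (s : seq I) (F : I -> R[i]) :
  cpart b (\sum_(i <- s) F i) = \sum_(i <- s) cpart b (F i).
Proof. by rewrite (big_morph (cpart b) (cpartD b) (cpart0 b)). Qed.

Lemma cpart_real b (r : R) : cpart b r%:C = if b then r else 0.
Proof. by case: b. Qed.

Lemma cpart_norm b (w : R[i]) : (`|cpart b w|)%:C <= `|w|.
Proof.
case: w => x y; rewrite /cpart normc_def /= lecR; case: b.
  by rewrite -[leLHS]ger0_norm// -sqrtr_sqr ler_wsqrtr// real_normK ?num_real// lerDl sqr_ge0.
by rewrite -[leLHS]ger0_norm// -sqrtr_sqr ler_wsqrtr// real_normK ?num_real// lerDr sqr_ge0.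
Qed.

Lemma cpart_cderive b e (u : Z -> R[i]) z :
  cpart b (cderive e u z) = 'D_e (fun y => cpart b (u y)) z.
Proof. by case: b. Qed.

Lemma cpart_eq (x y : R[i]) : (forall b, cpart b x = cpart b y) -> x = y.
Proof. by case: x y => [a b] [c e] h; have := h true; have := h false => /= -> ->. Qed.

Lemma smooth_differentiable b s (u : Z -> R[i]) z : smooth u ->
  differentiable (fun y => cpart b (iter_derive s u y)) z.
Proof. by move=> su; have [] := su s z; case: b. Qed.

Lemma smooth_pderiv b s k (u : Z -> R[i]) : smooth u ->
  pderiv (fun z => cpart b (iter_derive s u z)) (fun z => cpart b (iter_derive (k :: s) u z))
    (pdir k).
Proof.
move=> su z; apply: DeriveDef; first exact/diff_derivable/smooth_differentiable.
by rewrite [in RHS]/= cpart_cderive; case: k.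
Qed.

(** The difference quotients at the two points are the same function, so [lim] returns the same
    value, convergent or not. *)
Lemma torus_periodic_derive (F : Z -> R) e :
  (forall v, torus_periodic (fun x => F (x, v))) ->
  forall v, torus_periodic (fun x => 'D_e F (x, v)).
Proof.
move=> pF v x i; rewrite /derive.
set L := (X in lim (X @ _) = _); set L' := (X in _ = lim (X @ _)).
suff -> : L = L' by [].
apply/funext => h; rewrite /L /L' /= pF; congr (_ *: (_ - _)).
by rewrite -[in RHS](pF _ _ i); congr F; congr pair; rewrite /= addrA.
Qed.

Lemma torus_periodic_part b s (u : Z -> R[i]) :
  (forall v, torus_periodic (fun x => u (x, v))) ->
  forall v, torus_periodic (fun x => cpart b (iter_derive s u (x, v))).
Proof.
move=> pu; elim: s => [|k s IH] v x i; first by rewrite /= pu.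
by rewrite /= !cpart_cderive; exact: torus_periodic_derive.
Qed.

(** Translates the radial bounds of [schwartz] into powers of [vweight]: the inverse of
    [vweight v ^+ n] is at most [(1 + |v|^2)^(d n)], itself at most [2^(d n) (1 + |v|^(2 d n))]. *)
Lemma vweight_inv_le (n : nat) (v : 'rV[R]_d) :
  1 <= 2 ^+ (d * n) * (1 + Num.sqrt (sqnorm v) ^+ (2 * (d * n))) * vweight v ^+ n.
Proof.
have s0 : 0 <= sqnorm v by rewrite sumr_ge0// => i _; exact: sqr_ge0.
rewrite [_ ^+ (2 * _)]exprM sqr_sqrtr// -ler_pdivrMr ?exprn_gt0 ?vweight_gt0// mul1r.
have -> : (vweight v ^+ n)^-1 = \prod_(j < d) (1 + v ord0 j ^+ 2) ^+ n.
  rewrite /vweight -prodrXl -prodfV; apply: eq_bigr => j _.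
  by rewrite /cauchyw exprVn invrK.
apply: (@le_trans _ _ ((1 + sqnorm v) ^+ (d * n))).
  rewrite mulnC exprM -[d in _ ^+ d]card_ord -prodr_const; apply: ler_prod => j _.
  rewrite exprn_ge0 ?addr_ge0 ?sqr_ge0//= lerXn2r ?nnegrE ?addr_ge0 ?sqr_ge0//.
  rewrite lerD2l /sqnorm (bigD1 j)//= lerDl sumr_ge0// => i _; exact: sqr_ge0.
move: (sqnorm v) s0 => r r0; set m := (d * n)%N.
have [r1|r1] := leP r 1.
  apply: (@le_trans _ _ (2 ^+ m)); first by rewrite lerXn2r ?nnegrE ?addr_ge0//; lra.
  by rewrite ler_peMr ?exprn_ge0// lerDl exprn_ge0.
apply: (@le_trans _ _ ((2 * r) ^+ m)).
  by rewrite lerXn2r ?nnegrE ?addr_ge0 ?mulr_ge0//; lra.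
by rewrite exprMn ler_wpM2l ?exprn_ge0// lerDr.
Qed.

Lemma schwartz_regular b s (u : Z -> R[i]) : schwartz u ->
  regular (fun z => cpart b (iter_derive s u z)).
Proof.
move=> [pu su bu]; split.
- by move=> z; exact/differentiable_continuous/smooth_differentiable.
- move=> n; have [C0 h0] := bu s 0%N; have [C1 h1] := bu s (2 * (d * n))%N.
  exists (2 ^+ (d * n) * (`|C0| + `|C1|)).
    by rewrite mulr_ge0 ?exprn_ge0// addr_ge0.
  move=> [x v]; set w := iter_derive s u (x, v).
  have e0 : `|cpart b w| <= `|C0|.
    rewrite -lecR; apply: le_trans (cpart_norm b w) _; have := h0 x v.
    rewrite expr0 mul1r => /le_trans; apply; rewrite lecR; exact: ler_norm.
  have e1 : Num.sqrt (sqnorm v) ^+ (2 * (d * n)) * `|cpart b w| <= `|C1|.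
    rewrite -lecR; apply: le_trans (_ : _ <= C1%:C) _; last by rewrite lecR; exact: ler_norm.
    apply: le_trans (h1 x v); rewrite rmorphM/= ler_wpM2l ?cpart_norm//.
    by rewrite lecR exprn_ge0// sqrtr_ge0.
  have := vweight_inv_le n v; set q := vweight v ^+ n; set t := _ ^+ (2 * (d * n)) in e1 *.
  move=> hq; have q0 : 0 <= q by rewrite exprn_ge0// vweight_ge0.
  apply: (@le_trans _ _ (2 ^+ (d * n) * (1 + t) * q * `|cpart b w|)).
    by rewrite ler_peMl.
  have -> : 2 ^+ (d * n) * (1 + t) * q * `|cpart b w| =
     2 ^+ (d * n) * (`|cpart b w| + t * `|cpart b w|) * q by ring.
  by rewrite ler_wpM2r// ler_wpM2l ?exprn_ge0// lerD.
- exact: torus_periodic_part.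
Qed.

Lemma schwartz_test_data b (u : Z -> R[i]) : schwartz u ->
  test_data (fun z => cpart b (u z)) (fun i z => cpart b (cderive (ex i) u z))
    (fun j z => cpart b (cderive (ev j) u z))
    (fun j z => cpart b (cderive (ev j) (cderive (ev j) u) z)).
Proof.
move=> Su; have [_ su _] := Su; split; split.
- exact: (schwartz_regular b [::] Su).
- by move=> i; exact: (schwartz_regular b [:: inl i] Su).
- by move=> j; exact: (schwartz_regular b [:: inr j] Su).
- by move=> j; exact: (schwartz_regular b [:: inr j; inr j] Su).
- by move=> i; exact: (smooth_pderiv b [::] (inl i) su).
- by move=> j; exact: (smooth_pderiv b [::] (inr j) su).
- by move=> j; exact: (smooth_pderiv b [:: inr j] (inr j) su).
Qed.

Lemma cderive_real e (G G' : Z -> R) : pderiv G G' e ->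
  cderive e (fun z => (G z)%:C) = fun z => (G' z)%:C.
Proof.
move=> dG; apply/funext => z; rewrite /cderive /=.
by rewrite (@derive_val _ _ _ _ _ _ _ (dG z)) (@derive_cst _ _ _ 0).
Qed.

(** Reduces all Schwartz seminorms of a convolution to the decay of convolutions with kernels of the
    class. *)
Lemma iter_derive_kconv k g s : kernelf k -> sqi g ->
  exists2 k', kernelf k' & iter_derive s (fun z => (kconv k g z)%:C) = fun z => (kconv k' g z)%:C.
Proof.
move=> kk sg; elim: s => [|l s [k' kk' E]]; first by exists k.
have [k'' kk'' w] := kernelf_partial l kk'; exists k'' => //.
by rewrite /= E -(cderive_real (kconv_pderiv kk' kk'' sg w)); case: l w.
Qed.

Lemma sqnorm_vweight (v : 'rV[R]_d) : Num.sqrt (sqnorm v) * vweight v <= 1.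
Proof.
have s0 : 0 <= sqnorm v by rewrite sumr_ge0// => i _; exact: sqr_ge0.
have h : vweight v * (1 + sqnorm v) <= 1.
  have -> : vweight v = (\prod_(j < d) (1 + v ord0 j ^+ 2))^-1 by rewrite -prodfV.
  have P0 : 0 < \prod_(j < d) (1 + v ord0 j ^+ 2).
    by apply: prodr_gt0 => j _; rewrite ltr_pwDl// sqr_ge0.
  rewrite mulrC ler_pdivrMr// mul1r /sqnorm.
  suff [] : 0 <= \sum_(j < d) v ord0 j ^+ 2 /\
    1 + \sum_(j < d) v ord0 j ^+ 2 <= \prod_(j < d) (1 + v ord0 j ^+ 2) by [].
  elim/big_rec2 : _ => [|j p q _ [q0 h]]; first by rewrite addr0.
  have t0 := sqr_ge0 (v ord0 j); split; first exact: addr_ge0.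
  apply: (@le_trans _ _ ((1 + v ord0 j ^+ 2) * (1 + q))).
    by have := mulr_ge0 t0 q0; lra.
  by rewrite ler_wpM2l// addr_ge0.
apply: le_trans h; rewrite mulrC ler_wpM2l ?vweight_ge0//.
rewrite -[X in 1 + X](sqr_sqrtr s0); have := sqr_ge0 (Num.sqrt (sqnorm v) - 1).
by have := sqr_ge0 (Num.sqrt (sqnorm v)); lra.
Qed.

Lemma kconv_schwartz k g : kernelf k -> regular g -> schwartz (fun z : Z => (kconv k g z)%:C).
Proof.
move=> kk rg; have sg := regular_sqi rg; have [cg rapg _] := rg; split.
- by move=> v x i; rewrite (kconv_periodic g kk).
- move=> s z; have [k' kk' E] := iter_derive_kconv s kk sg; rewrite E; split.
    exact: kconv_differentiable.
  exact: differentiable_cst.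
- move=> s n; have [k' kk' E] := iter_derive_kconv s kk sg; rewrite E.
  have [C C0 h] := kconv_rapid kk' (continuous_measurable_phase cg) rapg n.
  exists C => x v; rewrite normc_def /= expr0n/= addr0 sqrtr_sqr -rmorphM lecR.
  apply: (@le_trans _ _ (Num.sqrt (sqnorm v) ^+ n * (C * vweight v ^+ n))).
    by rewrite ler_wpM2l ?exprn_ge0 ?sqrtr_ge0//; exact: (h (x, v)).
  rewrite mulrCA -exprMn ler_piMr// exprn_ile1 ?mulr_ge0 ?sqrtr_ge0 ?vweight_ge0//.
  exact: sqnorm_vweight.
Qed.

(** [cderive] acts on real and imaginary parts separately, while a complex scalar mixes them;
    smoothness of both parts makes the mixture differentiable. *)
Lemma iter_derive_lin (a : R[i]) (u v : Z -> R[i]) s : smooth u -> smooth v ->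
  iter_derive s (fun z => a * u z + v z) = fun z => a * iter_derive s u z + iter_derive s v z.
Proof.
move=> su sv; elim: s => [//|k s IH]; rewrite /= IH; apply/funext => z {IH}.
have du b : derivable (fun y => cpart b (iter_derive s u y)) z (pdir k).
  exact/diff_derivable/smooth_differentiable.
have dv b : derivable (fun y => cpart b (iter_derive s v y)) z (pdir k).
  exact/diff_derivable/smooth_differentiable.
set e := match k with inl i => _ | inr i => _ end.
have eE : e = pdir k by rewrite /e; case: (k).
rewrite eE; apply: cpart_eq => b; rewrite cpartD cpart_cderive.
case: a => a1 a2.
have dl (p q : R) b1 b2 : is_derive z (pdir k)
  (fun y => (p * cpart b1 (iter_derive s u y) + q * cpart b2 (iter_derive s u y))
     + cpart b (iter_derive s v y))
  ((p * 'D_(pdir k) (fun y => cpart b1 (iter_derive s u y)) z +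
    q * 'D_(pdir k) (fun y => cpart b2 (iter_derive s u y)) z)
     + 'D_(pdir k) (fun y => cpart b (iter_derive s v y)) z).
  apply: is_deriveD; last exact: DeriveDef.
  by apply: is_deriveD; apply: is_deriveZ; exact: DeriveDef.
case: b dl => dl.
  have -> : (fun y => cpart true ((a1 +i* a2) * iter_derive s u y + iter_derive s v y)) =
    fun y => (a1 * cpart true (iter_derive s u y) + (- a2) * cpart false (iter_derive s u y))
     + cpart true (iter_derive s v y).
    apply/funext => y; rewrite cpartD; congr (_ + _); case: (iter_derive s u y) => p q /=.
    by rewrite mulNr.
  by rewrite (@derive_val _ _ _ _ _ _ _ (dl a1 (- a2) true false)) /= mulNr.
have -> : (fun y => cpart false ((a1 +i* a2) * iter_derive s u y + iter_derive s v y)) =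
  fun y => (a1 * cpart false (iter_derive s u y) + a2 * cpart true (iter_derive s u y))
     + cpart false (iter_derive s v y).
  by apply/funext => y; rewrite cpartD; congr (_ + _); case: (iter_derive s u y) => p q /=.
by rewrite (@derive_val _ _ _ _ _ _ _ (dl a1 a2 false true)).
Qed.

Lemma schwartz_lin (a : R[i]) (u v : Z -> R[i]) : schwartz u -> schwartz v ->
  schwartz (fun z => a * u z + v z).
Proof.
move=> [pu su bu] [pv sv bv]; split.
- by move=> w x i; rewrite pu pv.
- move=> s z; rewrite (iter_derive_lin a s su sv).
  have du b := @smooth_differentiable b s u z su.
  have dv b := @smooth_differentiable b s v z sv.
  case: a => a1 a2; split.
    rewrite (_ : (fun y => _) = fun y => (a1 * cpart true (iter_derive s u y)
      - a2 * cpart false (iter_derive s u y)) + cpart true (iter_derive s v y)).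
      apply: differentiableD => //; apply: differentiableB; apply: differentiableM => //.
    by apply/funext => y; case: (iter_derive s u y) (iter_derive s v y) => [? ?] [? ?].
  rewrite (_ : (fun y => _) = fun y => (a1 * cpart false (iter_derive s u y)
      + a2 * cpart true (iter_derive s u y)) + cpart false (iter_derive s v y)).
    apply: differentiableD => //; apply: differentiableD; apply: differentiableM => //.
  by apply/funext => y; case: (iter_derive s u y) (iter_derive s v y) => [? ?] [? ?].
- move=> s n; have [C h] := bu s n; have [D h'] := bv s n.
  exists (Normc.normc a * C + D) => x w; rewrite (iter_derive_lin a s su sv).
  set t := (_ ^+ n)%:C; have t0 : 0 <= t by rewrite lecR exprn_ge0// sqrtr_ge0.
  apply: (@le_trans _ _ (t * (`|a| * `|iter_derive s u (x, w)| + `|iter_derive s v (x, w)|))).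
    by rewrite ler_wpM2l// -normrM ler_normD.
  rewrite mulrDr rmorphD rmorphM/= lerD//; last exact: h'.
  by rewrite mulrCA ler_wpM2l//; exact: h.
Qed.

End schwartz_functions.

(** * The magnetic field as a bounded antisymmetric matrix *)

Section magnetic_field.
Context {R : realType}.
Local Open Scope complex_scope.

Lemma Linfty_bounded d (T : measurableType d) (mu : {measure set T -> \bar R}) (f : T -> R) :
  f \in Lfun mu +oo%E ->
  measurable_fun setT f /\ exists2 M, 0 <= M & \forall x \ae mu, `|f x| <= M.
Proof.
move=> /andP[]; rewrite !inE /= => mf; split=> //.
move: b; rewrite /finite_norm unlock /Lnorm; case: ifPn => [_ h|mu0 _].
  have [|M hM] := @ess_sup_inf.ess_supr_bounded _ _ _ mu (fun x => `|f x|); first exact: h.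
  exists `|M| => //; apply: filterS hM => x /le_trans; apply; exact: ler_norm.
(* For a null measure the norm is 0 by convention, and the whole space is taken as the exceptional
   set. *)
exists 0 => //; exists setT; split=> //.
by apply/eqP; rewrite eq_le measure_ge0 andbT leNgt.
Qed.

(** The field is bounded almost everywhere, whereas the energy method works with a bound at every
    point; truncation changes the field on a null set only. *)
Definition clamp (M x : R) : R := Num.max (- M) (Num.min x M).

Lemma clamp_le M x : 0 <= M -> `|clamp M x| <= M.
Proof.
by move=> M0; rewrite /clamp ler_norml le_max lexx/= ge_max ge_min lexx orbT andbT; lra.
Qed.

Lemma clamp_id M x : `|x| <= M -> clamp M x = x.
Proof.
rewrite ler_norml => /andP[h1 h2]; rewrite /clamp (min_idPl h2).
exact/max_idPr.
Qed.

(** The Levi-Civita symbols. They put the formulas of dimensions 2 and 3 into the single form of an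
    antisymmetric matrix [beta i j], after which the dimension is arbitrary. *)
Definition levi2 (i j : 'I_2) (l : 'I_1) : R :=
  ((i == 0 :> nat) && (j == 1 :> nat))%:R - ((j == 0 :> nat) && (i == 1 :> nat))%:R.

Definition levi3 (i j l : 'I_3) : R :=
  ((i == (l.+1 %% 3)%N :> nat) && (j == (l.+2 %% 3)%N :> nat))%:R
   - ((j == (l.+1 %% 3)%N :> nat) && (i == (l.+2 %% 3)%N :> nat))%:R.

Lemma wedge_grad2 (b : 'rV[R]_1) (v : 'rV[R]_2) (D : 'I_2 -> R[i]) :
  @wedge_grad R 2 b v D =
  \sum_i \sum_j (\sum_l levi2 i j l * b ord0 l)%:C * ((v ord0 i)%:C * D j).
Proof.
rewrite !big_ord_recl !big_ord0 /levi2 /=.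
have -> : lift ord0 ord0 = 1 :> 'I_2 by exact: val_inj.
have -> : (0 : 'I_1) = ord0 by exact: val_inj.
have -> : (0 : 'I_2) = ord0 by exact: val_inj.
rewrite !(subrr, subr0, sub0r, mul0r, mul1r, mulN1r, addr0, add0r, mulr0, rmorph0, rmorphN)/=.
by ring.
Qed.

Lemma wedge_grad3 (b v : 'rV[R]_3) (D : 'I_3 -> R[i]) :
  @wedge_grad R 3 b v D =
  \sum_i \sum_j (\sum_l levi3 i j l * b ord0 l)%:C * ((v ord0 i)%:C * D j).
Proof.
rewrite !big_ord_recl !big_ord0 /levi3 /=.
have -> : lift ord0 (lift ord0 ord0) = 2 :> 'I_3 by exact: val_inj.
have -> : lift ord0 ord0 = 1 :> 'I_3 by exact: val_inj.
have -> : (0 : 'I_1) = ord0 by exact: val_inj.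
have -> : (0 : 'I_3) = ord0 by exact: val_inj.
rewrite !(subrr, subr0, sub0r, mul0r, mul1r, mulN1r, addr0, add0r, mulr0, rmorph0, rmorphN)/=.
by ring.
Qed.

Lemma wedge_grad_beta (d : nat) (hd : d = 2%N \/ d = 3%N)
    (B : 'rV[R]_d -> 'rV[R]_((d * d.-1)./2)) : Linfty_torus B ->
  exists (beta : 'I_d -> 'I_d -> 'rV[R]_d -> R) (b : R),
  [/\ forall i j, measurable_fun setT (beta i j), forall i j x, `|beta i j x| <= b,
      forall i j x, beta i j x = - beta j i x &
      \forall x \ae @torus_vol R d, forall v D,
        wedge_grad (B x) v D = \sum_i \sum_j (beta i j x)%:C * ((v ord0 i)%:C * D j)].
Proof.
move=> [_ hB].
have [eps [ea we]] : exists eps : 'I_d -> 'I_d -> 'I_((d * d.-1)./2) -> R,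
    (forall i j l, eps i j l = - eps j i l) /\
    forall (b : 'rV[R]_((d * d.-1)./2)) v D, wedge_grad b v D =
      \sum_i \sum_j (\sum_l eps i j l * b ord0 l)%:C * ((v ord0 i)%:C * D j).
  case: hd B hB => -> B hB.
    exists levi2; split; last exact: wedge_grad2.
    by move=> i j l; rewrite /levi2 opprB.
  exists levi3; split; last exact: wedge_grad3.
  by move=> i j l; rewrite /levi3 opprB.
have hB' l := Linfty_bounded (hB l).
have /choice[M MP] : forall l, exists M, 0 <= M /\ \forall x \ae @torus_vol R d, `|B x ord0 l| <= M.
  by move=> l; have [_ [M M0 h]] := hB' l; exists M.
exists (fun i j x => \sum_l eps i j l * clamp (M l) (B x ord0 l)).
exists (\sum_i \sum_j \sum_l `|eps i j l| * M l); split.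
- move=> i j; apply: measurable_sum => l; apply: measurable_funM => //.
  apply: measurable_maxr => //; apply: measurable_minr => //.
  by case: (hB' l).
- move=> i j x; apply: le_trans (ler_norm_sum _ _ _) _.
  apply: (@le_trans _ _ (\sum_l `|eps i j l| * M l)).
    by apply: ler_sum => l _; rewrite normrM ler_wpM2l// clamp_le//; case: (MP l).
  have h0 i' j' : 0 <= \sum_l `|eps i' j' l| * M l.
    by apply: sumr_ge0 => l _; rewrite mulr_ge0//; case: (MP l).
  rewrite [leRHS](bigD1 i)//= (bigD1 j)//= -addrA lerDl addr_ge0// sumr_ge0// => i' _.
  exact: sumr_ge0.
- by move=> i j x; rewrite -sumrN; apply: eq_bigr => l _; rewrite ea mulNr.
- have : \forall x \ae @torus_vol R d, forall l, `|B x ord0 l| <= M l.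
    by apply: filter_forall => l; case: (MP l).
  apply: filterS => x hx v D; rewrite we; apply: eq_bigr => i _; apply: eq_bigr => j _.
  by congr (_%:C * _); apply: eq_bigr => l _; rewrite clamp_id.
Qed.

Lemma ae_torus_phase (d : nat) (P : 'rV[R]_d -> Prop) :
  (\forall x \ae @torus_vol R d, P x) -> \forall z \ae @phase_vol R d, P z.1.
Proof.
move=> [N [mN N0 h]]; exists (N `*` setT); split.
- exact: measurableX.
- transitivity (@torus_vol R d N * @vol R d setT)%E; first exact: product_measure1E.
  (* The convention [0 * +oo = 0] deals with the velocity space of infinite volume. *)
  by rewrite N0 mul0e.
- by move=> z nP; split=> //; apply: h.
Qed.

End magnetic_field.

(** * The Hilbert space and its orthogonal projections *)

Section L2_parts.
Context d (T : measurableType d) (R : realType).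
Variable mu : {measure set T -> \bar R}.
Notation itg f := (mu.-integrable setT (EFin \o f)).
Notation sqi := (sqi mu).
Notation N2 := (N2 mu).
Notation ip := (ip mu).
Notation H := (L2 mu).
Local Open Scope complex_scope.
Local Open Scope quotient_scope.
Implicit Types (f g h : H) (p q : T -> R).

Lemma Lfun2_sqi p : p \in Lfun mu 2%:E <-> sqi p.
Proof.
have E : measurable_fun setT p -> ((\int[mu]_x (`|p x| `^ 2)%:E)%E < +oo)%E = 
    ((\int[mu]_x `|(p x ^+ 2)%:E|)%E < +oo)%E.
  move=> mp; congr (_ < _)%E; apply: eq_integral => x _.
  by rewrite powR_mulrn// abse_EFin normrX.
split.
  move=> /andP[]; rewrite !inE /= => mp; rewrite /finite_norm unlock /Lnorm => fp; split=> //.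
  apply/integrableP; split.
    by apply/measurable_EFinP; exact: measurable_funX.
  have : (\int[mu]_x (`|p x| `^ 2)%:E < +oo)%E.
    rewrite ltNge leye_eq; apply/negP => /eqP e; move: fp.
    rewrite (_ : (\int[mu]_x _)%E = +oo%E); first by rewrite poweRyr ?ltxx// invr_eq0.
    by rewrite -e; apply: eq_integral.
  by rewrite E.
move=> [mp /integrableP[_]] fp; apply/andP; split; rewrite inE//=.
rewrite /finite_norm unlock /Lnorm; apply: poweR_lty.
by rewrite E.
Qed.

Definition L2part b (h : H) (z : T) : R := cpart b ((repr h : T -> R[i]) z).

Lemma L2part_sqi b h : sqi (L2part b h).
Proof.
apply/Lfun2_sqi; rewrite /L2part; case: (repr h) => u /= /andP[h1 h2].
by case: b.
Qed.

Lemma L2part_measurable b h : measurable_fun setT (L2part b h).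
Proof. by case: (L2part_sqi b h). Qed.

Lemma L2_exists p q : sqi p -> sqi q -> exists h, represents h (fun z => p z +i* q z).
Proof.
move=> sp sq; have hu : (fun z => p z +i* q z : R[i]^o) \in is_L2 mu.
  by apply/andP; split; [exact: (Lfun2_sqi p).2|exact: (Lfun2_sqi q).2].
exists (\pi_(H) (L2Fun hu)); rewrite /represents.
exact: (L2_repr_pi (L2Fun hu)).
Qed.

Lemma L2partD b g h : L2part b (g + h) = (fun z => L2part b g z + L2part b h z) %[ae mu].
Proof.
have := L2_repr_pi (repr g + repr h); rewrite pi_L2D !reprK.
by apply: filterS => z /(_ I) e _; rewrite /L2part e; exact: cpartD.
Qed.

Lemma repr_scale (a : R[i]) h : (repr (a *: h) : T -> R[i]) = (fun z => a * (repr h : T -> R[i]) z) %[ae mu].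
Proof.
by have := L2_repr_pi (a *: repr h); rewrite pi_L2Z reprK.
Qed.

Lemma L2partZ b (r : R) h : L2part b (r%:C *: h) = (fun z => r * L2part b h z) %[ae mu].
Proof. by have := repr_scale r%:C h; apply: filterS => z /(_ I); rewrite /L2part => -> _; exact: cpartZ. Qed.

(** Accretivity involves only the real part, so [L2] is treated as a real Hilbert space under this
    scalar product. *)
Definition rdot g h : R := complex.Re (L2_dot g h).
Definition n2 h : R := rdot h h.

Lemma rdotE g h : rdot g h = ip (L2part true g) (L2part true h) + ip (L2part false g) (L2part false h).
Proof.
rewrite /rdot /= /ip -RintegralD//; [|apply: sqi_mul; exact: L2part_sqi..].
apply: eq_Rintegral => z _; rewrite /L2part.
by case: ((repr g : T -> R[i]) z) ((repr h : T -> R[i]) z) => [a1 a2] [b1 b2] /=; rewrite mulrN opprK.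
Qed.

Lemma n2E h : n2 h = N2 (L2part true h) + N2 (L2part false h).
Proof. by rewrite /n2 rdotE !ipxx. Qed.

Lemma rdotC g h : rdot g h = rdot h g.
Proof. by rewrite !rdotE ![ip (L2part _ g) _]ipC. Qed.

Lemma rdotDl f g h : rdot (f + g) h = rdot f h + rdot g h.
Proof.
have E b : ip (L2part b (f + g)) (L2part b h) = ip (L2part b f) (L2part b h) + ip (L2part b g) (L2part b h).
  rewrite -ipDl; [|exact: L2part_sqi..].
  apply: ae_eq_ip;
    [exact: L2part_measurable|exact: L2part_measurable| |exact: L2part_measurable|exact: L2partD|exact: aeW].
  by apply: measurable_funD; exact: L2part_measurable.
by rewrite !rdotE !E; ring.
Qed.

Lemma rdotZl (r : R) g h : rdot (r%:C *: g) h = r * rdot g h.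
Proof.
have E b : ip (L2part b (r%:C *: g)) (L2part b h) = r * ip (L2part b g) (L2part b h).
  rewrite -ipZl; [|exact: L2part_sqi..].
  apply: ae_eq_ip;
    [exact: L2part_measurable|exact: L2part_measurable| |exact: L2part_measurable|exact: L2partZ|exact: aeW].
  by apply: measurable_funM => //; exact: L2part_measurable.
by rewrite !rdotE !E mulrDr.
Qed.

Lemma n2_ge0 h : 0 <= n2 h.
Proof. by rewrite n2E addr_ge0// N2_ge0. Qed.

Lemma n2_eq0 h : n2 h = 0 -> h = 0.
Proof.
rewrite n2E => /eqP; rewrite paddr_eq0 ?N2_ge0// => /andP[/eqP h1 /eqP h2].
have e1 := N2_eq0 (L2part_sqi true h) h1; have e2 := N2_eq0 (L2part_sqi false h) h2.
rewrite -[LHS]reprK; have <- : \pi_(H) (0 : L2fun mu) = 0 by exact: pi_zeror.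
apply/L2_eqP; apply: filterS2 e1 e2 => z e1 e2 _; apply: cpart_eq => b.
by case: b; [exact: e1|exact: e2].
Qed.

Lemma L2_norm_n2 h : `|h| = (Num.sqrt (n2 h))%:C.
Proof.
have nE : `|h| = (fine (Lnorm2 mu (repr h)))%:C by [].
rewrite nE; congr (_%:C); rewrite /n2 /rdot L2_dotxx nE -rmorphXn/=.
by rewrite sqrtr_sqr ger0_norm// fine_ge0// Lnorm_ge0.
Qed.

Lemma n2Z (a : R[i]) h : n2 (a *: h) = Normc.normc a ^+ 2 * n2 h.
Proof.
have : `|a *: h| = `|a| * `|h| by exact: normrZ.
rewrite !L2_norm_n2 => /(congr1 (fun c => complex.Re c ^+ 2)).
rewrite [`|a|]normc_def /= mul0r subr0 exprMn !sqr_sqrtr ?n2_ge0//.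
  by case: a => p q /=; rewrite sqr_sqrtr// addr_ge0// sqr_ge0.
by rewrite addr_ge0// sqr_ge0.
Qed.

Lemma n2Zr (r : R) h : n2 (r%:C *: h) = r ^+ 2 * n2 h.
Proof. by rewrite n2Z /= expr0n addr0 sqr_sqrtr ?sqr_ge0. Qed.

Lemma scaleNr1 h : (- 1 : R)%:C *: h = - h.
Proof. by rewrite rmorphN/= scaleN1r. Qed.

Lemma rdotNl g h : rdot (- g) h = - rdot g h.
Proof. by rewrite -scaleNr1 rdotZl mulN1r. Qed.

Lemma rdotBl f g h : rdot (f - g) h = rdot f h - rdot g h.
Proof. by rewrite rdotDl rdotNl. Qed.

Lemma rdotDr f g h : rdot f (g + h) = rdot f g + rdot f h.
Proof. by rewrite rdotC rdotDl ![rdot _ f]rdotC. Qed.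

Lemma rdotNr g h : rdot g (- h) = - rdot g h.
Proof. by rewrite rdotC rdotNl rdotC. Qed.

Lemma rdotBr f g h : rdot f (g - h) = rdot f g - rdot f h.
Proof. by rewrite rdotDr rdotNr. Qed.

Lemma rdotZr (r : R) g h : rdot g (r%:C *: h) = r * rdot g h.
Proof. by rewrite rdotC rdotZl rdotC. Qed.

Lemma n2D g h : n2 (g + h) = n2 g + 2 * rdot g h + n2 h.
Proof. by rewrite /n2 rdotDl !rdotDr [rdot h g]rdotC; ring. Qed.

Lemma n2N h : n2 (- h) = n2 h.
Proof. by rewrite /n2 rdotNl rdotNr opprK. Qed.

Lemma n2B g h : n2 (g - h) = n2 g - 2 * rdot g h + n2 h.
Proof. by rewrite n2D rdotNr n2N; ring. Qed.

Lemma rdot_young (t : R) g h : 0 < t -> 2 * rdot g h <= t * n2 g + t^-1 * n2 h.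
Proof.
move=> t0; have := n2_ge0 (t%:C *: g - h); rewrite n2B n2Zr rdotZl => h0.
have -> : t * n2 g + t^-1 * n2 h = 2 * rdot g h
    + t^-1 * (t ^+ 2 * n2 g - 2 * (t * rdot g h) + n2 h) by field; rewrite gt_eqF.
by rewrite lerDl mulr_ge0// invr_ge0 ltW.
Qed.

Lemma n2D_le g h : n2 (g + h) <= 2 * n2 g + 2 * n2 h.
Proof. by have := n2_ge0 (g - h); rewrite n2B n2D; lra. Qed.

End L2_parts.

(** * Completeness of L^2 and density by orthogonality *)

Section riesz_fischer.
Context d (T : measurableType d) (R : realType).
Variable mu : {measure set T -> \bar R}.
Notation itg f := (mu.-integrable setT (EFin \o f)).
Notation sqi := (sqi mu).
Notation N2 := (N2 mu).

Lemma sum_half_le n : \sum_(0 <= k < n) (2 ^+ k)^-1 <= 2 :> R.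
Proof.
suff -> : \sum_(0 <= k < n) (2 ^+ k)^-1 = 2 - 2 * (2 ^+ n)^-1 :> R.
  by rewrite lerBlDr lerDl mulr_ge0// invr_ge0 exprn_ge0.
elim: n => [|n IH]; first by rewrite big_nil expr0 invr1; ring.
by rewrite big_nat_recr//= IH exprS invfM; have := expf_neq0 n (@lt0r_neq0 R 2 (ltr0n _ 2)); move=> h; field.
Qed.

Variable F : nat -> T -> R.
Hypothesis sF : forall n, sqi (F n).
Hypothesis fast : forall n, N2 (fun z => F n.+1 z - F n z) <= (8 ^+ n)^-1.

Let dF n z := F n.+1 z - F n z.

Let sdF n : sqi (dF n). Proof. exact: sqiB. Qed.

(** The constant 4 is stable under the recursion, in units of [8^-n]: the step gives
    [2 * 4 / 8 + 2 = 3]. *)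
Let tail n k : N2 (fun z => F (n + k)%N z - F n z) <= 4 * (8 ^+ n)^-1.
Proof.
have p8 m : 0 < (8 ^+ m)^-1 :> R by rewrite invr_gt0 exprn_gt0.
elim: k n => [|k IH] n.
  rewrite addn0 (_ : N2 _ = 0); first by rewrite mulr_ge0// ltW.
  rewrite /N2 /Rintegral (eq_integral (cst 0%E)) ?integral0//.
  by move=> z _; rewrite subrr expr0n.
have -> : (fun z => F (n + k.+1)%N z - F n z) = fun z => (F (n.+1 + k)%N z - F n.+1 z) + dF n z.
  by apply/funext => z; rewrite addSnnS /dF; ring.
apply: le_trans (N2D_le _ (sdF n)) _; first exact: sqiB.
have := IH n.+1; have := fast n; rewrite -/(dF n) exprS invfM; have := p8 n.
by move: (N2 _) (N2 _) (8 ^+ n)^-1 => x y q; lra.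
Qed.

(** The weights [2^k] serve twice: the integral is finite since [2^k / 8^k <= 2^-k], and finiteness
    of the sum at a point gives absolute convergence there by [2 y <= 2^-k + 2^k y^2]. *)
Let G z := (\sum_(0 <= k <oo) ((2 ^+ k * dF k z ^+ 2)%:E : \bar R))%E.

Let ae_summable : \forall z \ae mu, G z \is a fin_num.
Proof.
have mf k : measurable_fun setT (fun z => (2 ^+ k * dF k z ^+ 2)%:E : \bar R).
  apply/measurable_EFinP; apply: measurable_funM => //; apply: measurable_funX.
  by case: (sdF k).
have f0 k z : setT z -> (0 <= (2 ^+ k * dF k z ^+ 2)%:E :> \bar R)%E.
  by rewrite lee_fin mulr_ge0 ?sqr_ge0// exprn_ge0.
have mG : measurable_fun setT G.
  exact: (@ge0_emeasurable_sum _ _ _ setT (fun k z => (2 ^+ k * dF k z ^+ 2)%:E) xpredT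
    (fun k z Dz _ => f0 k z Dz) (fun k _ => mf k)).
have iG : mu.-integrable setT G.
  apply/integrableP; split=> //.
  rewrite (eq_integral G) => [|z _]; last first.
    by rewrite gee0_abs// nneseries_ge0// => k _ _; exact: f0.
  rewrite integral_nneseries//; apply: le_lt_trans (ltry 2).
  apply: lime_le; first by apply: is_cvg_nneseries => n _ _; apply: integral_ge0 => z; exact: f0.
  apply: nearW => n; apply: (@le_trans _ _ (\sum_(0 <= k < n) ((2 ^+ k)^-1)%:E)%E).
    apply: lee_sum => k _.
    have i2 : itg (fun z => 2 ^+ k * dF k z ^+ 2) by apply: itgZ; case: (sdF k).
    rewrite -(itg_EFin i2) lee_fin RintegralZl//; last by case: (sdF k).
    apply: (@le_trans _ _ (2 ^+ k * (8 ^+ k)^-1)).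
      by rewrite ler_wpM2l ?exprn_ge0//; exact: fast.
    rewrite (_ : 8 = 2 * 4); last by ring.
    rewrite exprMn invfM mulrA mulfV ?expf_neq0// mul1r lef_pV2 ?posrE ?exprn_gt0//.
    by rewrite lerXn2r ?nnegrE// ler_nat.
  by rewrite sumEFin lee_fin sum_half_le.
by have := integrable_ae measurableT iG; apply: filterS => z; exact.
Qed.

Let ae_cvg : \forall z \ae mu, cvgn (fun n => F n z).
Proof.
apply: filterS ae_summable => z Gz.
have -> : (fun n => F n z) = fun n => F 0%N z + series (dF^~ z) n.
  apply/funext; elim=> [|n IH]; first by rewrite /series/= big_nil addr0.
  by rewrite seriesSr /dF addrA -IH; ring.
apply: is_cvgD; first exact: is_cvg_cst.
apply: normed_cvg; apply: nondecreasing_is_cvgn.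
  by apply: nondecreasing_series => n _ _; exact: normr_ge0.
exists (1 + fine (G z) / 2) => _ [n _ <-]; rewrite /series/=.
apply: (@le_trans _ _ (\sum_(0 <= k < n) ((2 ^+ k)^-1 / 2 + (2 ^+ k * dF k z ^+ 2) / 2))).
  apply: ler_sum => k _; have q0 : 0 < 2 ^+ k :> R by rewrite exprn_gt0.
  have := sqr_ge0 (2 ^+ k * `|dF k z| - 1).
  rewrite -[X in _ + _ * X / 2]real_normK ?num_real//; move: (2 ^+ k) q0 (`|dF k z|) => q q0 y h.
  have -> : q^-1 / 2 + q * y ^+ 2 / 2 = y + q^-1 / 2 * (q * y - 1) ^+ 2 by field; rewrite gt_eqF.
  by rewrite lerDl mulr_ge0// divr_ge0// invr_ge0 ltW.
rewrite big_split/= -!mulr_suml; apply: lerD.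
  by rewrite ler_pdivrMr// mul1r sum_half_le.
rewrite ler_pM2r ?invr_gt0// -lee_fin fineK// -sumEFin.
by apply: nneseries_lim_ge => k _ _; rewrite lee_fin mulr_ge0 ?sqr_ge0// exprn_ge0.
Qed.

(** The upper limit provides a measurable function defined everywhere, and Fatou's lemma carries the
    tail estimate over to it. *)
Lemma riesz_fischer : exists2 h, sqi h &
  forall n, N2 (fun z => h z - F n z) <= 4 * (8 ^+ n)^-1.
Proof.
pose h z := fine (limn_esup (fun n => (F n z)%:E)).
have mF n : measurable_fun setT (F n) by case: (sF n).
have mh : measurable_fun setT h.
  apply: (@measurableT_comp _ _ _ _ _ _ fine) => //.
  by apply: measurable_fun_limn_esup => n; exact/measurable_EFinP.
have ch : \forall z \ae mu, F n z @[n --> \oo] --> h z.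
  apply: filterS ae_cvg => z /cvg_ex[l hl].
  have hE : (F n z)%:E @[n --> \oo] --> l%:E by apply: cvg_EFin => //; exact: nearW.
  by rewrite /h (cvg_limn_einf_sup hE).2.
have est n : (\int[mu]_z ((h z - F n z) ^+ 2)%:E <= (4 * (8 ^+ n)^-1)%:E)%E.
  pose f k z := ((F (n + k)%N z - F n z) ^+ 2)%:E : \bar R.
  have mf k : measurable_fun setT (f k).
    by apply/measurable_EFinP; apply: measurable_funX; exact: measurable_funB.
  have f0 k z : setT z -> (0 <= f k z)%E by rewrite lee_fin sqr_ge0.
  have := @fatou _ _ _ mu setT measurableT f mf f0.
  rewrite (_ : (\int[mu]_z ((h z - F n z) ^+ 2)%:E)%E = (\int[mu]_z limn_einf (f^~ z))%E).
    move=> /le_trans; apply; rewrite limn_einf_lim; apply: lime_le.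
      exact: is_cvg_einfs.
    apply: nearW => k; apply: (@le_trans _ _ (\int[mu]_z f k z)%E).
      by apply: ereal_inf_lbound; exists k => //=.
    have ifk : itg (fun z => (F (n + k)%N z - F n z) ^+ 2) by case: (sqiB (sF (n + k)%N) (sF n)).
    by rewrite /f -(itg_EFin ifk) lee_fin; exact: tail.
  apply: ae_eq_integral => //.
  - by apply/measurable_EFinP; apply: measurable_funX; exact: measurable_funB.
  - have -> : (fun z => limn_einf (f^~ z)) = fun z => (- limn_esup ((fun k => - f k z)%E))%E.
      apply/funext => z; rewrite -limn_einfN; congr limn_einf.
      by apply/funext => k; exact/esym/oppeK.
    apply: measurableT_comp => //; apply: measurable_fun_limn_esup => k.
    exact: measurableT_comp.
  - apply: filterS ch => z hz _; apply/esym; apply: (cvg_limn_einf_sup _).1.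
    apply: cvg_EFin; first exact: nearW.
    have hz' : F (n + k)%N z @[k --> \oo] --> h z.
      by move: hz; rewrite -(cvg_shiftn n (F^~ z)) /=; under eq_fun do rewrite addnC.
    apply: cvgM; apply: cvgB => //; exact: cvg_cst.
have sh n : sqi (fun z => h z - F n z).
  split; first exact: measurable_funB.
  apply/integrableP; split.
    by apply/measurable_EFinP; apply: measurable_funX; exact: measurable_funB.
  under eq_integral do rewrite gee0_abs ?lee_fin ?sqr_ge0//.
  exact: le_lt_trans (est n) (ltry _).
exists h.
  rewrite (_ : h = fun z => (h z - F 0%N z) + F 0%N z); first exact: sqiD.
  by apply/funext => z; rewrite subrK.
move=> n; have [_ ih] := sh n; rewrite -lee_fin itg_EFin//; exact: est.
Qed.

End riesz_fischer.

Section L2_complete.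
Context d (T : measurableType d) (R : realType).
Variable mu : {measure set T -> \bar R}.
Notation N2 := (N2 mu).
Notation H := (L2 mu).
Local Open Scope complex_scope.

Lemma L2part_N2B b (g h : H) : N2 (fun z => L2part b g z - L2part b h z) = N2 (L2part b (g - h)).
Proof.
apply: ae_eq_N2; last 1 first.
- have e1 := L2partD b g (- h); have e2 := L2partZ b (- 1) h; rewrite scaleNr1 in e2.
  by apply: filterS2 e1 e2 => z /(_ I) -> /(_ I) -> _; rewrite mulN1r.
- by apply: measurable_funB; exact: L2part_measurable.
- exact: L2part_measurable.
Qed.

Lemma N2_L2part_le b (h : H) : N2 (L2part b h) <= n2 h.
Proof. by rewrite n2E; case: b; rewrite ?lerDl ?lerDr N2_ge0. Qed.

Lemma L2_complete (x : nat -> H) : (forall n, n2 (x n.+1 - x n) <= (8 ^+ n)^-1) ->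
  exists y, forall n, n2 (y - x n) <= 8 * (8 ^+ n)^-1.
Proof.
move=> fast.
have RF b : exists2 h, sqi mu h &
    forall n, N2 (fun z => h z - L2part b (x n) z) <= 4 * (8 ^+ n)^-1.
  apply: riesz_fischer => n; first exact: L2part_sqi.
  by rewrite L2part_N2B; apply: le_trans (N2_L2part_le _ _) (fast n).
have [p sp hp] := RF true; have [q sq hq] := RF false.
have [y yE] := L2_exists sp sq; exists y => n.
have partE b : L2part b y = (if b then p else q) %[ae mu].
  by apply: filterS yE => z /(_ I) e _; rewrite /L2part e; case: b.
rewrite n2E -!L2part_N2B.
have N2E b : N2 (fun z => L2part b y z - L2part b (x n) z) =
    N2 (fun z => (if b then p else q) z - L2part b (x n) z).
  apply: ae_eq_N2.
  - by apply: measurable_funB; exact: L2part_measurable.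
  - by apply: measurable_funB; [case: b; [case: sp|case: sq]|exact: L2part_measurable].
  - by apply: filterS (partE b) => z /(_ I) -> _.
rewrite !N2E; have := hp n; have := hq n.
by move: (8 ^+ n)^-1 => r; lra.
Qed.

(* Cauchy property of a minimizing sequence by the parallelogram identity, then
   the residual [x - lim v] is orthogonal to [V], hence zero. *)
Lemma dense_of_orthogonal (V : set H) : V 0 -> (forall x y, V x -> V y -> V (x + y)) ->
  (forall (t : R) x, V x -> V (t%:C *: x)) ->
  (forall x, (forall v, V v -> rdot x v = 0) -> x = 0) ->
  forall x eps, 0 < eps -> exists2 v, V v & n2 (x - v) <= eps.
Proof.
move=> V0 VD VZ Vo x eps eps0; apply: contrapT => /forall2NP far.
have far' v : V v -> eps < n2 (x - v).
  by move=> Vv; have [//|/negP] := far v; rewrite -ltNge.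
pose S := [set n2 (x - v) | v in V].
have S0 : S (n2 (x - 0)) by exists 0.
have lS : lbound S 0 by move=> _ [v _ <-]; exact: n2_ge0.
have iS : has_inf S by split; [exists (n2 (x - 0))|exists 0].
pose delta := inf S.
have dle v : V v -> delta <= n2 (x - v) by move=> Vv; apply: ge_inf; [exists 0|exists v].
(* The parallelogram identity bounds the squared increments by [4 * eta n], within the rate [8^-n]
   required by [L2_complete]. *)
pose eta n : R := 16^-1 * (8 ^+ n)^-1.
have eta0 n : 0 < eta n by rewrite mulr_gt0 ?invr_gt0// exprn_gt0.
have /choice[v vP] : forall n, exists v, V v /\ n2 (x - v) <= delta + eta n.
  move=> n; have [_ [v Vv <-] h] := inf_adherent (eta0 n) iS.
  by exists v; split=> //; exact: ltW.
have Vv n : V (v n) by case: (vP n).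
have vd n : n2 (x - v n) <= delta + eta n by case: (vP n).
have etaS n : eta n.+1 <= eta n.
  by rewrite /eta exprS invfM; have : 0 < (8 ^+ n)^-1 :> R by [rewrite invr_gt0 exprn_gt0]; lra.
have cau n : n2 (v n.+1 - v n) <= (8 ^+ n)^-1.
  pose m := (2^-1)%:C *: (v n.+1 + v n).
  have Vm : V m by apply: VZ; exact: VD.
  have par : n2 (v n.+1 - v n) = 2 * n2 (x - v n.+1) + 2 * n2 (x - v n) - 4 * n2 (x - m).
    by rewrite /m !(n2B, n2D, n2Zr, rdotZr, rdotDr) [rdot (v n.+1) (v n)]rdotC; field.
  have := dle m Vm; have := vd n; have := vd n.+1; have := etaS n; rewrite par.
  have -> : (8 ^+ n)^-1 = 16 * eta n by rewrite /eta; field; rewrite expf_neq0.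
  by have := eta0 n; lra.
have [y yP] := L2_complete cau.
have small (r c : R) : 0 <= c -> (forall n, r <= c * (8 ^+ n)^-1) -> r <= 0.
  move=> c0 h; apply/ler_addgt0Pr => e e0; rewrite add0r.
  have [M _ hM] := nbhs_infty_ger (c / e); have := hM M (leqnn _).
  rewrite ler_pdivrMr// => hc; apply: le_trans (h M) _.
  rewrite ler_pdivrMr ?exprn_gt0//; apply: le_trans hc _; rewrite mulrC ler_wpM2l ?(ltW e0)//.
  by rewrite -natrX ler_nat ltnW// ltn_expl.
have xy : x - y = 0.
  apply: Vo => w Vw.
  have ort n : rdot (x - v n) w ^+ 2 <= eta n * n2 w.
    (* Near-minimality of [v n], compared with the competitor [v n + t w] of [V]. *)
    have quad (t : R) : 0 <= eta n - 2 * t * rdot (x - v n) w + t ^+ 2 * n2 w.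
      have := dle _ (VD _ _ (Vv n) (VZ t _ Vw)); rewrite opprD addrA n2B rdotZr n2Zr => h.
      by have := vd n; lra.
    have [w0|w0] := eqVneq (n2 w) 0.
      have -> : w = 0 by exact: n2_eq0.
      by rewrite -(scale0r (0 : H)) -(rmorph0 (real_complex R)) rdotZr mul0r expr0n/= mulr_ge0 ?n2_ge0// ltW.
    have w1 : 0 < n2 w by rewrite lt_neqAle eq_sym w0 n2_ge0.
    have := quad (rdot (x - v n) w / n2 w); set r := rdot _ _.
    have -> : eta n - 2 * (r / n2 w) * r + (r / n2 w) ^+ 2 * n2 w = eta n - r ^+ 2 / n2 w by field.
    by rewrite subr_ge0 ler_pdivrMr.
  have ry n : rdot (v n - y) w ^+ 2 <= (8 * (8 ^+ n)^-1) * n2 w.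
    have h := yP n; rewrite -n2N opprB in h.
    apply: le_trans (_ : _ <= n2 (v n - y) * n2 w) _; last by rewrite ler_wpM2r ?n2_ge0.
    have [w0|w0] := eqVneq (n2 w) 0.
      have -> : w = 0 by exact: n2_eq0.
      by rewrite -(scale0r (0 : H)) -(rmorph0 (real_complex R)) rdotZr mul0r expr0n/= mulr_ge0 ?n2_ge0.
    have w1 : 0 < n2 w by rewrite lt_neqAle eq_sym w0 n2_ge0.
    have := n2_ge0 ((v n - y) - (rdot (v n - y) w / n2 w)%:C *: w).
    rewrite n2B rdotZr n2Zr; set r := rdot _ _.
    have -> : n2 (v n - y) - 2 * (r / n2 w * r) + (r / n2 w) ^+ 2 * n2 w =
       n2 (v n - y) - r ^+ 2 / n2 w by field.
    by rewrite subr_ge0 ler_pdivrMr.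
  have sq0 : rdot (x - y) w ^+ 2 <= 0.
    (* 18 exceeds [2 (1/16 + 8)], which results from the two bounds above and
       [(a + b)^2 <= 2 a^2 + 2 b^2]. *)
    apply: (small _ (18 * n2 w)); first by rewrite mulr_ge0// n2_ge0.
    move=> n; have -> : x - y = (x - v n) + (v n - y) by rewrite addrA subrK.
    rewrite rdotDl; have := ort n; have := ry n; rewrite /eta.
    have := sqr_ge0 (rdot (x - v n) w - rdot (v n - y) w).
    have : 0 <= n2 w * (8 ^+ n)^-1 by rewrite mulr_ge0 ?n2_ge0// invr_ge0 exprn_ge0.
    by move: (n2 w) (rdot _ _) (rdot _ _) (8 ^+ n)^-1 => a r1 r2 q; nra.
  by apply/eqP; rewrite -sqrf_eq0 eq_le sq0 sqr_ge0.
have xE : x = y by apply/eqP; rewrite -subr_eq0 xy.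
have : eps <= 0 by apply: (small _ 8) => // n; apply: le_trans (yP n); rewrite -xE ltW// far'.
by rewrite leNgt eps0.
Qed.

End L2_complete.

(** * Maximal accretivity *)

(** If [a] were negative, [s = - a / (C - a)] would give the negative value [- a^2 / (C - a)]. *)
Lemma ge0_of_affine (R : realType) (a C : R) :
  (forall s, 0 < s -> s <= 1 -> 0 <= a + s * C) -> 0 <= C -> 0 <= a.
Proof.
move=> h C0; rewrite leNgt; apply/negP => a0.
have Ca : 0 < C - a by lra.
have := h (- a / (C - a)); rewrite divr_gt0 ?oppr_gt0// ler_pdivrMr// mul1r.
rewrite lerDr C0 => /(_ isT isT).
have -> : a + - a / (C - a) * C = - (a ^+ 2 / (C - a)) by field; rewrite gt_eqF.
by rewrite oppr_ge0 leNgt divr_gt0// exprn_even_gt0//= lt_eqF.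
Qed.

(** * An abstract criterion for the closure of an accretive operator to be maximal *)

Section maximality.
Context d (T : measurableType d) (R : realType).
Variable mu : {measure set T -> \bar R}.
Notation H := (L2 mu).
Local Open Scope complex_scope.

Lemma ball_n2 (g h : H) (r : R) : 0 <= r -> ball g r%:C h <-> n2 (g - h) < r ^+ 2.
Proof.
move=> r0; rewrite -ball_normE /ball_ /= L2_norm_n2 ltcR.
split=> [lt|lt].
  by rewrite -[ltLHS]sqr_sqrtr ?n2_ge0// ltrXn2r ?nnegrE ?sqrtr_ge0.
by rewrite -ltr_sqr ?nnegrE ?sqrtr_ge0// sqr_sqrtr ?n2_ge0.
Qed.

Lemma op_closureP (A : set (H * H)) (p : H * H) : op_closure A p <->
  forall e : R, 0 < e -> exists q, [/\ A q, n2 (p.1 - q.1) <= e & n2 (p.2 - q.2) <= e].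
Proof.
split=> [cl e e0|h B /nbhs_ballP[e /= e0 sB]].
  have s0 : 0 < Num.sqrt e by rewrite sqrtr_gt0.
  have s0' : 0 < (Num.sqrt e)%:C :> R[i] by rewrite ltcR.
  have [q [Aq [q1 q2]]] := cl _ (nbhsx_ballx p _ s0').
  exists q; split=> //.
    by have /(ball_n2 _ _ (ltW s0)) := q1; rewrite sqr_sqrtr ?(ltW e0)// => /ltW.
  by have /(ball_n2 _ _ (ltW s0)) := q2; rewrite sqr_sqrtr ?(ltW e0)// => /ltW.
have [r r0 eE] : exists2 r : R, 0 < r & e = r%:C.
  by case: e e0 {sB} => a b; rewrite ltcE/= => /andP[/eqP -> a0]; exists a.
have r2 : 0 < r ^+ 2 / 2 by rewrite divr_gt0// exprn_gt0.
have r2' : r ^+ 2 / 2 < r ^+ 2 by have := exprn_gt0 2 r0; lra.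
have [q [Aq q1 q2]] := h _ r2.
exists q; split=> //; apply: sB; rewrite eE; split.
  by apply/(ball_n2 _ _ (ltW r0)); exact: le_lt_trans r2'.
by apply/(ball_n2 _ _ (ltW r0)); exact: le_lt_trans r2'.
Qed.

Variable A : set (H * H).
Hypothesis A0 : A (0, 0).
Hypothesis AL : forall (a : R[i]) p q, A p -> A q -> A (a *: p + q).
Hypothesis Aacc : accretive A.
Hypothesis Adom : forall f, (forall u g, A (u, g) -> rdot f u = 0) -> f = 0.

Let sub_closure p : A p -> op_closure A p.
Proof. exact: subset_closure. Qed.

Let closureL (a : R[i]) p q : op_closure A p -> op_closure A q -> op_closure A (a *: p + q).
Proof.
move=> /op_closureP cp /op_closureP cq; apply/op_closureP => e e0.
pose c := Normc.normc a ^+ 2.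
have c0 : 0 <= c by exact: sqr_ge0.
have e1 : 0 < e / (2 * c + 2) by rewrite divr_gt0// ltr_wpDl// mulr_ge0.
have [p' [Ap' p1 p2]] := cp _ e1; have [q' [Aq' q1 q2]] := cq _ e1.
have key (x x' y y' : H) : n2 (x - x') <= e / (2 * c + 2) -> n2 (y - y') <= e / (2 * c + 2) ->
    n2 (a *: x + y - (a *: x' + y')) <= e.
  move=> hx hy; have -> : a *: x + y - (a *: x' + y') = a *: (x - x') + (y - y').
    by rewrite scalerBr opprD addrACA.
  apply: le_trans (n2D_le _ _) _; rewrite n2Z -/c.
  have -> : e = 2 * (c * (e / (2 * c + 2))) + 2 * (e / (2 * c + 2)).
    by field; rewrite gt_eqF// ltr_wpDl// mulr_ge0.
  by apply: lerD; rewrite ler_wpM2l//; exact: ler_wpM2l.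
by exists (a *: p' + q'); split; [exact: AL|exact: key|exact: key].
Qed.

(** The graph is approximated with squared errors [s^2] and the cross terms are bounded by Young's
    inequality with weights [s], [1 / s] and 1; the total loss is linear in [s], and [s] tends to
    0. *)
Let closure_acc : accretive (op_closure A).
Proof.
move=> u f /op_closureP cl; rewrite -/(rdot f u).
suff : 0 <= 2 * rdot f u by rewrite pmulr_rge0.
apply: (@ge0_of_affine _ _ (n2 u + n2 f + 4)); last first.
  by rewrite !addr_ge0 ?n2_ge0.
move=> s s0 s1; have [|[w g] [Awg /= hu hf]] := cl (s ^+ 2); first exact: exprn_gt0.
have /Aacc : A (w, g) by [].
rewrite -/(rdot g w).
have E : rdot f u = rdot g w - rdot (g - f) u - rdot f (w - u) - rdot (f - g) (u - w).
  by rewrite !(rdotBl, rdotBr); ring.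
have sV : 0 < s^-1 by rewrite invr_gt0.
have := rdot_young (g - f) u sV; have := rdot_young f (w - u) s0.
have := rdot_young (f - g) (u - w) (ltr01 : 0 < 1 :> R).
rewrite invr1 !mul1r invrK -[g - f]opprB -[w - u]opprB !n2N {}E.
have cs x : x <= s ^+ 2 -> s^-1 * x <= s.
  move=> h; apply: (@le_trans _ _ (s^-1 * s ^+ 2)); first by rewrite ler_wpM2l// ltW.
  by rewrite expr2 mulKf// gt_eqF.
have ss : s ^+ 2 <= s by rewrite expr2 ger_pMr.
have := cs _ hu; have := cs _ hf; rewrite !opprB.
move: hu hf ss; move: (rdot g w) (rdot (g - f) u) (rdot f (w - u)) (rdot (f - g) (u - w)).
move: (n2 (u - w)) (n2 (f - g)) (n2 u) (n2 f) => a b c k x1 x2 x3 x4.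
rewrite !mulrDr; move: (s * c) (s * k) (s^-1 * a) (s^-1 * b) (s ^+ 2) => m1 m2 m3 m4 m5.
by clear; lra.
Qed.

(** For [(0, f)] in the closure and [(w, k)] in [A], accretivity along [t (w, k) + (0, f)] gives a
    polynomial in [t] with no constant term that is nonnegative for every real [t]. Its linear
    coefficient [rdot f w] must vanish, and the domain is dense. *)
Let closure_operator : is_operator (op_closure A).
Proof.
split; [exact: sub_closure|exact: closureL|move=> f cf].
apply: Adom => w k Awk.
have quad (t : R) : 0 <= t ^+ 2 * rdot k w + t * rdot f w.
  have := @closureL t%:C _ _ (sub_closure Awk) cf.
  rewrite [X in op_closure _ X](_ : _ = (t%:C *: w + 0, t%:C *: k + f))//.
  move=> /closure_acc; rewrite addr0 -/(rdot (t%:C *: k + f) (t%:C *: w)) rdotDl !rdotZr rdotZl.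
  by rewrite mulrA -expr2.
have a0 : 0 <= rdot k w by exact: Aacc.
have a1 : rdot k w + 1 != 0 by rewrite gt_eqF// ltr_wpDl.
(* Adding 1 guards against [rdot k w = 0]; at this point the polynomial equals minus a square. *)
have := quad (- rdot f w / (rdot k w + 1)).
have -> : (- rdot f w / (rdot k w + 1)) ^+ 2 * rdot k w + - rdot f w / (rdot k w + 1) * rdot f w
    = - (rdot f w / (rdot k w + 1)) ^+ 2 by field.
by rewrite oppr_ge0 => h; apply/eqP; have := sqr_ge0 (rdot f w / (rdot k w + 1));
  rewrite le_eqVlt ltNge h orbF eq_sym sqrf_eq0 mulf_eq0 invr_eq0 (negbTE a1) orbF.
Qed.

(* If [(u, h)] belongs to an accretive extension and [h + lam u] is approximated by
   [g + lam w] with [(w, g)] in [A], then accretivity of [(u - w, h - g)] bounds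
   both [n2 (h - g)] and [lam ^+ 2 * n2 (u - w)] by the error. *)
Lemma maximally_accretive_closure (lam : R) : 0 < lam ->
  (forall f, (forall u g, A (u, g) -> rdot f (g + lam%:C *: u) = 0) -> f = 0) ->
  maximally_accretive (op_closure A).
Proof.
move=> lam0 Aran; split; [exact: closure_operator|exact: closure_acc|].
move=> A' [_ A'L _] A'acc sA; apply/seteqP; split=> // -[u h] A'uh.
apply/op_closureP => e e0.
pose V := [set q.2 + lam%:C *: q.1 | q in A].
have V0 : V 0 by exists (0, 0); rewrite //= scaler0 addr0.
have VL (a : R[i]) x y : V x -> V y -> V (a *: x + y).
  move=> [p Ap <-] [q Aq <-]; exists (a *: p + q); first exact: AL.
  rewrite /= !scalerDr addrACA; congr (_ + _ + _).
  by rewrite !scalerA mulrC.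
have VD x y : V x -> V y -> V (x + y) by move=> Vx Vy; rewrite -[x]scale1r; exact: VL.
have VZ (t : R) x : V x -> V (t%:C *: x) by move=> Vx; rewrite -[_ *: _]addr0; exact: VL.
have Vo x : (forall v, V v -> rdot x v = 0) -> x = 0.
  by move=> o; apply: Aran => w g Awg; apply: o; exists (w, g).
have l2 : 0 < lam ^+ 2 by rewrite exprn_gt0.
have eps0 : 0 < e * (lam ^+ 2 / (1 + lam ^+ 2)) by rewrite mulr_gt0// divr_gt0// addr_gt0.
have [_ [[w g] Awg <-] /=] := dense_of_orthogonal V0 VD VZ Vo (h + lam%:C *: u) eps0.
rewrite opprD addrACA -scalerBr n2D n2Zr rdotZr => le.
have acc : 0 <= rdot (h - g) (u - w).
  have : A' ((- 1) *: (w, g) + (u, h)) by apply: A'L => //; apply: sA; exact: subset_closure.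
  rewrite [X in A' X](_ : _ = (u - w, h - g)); first exact: A'acc.
  by rewrite scaleN1r; congr pair; rewrite addrC.
have acc' : 0 <= lam * rdot (h - g) (u - w) by rewrite mulr_ge0// ltW.
exists (w, g); split=> //=.
  rewrite -(ler_pM2l l2); apply: (@le_trans _ _ (e * (lam ^+ 2 / (1 + lam ^+ 2)))).
    by have := n2_ge0 (h - g); lra.
  by rewrite mulrC ler_pM2r// ler_pdivrMr ?addr_gt0// ler_peMr ?(ltW l2)// lerDl ltW.
apply: (@le_trans _ _ (e * (lam ^+ 2 / (1 + lam ^+ 2)))).
  by have := mulr_ge0 (ltW l2) (n2_ge0 (u - w)); lra.
by rewrite ler_piMr ?(ltW e0)// ler_pdivrMr ?addr_gt0// mul1r lerDr.
Qed.

End maximality.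

(** The terms in the second group are divergences. The divergence of [v p^2 / 2] supplies the cross
    term that completes the squares, and its constant part is the [d / 2] of the right-hand side. *)
Lemma coercive_pointwise {R : realType} (d : nat) (w Px Pv Pvv : 'I_d -> R)
    (beta : 'I_d -> 'I_d -> R) (p : R) : (forall i j, beta i j = - beta j i) ->
  (\sum_i w i * Px i - \sum_i \sum_j beta i j * (w i * Pv j) - \sum_j Pvv j
     + ((\sum_i w i ^+ 2) / 4 + 1) * p) * p
  + (\sum_i \sum_j beta i j * (w i * (p * Pv j) + 2^-1 * ((i == j)%:R * p ^+ 2))
     - \sum_i w i * (p * Px i) + \sum_j (Pv j ^+ 2 + p * Pvv j)
     + \sum_j (w j * (p * Pv j) + 2^-1 * p ^+ 2))
  = (d%:R / 2 + 1) * p ^+ 2 + \sum_j (Pv j + 2^-1 * w j * p) ^+ 2.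
Proof.
move=> ba.
have b0 i j : beta i j * (i == j)%:R = 0.
  case: eqP => [->|_]; last by rewrite mulr0.
  by have := ba j j; rewrite mulr1; lra.
have -> : \sum_i \sum_j beta i j * (w i * (p * Pv j) + 2^-1 * ((i == j)%:R * p ^+ 2)) =
    p * \sum_i \sum_j beta i j * (w i * Pv j).
  rewrite mulr_sumr; apply: eq_bigr => i _; rewrite mulr_sumr; apply: eq_bigr => j _.
  have -> : beta i j * (w i * (p * Pv j) + 2^-1 * ((i == j)%:R * p ^+ 2)) =
    p * (beta i j * (w i * Pv j)) + beta i j * (i == j)%:R * (2^-1 * p ^+ 2) by ring.
  by rewrite b0 mul0r addr0.
have -> : \sum_i w i * (p * Px i) = p * \sum_i w i * Px i.
  by rewrite mulr_sumr; apply: eq_bigr => i _; ring.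
have -> : \sum_j (Pv j ^+ 2 + p * Pvv j) = \sum_j Pv j ^+ 2 + p * \sum_j Pvv j.
  by rewrite big_split/= mulr_sumr.
have -> : \sum_j (w j * (p * Pv j) + 2^-1 * p ^+ 2) = p * \sum_j w j * Pv j + d%:R / 2 * p ^+ 2.
  rewrite big_split/= mulr_sumr sumr_const card_ord -[X in _ + X = _]mulr_natl.
  by congr (_ + _); [apply: eq_bigr => j _; ring|ring].
have -> : \sum_j (Pv j + 2^-1 * w j * p) ^+ 2 =
    \sum_j Pv j ^+ 2 + p * \sum_j w j * Pv j + 4^-1 * p ^+ 2 * \sum_j w j ^+ 2.
  by rewrite !mulr_sumr -!big_split/=; apply: eq_bigr => j _; field.
move: (\sum_j Pv j ^+ 2) (\sum_j w j * Pv j) (\sum_j w j ^+ 2) (\sum_j Pvv j) (\sum_i w i * Px i).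
by move: (\sum_i \sum_j _); clear; move=> *; field.
Qed.

(** * Real form of the accretivity of the operator *)

Section fokker_planck_operator.
Context {R : realType} (d : nat).
Notation Z := ('rV[R]_d * 'rV[R]_d)%type.
Notation mu := (@phase_vol R d).
Notation itg f := (mu.-integrable setT (EFin \o f)).
Notation sqi := (sqi mu).
Notation N2 := (N2 mu).
Notation ip := (ip mu).
Notation eqint := (eqint mu).
Notation H := (L2 mu).
Local Open Scope complex_scope.

Lemma regularM (f g : Z -> R) : regular f -> regular g -> regular (fun z => f z * g z).
Proof.
move=> [cf rf pf] [cg rg pg]; split.
- by move=> z; apply: cvgM; [exact: cf|exact: cg].
- move=> n; have [C C0 fC] := rf n; have [D D0 gD] := rg 0%N.
  exists (C * D); first exact: mulr_ge0.
  move=> z; have := gD z; rewrite expr0 mulr1 => gD'.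
  have -> : C * D * vweight z.2 ^+ n = C * vweight z.2 ^+ n * D by ring.
  by rewrite normrM ler_pM.
- by move=> v x i; rewrite pf pg.
Qed.

(** Differentiation normally changes the kernel; moving it onto [g] keeps [k], so all terms of the
    operator contain the same symmetric convolution. *)
Lemma kconv_pderiv_swap k l (g g' : Z -> R) : kernelf k -> regular g -> regular g' ->
  pderiv g g' (pdir l) -> pderiv (kconv k g) (kconv k g') (pdir l).
Proof.
move=> kk rg rg' dg; have [k' kk' w] := kernelf_partial l kk.
have [cg rapg pg] := rg; have [cg' rapg' _] := rg'.
apply: pderiv_eq (kconv_pderiv kk kk' (regular_sqi rg) w) _.
by apply: (kconv_deriv_swap kk kk' w dg) => //; exact: rapid_decaying.
Qed.

Variables (beta : 'I_d -> 'I_d -> 'rV[R]_d -> R) (b : R).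
Hypothesis beta_measurable : forall i j, measurable_fun setT (beta i j).
Hypothesis beta_bounded : forall i j x, `|beta i j x| <= b.
Hypothesis beta_antisym : forall i j x, beta i j x = - beta j i x.

Lemma kinetic_sqi (u : Z -> R) (ux uv uvv : 'I_d -> Z -> R) : regular u ->
  (forall i, regular (ux i)) -> (forall i, regular (uv i)) -> (forall i, regular (uvv i)) ->
  sqi (kinetic beta u ux uv uvv).
Proof.
move=> ru rx rv rvv; apply: sqiD.
  apply: sqiB.
    apply: sqiB; first by apply: sqi_sum => i; exact/regular_sqi/regular_mulv.
    apply: sqi_sum => i; apply: sqi_sum => j.
    by apply: (beta_sqi beta_measurable beta_bounded); exact/regular_sqi/regular_mulv.
  by apply: sqi_sum => j; exact: regular_sqi.
have -> : (fun z : Z => (sqnorm z.2 / 4 + 1) * u z) =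
    fun z : Z => (\sum_j 4^-1 * (z.2 ord0 j * (z.2 ord0 j * u z))) + u z.
  apply/funext => z; rewrite mulrDl mul1r -mulr_sumr /sqnorm [_ / 4]mulrC -mulrA mulr_suml.
  by congr (_ * _ + _); apply: eq_bigr => j _; rewrite mulrA.
apply: sqiD; last exact: regular_sqi.
by apply: sqi_sum => j; apply/sqiZ/regular_sqi; do 2 apply: regular_mulv.
Qed.

(** The constant on the left is exactly the shift built into [kinetic], so subtracting it leaves the
    accretivity of [K] itself. *)
Lemma kinetic_coercive p (px pv pvv : 'I_d -> Z -> R) : test_data p px pv pvv ->
  (d%:R / 2 + 1) * N2 p <= ip (kinetic beta p px pv pvv) p.
Proof.
move=> [[rp rpx rpv rpvv] [dpx dpv dpvv]].
have c1 : exists C : R, 'rV[R]_d -> `|1 : R| <= C by exists 1; move=> _; rewrite normr1.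
have dvp j i : pderiv (fun z : Z => z.2 ord0 i * p z)
    (fun z => z.2 ord0 i * pv j z + (i == j)%:R * p z) (ev j).
  by apply: pderivM => //; exact: pderiv_coordv.
have rdvp j i : regular (fun z : Z => z.2 ord0 i * pv j z + (i == j)%:R * p z).
  by apply: regularD; [exact: regular_mulv|exact: regularZ].
have nx i : eqint (fun z => z.2 ord0 i * (p z * px i z)) (fun=> 0).
  have dw : pderiv (fun z : Z => z.2 ord0 i) (fun=> 0) (ex i) by exact: pderiv_x_cst.
  apply: (eqint_ibp_x (G := fun z : Z => 2^-1 * ((z.2 ord0 i * p z) * p z)) (i := i)).
  - by apply/regularZ/regularM => //; exact: regular_mulv.
  - by apply/regular_mulv/regularM.
  - by apply: pderiv_eq (pderivZ _ (pderivM (pderivM dw (dpx i)) (dpx i))) _ => z; field.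
have nb i j : eqint (fun z => beta i j z.1 * (z.2 ord0 i * (p z * pv j z) + 2^-1 * ((i == j)%:R * p z ^+ 2))) (fun=> 0).
  apply: (eqint_ibp_v (G := fun z : Z => 2^-1 * ((z.2 ord0 i * p z) * p z)) _ _) => //.
  - by exists b; exact: beta_bounded.
  - by apply/regularZ/regularM => //; exact: regular_mulv.
  - apply: regularD; first by apply/regular_mulv/regularM.
    by apply/regularZ/regularZ; exact: regularM.
  - by apply: pderiv_eq (pderivZ _ (pderivM (dvp j i) (dpv j))) _ => z; field.
have nvv j : eqint (fun z => pv j z ^+ 2 + p z * pvv j z) (fun=> 0).
  have -> : (fun z => pv j z ^+ 2 + p z * pvv j z) = fun z => 1 * (p z * pvv j z + pv j z * pv j z).
    by apply/funext => z; ring.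
  apply: (eqint_ibp_v (G := fun z => p z * pv j z) (c := fun=> 1)) => //.
  - exact: regularM.
  - by apply: regularD; exact: regularM.
  - exact: pderivM.
have nv j : eqint (fun z => z.2 ord0 j * (p z * pv j z) + 2^-1 * p z ^+ 2) (fun=> 0).
  have -> : (fun z : Z => z.2 ord0 j * (p z * pv j z) + 2^-1 * p z ^+ 2) =
     fun z : Z => 1 * (2^-1 * (z.2 ord0 j * p z * pv j z + (z.2 ord0 j * pv j z + (j == j)%:R * p z) * p z)).
    by apply/funext => z; rewrite eqxx /=; field.
  apply: (eqint_ibp_v (G := fun z : Z => 2^-1 * ((z.2 ord0 j * p z) * p z)) (c := fun=> 1)) => //.
  - by apply/regularZ/regularM => //; exact: regular_mulv.
  - apply: regularZ; apply: regularD; apply: regularM => //; exact: regular_mulv.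
  - exact/pderivZ/pderivM.
have [iD _ D0] := eqintD (eqintD (eqintB (eqint_sum (index_enum 'I_d) (fun i => eqint_sum (index_enum 'I_d) (nb i)))
   (eqint_sum (index_enum 'I_d) nx)) (eqint_sum (index_enum 'I_d) nvv)) (eqint_sum (index_enum 'I_d) nv).
have sK := kinetic_sqi rp rpx rpv rpvv; have sp := regular_sqi rp.
have iK := sqi_mul sK sp; have [_ ip2] := sp.
rewrite /N2 -RintegralZl// -[leRHS]addr0.
have -> : 0 = \int[mu]_z 0 :> R by rewrite /Rintegral integral0.
move: D0; under [X in _ = X -> _]eq_Rintegral do rewrite /= !big1_eq subrr !addr0.
move=> <-; rewrite /ip -RintegralD//.
apply: le_Rintegral => //; [exact: itgZ|exact: itgD|move=> z _].
rewrite [leRHS](@coercive_pointwise _ _ (fun i => z.2 ord0 i) (px^~ z) (pv^~ z) (pvv^~ z)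
  (fun i j => beta i j z.1)) => [|i j]; last exact: beta_antisym.
by rewrite lerDl sumr_ge0// => j _; exact: sqr_ge0.
Qed.

End fokker_planck_operator.

Section represented.
Context d (T : measurableType d) (R : realType).
Variable mu : {measure set T -> \bar R}.
Notation ip := (ip mu).
Notation H := (L2 mu).
Local Open Scope complex_scope.
Local Open Scope quotient_scope.

Lemma represents_lin (a : R[i]) (g h : H) (u v : T -> R[i]) : represents g u ->
  represents h v -> represents (a *: g + h) (fun z => a * u z + v z).
Proof.
move=> gu hv; have := L2_repr_pi (a *: repr g + repr h); rewrite pi_L2D pi_L2Z !reprK.
by apply: filterS3 gu hv => z e1 e2 e _; rewrite e//= -e1// -e2.
Qed.

Lemma represents_ae (h : H) (u v : T -> R[i]) : represents h u -> u = v %[ae mu] ->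
  represents h v.
Proof. by apply: filterS2 => z e1 e2 _; rewrite e1// e2. Qed.

Lemma rdot_represents (f h : H) (p q : T -> R) : measurable_fun setT p ->
  measurable_fun setT q -> represents h (fun z => p z +i* q z) ->
  rdot f h = ip (L2part true f) p + ip (L2part false f) q.
Proof.
move=> mp mq hE; have e b : L2part b h = (if b then p else q) %[ae mu].
  by apply: filterS hE => z /(_ I) e _; rewrite /L2part e; case: b.
rewrite rdotE; congr (_ + _); apply: ae_eq_ip => //; by [exact: L2part_measurable|exact: aeW|exact: e].
Qed.

End represented.

(** * The Fokker-Planck operator on the complex space L^2 *)

Section fokker_planck_parts.
Context {R : realType} (d : nat).
Notation Z := ('rV[R]_d * 'rV[R]_d)%type.
Notation mu := (@phase_vol R d).
Notation sqi := (sqi mu).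
Notation N2 := (N2 mu).
Notation ip := (ip mu).
Notation H := (L2 mu).
Local Open Scope complex_scope.

Lemma wedge_grad_lin (c : 'rV[R]_((d * d.-1)./2)) v (a : R[i]) (D D' : 'I_d -> R[i]) :
  wedge_grad c v (fun i => a * D i + D' i) = a * wedge_grad c v D + wedge_grad c v D'.
Proof.
by move: d c v D D' => [|[|[|[|n]]]] c v D D'; rewrite /wedge_grad; ring.
Qed.

Variable B : 'rV[R]_d -> 'rV[R]_((d * d.-1)./2).

(** The derivatives are free variables here, so linearity of the operator splits into algebra and
    linearity of the derivatives. *)
Let fp (x w : 'rV[R]_d) (X V W : 'I_d -> R[i]) (U : R[i]) : R[i] :=
  (\sum_i (w ord0 i)%:C * X i) - wedge_grad (B x) w V - (\sum_i W i)
  + (sqnorm w / 4%:R - d%:R / 2%:R)%:C * U.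

Let fp_lin x w (a : R[i]) X V W U X' V' W' U' :
  fp x w (fun i => a * X i + X' i) (fun i => a * V i + V' i) (fun i => a * W i + W' i) (a * U + U') =
  a * fp x w X V W U + fp x w X' V' W' U'.
Proof.
rewrite /fp wedge_grad_lin big_split/= -mulr_sumr.
have -> : \sum_i (w ord0 i)%:C * (a * X i + X' i) =
  a * (\sum_i (w ord0 i)%:C * X i) + \sum_i (w ord0 i)%:C * X' i.
  by rewrite mulr_sumr -big_split/=; apply: eq_bigr => i _; ring.
by ring.
Qed.

Lemma fokker_planck_lin (a : R[i]) (u v : Z -> R[i]) : smooth u -> smooth v ->
  fokker_planck B (fun z => a * u z + v z) =
  fun z => a * fokker_planck B u z + fokker_planck B v z.
Proof.
move=> su sv; apply/funext => -[x w].
have E f : fokker_planck B f (x, w) = fp x w (fun i => cderive (ex i) f (x, w))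
  (fun i => cderive (ev i) f (x, w)) (fun i => cderive (ev i) (cderive (ev i) f) (x, w)) (f (x, w)).
  by [].
rewrite !E -fp_lin; congr fp; apply/funext => i.
- by have := iter_derive_lin a [:: inl i] su sv => /= ->.
- by have := iter_derive_lin a [:: inr i] su sv => /= ->.
- by have := iter_derive_lin a [:: inr i; inr i] su sv => /= ->.
Qed.

Lemma fokker_planck_op_lin (a : R[i]) (p q : H * H) : fokker_planck_op B p ->
  fokker_planck_op B q -> fokker_planck_op B (a *: p + q).
Proof.
move=> [u Su [p1 p2]] [v Sv [q1 q2]]; exists (fun z => a * u z + v z).
  exact: schwartz_lin.
have [_ su _] := Su; have [_ sv _] := Sv.
by rewrite fokker_planck_lin//; split; exact: represents_lin.
Qed.

Lemma kconv_regular k (g : Z -> R) : kernelf k -> regular g -> regular (kconv k g).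
Proof. by move=> kk rg; exact: (schwartz_regular true [::] (kconv_schwartz kk rg)). Qed.

Variables (beta : 'I_d -> 'I_d -> 'rV[R]_d -> R) (b : R).
Hypothesis beta_measurable : forall i j, measurable_fun setT (beta i j).
Hypothesis beta_bounded : forall i j x, `|beta i j x| <= b.
Hypothesis beta_antisym : forall i j x, beta i j x = - beta j i x.
Hypothesis wedge_beta : \forall z \ae mu, forall v D,
  wedge_grad (B z.1) v D = \sum_i \sum_j (beta i j z.1)%:C * ((v ord0 i)%:C * D j).

Let lam : R := d%:R / 2 + 1.

Definition kinetic_part c (u : Z -> R[i]) : Z -> R :=
  kinetic beta (fun z => cpart c (u z)) (fun i z => cpart c (cderive (ex i) u z))
    (fun j z => cpart c (cderive (ev j) u z))
    (fun j z => cpart c (cderive (ev j) (cderive (ev j) u) z)).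

(** The coefficients are real, so each part is acted upon separately. The equality holds almost
    everywhere because [beta] is a truncation of the field. *)
Lemma fokker_planck_part c (u : Z -> R[i]) : \forall z \ae mu,
  cpart c (fokker_planck B u z) = kinetic_part c u z - lam * cpart c (u z).
Proof.
apply: filterS wedge_beta => -[x v] /= we; rewrite we.
rewrite !(cpartD, cpartN) cpartZ !cpart_sum /kinetic_part /kinetic /=.
have -> : \sum_i cpart c ((v ord0 i)%:C * cderive (ex i) u (x, v)) =
  \sum_i v ord0 i * cpart c (cderive (ex i) u (x, v)).
  by apply: eq_bigr => i _; rewrite cpartZ.
have -> : \sum_i cpart c (\sum_j (beta i j x)%:C * ((v ord0 i)%:C * cderive (ev j) u (x, v))) =
  \sum_i \sum_j beta i j x * (v ord0 i * cpart c (cderive (ev j) u (x, v))).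
  by apply: eq_bigr => i _; rewrite cpart_sum; apply: eq_bigr => j _; rewrite !cpartZ.
rewrite /lam; move: (\sum_i _) (\sum_i _) (\sum_i _) => t1 t2 t3.
by ring.
Qed.

Lemma kinetic_part_sqi c u : schwartz u -> sqi (kinetic_part c u).
Proof.
by move=> /(schwartz_test_data c)[[? ? ? ?] _]; apply: (kinetic_sqi beta_measurable beta_bounded).
Qed.

Lemma schwartz_sqi c (u : Z -> R[i]) : schwartz u -> sqi (fun z => cpart c (u z)).
Proof. by move=> /(schwartz_test_data c)[[/regular_sqi]]. Qed.

Let Kpart c u z := kinetic_part c u z - lam * cpart c (u z).

Let Kpart_sqi c u : schwartz u -> sqi (Kpart c u).
Proof. by move=> Su; apply: sqiB; [exact: kinetic_part_sqi|apply: sqiZ; exact: schwartz_sqi]. Qed.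

Let fokker_planck_ae u : fokker_planck B u = (fun z => Kpart true u z +i* Kpart false u z) %[ae mu].
Proof.
apply: filterS2 (fokker_planck_part true u) (fokker_planck_part false u) => z e1 e2 _.
by apply: cpart_eq => -[]; [exact: e1|exact: e2].
Qed.

Lemma fokker_planck_op_exists u : schwartz u -> exists p, [/\ fokker_planck_op B p,
  represents p.1 u & represents p.2 (fokker_planck B u)].
Proof.
move=> Su; have [h hE] := L2_exists (schwartz_sqi true Su) (schwartz_sqi false Su).
have [k kE] := L2_exists (Kpart_sqi true Su) (Kpart_sqi false Su).
have h1 : represents h u.
  by apply: represents_ae hE _; apply: aeW => z _; apply: cpart_eq => -[].
have h2 : represents k (fokker_planck B u).
  by apply: represents_ae kE _; apply: filterS (fokker_planck_ae u) => z h' /h' ->.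
by exists (h, k); split=> //; exists u.
Qed.

Lemma fokker_planck_op_accretive : accretive (fokker_planck_op B).
Proof.
move=> h k [u Su [hE kE]]; rewrite -/(rdot k h); rewrite /= in hE kE.
have mp c : measurable_fun setT (fun z => cpart c (u z)) by case: (schwartz_sqi c Su).
have mK c : measurable_fun setT (Kpart c u) by case: (Kpart_sqi c Su).
have hE' : represents h (fun z => cpart true (u z) +i* cpart false (u z)).
  by apply: represents_ae hE _; apply: aeW => z _; apply: cpart_eq => -[].
have kE' := represents_ae kE (fokker_planck_ae u).
rewrite (rdot_represents _ (mp true) (mp false) hE').
have pos c : 0 <= ip (L2part c k) (fun z => cpart c (u z)).
  have -> : ip (L2part c k) (fun z => cpart c (u z)) = ip (Kpart c u) (fun z => cpart c (u z)).
    apply: ae_eq_ip => //; [exact: L2part_measurable| |exact: aeW].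
    by apply: filterS kE' => z /(_ I) e _; rewrite /L2part e; case: (c).
  have sp := schwartz_sqi c Su.
  rewrite ipBl//; [|exact: kinetic_part_sqi|exact: sqiZ].
  rewrite ipZl// ipxx subr_ge0.
  exact: (kinetic_coercive beta_measurable beta_bounded beta_antisym (schwartz_test_data c Su)).
by rewrite addr_ge0.
Qed.

(** Connects orthogonality in the Hilbert space with [kinetic_orthogonal]: a convolution is in the
    domain, and [K + lam] acts on it as a real function with the derivatives moved onto [g]. *)
Lemma fokker_planck_op_kconv k g (gx gv gvv : 'I_d -> Z -> R) : kernelf k ->
  test_data g gx gv gvv -> exists p, [/\ fokker_planck_op B p,
    represents p.1 (fun z => kconv k g z +i* 0) &
    represents (p.2 + lam%:C *: p.1) (fun z => kinetic beta (kconv k g) (fun i => kconv k (gx i))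
      (fun j => kconv k (gv j)) (fun j => kconv k (gvv j)) z +i* 0)].
Proof.
move=> kk [[rg rgx rgv rgvv] [dgx dgv dgvv]].
pose u (z : Z) := (kconv k g z)%:C.
have Su : schwartz u by exact: kconv_schwartz.
have [p [Ap p1 p2]] := fokker_planck_op_exists Su; exists p; split=> //.
have := represents_lin lam%:C p1 p2; rewrite addrC => /represents_ae; apply.
have ux i : cderive (ex i) u = fun z => (kconv k (gx i) z)%:C.
  exact/cderive_real/(kconv_pderiv_swap (l := inl i) kk rg (rgx i) (dgx i)).
have uv j : cderive (ev j) u = fun z => (kconv k (gv j) z)%:C.
  exact/cderive_real/(kconv_pderiv_swap (l := inr j) kk rg (rgv j) (dgv j)).
have uvv j : cderive (ev j) (fun z => (kconv k (gv j) z)%:C) = fun z => (kconv k (gvv j) z)%:C.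
  exact/cderive_real/(kconv_pderiv_swap (l := inr j) kk (rgv j) (rgvv j) (dgvv j)).
have ext z F F' Fx Fx' Fv Fv' Fvv Fvv' : F = F' -> Fx = Fx' -> Fv = Fv' -> Fvv = Fvv' ->
    kinetic beta F Fx Fv Fvv z = kinetic beta F' Fx' Fv' Fvv' z by move=> -> -> -> ->.
have KE c z : kinetic_part c u z = if c then kinetic beta (kconv k g) (fun i => kconv k (gx i))
      (fun j => kconv k (gv j)) (fun j => kconv k (gvv j)) z else 0.
  transitivity (kinetic beta (fun z => if c then kconv k g z else 0)
    (fun i z => if c then kconv k (gx i) z else 0) (fun j z => if c then kconv k (gv j) z else 0)
    (fun j z => if c then kconv k (gvv j) z else 0) z).
    apply: ext.
    - by apply/funext => y; rewrite cpart_real.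
    - by apply/funext => i; apply/funext => y; rewrite ux cpart_real.
    - by apply/funext => j; apply/funext => y; rewrite uv cpart_real.
    - by apply/funext => j; apply/funext => y; rewrite uv uvv cpart_real.
  case: c => //; rewrite /kinetic mulr0 addr0 !big1 ?subr0// => i _; last by rewrite mulr0.
  by rewrite big1// => j _; rewrite !mulr0.
apply: filterS2 (fokker_planck_part true u) (fokker_planck_part false u) => z e1 e2 _.
apply: cpart_eq => c; rewrite cpartD cpartZ.
have -> : cpart c (fokker_planck B u z) = kinetic_part c u z - lam * cpart c (u z) by case: c.
by rewrite addrC subrK KE; case: c.
Qed.

(** The graph is nonempty and stable under linear combinations, so it contains [- p + p]. *)
Let op0 : fokker_planck_op B (0, 0).
Proof.
have r0 : regular (fun _ : Z => 0 : R).
  split; [exact: cst_continuous| |by []].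
  by move=> m; exists 0 => // z; rewrite normr0 mul0r.
have k1 : kernelf (@gweight R d 1) by exact: gweight_kernelf.
have [p [Ap _ _]] := fokker_planck_op_exists (kconv_schwartz k1 r0).
have := fokker_planck_op_lin (- 1) Ap Ap.
by rewrite [X in fokker_planck_op B X](_ : _ = 0)// scaleN1r addNr.
Qed.

(* Multiplication by [i] turns [p] into an element of the operator that detects
   the imaginary part of [f]. *)
Let op_orthogonal (f : H) (F : H * H -> H) (Q : (Z -> R) -> Prop) :
  (forall (a : R[i]) p, F (a *: p + (0, 0)) = a *: F p) ->
  (forall p, fokker_planck_op B p -> rdot f (F p) = 0) ->
  (forall q, Q q -> sqi q /\ exists2 p, fokker_planck_op B p & represents (F p) (fun z => q z +i* 0)) ->
  (forall h, sqi h -> (forall q, Q q -> ip h q = 0) -> h = (fun=> 0) %[ae mu]) -> f = 0.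
Proof.
move=> FZ orth wit uniq.
have m0 : measurable_fun setT (fun _ : Z => 0 : R) by exact: measurable_cst.
have ip0 h : ip h (fun=> 0) = 0 by rewrite /ip /Rintegral (eq_integral (cst 0%E)) ?integral0// => z _; rewrite mulr0.
have e c : L2part c f = (fun=> 0) %[ae mu].
  apply: uniq => [|q /wit[[mq _] [p Ap Fp]]]; first exact: L2part_sqi.
  case: c.
    by have := orth p Ap; rewrite (rdot_represents _ mq m0 Fp) ip0 addr0.
  have /orth := fokker_planck_op_lin (0 +i* 1) Ap op0; rewrite FZ.
  rewrite (rdot_represents _ m0 mq) ?ip0 ?add0r//.
  have := repr_scale (0 +i* 1) (F p); apply: filterS2 Fp => z /(_ I) -> /(_ I) -> _.
  by apply: cpart_eq => -[] /=; ring.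
apply: n2_eq0; rewrite n2E.
have N0 c : N2 (L2part c f) = 0.
  transitivity (N2 (fun=> 0)); first by apply: ae_eq_N2 => //; exact: L2part_measurable.
  by rewrite /N2 /Rintegral (eq_integral (cst 0%E)) ?integral0// => z _; rewrite expr0n.
by rewrite !N0 addr0.
Qed.

(** [op_orthogonal] is applied twice: with [fst] for the density of the domain, and with
    [p.2 + lam p.1] for the density of the range of [K + lam]. *)
Lemma fokker_planck_op_maximal : maximally_accretive (op_closure (fokker_planck_op B)).
Proof.
have lam0 : 0 < lam by rewrite ltr_wpDl// divr_ge0.
apply: (maximally_accretive_closure op0 fokker_planck_op_lin fokker_planck_op_accretive _ lam0).
- move=> f orth; apply: (@op_orthogonal f fst (fun q => exists k g gx gv gvv,
    [/\ kernelf k, test_data g gx gv gvv & q = kconv k g])) => [a p|[h k] A|q|h sh orth'].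
  + by rewrite /= addr0.
  + exact: orth A.
  + move=> [k [g [gx [gv [gvv [kk td ->]]]]]]; split.
      by have [[rg _ _ _] _] := td; exact/regular_sqi/kconv_regular.
    by have [p [Ap p1 _]] := fokker_planck_op_kconv kk td; exists p.
  + apply: test_orthogonal_eq0 sh _ => k g gx gv gvv kk td; apply: orth'.
    by exists k, g, gx, gv, gvv.
- move=> f orth; apply: (@op_orthogonal f (fun p => p.2 + lam%:C *: p.1) (fun q =>
    exists k g gx gv gvv, [/\ kernelf k, test_data g gx gv gvv & q = kinetic beta (kconv k g)
      (fun i => kconv k (gx i)) (fun j => kconv k (gv j)) (fun j => kconv k (gvv j))]))
      => [a p|[h k] A|q|h sh orth'].
  + by rewrite /= !addr0 scalerDr !scalerA [a * _]mulrC.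
  + exact: orth A.
  + move=> [k [g [gx [gv [gvv [kk td ->]]]]]].
    have [p [Ap _ p2]] := fokker_planck_op_kconv kk td; split; last by exists p.
    have [[rg rgx rgv rgvv] _] := td.
    by apply: (kinetic_sqi beta_measurable beta_bounded) => [|i|i|i]; exact: kconv_regular.
  + apply: (kinetic_orthogonal_eq0 beta_measurable beta_bounded beta_antisym sh).
    by move=> k g gx gv gvv kk td; apply: orth'; exists k, g, gx, gv, gvv.
Qed.

End fokker_planck_parts.

Theorem theorem1p1 (R : realType) (d : nat) (hd : d = 2%N \/ d = 3%N)
    (B : 'rV[R]_d -> 'rV[R]_((d * d.-1)./2)) (hB : Linfty_torus B) :
  maximally_accretive (op_closure (fokker_planck_op B)).
Proof.
have [beta [b [mb bb ab wb]]] := wedge_grad_beta hd hB.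
exact: (fokker_planck_op_maximal mb bb ab (ae_torus_phase wb)).
Qed.
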